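(* Let $\Bbbk$ be a field of characteristic zero. The operad $\mathrm{FMan}$ of $F$-manifold algebras over $\Bbbk$ is a free right $\mathrm{Lie}$-module; the Schur functor of generators is isomorphic to $\mathrm{RT}_{\neq 1}\circ\mathrm{Com}$. That is, there is an isomorphism of right $\mathrm{Lie}$-modules $\mathrm{FMan}\cong(\mathrm{RT}_{\neq1}\circ\mathrm{Com})\circ\mathrm{Lie}$.
   Context: The operad $\mathrm{FMan}$ is the symmetric operad generated by a symmetric binary operation $-\circ-$ and a skew-symmetric binary operation $[-,-]$ subject to the relations $(a_1\circ a_2)\circ a_3=a_1\circ(a_2\circ a_3)$, $[[a_1,a_2],a_3]+[[a_2,a_3],a_1]+[[a_3,a_1],a_2]=0$, and the Hertling–Manin relation $$[a_1\circ a_2,a_3\circ a_4]=[a_1\circ a_2,a_3]\circ a_4+[a_1\circ a_2,a_4]\circ a_3+a_1\circ[a_2,a_3\circ a_4]+a_2\circ[a_1,a_3\circ a_4]-(a_1\circ a_3)\circ[a_2,a_4]-(a_2\circ a_3)\circ[a_1,a_4]-(a_2\circ a_4)\circ[a_1,a_3]-(a_1\circ a_4)\circ[a_2,a_3].$$ It is a right module over the operad $\mathrm{Lie}$ via the operad morphism $\mathrm{Lie}\to\mathrm{FMan}$ sending the bracket to $[-,-]$. In the claim, $\circ$ between symmetric sequences (Schur functors) denotes their composition. $\mathrm{Com}$ is the underlying symmetric sequence of the operad of (non-unital) commutative associative algebras: $\mathrm{Com}(n)=\Bbbk$ with trivial action for $n\ge1$, $\mathrm{Com}(0)=0$. $\mathrm{RT}_{\neq1}$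 is the linear species for which $\mathrm{RT}_{\neq1}(I)$, for a finite nonempty set $I$, has as basis the rooted trees with vertex set $I$ such that no vertex has exactly one child (the one-vertex tree is allowed), and $\mathrm{RT}_{\neq 1}(\varnothing)=0$. A right $\mathrm{Lie}$-module is free with Schur functor of generators $\mathcal{X}$ if it is isomorphic to $\mathcal{X}\circ\mathrm{Lie}$. *)

(* Defs.v *)
From HB Require Import structures.
From mathcomp Require Import all_boot all_order all_algebra.
From mathcomp Require Import boolp.
Set Implicit Arguments.
Unset Strict Implicit.
Unset Printing Implicit Defensive.
Import GRing.Theory.
Local Open Scope ring_scope.
Local Open Scope quotient_scope.

Record equiv (A B : Type) := Equiv {
  efun :> A -> B;
  einv : B -> A;
  efunK : cancel efun einv;
  einvK : cancel einv efun }.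

Definition equiv_id (A : Type) : equiv A A :=
  @Equiv A A id id (fun=> erefl) (fun=> erefl).

Definition equiv_comp (A B C : Type) (f : equiv B C) (e : equiv A B) :
  equiv A C :=
  Equiv (can_comp (efunK f) (efunK e)) (can_comp (einvK e) (einvK f)).

Definition equiv_inv (A B : Type) (e : equiv A B) : equiv B A :=
  Equiv (einvK e) (efunK e).

Lemma efun_inj (A B : Type) (e : equiv A B) : injective e.
Proof. exact: can_inj (efunK e). Qed.

Section SubEquiv.
Variables (A B : Type) (P : pred A) (Q : pred B) (e : equiv A B).
Hypothesis PQ : forall a, Q (e a) = P a.

Let fw (a : {a | P a}) : {b | Q b} :=
  exist _ (e (sval a)) (etrans (PQ (sval a)) (svalP a)).

Let bwP (b : {b | Q b}) : P (einv e (sval b)).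
Proof. by rewrite -PQ einvK (svalP b). Qed.

Let bw (b : {b | Q b}) : {a | P a} := exist _ (einv e (sval b)) (bwP b).

Let fwK : cancel fw bw.
Proof. by move=> a; apply: val_inj; rewrite /= efunK. Qed.

Let bwK : cancel bw fw.
Proof. by move=> b; apply: val_inj; rewrite /= einvK. Qed.

Definition sub_equiv : equiv {a | P a} {b | Q b} := Equiv fwK bwK.
End SubEquiv.

(* The vector space axioms hold up to ps_eq only; lquot below is the quotient. *)
Record prespace (k : fieldType) := Prespace {
  ps_sort :> Type;
  ps_eq : ps_sort -> ps_sort -> Prop;
  ps_zero : ps_sort;
  ps_add : ps_sort -> ps_sort -> ps_sort;
  ps_scale : k -> ps_sort -> ps_sort;
  ps_refl : forall x, ps_eq x x;
  ps_sym : forall x y, ps_eq x y -> ps_eq y x;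
  ps_trans : forall x y z, ps_eq x y -> ps_eq y z -> ps_eq x z;
  ps_addE : forall x x' y y',
    ps_eq x x' -> ps_eq y y' -> ps_eq (ps_add x y) (ps_add x' y');
  ps_scaleE : forall a x x', ps_eq x x' -> ps_eq (ps_scale a x) (ps_scale a x');
  ps_addA : forall x y z,
    ps_eq (ps_add x (ps_add y z)) (ps_add (ps_add x y) z);
  ps_addC : forall x y, ps_eq (ps_add x y) (ps_add y x);
  ps_add0 : forall x, ps_eq (ps_add ps_zero x) x;
  ps_addN : forall x, ps_eq (ps_add (ps_scale (-1) x) x) ps_zero;
  ps_scaleA : forall a b x,
    ps_eq (ps_scale a (ps_scale b x)) (ps_scale (a * b) x);
  ps_scale1 : forall x, ps_eq (ps_scale 1 x) x;
  ps_scaleDr : forall a x y,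
    ps_eq (ps_scale a (ps_add x y)) (ps_add (ps_scale a x) (ps_scale a y));
  ps_scaleDl : forall a b x,
    ps_eq (ps_scale (a + b) x) (ps_add (ps_scale a x) (ps_scale b x)) }.

Section LQuot.
Variables (k : fieldType) (S : prespace k).

Definition lq_rel (x y : {classic S}) : bool := `[< ps_eq x y >].

Lemma lq_rel_refl : reflexive lq_rel.
Proof. by move=> x; apply/asboolP/ps_refl. Qed.

Lemma lq_rel_sym : symmetric lq_rel.
Proof. by move=> x y; apply/asboolP/asboolP => /ps_sym. Qed.

Lemma lq_rel_trans : transitive lq_rel.
Proof.
by move=> y x z /asboolP xy /asboolP yz; apply/asboolP/(ps_trans xy yz).
Qed.

Canonical lq_equiv := EquivRel lq_rel lq_rel_refl lq_rel_sym lq_rel_trans.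

Definition lquot := {eq_quot lq_equiv}.
HB.instance Definition _ := Choice.on lquot.
HB.instance Definition _ := EqQuotient.on lquot.

Definition lq_class (x : S) : lquot := \pi_lquot (x : {classic S}).

Definition lq_repr (u : lquot) : S := repr u.

Lemma lq_reprK : cancel lq_repr lq_class.
Proof. exact: reprK. Qed.

Lemma lq_eqP (x y : S) : lq_class x = lq_class y <-> ps_eq x y.
Proof.
split; last by move=> xy; apply/eqmodP/asboolP.
by move/eqmodP/asboolP.
Qed.

Lemma lq_class_repr (x : S) : ps_eq (lq_repr (lq_class x)) x.
Proof. by apply/lq_eqP; rewrite lq_reprK. Qed.

Definition lq_add (u v : lquot) : lquot :=
  lq_class (ps_add (lq_repr u) (lq_repr v)).
Definition lq_scale (a : k) (u : lquot) : lquot :=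
  lq_class (ps_scale a (lq_repr u)).
Definition lq_opp (u : lquot) : lquot := lq_scale (-1) u.
Definition lq_zero : lquot := lq_class (ps_zero S).

Lemma lq_addE x y : lq_add (lq_class x) (lq_class y) = lq_class (ps_add x y).
Proof. by apply/lq_eqP/ps_addE; apply: lq_class_repr. Qed.

Lemma lq_scaleE a x : lq_scale a (lq_class x) = lq_class (ps_scale a x).
Proof. by apply/lq_eqP/ps_scaleE; apply: lq_class_repr. Qed.

Lemma lq_ind (P : lquot -> Prop) : (forall x, P (lq_class x)) -> forall u, P u.
Proof. by move=> Px u; rewrite -[u]lq_reprK. Qed.

Lemma lq_addA : associative lq_add.
Proof.
elim/lq_ind=> x; elim/lq_ind=> y; elim/lq_ind=> z.
by rewrite !lq_addE; apply/lq_eqP/ps_addA.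
Qed.

Lemma lq_addC : commutative lq_add.
Proof.
by elim/lq_ind=> x; elim/lq_ind=> y; rewrite !lq_addE; apply/lq_eqP/ps_addC.
Qed.

Lemma lq_add0 : left_id lq_zero lq_add.
Proof. by elim/lq_ind=> x; rewrite lq_addE; apply/lq_eqP/ps_add0. Qed.

Lemma lq_addN : left_inverse lq_zero lq_opp lq_add.
Proof.
by elim/lq_ind=> x; rewrite /lq_opp lq_scaleE lq_addE; apply/lq_eqP/ps_addN.
Qed.

HB.instance Definition _ :=
  GRing.isZmodule.Build lquot lq_addA lq_addC lq_add0 lq_addN.

Lemma lq_scaleA a b u : lq_scale a (lq_scale b u) = lq_scale (a * b) u.
Proof. by elim/lq_ind: u => x; rewrite !lq_scaleE; apply/lq_eqP/ps_scaleA. Qed.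

Lemma lq_scale1 : left_id 1 lq_scale.
Proof. by elim/lq_ind=> x; rewrite lq_scaleE; apply/lq_eqP/ps_scale1. Qed.

Lemma lq_scaleDr : right_distributive lq_scale +%R.
Proof.
move=> a; elim/lq_ind=> x; elim/lq_ind=> y.
rewrite /GRing.add /= lq_addE !lq_scaleE lq_addE; exact/lq_eqP/ps_scaleDr.
Qed.

Lemma lq_scaleDl u : {morph lq_scale^~ u : a b / a + b}.
Proof.
move=> a b; elim/lq_ind: u => x.
by rewrite /GRing.add /= !lq_scaleE lq_addE; exact/lq_eqP/ps_scaleDl.
Qed.

HB.instance Definition _ := GRing.Zmodule_isLmodule.Build k lquot
  lq_scaleA lq_scale1 lq_scaleDr lq_scaleDl.

Lemma lq_classD x y : lq_class (ps_add x y) = lq_class x + lq_class y.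
Proof. by rewrite -lq_addE. Qed.

Lemma lq_classZ a x : lq_class (ps_scale a x) = a *: lq_class x.
Proof. by rewrite -lq_scaleE. Qed.

Lemma lq_class0 : lq_class (ps_zero S) = 0.
Proof. by []. Qed.

Definition lq_lift (V : lmodType k) (h : S -> V) (u : lquot) : V :=
  h (lq_repr u).

Lemma lq_liftE (V : lmodType k) (h : S -> V) :
  (forall x y, ps_eq x y -> h x = h y) ->
  forall x, lq_lift h (lq_class x) = h x.
Proof. by move=> hE x; apply: hE; apply: lq_class_repr. Qed.

Lemma lq_lift_linear (V : lmodType k) (h : S -> V) :
  (forall x y, ps_eq x y -> h x = h y) ->
  (forall x y, h (ps_add x y) = h x + h y) ->
  (forall a x, h (ps_scale a x) = a *: h x) ->
  linear (lq_lift h).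
Proof.
move=> hE hD hZ a; elim/lq_ind=> x; elim/lq_ind=> y.
by rewrite -lq_classZ -lq_classD !lq_liftE// hD hZ.
Qed.

End LQuot.

(* Symmetric sequences (Schur functors) are represented by functors from the
   groupoid of finite sets and bijections to vector spaces. Functoriality is
   stated for every bijection with the prescribed values, so that it does not
   depend on the proofs stored in equiv. *)
Record species (k : fieldType) := Species {
  sp_ob :> finType -> lmodType k;
  sp_map : forall I J : finType, equiv I J -> sp_ob I -> sp_ob J;
  sp_linear : forall (I J : finType) (e : equiv I J), linear (sp_map e);
  sp_id : forall (I : finType) (e : equiv I I),
    (forall i, e i = i) -> forall x, sp_map e x = x;
  sp_comp : forall (I J L : finType) (e : equiv I J) (f : equiv J L)
      (g : equiv I L),
    (forall i, g i = f (e i)) -> forall x, sp_map g x = sp_map f (sp_map e x) }.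

Lemma sp_map_comp (k : fieldType) (X : species k) (I J L : finType)
    (e : equiv I J) (f : equiv J L) (x : X I) :
  sp_map (equiv_comp f e) x = sp_map f (sp_map e x).
Proof. exact: sp_comp. Qed.

Lemma sp_map_eq (k : fieldType) (X : species k) (I J : finType)
    (e f : equiv I J) (x : X I) :
  (forall i, e i = f i) -> sp_map e x = sp_map f x.
Proof.
by move=> ef; rewrite (@sp_comp _ _ _ _ _ (equiv_id I) f e) // sp_id.
Qed.

Section Operads.
Variable k : fieldType.

Definition fin_sum (I : finType) (J : I -> finType) : finType :=
  {i : I & J i}.

(* Operads and right modules are given by the total compositions
     M(I) (x) (x)_(i in I) P(J_i) -> M(sum_i J_i),
   the sets J_i being the blocks of a decomposition of the disjoint union. *)
Notation composition_map M P :=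
  (forall (I : finType) (J : I -> finType),
    sp_ob M I -> (forall i, sp_ob P (J i)) -> sp_ob M (fin_sum J)).

(* The bijections E between iterated disjoint unions are the canonical ones:
   each is determined by the condition on its values. Taking M = P, the axioms
   are those of a symmetric operad, apart from the left unit law. *)
Section RightAction.
Variables (P : species k) (one : P unit) (gamma : composition_map P P).

Record right_action_axioms (M : species k) (act : composition_map M P) : Prop :=
  RightActionLaws {
  act_linear_l : forall (I : finType) (J : I -> finType) (p : forall i, P (J i)),
    linear (fun x : M I => act _ _ x p);
  act_linear_r : forall (I : finType) (J : I -> finType) (x : M I)
      (p : forall i, P (J i)) (i : I),
    linear (fun q : P (J i) => act _ _ x (dfwith p q));
  act_natural : forall (I I' : finType) (J : I -> finType) (J' : I' -> finType)
      (e : equiv I I') (f : forall i, equiv (J i) (J' (e i)))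
      (E : equiv (fin_sum J) (fin_sum J')),
    (forall i j, E (existT _ i j) = existT _ (e i) (f i j)) ->
    forall (x : M I) (p : forall i, P (J i)) (p' : forall i, P (J' i)),
    (forall i, p' (e i) = sp_map (f i) (p i)) ->
    sp_map E (act _ _ x p) = act _ _ (sp_map e x) p';
  act_one : forall (I : finType) (E : equiv I (fin_sum (fun _ : I => unit))),
    (forall i, E i = existT _ i tt) ->
    forall x : M I, act _ _ x (fun=> one) = sp_map E x;
  act_assoc : forall (I : finType) (J : I -> finType)
      (L : forall i, J i -> finType)
      (E : equiv (fin_sum (fun i => fin_sum (L i)))
                 (fin_sum (fun s : fin_sum J => L (tag s) (tagged s)))),
    (forall i j l,
      E (existT _ i (existT _ j l)) = existT _ (existT _ i j) l) ->
    forall (x : M I) (p : forall i, P (J i)) (q : forall i j, P (L i j)),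
    act _ _ (act _ _ x p) (fun s => q (tag s) (tagged s)) =
    sp_map E (act _ _ x (fun i => gamma (p i) (q i))) }.
End RightAction.

Record operad := Operad {
  op_sp :> species k;
  op_one : op_sp unit;
  op_gamma : composition_map op_sp op_sp;
  op_axioms : right_action_axioms op_one (@op_gamma) (@op_gamma);
  op_one_l : forall (J : finType) (E : equiv J (fin_sum (fun _ : unit => J))),
    (forall j, E j = existT _ tt j) ->
    forall p : op_sp J, op_gamma op_one (fun=> p) = sp_map E p }.

Record right_module (P : operad) := RightModule {
  rm_sp :> species k;
  rm_act : composition_map rm_sp P;
  rm_axioms : right_action_axioms (op_one P) (@op_gamma P) (@rm_act) }.

Record right_module_iso (P : operad) (M N : right_module P) := RightModuleIso {
  rmi_fun : forall I : finType, M I -> N I;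
  rmi_linear : forall I, linear (@rmi_fun I);
  rmi_bij : forall I, bijective (@rmi_fun I);
  rmi_natural : forall (I J : finType) (e : equiv I J) x,
    rmi_fun (sp_map e x) = sp_map e (rmi_fun x);
  rmi_act : forall (I : finType) (J : I -> finType) (x : M I)
      (p : forall i, P (J i)),
    rmi_fun (rm_act x p) = rm_act (rmi_fun x) p }.

Definition isomorphic (P : operad) (M N : right_module P) : Prop :=
  inhabited (right_module_iso M N).

Record operad_morphism (P Q : operad) := OperadMorphism {
  om_fun :> forall I : finType, P I -> Q I;
  om_linear : forall I, linear (@om_fun I);
  om_natural : forall (I J : finType) (e : equiv I J) x,
    om_fun (sp_map e x) = sp_map e (om_fun x);
  om_one : om_fun (op_one P) = op_one Q;
  om_gamma : forall (I : finType) (J : I -> finType) (x : P I)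
      (p : forall i, P (J i)),
    om_fun (op_gamma x p) = op_gamma (om_fun x) (fun i => om_fun (p i)) }.

Section Pullback.
Variables (P Q : operad) (phi : operad_morphism P Q).

Definition pullback_act : composition_map Q P :=
  fun I J x p => op_gamma x (fun i => phi _ (p i)).

Lemma om_dfwith (I : finType) (J : I -> finType) (p : forall i, P (J i)) i
    (q : P (J i)) :
  (fun j => phi _ (dfwith p q j)) = dfwith (fun j => phi _ (p j)) (phi _ q).
Proof.
apply: functional_extensionality_dep => j.
case: (dfwithP p q j) => [|j' ij]; first by rewrite dfwith_in.
by rewrite dfwith_out.
Qed.

Lemma pullback_axioms :
  right_action_axioms (op_one P) (@op_gamma P) (@pullback_act).
Proof.
have [linl linr nat one assoc] := op_axioms Q; split.
- by move=> I J p; apply: linl.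
- move=> I J x p i a u v; rewrite /pullback_act !om_dfwith om_linear.
  exact: linr.
- move=> I I' J J' e f E EE x p p' pp'.
  apply: (nat _ _ _ _ e f E EE) => i.
  by rewrite pp' om_natural.
- move=> I E EE x; rewrite /pullback_act om_one; exact: one.
- move=> I J L E EE x p q; rewrite /pullback_act.
  rewrite (assoc I J L E EE x (fun i => phi _ (p i)) (fun i j => phi _ (q i j))).
  congr (sp_map _ (op_gamma _ _)).
  by apply: functional_extensionality_dep => i; rewrite om_gamma.
Qed.

Definition pullback_module : right_module P := RightModule pullback_axioms.
End Pullback.
End Operads.

Record set_species := SetSpecies {
  ss_ob :> finType -> finType;
  ss_map : forall I J : finType, equiv I J -> ss_ob I -> ss_ob J;
  ss_id : forall (I : finType) (e : equiv I I),
    (forall i, e i = i) -> forall x, ss_map e x = x;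
  ss_comp : forall (I J L : finType) (e : equiv I J) (f : equiv J L)
      (g : equiv I L),
    (forall i, g i = f (e i)) -> forall x, ss_map g x = ss_map f (ss_map e x) }.

Section Linearize.
Variables (k : fieldType) (S : set_species).

Definition lin_ob (I : finType) : lmodType k := {ffun S I -> k^o}.

(* The basis element s : S I, i.e. its indicator function, goes to ss_map e s. *)
Definition lin_map (I J : finType) (e : equiv I J) (x : lin_ob I) : lin_ob J :=
  [ffun t => \sum_(s | ss_map e s == t) x s].

Lemma lin_map_linear (I J : finType) (e : equiv I J) : linear (lin_map e).
Proof.
move=> a x y; apply/ffunP=> t; rewrite !ffunE scaler_sumr -big_split /=.
by apply: eq_bigr => s _; rewrite !ffunE.
Qed.

Lemma lin_map_id (I : finType) (e : equiv I I) :
  (forall i, e i = i) -> forall x, lin_map e x = x.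
Proof.
move=> e1 x; apply/ffunP=> t; rewrite ffunE.
by under eq_bigl do rewrite ss_id //; rewrite big_pred1_eq.
Qed.

Lemma lin_map_comp (I J L : finType) (e : equiv I J) (f : equiv J L)
    (g : equiv I L) :
  (forall i, g i = f (e i)) -> forall x, lin_map g x = lin_map f (lin_map e x).
Proof.
move=> gE x; apply/ffunP=> t; rewrite !ffunE.
under eq_bigl do rewrite (ss_comp gE).
rewrite (partition_big (ss_map e) (fun s => ss_map f s == t)) //=.
apply: eq_bigr => s /eqP fs; rewrite ffunE; apply: eq_bigl => r.
by case: (ss_map e r =P s) => [->|]; rewrite ?fs ?eqxx ?andbT ?andbF.
Qed.

Definition linearize : species k :=
  Species lin_map_linear lin_map_id lin_map_comp.
End Linearize.

(* Exactly one structure on each nonempty set, none on the empty set. *)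
Definition nonempty_ob (I : finType) : finType := {u : unit | (0 < #|I|)%N}.

Lemma equiv_card (I J : finType) (e : equiv I J) : #|I| = #|J|.
Proof. exact: (bij_eq_card (Bijective (efunK e) (einvK e))). Qed.

Definition nonempty_map (I J : finType) (e : equiv I J) (x : nonempty_ob I) :
  nonempty_ob J := exist _ (sval x) (etrans (congr1 (leq 1) (esym (equiv_card e))) (svalP x)).

Lemma nonempty_id (I : finType) (e : equiv I I) :
  (forall i, e i = i) -> forall x, nonempty_map e x = x.
Proof. by move=> _ x; apply: val_inj. Qed.

Lemma nonempty_comp (I J L : finType) (e : equiv I J) (f : equiv J L)
    (g : equiv I L) :
  (forall i, g i = f (e i)) ->
  forall x, nonempty_map g x = nonempty_map f (nonempty_map e x).
Proof. by move=> _ x; apply: val_inj. Qed.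

Definition nonempty_species : set_species :=
  SetSpecies nonempty_id nonempty_comp.

Definition Com (k : fieldType) : species k := linearize k nonempty_species.

(* A rooted tree with vertex set I is encoded by its parent function
   p : I -> option I: p r = None at the root r, and following parents leads
   from every vertex to r (hence r is unique and there are no cycles). *)
Section RootedTrees.
Variable I : finType.
Implicit Type p : {ffun I -> option I}.

Definition children p (v : I) : {set I} := [set u | p u == Some v].

Definition is_rooted_tree p : bool :=
  [exists r, (p r == None) &&
    [forall v, connect (fun u w => p u == Some w) v r]].

Definition is_RTn1 p : bool :=
  is_rooted_tree p && [forall v, #|children p v| != 1%N].

Definition RTn1_ob : finType := {p : {ffun I -> option I} | is_RTn1 p}.
End RootedTrees.

Definition relabel_parent (I J : finType) (e : equiv I J)
    (p : {ffun I -> option I}) : {ffun J -> option J} :=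
  [ffun j => omap e (p (einv e j))].

Lemma relabel_parentE (I J : finType) (e : equiv I J) p u w :
  (relabel_parent e p (e u) == Some (e w)) = (p u == Some w).
Proof.
rewrite ffunE efunK; case: (p u) => //= v.
by rewrite !(inj_eq Some_inj) (inj_eq (@efun_inj _ _ e)).
Qed.

Lemma relabel_parent_RTn1 (I J : finType) (e : equiv I J) p :
  is_RTn1 p -> is_RTn1 (relabel_parent e p).
Proof.
case/andP=> /existsP[r /andP[/eqP pr /forallP conn]] /forallP ch.
apply/andP; split.
  apply/existsP; exists (e r); rewrite ffunE efunK pr /=.
  apply/forallP=> j; rewrite -[j](einvK e).
  have /connectP[s] := conn (einv e j).
  elim: s (einv e j) => [|w s IHs] v /=; first by move=> _ ->; rewrite connect0.
  case/andP=> vw ps ls; apply: connect_trans (IHs _ ps ls).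
  by apply: connect1; rewrite relabel_parentE.
apply/forallP=> j; rewrite -[j](einvK e).
suff -> : children (relabel_parent e p) (e (einv e j)) =
    e @: children p (einv e j).
  by rewrite card_imset //; apply: efun_inj.
apply/setP=> w; rewrite -[w](einvK e) mem_imset; last exact: efun_inj.
by rewrite !inE relabel_parentE.
Qed.

Definition RTn1_map (I J : finType) (e : equiv I J) (x : RTn1_ob I) :
  RTn1_ob J := exist (@is_RTn1 J) _ (relabel_parent_RTn1 e (svalP x)).

Lemma RTn1_id (I : finType) (e : equiv I I) :
  (forall i, e i = i) -> forall x, RTn1_map e x = x.
Proof.
move=> e1 x; apply: val_inj; apply/ffunP=> j; rewrite /= ffunE.
by rewrite -[in RHS](einvK e j) e1; case: (sval x _) => //= i; rewrite e1.
Qed.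

Lemma RTn1_comp (I J L : finType) (e : equiv I J) (f : equiv J L)
    (g : equiv I L) :
  (forall i, g i = f (e i)) ->
  forall x, RTn1_map g x = RTn1_map f (RTn1_map e x).
Proof.
move=> gE x; apply: val_inj; apply/ffunP=> j; rewrite /= !ffunE.
have -> : einv g j = einv e (einv f j).
  by apply: (@efun_inj _ _ g); rewrite einvK gE !einvK.
by case: (sval x _) => //= i; rewrite gE.
Qed.

Definition RTn1_species : set_species := SetSpecies RTn1_id RTn1_comp.

Definition RTn1 (k : fieldType) : species k := linearize k RTn1_species.

(* presented R is the vector space with generators G and relations R; elements
   of lterm are formal linear combinations of generators. *)
Section Presented.
Variables (k : fieldType) (G : Type).

Inductive lterm : Type :=
| LGen of G
| LZero
| LAdd of lterm & lterm
| LScale of k & lterm.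

Variable R : lterm -> lterm -> Prop.

Inductive lcong : lterm -> lterm -> Prop :=
| lc_rel x y : R x y -> lcong x y
| lc_refl x : lcong x x
| lc_sym x y : lcong x y -> lcong y x
| lc_trans x y z : lcong x y -> lcong y z -> lcong x z
| lc_add x x' y y' : lcong x x' -> lcong y y' -> lcong (LAdd x y) (LAdd x' y')
| lc_scale a x x' : lcong x x' -> lcong (LScale a x) (LScale a x')
| lc_addA x y z : lcong (LAdd x (LAdd y z)) (LAdd (LAdd x y) z)
| lc_addC x y : lcong (LAdd x y) (LAdd y x)
| lc_add0 x : lcong (LAdd LZero x) x
| lc_addN x : lcong (LAdd (LScale (-1) x) x) LZero
| lc_scaleA a b x : lcong (LScale a (LScale b x)) (LScale (a * b) x)
| lc_scale1 x : lcong (LScale 1 x) x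
| lc_scaleDr a x y :
    lcong (LScale a (LAdd x y)) (LAdd (LScale a x) (LScale a y))
| lc_scaleDl a b x : lcong (LScale (a + b) x) (LAdd (LScale a x) (LScale b x)).

Definition presented_prespace : prespace k :=
  Prespace lc_refl lc_sym lc_trans lc_add lc_scale lc_addA lc_addC lc_add0
    lc_addN lc_scaleA lc_scale1 lc_scaleDr lc_scaleDl.

Definition presented : lmodType k := lquot presented_prespace.

Definition pgen (g : G) : presented := @lq_class k presented_prespace (LGen g).

Fixpoint leval (V : lmodType k) (h : G -> V) (x : lterm) : V :=
  match x with
  | LGen g => h g
  | LZero => 0
  | LAdd x y => leval h x + leval h y
  | LScale a x => a *: leval h x
  end.

Lemma leval_cong (V : lmodType k) (h : G -> V) :
  (forall x y, R x y -> leval h x = leval h y) ->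
  forall x y, lcong x y -> leval h x = leval h y.
Proof.
move=> hR x y; elim=> {x y} //=.
- by move=> x y z _ -> _ ->.
- by move=> x x' y y' _ -> _ ->.
- by move=> a x x' _ ->.
- by move=> x y z; rewrite addrA.
- by move=> x y; rewrite addrC.
- by move=> x; rewrite add0r.
- by move=> x; rewrite scaleN1r addNr.
- by move=> a b x; rewrite scalerA.
- by move=> x; rewrite scale1r.
- by move=> a x y; rewrite scalerDr.
- by move=> a b x; rewrite scalerDl.
Qed.

Definition plift (V : lmodType k) (h : G -> V) : presented -> V :=
  @lq_lift k presented_prespace V (leval h).

Lemma plift_linear (V : lmodType k) (h : G -> V) :
  (forall x y, R x y -> leval h x = leval h y) -> linear (plift h).
Proof. by move=> hR; apply: lq_lift_linear => // x y; apply: leval_cong. Qed.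

Lemma plift_gen (V : lmodType k) (h : G -> V) :
  (forall x y, R x y -> leval h x = leval h y) ->
  forall g, plift h (pgen g) = h g.
Proof.
by move=> hR g; rewrite /plift lq_liftE // => x y; apply: leval_cong.
Qed.

Lemma lq_class_leval (x : lterm) :
  @lq_class k presented_prespace x = leval pgen x.
Proof.
elim: x => //= [x <- y <-|a x <-].
- exact: (@lq_classD k presented_prespace).
- exact: (@lq_classZ k presented_prespace).
Qed.

Lemma prel x y : R x y -> leval pgen x = leval pgen y.
Proof.
by move=> xy; rewrite -!lq_class_leval; apply/lq_eqP/lc_rel.
Qed.

Lemma pext (V : lmodType k) (f g : presented -> V) :
  linear f -> linear g -> (forall x, f (pgen x) = g (pgen x)) -> f =1 g.
Proof.
move=> linf ling fg; apply: lq_ind => x; rewrite lq_class_leval.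
have f0 : f 0 = 0 by have := linf (-1) 0 0; rewrite scaler0 addr0 scaleN1r addNr.
have g0 : g 0 = 0 by have := ling (-1) 0 0; rewrite scaler0 addr0 scaleN1r addNr.
elim: x => //= [|x IHx y IHy|a x IHx]; first by rewrite f0 g0.
- by have := linf 1 (leval pgen x) (leval pgen y);
    have := ling 1 (leval pgen x) (leval pgen y); rewrite !scale1r IHx IHy => -> ->.
- by have := linf a (leval pgen x) 0; have := ling a (leval pgen x) 0;
    rewrite f0 g0 !addr0 IHx => -> ->.
Qed.
End Presented.

Lemma linear_comp2 (k : fieldType) (U V W : lmodType k) (f : V -> W)
  (g : U -> V) : linear f -> linear g -> linear (fun x => f (g x)).
Proof. by move=> lf lg a x y; rewrite lg lf. Qed.

(* Composition of species:
     (X o Y)(J) = (+)_n (X(n) (x) (+)_(f : J -> [n]) (x)_i Y(f^-1(i)))_(S_n),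
   presented by the decomposable tensors x (x) y_0 (x) ... (x) y_(n-1), subject
   to multilinearity and to the identification of S_n-orbits. *)
Definition fiber (J : finType) (T : eqType) (f : J -> T) (i : T) : finType :=
  {j : J | f j == i}.

Section Composite.
Variables (k : fieldType) (X Y : species k).

Record cgen (J : finType) := CGen {
  cg_n : nat;
  cg_f : J -> 'I_cg_n;
  cg_x : X 'I_cg_n;
  cg_y : forall i, Y (fiber cg_f i) }.

Lemma perm_fiber (J : finType) n (f : J -> 'I_n) (s : equiv 'I_n 'I_n) i j :
  (s (f (equiv_id J j)) == s i) = (f j == i).
Proof. exact: (inj_eq (@efun_inj _ _ s)). Qed.

Inductive crel (J : finType) : lterm k (cgen J) -> lterm k (cgen J) -> Prop :=
| crel_x n (f : J -> 'I_n) a (x x' : X 'I_n) (y : forall i, Y (fiber f i)) :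
    crel (LGen k (CGen (a *: x + x') y))
         (LAdd (LScale a (LGen k (CGen x y))) (LGen k (CGen x' y)))
| crel_y n (f : J -> 'I_n) (x : X 'I_n) (y : forall i, Y (fiber f i)) i a
      (u v : Y (fiber f i)) :
    crel (LGen k (CGen x (dfwith y (a *: u + v))))
         (LAdd (LScale a (LGen k (CGen x (dfwith y u))))
               (LGen k (CGen x (dfwith y v))))
| crel_perm n (f : J -> 'I_n) (s : equiv 'I_n 'I_n) (x : X 'I_n)
      (y : forall i, Y (fiber f i)) (y' : forall i, Y (fiber (s \o f) i)) :
    (forall i, y' (s i) = sp_map (sub_equiv (@perm_fiber J n f s i)) (y i)) ->
    crel (LGen k (CGen x y)) (LGen k (CGen (sp_map s x) y')).

Definition comp_ob (J : finType) : lmodType k := presented (@crel J).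

Definition cpgen (J : finType) n (f : J -> 'I_n) (x : X 'I_n)
    (y : forall i, Y (fiber f i)) : comp_ob J :=
  pgen (@crel J) (CGen x y).

Lemma cpgen_x (J : finType) n (f : J -> 'I_n) (y : forall i, Y (fiber f i)) :
  linear (fun x : X 'I_n => cpgen x y).
Proof. by move=> a u v; apply: prel (crel_x _ _ _ _). Qed.

Lemma cpgen_y (J : finType) n (f : J -> 'I_n) (x : X 'I_n)
    (y : forall i, Y (fiber f i)) i :
  linear (fun u : Y (fiber f i) => cpgen x (dfwith y u)).
Proof. by move=> a u v; apply: prel (crel_y _ _ _ _ _). Qed.

Lemma cpgen_perm (J : finType) n (f : J -> 'I_n) (s : equiv 'I_n 'I_n)
      (x : X 'I_n)
      (y : forall i, Y (fiber f i)) (y' : forall i, Y (fiber (s \o f) i)) :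
    (forall i, y' (s i) = sp_map (sub_equiv (@perm_fiber J n f s i)) (y i)) ->
  cpgen x y = cpgen (sp_map s x) y'.
Proof. by move=> yy'; apply: prel (crel_perm _ yy'). Qed.

Lemma comp_lift_rel (J : finType) (V : lmodType k) (h : cgen J -> V) :
  (forall n (f : J -> 'I_n) y, linear (fun x : X 'I_n => h (@CGen J n f x y))) ->
  (forall n (f : J -> 'I_n) (x : X 'I_n) (y : forall i, Y (fiber f i)) i,
     linear (fun u : Y (fiber f i) => h (CGen x (dfwith y u)))) ->
  (forall n (f : J -> 'I_n) (s : equiv 'I_n 'I_n) (x : X 'I_n)
      (y : forall i, Y (fiber f i)) (y' : forall i, Y (fiber (s \o f) i)),
    (forall i, y' (s i) = sp_map (sub_equiv (@perm_fiber J n f s i)) (y i)) ->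
    h (CGen x y) = h (CGen (sp_map s x) y')) ->
  forall u v, crel u v -> leval h u = leval h v.
Proof.
move=> hx hy hs u v [] /= {u v}.
- by move=> n f a x x' y; apply: hx.
- by move=> n f x y i a u v; apply: hy.
- by move=> n f s x y y' yy'; apply: hs.
Qed.

Lemma cpgen_ext (J : finType) n (f f' : J -> 'I_n) (x : X 'I_n)
    (y : forall i, Y (fiber f i)) (y' : forall i, Y (fiber f' i)) :
  f =1 f' ->
  (forall i (E : equiv (fiber f i) (fiber f' i)),
     (forall j, sval (E j) = sval j) -> y' i = sp_map E (y i)) ->
  cpgen x y = cpgen x y'.
Proof.
move=> /funext ff'; move: y y'; rewrite -{f'}ff' => y y' yy'.
congr (cpgen x _); apply: functional_extensionality_dep => i.
by rewrite (yy' i (equiv_id _)) // sp_id.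
Qed.

Section Map.
Variables (J L : finType) (e : equiv J L).

Lemma map_fiber n (f : J -> 'I_n) i j : (f (einv e (e j)) == i) = (f j == i).
Proof. by rewrite efunK. Qed.

Definition comp_map_gen (g : cgen J) : comp_ob L :=
  @cpgen L (cg_n g) (cg_f g \o einv e) (cg_x g)
    (fun i => sp_map (sub_equiv (map_fiber (cg_f g) i)) (@cg_y _ g i)).

Lemma comp_map_rel u v :
  @crel J u v -> leval comp_map_gen u = leval comp_map_gen v.
Proof.
apply: comp_lift_rel => [n f y|n f x y i a u1 u2|n f s x y y' yy'].
- by move=> a x x'; rewrite /comp_map_gen /= cpgen_x.
- pose y1 i : Y (fiber (f \o einv e) i) :=
    sp_map (sub_equiv (map_fiber f i)) (y i).
  have dfE (w : Y (fiber f i)) : (fun j => sp_map (sub_equiv (map_fiber f j)) (dfwith y w j)) =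
      dfwith y1 (sp_map (sub_equiv (map_fiber f i)) w).
    apply: functional_extensionality_dep => j.
    case: (dfwithP y w j) => [|j' ij]; first by rewrite dfwith_in.
    by rewrite dfwith_out.
  by rewrite /comp_map_gen /= !dfE sp_linear cpgen_y.
- rewrite /comp_map_gen /=; apply: cpgen_perm => i.
  rewrite yy'.
  set E1 := sub_equiv _; set E2 := sub_equiv _.
  set E3 := sub_equiv _; set E4 := sub_equiv _.
  have EE (j : fiber f i) : E1 (E2 j) = E3 (E4 j) by exact: val_inj.
  by rewrite -!sp_map_comp; apply: sp_map_eq.
Qed.

Definition comp_map : comp_ob J -> comp_ob L := plift comp_map_gen.

Lemma comp_map_linear : linear comp_map.
Proof. exact: plift_linear comp_map_rel. Qed.

Lemma comp_map_cpgen n (f : J -> 'I_n) x y :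
  comp_map (@cpgen J n f x y) = @cpgen L n (f \o einv e) x
    (fun i => sp_map (sub_equiv (map_fiber f i)) (y i)).
Proof. exact: plift_gen comp_map_rel _. Qed.
End Map.

Lemma id_linear (V : lmodType k) : linear (@id V).
Proof. by []. Qed.

Lemma comp_map_id (J : finType) (e : equiv J J) :
  (forall j, e j = j) -> forall x, comp_map e x = x.
Proof.
move=> e1; apply: (pext (comp_map_linear e) (@id_linear _)).
case=> n f x y; rewrite [LHS]comp_map_cpgen; apply: cpgen_ext.
  by move=> j; rewrite /= -{1}[j]e1 efunK.
move=> i E EE; rewrite -(@sp_comp _ _ _ _ _ _ _ (equiv_id _)) ?sp_id //.
by move=> j; apply: val_inj; rewrite /= EE /= e1.
Qed.

Lemma comp_map_comp (I J L : finType) (e : equiv I J) (f : equiv J L)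
    (g : equiv I L) :
  (forall i, g i = f (e i)) ->
  forall x, comp_map g x = comp_map f (comp_map e x).
Proof.
move=> gE; apply: (pext (comp_map_linear g)).
  exact: linear_comp2 (comp_map_linear f) (comp_map_linear e).
case=> n h x y; rewrite -/(cpgen _ _) !comp_map_cpgen; apply: cpgen_ext.
  move=> l /=; congr h; apply: (@efun_inj _ _ g).
  by rewrite einvK gE !einvK.
move=> i E EE; rewrite -!sp_map_comp.
apply: sp_map_eq => j; apply: val_inj.
by rewrite /= EE /= gE.
Qed.

Definition comp_species : species k :=
  Species comp_map_linear comp_map_id comp_map_comp.
End Composite.

Lemma sub_tag_inj (J : finType) (L : J -> finType) (Q : pred J)
    (s t : fin_sum (fun j : {j | Q j} => L (sval j))) :
  existT (fun j => L j : Type) (sval (tag s)) (tagged s) =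
  existT (fun j => L j : Type) (sval (tag t)) (tagged t) -> s = t.
Proof.
move: s t => [[j jQ] l] [[j' j'Q] l'] /= eq_st.
have /= jj' := congr1 (@tag _ _) eq_st.
move: j'Q l' eq_st; case: _ / jj' => j'Q l' /eqP.
by rewrite (eq_irrelevance j'Q jQ) eq_Tagged => /eqP /= ->.
Qed.

Section TagFiber.
Variables (J : finType) (L : J -> finType) (T : eqType) (f : J -> T) (i : T).

Let fw (s : fin_sum (fun j : fiber f i => L (sval j))) :
    fiber (fun t : fin_sum L => f (tag t)) i :=
  exist _ (existT _ (sval (tag s)) (tagged s)) (proj2_sig (tag s)).

Let bw (t : fiber (fun t : fin_sum L => f (tag t)) i) :
    fin_sum (fun j : fiber f i => L (sval j)) :=
  existT _ (exist _ (tag (sval t)) (proj2_sig t)) (tagged (sval t)).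

Let fwK : cancel fw bw. Proof. by move=> [[j ji] l]. Qed.
Let bwK : cancel bw fw. Proof. by move=> [[j l] jl]. Qed.

Definition tag_fiber : equiv (fin_sum (fun j : fiber f i => L (sval j)))
    (fiber (fun t : fin_sum L => f (tag t)) i) := Equiv fwK bwK.
End TagFiber.

Section SumEquiv.
Variables (I : finType) (J : I -> finType) (L : forall i, J i -> finType).

Let unit_fw (i : I) : fin_sum (fun _ : I => unit) := existT _ i tt.
Let unit_fwK : cancel unit_fw (@tag _ _). Proof. by []. Qed.
Let unit_bwK : cancel (@tag _ _) unit_fw. Proof. by move=> [i []]. Qed.
Definition sum_unit_equiv : equiv I (fin_sum (fun _ : I => unit)) :=
  Equiv unit_fwK unit_bwK.

Let assoc_fw (s : fin_sum (fun i => fin_sum (@L i))) :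
    fin_sum (fun s : fin_sum J => L (tagged s)) :=
  existT (fun s : fin_sum J => L (tagged s) : Type)
    (existT (fun i => J i : Type) (tag s) (tag (tagged s)))
    (tagged (tagged s)).
Let assoc_bw (s : fin_sum (fun s : fin_sum J => L (tagged s))) :
    fin_sum (fun i => fin_sum (@L i)) :=
  existT (fun i => fin_sum (@L i) : Type) (tag (tag s))
    (existT (fun j => L j : Type) (tagged (tag s)) (tagged s)).
Let assoc_fwK : cancel assoc_fw assoc_bw. Proof. by move=> [i [j l]]. Qed.
Let assoc_bwK : cancel assoc_bw assoc_fw. Proof. by move=> [[i j] l]. Qed.
Definition sum_assoc_equiv := Equiv assoc_fwK assoc_bwK.

Variables (T : eqType) (f : I -> T) (t : T).
Let A := fin_sum (fun s : fin_sum (fun i : fiber f t => J (sval i)) =>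
  L (tagged s)).
Let B := fin_sum (fun s : fiber (fun s : fin_sum J => f (tag s)) t =>
  L (tagged (sval s))).
Let fiber_fw (s : A) : B :=
  existT (fun s : fiber (fun s : fin_sum J => f (tag s)) t =>
    L (tagged (sval s)) : Type) (tag_fiber J f t (tag s)) (tagged s).
Let fiber_bw (s : B) : A :=
  existT (fun s : fin_sum (fun i : fiber f t => J (sval i)) =>
    L (tagged s) : Type) (einv (tag_fiber J f t) (tag s)) (tagged s).
Let fiber_fwK : cancel fiber_fw fiber_bw.
Proof. by move=> [[[i fi] j] l]. Qed.
Let fiber_bwK : cancel fiber_bw fiber_fw.
Proof. by move=> [[[i j] fi] l]. Qed.
Definition sum_fiber_equiv : equiv A B := Equiv fiber_fwK fiber_bwK.
End SumEquiv.

(* X o P with P acting on the right factor: p in prod_j P(L_j) sends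
   x (x) (y_i)_i, supported by f : J -> [n], to x (x) (gamma(y_i; p_j))_i, with
   j ranging over f^-1(i), supported by the composite sum_j L_j -> J -> [n]. *)
Section FreeModule.
Variables (k : fieldType) (X : species k) (P : operad k).

Lemma gamma_natural (I I' : finType) (J : I -> finType) (J' : I' -> finType)
    (e : equiv I I') (f : forall i, equiv (J i) (J' (e i)))
    (E : equiv (fin_sum J) (fin_sum J')) (x : P I) (p : forall i, P (J i))
    (p' : forall i, P (J' i)) :
  (forall i j, E (existT _ i j) = existT _ (e i) (f i j)) ->
  (forall i, p' (e i) = sp_map (f i) (p i)) ->
  sp_map E (op_gamma x p) = op_gamma (sp_map e x) p'.
Proof. by move=> EE; apply: (act_natural (op_axioms P) EE). Qed.

Section GammaFiber.
Variables (J J' : finType) (L : J -> finType) (L' : J' -> finType).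
Variables (e : equiv J J') (f : forall j, equiv (L j) (L' (e j))).
Variables (E : equiv (fin_sum L) (fin_sum L')).
Hypothesis EE : forall j l, E (existT _ j l) = existT _ (e j) (f j l).
Variables (p : forall j, P (L j)) (p' : forall j, P (L' j)).
Hypothesis pp' : forall j, p' (e j) = sp_map (f j) (p j).
Variables (T T' : eqType) (h : J -> T) (h' : J' -> T') (i : T) (i' : T').
Hypothesis hh' : forall j, (h' (e j) == i') = (h j == i).

Lemma gamma_fiber (y : P (fiber h i))
    (F : equiv (fiber (fun t : fin_sum L => h (tag t)) i)
               (fiber (fun t : fin_sum L' => h' (tag t)) i')) :
  (forall t, sval (F t) = E (sval t)) ->
  sp_map F (sp_map (tag_fiber L h i) (op_gamma y (fun j => p (sval j)))) =
  sp_map (tag_fiber L' h' i')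
    (op_gamma (sp_map (sub_equiv hh') y) (fun j => p' (sval j))).
Proof.
move=> FE.
pose G := equiv_comp (equiv_inv (tag_fiber L' h' i'))
  (equiv_comp F (tag_fiber L h i)).
pose e1 : equiv (fiber h i) (fiber h' i') := sub_equiv hh'.
pose fs (j : fiber h i) : equiv (L (sval j)) (L' (sval (e1 j))) := f (sval j).
rewrite -(@gamma_natural _ _ (fun j => L (sval j)) (fun j => L' (sval j))
  e1 fs G y (fun j => p (sval j))).
- rewrite -!sp_map_comp; apply: sp_map_eq => t.
  by rewrite /G /= -[LHS](einvK (tag_fiber L' h' i')).
- move=> j l; apply: (@efun_inj _ _ (tag_fiber L' h' i')).
  rewrite /G /= [LHS](einvK (tag_fiber L' h' i')).
  by apply: val_inj; rewrite [LHS]FE /= EE.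
- by move=> j; apply: pp'.
Qed.
End GammaFiber.

Let XP : species k := comp_species X P.

Section Act.
Variables (J : finType) (L : J -> finType).

Definition act_y n (f : J -> 'I_n) (y : forall i, P (fiber f i))
    (p : forall j, P (L j)) i :
    P (fiber (fun t : fin_sum L => f (tag t)) i) :=
  sp_map (tag_fiber L f i) (op_gamma (y i) (fun j => p (sval j))).

Definition act_gen (p : forall j, P (L j)) (g : cgen X P J) : XP (fin_sum L) :=
  @cpgen k X P (fin_sum L) (cg_n g) (fun t => cg_f g (tag t)) (cg_x g)
    (act_y (@cg_y _ _ _ _ g) p).

Lemma act_y_dfwith_l n (f : J -> 'I_n) (y : forall i, P (fiber f i))
    (p : forall j, P (L j)) i (w : P (fiber f i)) :
  act_y (dfwith y w) p = dfwith (act_y y p)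
    (sp_map (tag_fiber L f i) (op_gamma w (fun j => p (sval j)))).
Proof.
apply: functional_extensionality_dep => j; rewrite {1}/act_y.
case: (dfwithP y w j) => [|j' ij]; first by rewrite dfwith_in.
by rewrite dfwith_out.
Qed.

Lemma act_gen_rel p u v : @crel k X P J u v ->
  leval (act_gen p) u = leval (act_gen p) v.
Proof.
apply: comp_lift_rel => [n f y|n f x y i a u1 u2|n f s x y y' yy'].
- by move=> a x x'; rewrite /act_gen /= cpgen_x.
- rewrite /act_gen /= !act_y_dfwith_l.
  rewrite (act_linear_l (op_axioms P)) sp_linear; exact: cpgen_y.
- rewrite /act_gen /=; apply: cpgen_perm => i.
  rewrite /act_y yy'.
  symmetry; apply: (@gamma_fiber _ _ _ _ (equiv_id J) (fun j => equiv_id (L j))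
    (equiv_id (fin_sum L))) => //.
  by move=> j; rewrite sp_id.
Qed.

Definition free_act (x : XP J) (p : forall j, P (L j)) : XP (fin_sum L) :=
  plift (act_gen p) x.

Lemma free_act_cpgen n (f : J -> 'I_n) (x : X 'I_n)
    (y : forall i, P (fiber f i)) p :
  free_act (cpgen x y) p = cpgen x (act_y y p).
Proof. exact: (plift_gen (act_gen_rel p)). Qed.

Lemma free_act_linear_l p : linear (fun x => free_act x p).
Proof. exact: plift_linear (act_gen_rel p). Qed.
End Act.

Lemma linear_fun_comb (U V : lmodType k) (f g : U -> V) (a : k) :
  linear f -> linear g -> linear (fun x => a *: f x + g x).
Proof.
move=> lf lg b u v; rewrite lf lg !scalerDr !scalerA [a * b]mulrC.
by rewrite -!addrA; congr (_ + _); rewrite addrCA.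
Qed.

Lemma free_act_linear_r (J : finType) (L : J -> finType) (x : XP J)
    (p : forall j, P (L j)) j :
  linear (fun w : P (L j) => free_act x (dfwith p w)).
Proof.
move=> a u v; move: x.
apply: pext; first exact: free_act_linear_l.
  by apply: linear_fun_comb; apply: free_act_linear_l.
case=> n f x y; rewrite -/(cpgen _ _) !free_act_cpgen.
have E (w : P (L j)) : act_y y (dfwith p w) = dfwith (act_y y p)
    (act_y y (dfwith p w) (f j)).
  apply: functional_extensionality_dep => i.
  have [->|ij] := eqVneq i (f j); first by rewrite dfwith_in.
  rewrite dfwith_out 1?eq_sym // /act_y; congr (sp_map _ (op_gamma _ _)).
  apply: functional_extensionality_dep => -[j' /= j'i].
  rewrite dfwith_out //; apply: contraNneq ij => jj'.
  by rewrite jj' eq_sym.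
rewrite (E (a *: u + v)) (E u) (E v) -cpgen_y; congr (cpgen _ (dfwith _ _)).
pose jf : fiber f (f j) := exist _ j (eqxx _).
have D (w : P (L j)) : (fun j' : fiber f (f j) => dfwith p w (sval j')) =
    dfwith (T := fun j' : fiber f (f j) => P (L (sval j')))
      (fun j' => p (sval j')) (i := jf) w.
  apply: functional_extensionality_dep => j'.
  have [jj|jj] := eqVneq jf j'; last by rewrite !dfwith_out // val_eqE.
  by case: _ / jj; rewrite dfwith_in [LHS]dfwith_in.
rewrite /act_y !D (act_linear_r (op_axioms P)); exact: sp_linear.
Qed.

Lemma free_act_natural (I I' : finType) (J : I -> finType) (J' : I' -> finType)
    (e : equiv I I') (f : forall i, equiv (J i) (J' (e i)))
    (E : equiv (fin_sum J) (fin_sum J')) :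
  (forall i j, E (existT _ i j) = existT _ (e i) (f i j)) ->
  forall (x : XP I) (p : forall i, P (J i)) (p' : forall i, P (J' i)),
  (forall i, p' (e i) = sp_map (f i) (p i)) ->
  sp_map E (free_act x p) = free_act (sp_map e x) p'.
Proof.
move=> EE x p p' pp'; move: x; apply: pext.
- exact: (@linear_comp2 k _ _ _ (sp_map E) (fun x => free_act x p)
    (sp_linear E) (free_act_linear_l p)).
- exact: (@linear_comp2 k _ _ _ (fun x => free_act x p') (sp_map e)
    (free_act_linear_l p') (sp_linear e)).
case=> n g x y; rewrite -/(cpgen _ _) /= free_act_cpgen !comp_map_cpgen.
rewrite free_act_cpgen; apply: cpgen_ext => [t|i F FE].
  rewrite -[t](einvK E); case: (einv E t) => j l /=.
  by rewrite efunK EE /= efunK.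
rewrite /act_y -sp_map_comp; symmetry.
apply: (gamma_fiber EE pp') => t.
by rewrite /= FE.
Qed.

Lemma free_axioms :
  right_action_axioms (op_one P) (@op_gamma k P) (@free_act).
Proof.
split.
- exact: free_act_linear_l.
- exact: free_act_linear_r.
- exact: free_act_natural.
- move=> I E EE; apply: pext; first exact: free_act_linear_l.
    exact: comp_map_linear.
  case=> n f x y; rewrite -/(cpgen _ _) /= free_act_cpgen comp_map_cpgen.
  symmetry; apply: cpgen_ext => [t|i F FE].
    by rewrite -[t](einvK E) /= efunK EE.
  rewrite /act_y (act_one (op_axioms P) (E := sum_unit_equiv _)) //.
  rewrite -!sp_map_comp; apply: sp_map_eq => j; apply: val_inj.
  by rewrite /= FE /= EE.
- move=> I J L E EE x p q; move: x; apply: pext.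
  + exact: (@linear_comp2 k _ _ _ (fun x => free_act x _)
      (fun x => free_act x p)
      (free_act_linear_l _) (free_act_linear_l p)).
  + exact: (@linear_comp2 k _ _ _ (sp_map E) (fun x => free_act x _)
      (sp_linear E) (free_act_linear_l _)).
  case=> n f x y; rewrite -/(cpgen _ _) /= !free_act_cpgen comp_map_cpgen.
  symmetry; apply: cpgen_ext => [t|i F FE].
    rewrite -[t](einvK E) /= efunK; case: (einv E t) => j [k0 l].
    by rewrite EE.
  pose QJ (s : fin_sum (fun j : fiber f i => J (sval j))) :=
    q (sval (tag s)) (tagged s).
  rewrite /act_y.
  rewrite -(@gamma_natural _ _ _ _ (tag_fiber J f i)
    (fun s => equiv_id (L (sval (tag s)) (tagged s)))
    (sum_fiber_equiv L f i) _ QJ) //; last by move=> s; rewrite sp_id.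
  rewrite /QJ (act_assoc (op_axioms P)
    (E := sum_assoc_equiv (fun j : fiber f i => L (sval j)))
    _ _ (fun j => p (sval j)) (fun j => q (sval j))) //.
  rewrite -!sp_map_comp; apply: sp_map_eq => -[j [x1 l]]; apply: val_inj.
  by rewrite /= FE /= EE.
Qed.

Definition free_module : right_module P := RightModule free_axioms.
End FreeModule.

(* The operad with binary generators O and given relations. Elements of the
   free operad at I are written as expressions in the elements of I in which
   each of them occurs exactly once in every monomial. The operadic ideal of
   the relations is encoded by the congruence econg: econg A relates
   expressions multilinear in A, and is generated by bilinearity of the
   operations and by all instances of the relations in which multilinear
   expressions with disjoint supports are substituted for the variables.
   The generators carry no symmetry: (skew-)symmetry is one of the relations. *)
Inductive expr (k O I : Type) : Type :=
| EVar of I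
| EOp of O & expr k O I & expr k O I
| EZero
| EAdd of expr k O I & expr k O I
| EScale of k & expr k O I.
Arguments EVar {k O I}.
Arguments EOp {k O I}.
Arguments EZero {k O I}.
Arguments EAdd {k O I}.
Arguments EScale {k O I}.

Fixpoint ebind (k O I J : Type) (t : expr k O I) (s : I -> expr k O J) :
    expr k O J :=
  match t with
  | EVar i => s i
  | EOp o t u => EOp o (ebind t s) (ebind u s)
  | EZero => EZero
  | EAdd t u => EAdd (ebind t s) (ebind u s)
  | EScale a t => EScale a (ebind t s)
  end.

Definition erelabel (k O I J : Type) (f : I -> J) (t : expr k O I) :
  expr k O J := ebind t (fun i => EVar (f i)).

Fixpoint eopmap (k O O' I : Type) (h : O -> O') (t : expr k O I) :
    expr k O' I :=
  match t with
  | EVar i => EVar i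
  | EOp o t u => EOp (h o) (eopmap h t) (eopmap h u)
  | EZero => EZero
  | EAdd t u => EAdd (eopmap h t) (eopmap h u)
  | EScale a t => EScale a (eopmap h t)
  end.

(* multilinear A t: t is a combination of monomials whose variables are the
   elements of A, each occurring once; EZero has every support. *)
Inductive multilinear (k O : Type) (I : finType) :
    {set I} -> expr k O I -> Prop :=
| ml_var i : multilinear [set i] (EVar i)
| ml_op o (A B : {set I}) t u :
    [disjoint A & B] -> multilinear A t -> multilinear B u ->
    multilinear (A :|: B) (EOp o t u)
| ml_zero A : multilinear A EZero
| ml_add A t u :
    multilinear A t -> multilinear A u -> multilinear A (EAdd t u)
| ml_scale A a t : multilinear A t -> multilinear A (EScale a t).

Record identity (k O : Type) := Identity {
  id_arity : nat;
  id_lhs : expr k O 'I_id_arity;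
  id_rhs : expr k O 'I_id_arity }.

Record presentation (k : fieldType) := Presentation {
  pr_ops : Type;
  pr_index : Type;
  pr_id : pr_index -> identity k pr_ops;
  pr_lhs_ml : forall r, multilinear [set: _] (id_lhs (pr_id r));
  pr_rhs_ml : forall r, multilinear [set: _] (id_rhs (pr_id r)) }.

Section PresentedOperad.
Variables (k : fieldType) (R : presentation k).
Local Notation O := (pr_ops R).
Local Notation expr := (expr k O).

Inductive econg (I : finType) : {set I} -> expr I -> expr I -> Prop :=
| ec_rel (r : pr_index R) (D : 'I_(id_arity (pr_id r)) -> {set I})
      (s : 'I_(id_arity (pr_id r)) -> expr I) :
    (forall i j, i != j -> [disjoint D i & D j]) ->
    (forall i, multilinear (D i) (s i)) ->
    econg (\bigcup_i D i) (ebind (id_lhs (pr_id r)) s)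
      (ebind (id_rhs (pr_id r)) s)
| ec_op o (A B : {set I}) t t' u u' :
    [disjoint A & B] -> econg A t t' -> econg B u u' ->
    econg (A :|: B) (EOp o t u) (EOp o t' u')
| ec_opDl o (A B : {set I}) t t' u :
    [disjoint A & B] ->
    multilinear A t -> multilinear A t' -> multilinear B u ->
    econg (A :|: B) (EOp o (EAdd t t') u) (EAdd (EOp o t u) (EOp o t' u))
| ec_opDr o (A B : {set I}) t u u' :
    [disjoint A & B] ->
    multilinear A t -> multilinear B u -> multilinear B u' ->
    econg (A :|: B) (EOp o t (EAdd u u')) (EAdd (EOp o t u) (EOp o t u'))
| ec_opZl o (A B : {set I}) a t u :
    [disjoint A & B] -> multilinear A t -> multilinear B u ->
    econg (A :|: B) (EOp o (EScale a t) u) (EScale a (EOp o t u))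
| ec_opZr o (A B : {set I}) a t u :
    [disjoint A & B] -> multilinear A t -> multilinear B u ->
    econg (A :|: B) (EOp o t (EScale a u)) (EScale a (EOp o t u))
| ec_refl A t : multilinear A t -> econg A t t
| ec_sym A t u : econg A t u -> econg A u t
| ec_trans A t u v : econg A t u -> econg A u v -> econg A t v
| ec_add A t t' u u' :
    econg A t t' -> econg A u u' -> econg A (EAdd t u) (EAdd t' u')
| ec_scale A a t t' : econg A t t' -> econg A (EScale a t) (EScale a t')
| ec_addA A t u v :
    multilinear A t -> multilinear A u -> multilinear A v ->
    econg A (EAdd t (EAdd u v)) (EAdd (EAdd t u) v)
| ec_addC A t u :
    multilinear A t -> multilinear A u -> econg A (EAdd t u) (EAdd u t)
| ec_add0 A t : multilinear A t -> econg A (EAdd EZero t) t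
| ec_addN A t : multilinear A t -> econg A (EAdd (EScale (-1) t) t) EZero
| ec_scaleA A a b t :
    multilinear A t -> econg A (EScale a (EScale b t)) (EScale (a * b) t)
| ec_scale1 A t : multilinear A t -> econg A (EScale 1 t) t
| ec_scaleDr A a t u :
    multilinear A t -> multilinear A u ->
    econg A (EScale a (EAdd t u)) (EAdd (EScale a t) (EScale a u))
| ec_scaleDl A a b t :
    multilinear A t ->
    econg A (EScale (a + b) t) (EAdd (EScale a t) (EScale b t)).

Lemma ebind_ext (I J : Type) (t : expr I) (s s' : I -> expr J) :
  s =1 s' -> ebind t s = ebind t s'.
Proof. by move=> ss'; elim: t => //= [o t -> u ->|t -> u ->|a t ->]. Qed.

Lemma ebindA (I J L : Type) (t : expr I) (s : I -> expr J) (r : J -> expr L) :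
  ebind (ebind t s) r = ebind t (fun i => ebind (s i) r).
Proof. by elim: t => //= [o t -> u ->|t -> u ->|a t ->]. Qed.

Lemma erelabel_id (I : Type) (f : I -> I) (t : expr I) :
  (forall i, f i = i) -> erelabel f t = t.
Proof.
rewrite /erelabel => f1.
by elim: t => //= [i|o t -> u ->|t -> u ->|a t ->] //; rewrite f1.
Qed.

Section Bind.
Variables (I J : finType) (D : I -> {set J}).
Hypothesis disjD : forall i j, i != j -> [disjoint D i & D j].

Lemma disjoint_bigcup (A B : {set I}) : [disjoint A & B] ->
  [disjoint \bigcup_(i in A) D i & \bigcup_(i in B) D i].
Proof.
move=> AB; apply/pred0P=> j /=; apply/negP => /andP[].
move=> /bigcupP[i iA ji] /bigcupP[i' i'B ji'].
have ii' : i != i' by apply: contraTneq iA => ->; rewrite (disjointFl AB i'B).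
by have := disjointFr (disjD ii') ji; rewrite ji'.
Qed.

Lemma ml_bind (A : {set I}) (t : expr I) (s : I -> expr J) :
  multilinear A t -> (forall i, multilinear (D i) (s i)) ->
  multilinear (\bigcup_(i in A) D i) (ebind t s).
Proof.
move=> At sD; elim: At => {A t} /=.
- by move=> i; rewrite big_set1.
- move=> o A B t u AB _ IHt _ IHu; rewrite bigcup_setU.
  by apply: ml_op => //; apply: disjoint_bigcup.
- by move=> A; apply: ml_zero.
- by move=> A t u _ IHt _ IHu; apply: ml_add.
- by move=> A a t _ IHt; apply: ml_scale.
Qed.
End Bind.

Lemma econg_ml (I : finType) (A : {set I}) t u :
  econg A t u -> multilinear A t /\ multilinear A u.
Proof.
elim=> {A t u}; try by move=> *; split; repeat
  (assumption || apply: ml_add || apply: ml_scale || apply: ml_zero ||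
   apply: ml_op).
- move=> r D s disjD sD.
  have -> : \bigcup_i D i = \bigcup_(i in [set: _]) D i.
    by apply: eq_bigl => i; rewrite inE.
  by split; apply: ml_bind => //; [apply: pr_lhs_ml|apply: pr_rhs_ml].
- by move=> o A B t t' u u' AB _ [? ?] _ [? ?]; split; apply: ml_op.
- by move=> A t u _ [? ?].
- by move=> A t u v _ [? ?] _ [? ?].
- by move=> A t t' u u' _ [? ?] _ [? ?]; split; apply: ml_add.
- by move=> A a t t' _ [? ?]; split; apply: ml_scale.
Qed.

Section Space.
Variables (I : finType) (A : {set I}).

Definition mexpr := {t : expr I | multilinear A t}.

Definition mzero : mexpr := exist _ EZero (ml_zero k O A).
Definition madd (t u : mexpr) : mexpr :=
  exist _ (EAdd (sval t) (sval u)) (ml_add (proj2_sig t) (proj2_sig u)).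
Definition mscale (a : k) (t : mexpr) : mexpr :=
  exist _ (EScale a (sval t)) (ml_scale a (proj2_sig t)).
Definition mcong (t u : mexpr) : Prop := econg A (sval t) (sval u).

Definition mexpr_prespace : prespace k.
Proof.
exists mexpr mcong mzero madd mscale; rewrite /mcong /=.
- by move=> [t At]; apply: ec_refl.
- by move=> [t At] [u Au]; apply: ec_sym.
- by move=> [t At] [u Au] [v Av]; apply: ec_trans.
- by move=> [t At] [t' At'] [u Au] [u' Au'] /=; apply: ec_add.
- by move=> a [t At] [t' At'] /=; apply: ec_scale.
- by move=> [t At] [u Au] [v Av]; apply: ec_addA.
- by move=> [t At] [u Au]; apply: ec_addC.
- by move=> [t At]; apply: ec_add0.
- by move=> [t At]; apply: ec_addN.
- by move=> a b [t At]; apply: ec_scaleA.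
- by move=> [t At]; apply: ec_scale1.
- by move=> a [t At] [u Au]; apply: ec_scaleDr.
- by move=> a b [t At]; apply: ec_scaleDl.
Defined.

Definition mspace : lmodType k := lquot mexpr_prespace.

Definition mclass (t : expr I) (At : multilinear A t) : mspace :=
  @lq_class k mexpr_prespace (exist _ t At).

Definition mrepr (x : mspace) : expr I :=
  sval (@lq_repr k mexpr_prespace x : mexpr).

Lemma mrepr_ml x : multilinear A (mrepr x).
Proof. exact: (proj2_sig (@lq_repr k mexpr_prespace x : mexpr)). Qed.

Lemma mclassP t u (At : multilinear A t) (Au : multilinear A u) :
  mclass At = mclass Au <-> econg A t u.
Proof. exact: (@lq_eqP k mexpr_prespace). Qed.

Lemma mreprK x (At : multilinear A (mrepr x)) : mclass At = x.
Proof.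
rewrite -[RHS](@lq_reprK k mexpr_prespace) /mclass.
exact/(@lq_eqP k mexpr_prespace)/ec_refl.
Qed.

Lemma mclass_ind (Q : mspace -> Prop) :
  (forall t (At : multilinear A t), Q (mclass At)) -> forall x, Q x.
Proof. by move=> Qt x; rewrite -(mreprK (mrepr_ml x)). Qed.

Lemma mrepr_class t (At : multilinear A t) : econg A (mrepr (mclass At)) t.
Proof.
by apply/(mclassP (mrepr_ml _) At); rewrite mreprK.
Qed.

Lemma mclassD t u (At : multilinear A t) (Au : multilinear A u) :
  mclass At + mclass Au = mclass (ml_add At Au).
Proof. by rewrite -[LHS](@lq_classD k mexpr_prespace). Qed.

Lemma mclassZ a t (At : multilinear A t) :
  a *: mclass At = mclass (ml_scale a At).
Proof. by rewrite -[LHS](@lq_classZ k mexpr_prespace). Qed.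

Lemma mclass0 (A0 : multilinear A EZero) : mclass A0 = 0.
Proof.
rewrite -[RHS](@lq_class0 k mexpr_prespace) /mclass.
exact/(@lq_eqP k mexpr_prespace)/ec_refl.
Qed.

End Space.

Section BindCong.
Variables (I J : finType) (D : I -> {set J}).
Hypothesis disjD : forall i j, i != j -> [disjoint D i & D j].
Implicit Types (s r : I -> expr J).

Lemma econg_bindl (A : {set I}) (t u : expr I) s :
  econg A t u -> (forall i, multilinear (D i) (s i)) ->
  econg (\bigcup_(i in A) D i) (ebind t s) (ebind u s).
Proof.
move=> tu sD.
have mlb B v : multilinear B v -> multilinear (\bigcup_(i in B) D i) (ebind v s).
  by move=> Bv; apply: ml_bind.
elim: tu => {A t u} /=.
- move=> r E w disjE wE; rewrite !ebindA.
  have -> : \bigcup_(i in \bigcup_j E j) D i = \bigcup_j \bigcup_(i in E j) D i.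
    apply/setP=> x; apply/bigcupP/bigcupP.
      move=> [i /bigcupP[j _ ij] xi]; exists j => //.
      by apply/bigcupP; exists i.
    move=> [j _ /bigcupP[i ij xi]]; exists i => //.
    by apply/bigcupP; exists j.
  apply: (ec_rel (r := r)) => [i j ij|i]; last exact: mlb.
  by apply: disjoint_bigcup => //; apply: disjE.
- by move=> *; rewrite bigcup_setU; apply: ec_op => //; apply: disjoint_bigcup.
- by move=> *; rewrite bigcup_setU; apply: ec_opDl => //;
    (apply: disjoint_bigcup || apply: mlb).
- by move=> *; rewrite bigcup_setU; apply: ec_opDr => //;
    (apply: disjoint_bigcup || apply: mlb).
- by move=> *; rewrite bigcup_setU; apply: ec_opZl => //;
    (apply: disjoint_bigcup || apply: mlb).
- by move=> *; rewrite bigcup_setU; apply: ec_opZr => //;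
    (apply: disjoint_bigcup || apply: mlb).
- by move=> A t At; apply: ec_refl; apply: mlb.
- by move=> A t u _; apply: ec_sym.
- by move=> A t u v _ tu _; apply: ec_trans.
- by move=> A t t' u u' _ IHt _ IHu; apply: ec_add.
- by move=> A a t t' _; apply: ec_scale.
- by move=> A t u v *; apply: ec_addA; apply: mlb.
- by move=> A t u *; apply: ec_addC; apply: mlb.
- by move=> A t *; apply: ec_add0; apply: mlb.
- by move=> A t *; apply: ec_addN; apply: mlb.
- by move=> A a b t *; apply: ec_scaleA; apply: mlb.
- by move=> A t *; apply: ec_scale1; apply: mlb.
- by move=> A a t u *; apply: ec_scaleDr; apply: mlb.
- by move=> A a b t *; apply: ec_scaleDl; apply: mlb.
Qed.

Lemma econg_bindr (A : {set I}) (t : expr I) s r :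
  multilinear A t -> (forall i, i \in A -> econg (D i) (s i) (r i)) ->
  econg (\bigcup_(i in A) D i) (ebind t s) (ebind t r).
Proof.
elim=> {A t} /=.
- by move=> i sr; rewrite big_set1; apply: sr; rewrite inE.
- move=> o A B t u AB _ IHt _ IHu sr; rewrite bigcup_setU.
  apply: ec_op; first exact: disjoint_bigcup.
    by apply: IHt => i iA; apply: sr; rewrite inE iA.
  by apply: IHu => i iB; apply: sr; rewrite inE iB orbT.
- by move=> A _; apply/ec_refl/ml_zero.
- by move=> A t u _ IHt _ IHu sr; apply: ec_add; auto.
- by move=> A a t _ IHt sr; apply: ec_scale; auto.
Qed.

Lemma econg_bind_linear (A : {set I}) (t : expr I) s s1 s2 a i0 :
  (forall i, multilinear (D i) (s1 i)) -> (forall i, multilinear (D i) (s2 i)) ->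
  econg (D i0) (s i0) (EAdd (EScale a (s1 i0)) (s2 i0)) ->
  (forall i, i != i0 -> econg (D i) (s i) (s1 i) /\ econg (D i) (s i) (s2 i)) ->
  multilinear A t -> i0 \in A ->
  econg (\bigcup_(i in A) D i) (ebind t s)
    (EAdd (EScale a (ebind t s1)) (ebind t s2)).
Proof.
move=> ml1 ml2 s0 s12.
have mlb1 B v : multilinear B v ->
    multilinear (\bigcup_(i in B) D i) (ebind v s1).
  by move=> Bv; apply: ml_bind.
have mlb2 B v : multilinear B v ->
    multilinear (\bigcup_(i in B) D i) (ebind v s2).
  by move=> Bv; apply: ml_bind.
elim=> {A t} /=.
- by move=> i; rewrite inE big_set1 => /eqP <-.
- move=> o A B t u AB At IHt Bu IHu; rewrite inE bigcup_setU => i0AB.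
  have dAB := disjoint_bigcup disjD AB.
  have [i0A|i0A] := boolP (i0 \in A).
    have i0B : i0 \notin B by rewrite (disjointFr AB i0A).
    have u12 : econg (\bigcup_(i in B) D i) (ebind u s) (ebind u s1) /\
               econg (\bigcup_(i in B) D i) (ebind u s) (ebind u s2).
      by split; apply: econg_bindr => // i iB;
        have [] := s12 i; rewrite ?(contraNneq _ i0B) // => <-.
    have [u1 u2] := u12.
    apply: ec_trans (ec_op o dAB (IHt i0A) (ec_refl (proj1 (econg_ml u1)))) _.
    have mlu := proj1 (econg_ml u1).
    apply: ec_trans (ec_opDl _ _ _ _ _) _ => //; auto.
      by apply: ml_scale; auto.
    apply: ec_add; last by apply: ec_op => //; apply: ec_refl; auto.
    apply: ec_trans (ec_opZl _ _ _ _ _) _ => //; auto.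
    by apply/ec_scale/ec_op => //; apply: ec_refl; auto.
  have i0B : i0 \in B by rewrite (negPf i0A) in i0AB.
  have t12 : econg (\bigcup_(i in A) D i) (ebind t s) (ebind t s1) /\
             econg (\bigcup_(i in A) D i) (ebind t s) (ebind t s2).
    by split; apply: econg_bindr => // i iA;
      have [] := s12 i; rewrite ?(contraNneq _ i0A) // => <-.
  have [t1 t2] := t12.
  have mlt := proj1 (econg_ml t1).
  apply: ec_trans (ec_op o dAB (ec_refl mlt) (IHu i0B)) _.
  apply: ec_trans (ec_opDr _ _ _ _ _) _ => //; auto.
    by apply: ml_scale; auto.
  apply: ec_add; last by apply: ec_op => //; apply: ec_refl; auto.
  apply: ec_trans (ec_opZr _ _ _ _ _) _ => //; auto.
  by apply/ec_scale/ec_op => //; apply: ec_refl; auto.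
- move=> A _; set B := \bigcup_(i in A) D i.
  have B0 := ml_zero k O B.
  apply/(mclassP B0 (ml_add (ml_scale a B0) B0)).
  by rewrite -mclassD -mclassZ !mclass0 scaler0 addr0.
- move=> A t u At IHt Au IHu i0A.
  apply: ec_trans (ec_add (IHt i0A) (IHu i0A)) _.
  set t1 := ebind t s1; set t2 := ebind t s2.
  set u1 := ebind u s1; set u2 := ebind u s2.
  have [t1A t2A] := (mlb1 _ _ At, mlb2 _ _ At).
  have [u1A u2A] := (mlb1 _ _ Au, mlb2 _ _ Au).
  apply/(mclassP (ml_add (ml_add (ml_scale a t1A) t2A)
                         (ml_add (ml_scale a u1A) u2A))
                 (ml_add (ml_scale a (ml_add t1A u1A)) (ml_add t2A u2A))).
  by rewrite -!(mclassD, mclassZ) scalerDr addrACA.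
- move=> A b t At IHt i0A.
  apply: ec_trans (ec_scale b (IHt i0A)) _.
  have [t1A t2A] := (mlb1 _ _ At, mlb2 _ _ At).
  apply/(mclassP (ml_scale b (ml_add (ml_scale a t1A) t2A))
                 (ml_add (ml_scale a (ml_scale b t1A)) (ml_scale b t2A))).
  by rewrite -!(mclassD, mclassZ) scalerDr !scalerA mulrC.
Qed.
End BindCong.

Section Relabel.
Variables (I J : finType) (f : I -> J).
Hypothesis f_inj : injective f.

Lemma disjoint_singletons i j : i != j -> [disjoint [set f i] & [set f j]].
Proof.
by move=> ij; rewrite disjoints1 inE (inj_eq f_inj).
Qed.

Lemma bigcup_singletons (A : {set I}) : \bigcup_(i in A) [set f i] = f @: A.
Proof.
apply/setP=> j; apply/bigcupP/imsetP => -[i iA].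
  by rewrite inE => /eqP ->; exists i.
by move=> ->; exists i; rewrite ?inE.
Qed.

Lemma ml_relabel (A : {set I}) (t : expr I) :
  multilinear A t -> multilinear (f @: A) (erelabel f t).
Proof.
move=> At; rewrite -bigcup_singletons.
by apply: ml_bind => // [|i]; [apply: disjoint_singletons|apply: ml_var].
Qed.

Lemma econg_relabel (A : {set I}) (t u : expr I) :
  econg A t u -> econg (f @: A) (erelabel f t) (erelabel f u).
Proof.
move=> tu; rewrite -bigcup_singletons.
by apply: econg_bindl => // [|i]; [apply: disjoint_singletons|apply: ml_var].
Qed.
End Relabel.

Lemma equiv_imset (I J : finType) (e : equiv I J) : e @: [set: I] = [set: J].
Proof.
by apply/setP=> j; rewrite [RHS]inE -[j](einvK e) imset_f ?inE.
Qed.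

Lemma ml_equiv (I J : finType) (e : equiv I J) (t : expr I) :
  multilinear [set: I] t -> multilinear [set: J] (erelabel e t).
Proof. by move/(ml_relabel (@efun_inj _ _ e)); rewrite equiv_imset. Qed.

Lemma econg_equiv (I J : finType) (e : equiv I J) (t u : expr I) :
  econg [set: I] t u -> econg [set: J] (erelabel e t) (erelabel e u).
Proof. by move/(econg_relabel (@efun_inj _ _ e)); rewrite equiv_imset. Qed.

Definition pr_ob (I : finType) : lmodType k := mspace [set: I].

Definition pr_map (I J : finType) (e : equiv I J) (x : pr_ob I) : pr_ob J :=
  mclass (ml_equiv e (mrepr_ml x)).

Lemma pr_mapE (I J : finType) (e : equiv I J) t (It : multilinear [set: I] t) :
  pr_map e (mclass It) = mclass (ml_equiv e It).
Proof. exact/mclassP/econg_equiv/mrepr_class. Qed.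

Lemma pr_map_linear (I J : finType) (e : equiv I J) : linear (pr_map e).
Proof.
move=> a; elim/mclass_ind=> t At; elim/mclass_ind=> u Au.
rewrite mclassZ mclassD !pr_mapE mclassZ mclassD.
exact/mclassP/ec_refl/ml_equiv/ml_add/Au/ml_scale.
Qed.

Lemma pr_map_id (I : finType) (e : equiv I I) :
  (forall i, e i = i) -> forall x, pr_map e x = x.
Proof.
move=> e1; elim/mclass_ind=> t At; rewrite pr_mapE; apply/mclassP.
by rewrite erelabel_id //; apply: ec_refl.
Qed.

Lemma pr_map_comp (I J L : finType) (e : equiv I J) (f : equiv J L)
    (g : equiv I L) :
  (forall i, g i = f (e i)) -> forall x, pr_map g x = pr_map f (pr_map e x).
Proof.
move=> gE; elim/mclass_ind=> t At; rewrite !pr_mapE; apply/mclassP.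
rewrite /erelabel ebindA /= -[X in econg _ _ X](@ebind_ext _ _ _
  (fun i => EVar (g i))); last by move=> i; rewrite gE.
exact/ec_refl/ml_equiv.
Qed.

Definition pr_species : species k :=
  Species pr_map_linear pr_map_id pr_map_comp.

Section Gamma.
Variables (I : finType) (J : I -> finType).

Definition inj_tag (i : I) (j : J i) : fin_sum J := existT _ i j.

Lemma inj_tag_inj i : injective (@inj_tag i).
Proof. by move=> j j' /eqP; rewrite /inj_tag eq_Tagged => /eqP. Qed.

Definition block (i : I) : {set fin_sum J} := @inj_tag i @: [set: J i].

Lemma in_block i s : (s \in block i) = (tag s == i).
Proof.
apply/imsetP/eqP => [[j _ ->] //|<-]; exists (tagged s) => //.
by case: s.
Qed.

Lemma disjoint_block i i' : i != i' -> [disjoint block i & block i'].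
Proof.
move=> ii'; apply/pred0P=> s /=; rewrite !in_block.
by apply: contra_neqF ii' => /andP[/eqP <- /eqP <-].
Qed.

Lemma bigcup_block : \bigcup_(i in [set: I]) block i = [set: fin_sum J].
Proof.
apply/setP=> s; rewrite inE; apply/bigcupP; exists (tag s) => //.
by rewrite in_block.
Qed.

Definition esubst (t : expr I) (s : forall i, expr (J i)) : expr (fin_sum J) :=
  ebind t (fun i => erelabel (@inj_tag i) (s i)).

Lemma ml_block i (t : expr (J i)) : multilinear [set: J i] t ->
  multilinear (block i) (erelabel (@inj_tag i) t).
Proof. by apply: ml_relabel; apply: inj_tag_inj. Qed.

Lemma econg_block i (t u : expr (J i)) : econg [set: J i] t u ->
  econg (block i) (erelabel (@inj_tag i) t) (erelabel (@inj_tag i) u).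
Proof. by apply: econg_relabel; apply: inj_tag_inj. Qed.

Lemma ml_subst t (s : forall i, expr (J i)) :
  multilinear [set: I] t -> (forall i, multilinear [set: J i] (s i)) ->
  multilinear [set: fin_sum J] (esubst t s).
Proof.
move=> It Js; rewrite -bigcup_block; apply: ml_bind => //.
  exact: disjoint_block.
by move=> i; apply: ml_block.
Qed.

Lemma econg_subst t t' (s s' : forall i, expr (J i)) :
  econg [set: I] t t' -> (forall i, econg [set: J i] (s i) (s' i)) ->
  econg [set: fin_sum J] (esubst t s) (esubst t' s').
Proof.
move=> tt' ss'; rewrite -bigcup_block.
apply: (@ec_trans _ _ _ (esubst t' s)).
  apply: econg_bindl => //; first exact: disjoint_block.
  by move=> i; apply/ml_block/(proj1 (econg_ml (ss' i))).
apply: econg_bindr => //; first exact: disjoint_block.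
  exact: proj2 (econg_ml tt').
by move=> i _; apply: econg_block.
Qed.

Definition pr_gamma (x : pr_ob I) (p : forall i, pr_ob (J i)) :
    pr_ob (fin_sum J) :=
  mclass (ml_subst (mrepr_ml x) (fun i => mrepr_ml (p i))).

Lemma pr_gammaE t (It : multilinear [set: I] t) (p : forall i, pr_ob (J i)) 
    (s : forall i, expr (J i)) (Js : forall i, multilinear [set: J i] (s i)) :
  (forall i, p i = mclass (Js i)) ->
  pr_gamma (mclass It) p = mclass (ml_subst It Js).
Proof.
move=> ps; apply/mclassP/econg_subst; first exact: mrepr_class.
by move=> i; rewrite ps; apply: mrepr_class.
Qed.

Lemma pr_gammaE' t (It : multilinear [set: I] t) (p : forall i, pr_ob (J i)) :
  pr_gamma (mclass It) p = mclass (ml_subst It (fun i => mrepr_ml (p i))).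
Proof. by apply: pr_gammaE => i; rewrite mreprK. Qed.

Lemma pr_gamma_linear_l p : linear (fun x => pr_gamma x p).
Proof.
move=> a; elim/mclass_ind=> t At; elim/mclass_ind=> u Au.
rewrite mclassZ mclassD !pr_gammaE' mclassZ mclassD.
apply/mclassP/ec_refl/(ml_subst (ml_add (ml_scale a At) Au)) => i.
exact: mrepr_ml.
Qed.

Lemma pr_gamma_linear_r x (p : forall i, pr_ob (J i)) i :
  linear (fun q : pr_ob (J i) => pr_gamma x (dfwith p q)).
Proof.
move=> a u v; elim/mclass_ind: x => t It; rewrite !pr_gammaE' mclassZ mclassD.
apply/mclassP; rewrite -bigcup_block.
apply: (@econg_bind_linear _ _ _ disjoint_block _ _ _ _ _ _ i) => //.
- by move=> j; apply/ml_block/mrepr_ml.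
- by move=> j; apply/ml_block/mrepr_ml.
- rewrite !dfwith_in; apply: (@econg_block i _ (EAdd (EScale a _) _)).
  have Ju := mrepr_ml u; have Jv := mrepr_ml v.
  apply/(mclassP (mrepr_ml _) (ml_add (ml_scale a Ju) Jv)).
  by rewrite mreprK -mclassD -mclassZ !mreprK.
- move=> j; rewrite eq_sym => ij; rewrite !dfwith_out //.
  by split; apply/ec_refl/ml_block/mrepr_ml.
Qed.
End Gamma.


Lemma ml_one : multilinear [set: unit] (EVar tt : expr unit).
Proof.
have -> : [set: unit] = [set tt] by apply/setP => -[]; rewrite !inE.
exact: ml_var.
Qed.

Definition pr_one : pr_ob unit := mclass ml_one.

Lemma pr_gamma_natural (I I' : finType) (J : I -> finType) (J' : I' -> finType)
    (e : equiv I I') (f : forall i, equiv (J i) (J' (e i)))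
    (E : equiv (fin_sum J) (fin_sum J')) :
  (forall i j, E (existT _ i j) = existT _ (e i) (f i j)) ->
  forall (x : pr_ob I) (p : forall i, pr_ob (J i)) (p' : forall i, pr_ob (J' i)),
  (forall i, p' (e i) = pr_map (f i) (p i)) ->
  pr_map E (pr_gamma x p) = pr_gamma (pr_map e x) p'.
Proof.
move=> EE x p p' pp'; elim/mclass_ind: x => t It.
rewrite pr_gammaE' !pr_mapE pr_gammaE'; apply/mclassP.
rewrite /erelabel /esubst !ebindA /=.
rewrite -(bigcup_block J') -(equiv_imset e).
have -> : \bigcup_(i in e @: [set: I]) block J' i =
    \bigcup_(i in [set: I]) block J' (e i).
  by rewrite big_imset //= => i j _ _; apply: efun_inj.
apply: econg_bindr => // [i i' ii'|i _].
  by apply: disjoint_block; rewrite (inj_eq (@efun_inj _ _ e)).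
rewrite ebindA /=.
rewrite (@ebind_ext _ _ _ _ (fun j => EVar (inj_tag (f i j)))); last first.
  by move=> j; rewrite /inj_tag EE.
have : econg [set: J' (e i)] (erelabel (f i) (mrepr (p i))) (mrepr (p' (e i))).
  apply/(mclassP (ml_equiv (f i) (mrepr_ml _)) (mrepr_ml _)).
  by rewrite mreprK pp'.
by move/econg_block; rewrite {1}/erelabel ebindA.
Qed.

Lemma pr_gamma_one (I : finType) (E : equiv I (fin_sum (fun _ : I => unit))) :
  (forall i, E i = existT _ i tt) ->
  forall x : pr_ob I, pr_gamma x (fun=> pr_one) = pr_map E x.
Proof.
move=> EE; elim/mclass_ind=> t It.
rewrite (@pr_gammaE _ _ _ It _ _ (fun=> ml_one)) // pr_mapE; apply/mclassP.
rewrite /esubst /erelabel /= (@ebind_ext _ _ _ _ (fun i => EVar (E i))).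
  exact/ec_refl/ml_equiv.
by move=> i; rewrite EE.
Qed.

Lemma pr_gamma_assoc (I : finType) (J : I -> finType)
    (L : forall i, J i -> finType)
    (E : equiv (fin_sum (fun i => fin_sum (L i)))
               (fin_sum (fun s : fin_sum J => L (tag s) (tagged s)))) :
  (forall i j l,
    E (existT _ i (existT _ j l)) = existT _ (existT _ i j) l) ->
  forall (x : pr_ob I) (p : forall i, pr_ob (J i))
    (q : forall i j, pr_ob (L i j)),
  pr_gamma (pr_gamma x p) (fun s => q (tag s) (tagged s)) =
  pr_map E (pr_gamma x (fun i => pr_gamma (p i) (q i))).
Proof.
move=> EE x p q; elim/mclass_ind: x => t It.
have Lq (s : fin_sum J) := mrepr_ml (q (tag s) (tagged s)).
have Lpq i := ml_subst (mrepr_ml (p i)) (fun j => mrepr_ml (q i j)).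
rewrite pr_gammaE' (@pr_gammaE _ _ _ _ _ _ Lq); last by move=> s; rewrite mreprK.
rewrite (@pr_gammaE _ _ _ It _ _ Lpq); last first.
  by move=> i; rewrite /pr_gamma; apply/mclassP/ec_refl/Lpq.
rewrite pr_mapE; apply/mclassP.
set t1 := erelabel E _; have -> : t1 = esubst (esubst t (fun i => mrepr (p i)))
    (fun s : fin_sum J => mrepr (q (tag s) (tagged s))).
  rewrite /t1 /esubst /erelabel !ebindA; apply: ebind_ext => i /=.
  rewrite !ebindA; apply: ebind_ext => j /=.
  by rewrite !ebindA; apply: ebind_ext => l /=; rewrite /inj_tag EE.
by apply/ec_refl/ml_subst => //; apply: ml_subst => // i; apply: mrepr_ml.
Qed.

Lemma pr_axioms : right_action_axioms (P := pr_species) pr_one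
  (@pr_gamma) (M := pr_species) (@pr_gamma).
Proof.
split.
- exact: pr_gamma_linear_l.
- exact: pr_gamma_linear_r.
- exact: pr_gamma_natural.
- exact: pr_gamma_one.
- exact: pr_gamma_assoc.
Qed.

Lemma pr_one_l (J : finType) (E : equiv J (fin_sum (fun _ : unit => J))) :
  (forall j, E j = existT _ tt j) ->
  forall p : pr_species J, pr_gamma pr_one (fun=> p) = sp_map E p.
Proof.
move=> EE; elim/mclass_ind=> t Jt.
rewrite /= pr_mapE (@pr_gammaE _ _ _ ml_one _ _ (fun=> Jt)) //; apply/mclassP.
rewrite /esubst /erelabel /= (@ebind_ext _ _ _ _ (fun j => EVar (E j))).
  exact/ec_refl/ml_equiv.
by move=> j; rewrite EE.
Qed.

Definition presented_operad : operad k := Operad pr_axioms pr_one_l.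
End PresentedOperad.

Definition identity_opmap (k O O' : Type) (h : O -> O') (r : identity k O) :
  identity k O' := Identity (eopmap h (id_lhs r)) (eopmap h (id_rhs r)).

Lemma eopmap_bind (k O O' I J : Type) (h : O -> O') (t : expr k O I)
    (s : I -> expr k O J) :
  eopmap h (ebind t s) = ebind (eopmap h t) (fun i => eopmap h (s i)).
Proof. by elim: t => //= [o t -> u ->|t -> u ->|a t ->]. Qed.

Section PresentedMorphism.
Variables (k : fieldType) (R R' : presentation k) (h : pr_ops R -> pr_ops R').
Variable (hr : pr_index R -> pr_index R').
Hypothesis hrE : forall r, pr_id (hr r) = identity_opmap h (pr_id r).

Lemma ml_opmap (I : finType) (A : {set I}) (t : expr k _ I) :
  multilinear A t -> multilinear A (eopmap h t).
Proof.
elim=> {A t} /=.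
- by move=> i; apply: ml_var.
- by move=> *; apply: ml_op.
- by move=> *; apply: ml_zero.
- by move=> *; apply: ml_add.
- by move=> *; apply: ml_scale.
Qed.

Lemma econg_opmap (I : finType) (A : {set I}) t u :
  @econg k R I A t u -> @econg k R' I A (eopmap h t) (eopmap h u).
Proof.
elim=> {A t u} /=.
- move=> r D s disjD sD; rewrite !eopmap_bind.
  have sD' i := ml_opmap (sD i).
  move: (@ec_rel k R' I (hr r)); rewrite hrE => ecr.
  exact: (ecr D (fun i => eopmap h (s i))).
- by move=> *; apply: ec_op.
- by move=> *; apply: ec_opDl => //; apply: ml_opmap.
- by move=> *; apply: ec_opDr => //; apply: ml_opmap.
- by move=> *; apply: ec_opZl => //; apply: ml_opmap.
- by move=> *; apply: ec_opZr => //; apply: ml_opmap.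
- by move=> *; apply/ec_refl/ml_opmap.
- by move=> *; apply: ec_sym.
- by move=> A t u v _ tu _; apply: ec_trans.
- by move=> *; apply: ec_add.
- by move=> *; apply: ec_scale.
- by move=> *; apply: ec_addA; apply: ml_opmap.
- by move=> *; apply: ec_addC; apply: ml_opmap.
- by move=> *; apply: ec_add0; apply: ml_opmap.
- by move=> *; apply: ec_addN; apply: ml_opmap.
- by move=> *; apply: ec_scaleA; apply: ml_opmap.
- by move=> *; apply: ec_scale1; apply: ml_opmap.
- by move=> *; apply: ec_scaleDr; apply: ml_opmap.
- by move=> *; apply: ec_scaleDl; apply: ml_opmap.
Qed.

Local Notation P := (presented_operad R).
Local Notation P' := (presented_operad R').

Definition pmor (I : finType) (x : P I) : P' I :=
  mclass (ml_opmap (mrepr_ml x)).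

Lemma pmorE (I : finType) t (It : multilinear [set: I] t) :
  pmor (mclass (R := R) It) = mclass (R := R') (ml_opmap It).
Proof. exact/mclassP/econg_opmap/mrepr_class. Qed.

Lemma pmor_linear I : linear (@pmor I).
Proof.
move=> a; elim/mclass_ind=> t At; elim/mclass_ind=> u Au.
rewrite mclassZ mclassD !pmorE mclassZ mclassD.
exact/mclassP/ec_refl/(ml_opmap (ml_add (ml_scale a At) Au)).
Qed.

Lemma pmor_natural (I J : finType) (e : equiv I J) x :
  pmor (sp_map e x) = sp_map e (pmor x).
Proof.
elim/mclass_ind: x => t It; rewrite /= pr_mapE !pmorE pr_mapE.
by apply/mclassP; rewrite /erelabel eopmap_bind; apply/ec_refl/ml_equiv/ml_opmap.
Qed.

Lemma pmor_one : pmor (op_one P) = op_one P'.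
Proof. by rewrite [LHS]pmorE; apply/mclassP/ec_refl/ml_one. Qed.

Lemma pmor_gamma (I : finType) (J : I -> finType) (x : P I)
    (p : forall i, P (J i)) :
  pmor (op_gamma x p) = op_gamma (pmor x) (fun i => pmor (p i)).
Proof.
elim/mclass_ind: x => t It; rewrite /= pr_gammaE' !pmorE.
rewrite (@pr_gammaE _ _ _ _ _ (ml_opmap It) _ _ (fun i => ml_opmap (mrepr_ml (p i)))) //.
apply/mclassP.
rewrite {1}/esubst eopmap_bind (@ebind_ext _ R' _ _ _ _
  (fun i => erelabel (@inj_tag I J i) (eopmap h (mrepr (p i))))).
  by apply/ec_refl/ml_subst => [|i]; apply: ml_opmap => //; apply: mrepr_ml.
by move=> i; rewrite /erelabel eopmap_bind.
Qed.

Definition presented_morphism : operad_morphism P P' :=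
  OperadMorphism pmor_linear pmor_natural pmor_one pmor_gamma.
End PresentedMorphism.

Section MultilinearTest.
Variables (k O : Type).

Fixpoint monomial_leaves (I : Type) (t : expr k O I) : option (seq I) :=
  match t with
  | EVar i => Some [:: i]
  | EOp _ t u =>
      if monomial_leaves t is Some s then
        if monomial_leaves u is Some r then Some (s ++ r) else None
      else None
  | _ => None
  end.

Fixpoint multilinear_test n (t : expr k O 'I_n) : bool :=
  match t with
  | EZero => true
  | EAdd t u => multilinear_test t && multilinear_test u
  | EScale _ t => multilinear_test t
  | _ => if monomial_leaves t is Some s then uniq s && (size s == n) else false
  end.

Lemma ml_monomial (I : finType) (t : expr k O I) s :
  monomial_leaves t = Some s -> uniq s -> multilinear [set i in s] t.
Proof.
elim: t s => //= [i s [<-] _|o t IHt u IHu s].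
  by rewrite set_cons set_nil setU0; apply: ml_var.
case: (monomial_leaves t) IHt => // s1 IHt.
case: (monomial_leaves u) IHu => // s2 IHu [<-]; rewrite cat_uniq.
case/and3P=> us1 /hasPn dis us2.
have -> : [set i in s1 ++ s2] = [set i in s1] :|: [set i in s2].
  by apply/setP=> i; rewrite !inE mem_cat.
apply: ml_op; [|exact: IHt|exact: IHu].
apply/pred0P=> i /=; rewrite !inE; apply/negP=> /andP[is1 is2].
by have := dis i is2; rewrite /= is1.
Qed.

Lemma multilinear_testP n (t : expr k O 'I_n) :
  multilinear_test t -> multilinear [set: 'I_n] t.
Proof.
have mono (u : expr k O 'I_n) :
    (if monomial_leaves u is Some s then uniq s && (size s == n) else false) ->
    multilinear [set: 'I_n] u.
  case E: (monomial_leaves u) => [s|//] /andP[us /eqP sn].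
  suff <- : [set i in s] = [set: 'I_n] by apply: ml_monomial.
  apply/eqP; rewrite eqEcard subsetT cardsT card_ord cardsE.
  by rewrite (card_uniqP us) sn leqnn.
elim: t => [i|o t _ u _||t IHt u IHu|a t IHt].
- exact: (mono (EVar i)).
- exact: (mono (EOp o t u)).
- by move=> _; apply: ml_zero.
- by move=> /= /andP[/IHt ? /IHu ?]; apply: ml_add.
- by move=> /= /IHt ?; apply: ml_scale.
Qed.
End MultilinearTest.

Section Identities.
Variables (k : fieldType) (O : Type).

Local Notation "x + y" := (EAdd x y).
Local Notation "x - y" := (EAdd x (EScale (-1) y)).
Local Notation a_ n i := (EVar (@Ordinal n i isT)).

Section Bracket.
Variable b : O.
Local Notation "[br x , y ]" := (EOp b x y).

Definition skew_symmetry : identity k O :=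
  let a1 := a_ 2 0 in
  let a2 := a_ 2 1 in
  @Identity k O 2 [br a1, a2] (EScale (-1) [br a2, a1]).

Definition Jacobi : identity k O :=
  let a1 := a_ 3 0 in
  let a2 := a_ 3 1 in
  let a3 := a_ 3 2 in
  @Identity k O 3
    ([br [br a1, a2], a3] + [br [br a2, a3], a1] + [br [br a3, a1], a2])
    EZero.
End Bracket.

Section Product.
Variable m : O.
Local Notation "x \circ y" := (EOp m x y) (at level 40, left associativity).

Definition commutativity : identity k O :=
  let a1 := a_ 2 0 in
  let a2 := a_ 2 1 in
  @Identity k O 2 (a1 \circ a2) (a2 \circ a1).

Definition associativity : identity k O :=
  let a1 := a_ 3 0 in
  let a2 := a_ 3 1 in
  let a3 := a_ 3 2 in
  @Identity k O 3 ((a1 \circ a2) \circ a3) (a1 \circ (a2 \circ a3)).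

Variable b : O.
Local Notation "[br x , y ]" := (EOp b x y).

Definition Hertling_Manin : identity k O :=
  let a1 := a_ 4 0 in
  let a2 := a_ 4 1 in
  let a3 := a_ 4 2 in
  let a4 := a_ 4 3 in
  @Identity k O 4 [br a1 \circ a2, a3 \circ a4]
    ([br a1 \circ a2, a3] \circ a4 + [br a1 \circ a2, a4] \circ a3
     + a1 \circ [br a2, a3 \circ a4] + a2 \circ [br a1, a3 \circ a4]
     - (a1 \circ a3) \circ [br a2, a4] - (a2 \circ a3) \circ [br a1, a4]
     - (a2 \circ a4) \circ [br a1, a3] - (a1 \circ a4) \circ [br a2, a3]).
End Product.
End Identities.

Section FMan.
Variable k : fieldType.

Variant Lie_op := Lie_bracket.
Variant Lie_relation := Lie_skew | Lie_Jacobi.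

Definition Lie_identity (r : Lie_relation) : identity k Lie_op :=
  match r with
  | Lie_skew => skew_symmetry k Lie_bracket
  | Lie_Jacobi => Jacobi k Lie_bracket
  end.

Lemma Lie_lhs_ml r : multilinear [set: _] (id_lhs (Lie_identity r)).
Proof. by case: r; apply: multilinear_testP. Qed.

Lemma Lie_rhs_ml r : multilinear [set: _] (id_rhs (Lie_identity r)).
Proof. by case: r; apply: multilinear_testP. Qed.

Definition Lie_presentation : presentation k :=
  Presentation Lie_lhs_ml Lie_rhs_ml.

Definition Lie : operad k := presented_operad Lie_presentation.

Variant FMan_op := FMan_product | FMan_bracket.
Variant FMan_relation :=
  FMan_comm | FMan_assoc | FMan_skew | FMan_Jacobi | FMan_HM.

Definition FMan_identity (r : FMan_relation) : identity k FMan_op :=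
  match r with
  | FMan_comm => commutativity k FMan_product
  | FMan_assoc => associativity k FMan_product
  | FMan_skew => skew_symmetry k FMan_bracket
  | FMan_Jacobi => Jacobi k FMan_bracket
  | FMan_HM => Hertling_Manin k FMan_product FMan_bracket
  end.

Lemma FMan_lhs_ml r : multilinear [set: _] (id_lhs (FMan_identity r)).
Proof. by case: r; apply: multilinear_testP. Qed.

Lemma FMan_rhs_ml r : multilinear [set: _] (id_rhs (FMan_identity r)).
Proof. by case: r; apply: multilinear_testP. Qed.

Definition FMan_presentation : presentation k :=
  Presentation FMan_lhs_ml FMan_rhs_ml.

Definition FMan : operad k := presented_operad FMan_presentation.

Definition Lie_to_FMan_op (o : pr_ops Lie_presentation) :
  pr_ops FMan_presentation := FMan_bracket.

Definition Lie_to_FMan_relation (r : pr_index Lie_presentation) :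
  pr_index FMan_presentation :=
  match r with Lie_skew => FMan_skew | Lie_Jacobi => FMan_Jacobi end.

Lemma Lie_to_FMan_relationE r :
  pr_id (Lie_to_FMan_relation r) = identity_opmap Lie_to_FMan_op (pr_id r).
Proof. by case: r. Qed.

Definition Lie_to_FMan : operad_morphism Lie FMan :=
  presented_morphism Lie_to_FMan_relationE.

Definition FMan_Lie_module : right_module Lie := pullback_module Lie_to_FMan.
End FMan.

(* Main.v *)
(* Write X for the right Lie-module (RT_{<>1} o Com) o Lie.  An explicit rule
   (node below) evaluates a rooted tree without unary vertices, whose vertices
   carry commuting Lie elements, in any F-manifold algebra, and so gives a
   morphism Phi from X to FMan.
   - Phi is onto: in an F-manifold algebra generated by Lie elements, the
     Hertling-Manin relation shows by induction on the degree that the values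
     of the trees span.
   - dim FMan(J) is at least the number of rooted trees on J: in a pre-Lie
     algebra, x o y = x < y + y < x and the commutator satisfy the relations of
     FMan up to terms with more commutators, so that FMan maps onto the graded
     object of the free pre-Lie algebra, filtered by the number of commutators.
   - X(J) is spanned by as many elements as there are rooted trees on J: order
     the Lie words at each vertex, each written with its least letter first, by
     decreasing first letter, concatenate them and expand the vertex into the
     resulting chain.  The chains are recovered as the maximal runs of unary
     vertices, and the words as the blocks between left-to-right minima.
   Hence Phi maps a spanning family of X(J) to a basis of FMan(J). *)

(* The node rule is modelled on a fact about free products of Lie algebras. By the Hertling-Manin
   relation the products form a Lie algebra P, next to the Lie algebra L of letters; the kernel of
   the map from the free product of L and P to L x P is free on the brackets [p1, ... [p(s-1), [x1,
   ... [xm, ps]]]] with m, s >= 1. Up to brackets of smaller ones and up to merging two entries,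
   these are symmetric in the x and in the p: a vertex with a set of letters and a set of children.
   It remains to reach products of Lie words in such vertices. Let mu_l be multiplication by l and
   ad_l be extended as a derivation. The commutator of m mu_l + ad_l and m' mu_l' + ad_l' is (m +
   m') mu_[l,l'] + ad_[l,l'], so that vertices, entered with coefficient 1, give Lie words of m
   vertices with coefficient m, invertible in characteristic zero. A vertex with a single child p
   would be [x1, ... [xm, p]]. It is traded for a vertex whose children are the factors of p: hence
   no unary vertices, and hence a subtree carries a pair, its indecomposable part and its product
   part. *)
Require Import Defs.
From HB Require Import structures.
From mathcomp Require Import all_boot all_order all_algebra.
From mathcomp Require Import boolp ring zify.
Set Implicit Arguments.
Unset Strict Implicit.
Unset Printing Implicit Defensive.
Import Defs GRing.Theory.
Local Open Scope ring_scope.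

(** * Linear identities, spans and sums over orderings *)

(* A reflexive decision procedure for linear identities in a module: it
   reduces them to equalities between the coefficients of the atoms. *)
Section LinearReflection.
Variables (k : comNzRingType) (V : lmodType k).

Inductive lexpr :=
| LAtom of nat | LNull | LSum of lexpr & lexpr | LOpp of lexpr
| LMul of k & lexpr.

Fixpoint lvalue (env : seq V) (e : lexpr) : V :=
  match e with
  | LAtom i => env`_i
  | LNull => 0
  | LSum e f => lvalue env e + lvalue env f
  | LOpp e => - lvalue env e
  | LMul a e => a *: lvalue env e
  end.

Fixpoint lcoef (e : lexpr) (i : nat) : k :=
  match e with
  | LAtom j => if eqn i j then 1 else 0
  | LNull => 0
  | LSum e f => lcoef e i + lcoef f i
  | LOpp e => - lcoef e i
  | LMul a e => a * lcoef e i
  end.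

Lemma lvalueE env e :
  lvalue env e = \sum_(i < size env) lcoef e i *: env`_i.
Proof.
elim: e => /= [j||e -> f ->|e ->|a e ->].
- have [js|js] := ltnP j (size env).
    rewrite (bigD1 (Ordinal js)) //= [eqn j j]eqxx scale1r big1 ?addr0 // => i ij.
    by rewrite [eqn _ _](negPf (_ : val i != j)) ?scale0r.
  rewrite nth_default // big1 // => i _.
  by rewrite [eqn _ _](ltn_eqF (leq_trans (ltn_ord i) js)) scale0r.
- by rewrite big1 // => i _; rewrite scale0r.
- by rewrite -big_split /=; apply: eq_bigr => i _; rewrite scalerDl.
- by rewrite -sumrN; apply: eq_bigr => i _; rewrite scaleNr.
- by rewrite scaler_sumr; apply: eq_bigr => i _; rewrite scalerA.
Qed.

Fixpoint lcheck n e f : Prop :=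
  if n is m.+1 then lcoef e m = lcoef f m /\ lcheck m e f else True.

Lemma lcheckP env e f :
  lcheck (size env) e f -> lvalue env e = lvalue env f.
Proof.
have lcheckE n : lcheck n e f -> forall i : 'I_n, lcoef e i = lcoef f i.
  elim: n => [_ []//|n IHn /= [en /IHn IH]] i.
  have [->//|lt_in] := eqVneq (i : nat) n.
  have ltn : (i < n)%N by rewrite ltn_neqAle lt_in -ltnS ltn_ord.
  exact: (IH (Ordinal ltn)).
by move=> /lcheckE ef; rewrite !lvalueE; apply: eq_bigr => i _; rewrite ef.
Qed.
End LinearReflection.
Arguments LNull {k}.
Arguments LAtom {k}.

Ltac lmod_find x env :=
  match env with
  | x :: _ => constr:(Some 0%N)
  | _ :: ?env' =>
    match lmod_find x env' with
    | Some ?i => constr:(Some i.+1)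
    | None => constr:(@None nat)
    end
  | _ => constr:(@None nat)
  end.

Ltac lmod_atoms x env :=
  match x with
  | 0 => env
  | ?a + ?b => let env1 := lmod_atoms a env in lmod_atoms b env1
  | - ?a => lmod_atoms a env
  | _ *: ?a => lmod_atoms a env
  | _ =>
    match lmod_find x env with
    | Some _ => env
    | None => constr:(x :: env)
    end
  end.

Ltac lmod_reify k x env :=
  match x with
  | 0 => constr:(@LNull k)
  | ?a + ?b =>
    let ra := lmod_reify k a env in let rb := lmod_reify k b env in
    constr:(LSum ra rb)
  | - ?a => let ra := lmod_reify k a env in constr:(LOpp ra)
  | ?c *: ?a => let ra := lmod_reify k a env in constr:(LMul c ra)
  | _ =>
    match lmod_find x env with
    | Some ?i => constr:(@LAtom k i)
    end
  end.

Ltac lmod k :=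
  match goal with
  | |- @eq ?V ?x ?y =>
    let env0 := constr:(@nil V) in
    let env1 := lmod_atoms x env0 in
    let env := lmod_atoms y env1 in
    let e := lmod_reify k x env in
    let f := lmod_reify k y env in
    change (lvalue env e = lvalue env f);
    apply: lcheckP; cbn [size lcheck lcoef eqn];
    repeat (split; first by ring); exact: I
  end.

Section Span.
Variables (k : nzRingType) (V : lmodType k).

(** A predicate rather than a [{vspace V}]: most of the spaces below come without a known finite
    basis. *)
Record subspace (W : V -> Prop) : Prop := Subspace {
  sub0 : W 0;
  subD : forall u v, W u -> W v -> W (u + v);
  subZ : forall a u, W u -> W (a *: u) }.

Inductive lspan (S : V -> Prop) : V -> Prop :=
| lspan_gen u : S u -> lspan S u
| lspan0 : lspan S 0
| lspanD u v : lspan S u -> lspan S v -> lspan S (u + v)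
| lspanZ a u : lspan S u -> lspan S (a *: u).

Lemma lspan_subspace S : subspace (lspan S).
Proof. by split; [exact: lspan0|exact: lspanD|exact: lspanZ]. Qed.

Lemma lspan_min (S W : V -> Prop) :
  subspace W -> (forall u, S u -> W u) -> forall u, lspan S u -> W u.
Proof.
move=> [W0 WD WZ] SW u; elim=> {u}; [exact: SW|exact: W0|by auto|by auto].
Qed.

Lemma lspan_mono (S S' : V -> Prop) :
  (forall u, S u -> S' u) -> forall u, lspan S u -> lspan S' u.
Proof.
by move=> SS'; apply: lspan_min (lspan_subspace S') _ => u /SS'; apply: lspan_gen.
Qed.

Section Closure.
Variables (W : V -> Prop) (subW : subspace W).

Lemma subN u : W u -> W (- u).
Proof. by move=> Wu; rewrite -scaleN1r; apply: subZ. Qed.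

Lemma subB u v : W u -> W v -> W (u - v).
Proof. by move=> Wu Wv; apply: subD => //; apply: subN. Qed.

Lemma sub_sum I (r : seq I) (Q : pred I) (F : I -> V) :
  (forall i, Q i -> W (F i)) -> W (\sum_(i <- r | Q i) F i).
Proof. by move=> WF; apply: big_ind => //; [apply: sub0|apply: subD]. Qed.

Lemma subBr u v : W v -> W (u - v) -> W u.
Proof. by move=> Wv Wuv; rewrite -[u](subrK v); apply: subD. Qed.

Lemma subBC u v : W (u - v) -> W (v - u).
Proof. by move=> Wuv; rewrite -opprB; apply: subN. Qed.

Lemma sub_congT u v w : W (u - v) -> W (v - w) -> W (u - w).
Proof. by move=> uv vw; rewrite -(subrKA v); apply: subD. Qed.
End Closure.
End Span.

Lemma subspace_preim (k : nzRingType) (U V : lmodType k) (f : U -> V)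
    (W : V -> Prop) :
  linear f -> subspace W -> subspace (fun u => W (f u)).
Proof.
move=> lf [W0 WD WZ].
have f0 : f 0 = 0 by have := lf (-1) 0 0; rewrite scaler0 addr0 scaleN1r addNr.
split=> [|u v Wu Wv|a u Wu]; first by rewrite f0.
  by rewrite -[u]scale1r lf scale1r; apply: WD.
by rewrite -[a *: u]addr0 lf f0 addr0; apply: WZ.
Qed.

Lemma scale_sub (k : fieldType) (V : lmodType k) (W : V -> Prop) (a : k) u :
  subspace W -> a != 0 -> W (a *: u) -> W u.
Proof.
by move=> subW a0 Wau; rewrite -[u]scale1r -(mulVf a0) -scalerA; apply: subZ.
Qed.

(* order_sum s h is the sum of h over the (size s)! orderings of s, counted
   with multiplicity when s has repetitions. *)
Section OrderSum.
Variables (k : nzRingType) (V : lmodType k) (T : Type).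
Implicit Types (x y : T) (s t u : seq T) (h : seq T -> V).

Fixpoint insert_sum x h u : V :=
  if u is z :: u' then h (x :: u) + insert_sum x (fun t => h (z :: t)) u'
  else h [:: x].

Fixpoint order_sum s h : V :=
  if s is x :: s' then order_sum s' (insert_sum x h) else h [::].

Lemma insert_sum_ext x h h' u : h =1 h' -> insert_sum x h u = insert_sum x h' u.
Proof.
by elim: u h h' => [|z u IHu] h h' hh' //=; rewrite hh' (IHu _ (fun t => h' (z :: t))).
Qed.

Lemma order_sum_ext s h h' : h =1 h' -> order_sum s h = order_sum s h'.
Proof.
elim: s h h' => [|x s IHs] h h' hh' //=; apply: IHs => u.
exact: insert_sum_ext.
Qed.

Lemma insert_sum_lin x a h h' u :
  insert_sum x (fun t => a *: h t + h' t) u =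
  a *: insert_sum x h u + insert_sum x h' u.
Proof.
by elim: u h h' => [|z u IHu] h h' //=; rewrite IHu scalerDr addrACA.
Qed.

Lemma order_sum_lin s a h h' :
  order_sum s (fun t => a *: h t + h' t) = a *: order_sum s h + order_sum s h'.
Proof.
elim: s h h' => [|x s IHs] h h' //=; rewrite -IHs.
by apply: order_sum_ext => u; rewrite insert_sum_lin.
Qed.

Lemma insert_sumD x h h' u :
  insert_sum x (fun t => h t + h' t) u = insert_sum x h u + insert_sum x h' u.
Proof.
rewrite -[insert_sum x h u]scale1r -insert_sum_lin.
by apply: insert_sum_ext => t; rewrite scale1r.
Qed.

Lemma order_sumD s h h' :
  order_sum s (fun t => h t + h' t) = order_sum s h + order_sum s h'.
Proof.
rewrite -[order_sum s h]scale1r -order_sum_lin.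
by apply: order_sum_ext => t; rewrite scale1r.
Qed.

Lemma insert_sumC x y h u :
  insert_sum y (insert_sum x h) u = insert_sum x (insert_sum y h) u.
Proof.
elim: u h => [|z u IHu] h /=; first by rewrite addrC.
rewrite !insert_sumD IHu -!addrA addrCA; congr (_ + (_ + _)).
by rewrite addrCA.
Qed.

Lemma order_sum_move s1 x s2 h :
  order_sum (s1 ++ x :: s2) h = order_sum (x :: s1 ++ s2) h.
Proof.
elim: s1 h => [|z s1 IHs] h //=; rewrite [LHS]IHs /=.
by apply: order_sum_ext => u; apply: insert_sumC.
Qed.
End OrderSum.

Lemma order_sum_map (k : nzRingType) (V : lmodType k) (T U : Type) (f : T -> U)
    s (h : seq U -> V) :
  order_sum (map f s) h = order_sum s (fun t => h (map f t)).
Proof.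
elim: s h => [|x s IHs] h //=; rewrite IHs; apply: order_sum_ext => u.
by elim: u h => [|z u IHu] h //=; rewrite IHu.
Qed.

Lemma order_sum_morph (k : nzRingType) (V W : lmodType k) (T : Type)
    (g : V -> W) s (h : seq T -> V) :
  {morph g : u v / u + v} ->
  g (order_sum s h) = order_sum s (fun t => g (h t)).
Proof.
move=> gD; elim: s h => [|x s IHs] h //=; rewrite IHs; apply: order_sum_ext => u.
by elim: u h => [|z u IHu] h //=; rewrite gD IHu.
Qed.

Section OrderSumEq.
Variables (k : nzRingType) (V : lmodType k) (T : eqType).
Implicit Types (x y : T) (s t u : seq T) (h : seq T -> V).

Lemma order_sum_perm s t h : perm_eq s t -> order_sum s h = order_sum t h.
Proof.
elim: s t h => [|x s IHs] t h; first by move/perm_size/esym/size0nil->.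
move=> st; have xt : x \in t by rewrite -(perm_mem st) mem_head.
case/splitPr: xt st => t1 t2 st; rewrite order_sum_move /=; apply: IHs.
by rewrite -(perm_cons x) (perm_trans st) // perm_catC /= perm_cons perm_catC.
Qed.

Variables (W : V -> Prop) (subW : subspace W).

Lemma insert_sum_cong x h u v :
  (forall t, perm_eq t (x :: u) -> W (h t - v)) ->
  W (insert_sum x h u - (size u).+1%:R *: v).
Proof.
elim: u h => [|z u IHu] h hv /=; first by rewrite scale1r; apply: hv.
rewrite -nat1r scalerDl scale1r opprD addrACA; apply: (subD subW).
  exact: hv.
apply: IHu => t tu; apply: hv.
by rewrite -(perm_cons z) in tu; rewrite (perm_trans tu) // (perm_catCA [:: z] [:: x]).
Qed.

Lemma order_sum_cong s h v :
  (forall t, perm_eq t s -> W (h t - v)) ->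
  W (order_sum s h - (size s)`!%:R *: v).
Proof.
elim: s h v => [|x s IHs] h v hv /=; first by rewrite scale1r; apply: hv.
rewrite factS mulnC natrM -scalerA; apply: IHs => t ts.
rewrite -(perm_size ts).
apply: insert_sum_cong => u ut; apply: hv.
by rewrite (perm_trans ut) // perm_cons.
Qed.

Lemma order_sum_sub s h :
  (forall t, perm_eq t s -> W (h t)) -> W (order_sum s h).
Proof.
move=> Wh; rewrite -[order_sum s h]subr0 -(scaler0 V ((size s)`!%:R)).
by apply: order_sum_cong => t ts; rewrite subr0; apply: Wh.
Qed.
End OrderSumEq.

Lemma zero_subspace (k : nzRingType) (V : lmodType k) :
  subspace (fun v : V => v = 0).
Proof. by split=> [//|u v -> ->|c u ->]; rewrite ?addr0 ?scaler0. Qed.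

Lemma order_sum_const (k : nzRingType) (V : lmodType k) (T : eqType)
    (s : seq T) (h : seq T -> V) v :
  (forall t, perm_eq t s -> h t = v) -> order_sum s h = (size s)`!%:R *: v.
Proof.
move=> hv; apply/eqP; rewrite -subr_eq0; apply/eqP.
apply: (@order_sum_cong _ _ _ (fun u => u = 0)) => [|t ts].
  exact: zero_subspace.
by rewrite hv ?subrr.
Qed.

Lemma order_sum_ext_perm (k : nzRingType) (V : lmodType k) (T : eqType)
    (s : seq T) (h h' : seq T -> V) :
  (forall t, perm_eq t s -> h t = h' t) -> order_sum s h = order_sum s h'.
Proof.
move=> hh'; apply/eqP; rewrite -subr_eq0 addrC -scaleN1r -order_sum_lin.
rewrite (order_sum_const (v := 0)) ?scaler0 // => t ts.
by rewrite scaleN1r hh' ?addNr.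
Qed.

Lemma insert_sum_sub (k : nzRingType) (V : lmodType k) (T : Type)
    (W : V -> Prop) x (h : seq T -> V) u :
  subspace W -> (forall s t, u = s ++ t -> W (h (s ++ x :: t))) ->
  W (insert_sum x h u).
Proof.
move=> subW; elim: u h => [|z u IHu] h Wh /=; first exact: (Wh [::] [::]).
apply: (subD subW); first exact: (Wh [::] (z :: u)).
by apply: IHu => s t u_st; apply: (Wh (z :: s)); rewrite u_st.
Qed.

(** Used for the children of a vertex, which enter by product parts or by indecomposable parts:
    orderings that mix the two kinds contribute 0, and the symmetrization splits. *)
Lemma order_sum_cat (k : nzRingType) (V : lmodType k) (T : eqType)
    (P : pred T) (a b : seq T) (h : seq T -> V) :
  let r := [rel x y | P y ==> P x] in
  all P a -> all (predC P) b ->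
  (forall t, ~~ pairwise r t -> h t = 0) ->
  order_sum (a ++ b) h =
  order_sum a (fun a' => order_sum b (fun b' => h (a' ++ b'))).
Proof.
move=> r; elim: a h => [|x a IHa] h //= /andP[Px Pa] Pb h0.
rewrite IHa //; last first.
  move=> t bad_t; apply: (insert_sum_sub (zero_subspace V)) => s u tE; apply: h0.
  apply: contra bad_t; rewrite tE !pairwise_cat /= allrel_consr.
  by case/and3P=> /andP[_ ->] -> /andP[_ ->].
rewrite /=; apply: order_sum_ext => a'.
elim: a' h h0 => [|z a' IHa'] h h0 /=.
  apply: order_sum_ext_perm => b' b'b.
  have: all (predC P) b' by rewrite (perm_all _ b'b).
  case: b' {b'b} => //= y b' /andP[Py _].
  rewrite (insert_sum_sub (zero_subspace V)) ?addr0 // => s t _; apply: h0.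
  by rewrite /= all_cat /= Px (negPf Py) /= andbF.
rewrite order_sumD IHa' // => t bad_t.
by apply: h0; rewrite /= (negPf bad_t) andbF.
Qed.

(** * Hertling-Manin algebras and tree nodes *)

Record falg (k : fieldType) := FAlg {
  fa :> lmodType k;
  fmul : fa -> fa -> fa;
  fbr : fa -> fa -> fa;
  fmul_lin : forall a, linear (fmul a);
  fbr_lin : forall a, linear (fbr a);
  fmulC : forall a b, fmul a b = fmul b a;
  fmulA : forall a b c, fmul (fmul a b) c = fmul a (fmul b c);
  fbrC : forall a b, fbr a b = - fbr b a;
  fJacobi : forall a b c, fbr a (fbr b c) = fbr (fbr a b) c + fbr b (fbr a c);
  fHM : forall a b c d, fbr (fmul a b) (fmul c d) =
    fmul (fbr (fmul a b) c) d + fmul (fbr (fmul a b) d) c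
    + fmul a (fbr b (fmul c d)) + fmul b (fbr a (fmul c d))
    - fmul (fmul a c) (fbr b d) - fmul (fmul b c) (fbr a d)
    - fmul (fmul b d) (fbr a c) - fmul (fmul a d) (fbr b c) }.

Declare Scope falg_scope.
Delimit Scope falg_scope with F.
Notation "x ** y" := (fmul x y) (at level 40, left associativity) : falg_scope.
Notation "{[ x , y ]}" := (fbr x y)
  (at level 0, x, y at level 99, format "{[ x ,  y ]}") : falg_scope.
Local Open Scope falg_scope.

Section LinearFacts.
Variables (k : nzRingType) (U V : lmodType k) (f : U -> V).
Hypothesis lf : linear f.
Lemma lin0 : f 0 = 0.
Proof. by have := lf (-1) 0 0; rewrite scaler0 addr0 scaleN1r addNr. Qed.
Lemma linD u v : f (u + v) = f u + f v.
Proof. by rewrite -[u]scale1r lf !scale1r. Qed.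
Lemma linZ a u : f (a *: u) = a *: f u.
Proof. by rewrite -[a *: u]addr0 lf lin0 addr0. Qed.
Lemma linN u : f (- u) = - f u.
Proof. by rewrite -scaleN1r linZ scaleN1r. Qed.
Lemma linB u v : f (u - v) = f u - f v.
Proof. by rewrite linD linN. Qed.
End LinearFacts.

Definition mlin (k : nzRingType) (U V : lmodType k) (h : seq U -> V) :=
  forall s a u v t,
    h (s ++ (a *: u + v) :: t) = a *: h (s ++ u :: t) + h (s ++ v :: t).

Lemma mlin_at (k : nzRingType) (U V : lmodType k) (h : seq U -> V) s t :
  mlin h -> linear (fun u => h (s ++ u :: t)).
Proof. by move=> hl a u v; apply: hl. Qed.

Section FAlgTheory.
Variables (k : fieldType) (A : falg k).
Implicit Types (a b c x y z p q : A) (s t u xs ps ys zs : seq A).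

Lemma fmul_linl b : linear (fun a => a ** b).
Proof. by move=> c x y; rewrite !(fmulC _ b); apply: fmul_lin. Qed.
Lemma fbr_linl b : linear (fun a => {[a, b]}).
Proof.
by move=> c x y; rewrite !(fbrC _ b) fbr_lin opprD scalerN.
Qed.

Lemma fmul0 a : a ** 0 = 0. Proof. exact: lin0 (fmul_lin a). Qed.
Lemma f0mul a : 0 ** a = 0. Proof. exact: lin0 (fmul_linl a). Qed.
Lemma fbr0 a : {[a, 0]} = 0. Proof. exact: lin0 (fbr_lin a). Qed.
Lemma f0br a : {[0, a]} = 0. Proof. exact: lin0 (fbr_linl a). Qed.

Definition ad xs p := foldr (@fbr k A) p xs.

(* kap [:: x1; ...; xm] [:: p1; ...; ps] = [p1, ... [p(s-1), ad xs ps]]. *)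
Fixpoint kap xs ps : A :=
  if ps is p :: ps' then
    if ps' is [::] then ad xs p else {[p, kap xs ps']}
  else 0.

Fixpoint prodl y s := if s is z :: s' then y ** prodl z s' else y.
Definition prods s : A := if s is y :: s' then prodl y s' else 0.

(** The first component holds what counts as indecomposable, the second what counts as a product.
    The value in [A] alone does not tell the two apart. *)
Definition psi s : A * A := if s is [:: y] then (y, 0) else (0, prods s).

(** Extends [ad l] to functions of several arguments, one slot at a time. This differs from
    bracketing a product with [l], since the bracket of an F-manifold algebra is no derivation of
    its product. *)
Fixpoint der (V : lmodType k) (l : A) (h : seq A -> V) s : V :=
  if s is y :: s' then h ({[l, y]} :: s') + der l (fun t => h (y :: t)) s'
  else 0.

(** Multiplication by [l] plus [ad l]. Multiplications alone commute; with [ad l] added, the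
    commutator of two such operators produces the factor [{[l, l']}]. *)
Definition Dd l ys : A * A := psi (l :: ys) + der l psi ys.

(** Children before a cut enter by their product parts, those after it by their indecomposable
    parts. The summand without product parts, [ad xs] of a product, makes up for the missing
    vertices with a single child. *)
Definition node1 xs (cs : seq (A * A)) : A * A :=
  if cs is [::] then psi xs else
  (ad xs (prods (map fst cs)), 0) +
  \sum_(s < size cs) Dd (kap xs (map snd (take s.+1 cs)))
                        (map fst (drop s.+1 cs)).

(** Symmetrized because neither the letters nor the children of a vertex are ordered; the resulting
    factorials are divided out where spans are computed. *)
Definition node xs cs : A * A :=
  order_sum xs (fun xs' => order_sum cs (node1 xs')).

Lemma ad_cat s t p : ad (s ++ t) p = ad s (ad t p).
Proof. by rewrite /ad foldr_cat. Qed.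

Lemma ad_lin s : linear (ad s).
Proof. by elim: s => [//|x s IHs] a u v /=; rewrite IHs fbr_lin. Qed.

Lemma ad_mlin p : mlin (ad^~ p).
Proof. by move=> s a x y t; rewrite !ad_cat /= fbr_linl ad_lin. Qed.

Lemma kap_rcons xs ps p : kap xs (rcons ps p) = ad (ps ++ xs) p.
Proof. by elim: ps => [//|q ps IHps] /=; rewrite -IHps; case: ps {IHps}. Qed.

Lemma kap_mlinr xs : mlin (kap xs).
Proof.
move=> s a p q t; case/lastP: t => [|t r].
  by rewrite !cats1 !kap_rcons ad_lin.
rewrite -!rcons_cons -!rcons_cat !kap_rcons -!catA /=; exact: ad_mlin.
Qed.

Lemma prods_cons y z s : prods (y :: z :: s) = y ** prods (z :: s).
Proof. by []. Qed.

Lemma prods_mlin : mlin prods.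
Proof.
move=> s a u v t; elim: s => [|y s IHs].
  by case: t => [//|z t]; rewrite !cat0s !prods_cons fmul_linl.
by case: s IHs => [|z s] IHs; rewrite !cat_cons !prods_cons IHs fmul_lin.
Qed.

Lemma pairZD (a : k) (u v w w' : A) :
  a *: (u, w) + (v, w') = (a *: u + v, a *: w + w').
Proof. by []. Qed.

Lemma psiE s : size s != 1%N -> psi s = (0, prods s).
Proof. by case: s => [|x [|y s]]. Qed.

Lemma psi_mlin : mlin psi.
Proof.
move=> s a x y t; have [st|st] := boolP (size (s ++ t) == 0%N).
  move: st; rewrite size_cat addn_eq0 !size_eq0 => /andP[/eqP -> /eqP ->] /=.
  by rewrite pairZD scaler0 addr0.
have st1 z : size (s ++ z :: t) != 1%N by rewrite size_cat addnS -size_cat eqSS.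
by rewrite !psiE // prods_mlin pairZD scaler0 addr0.
Qed.

Lemma mlin0 (V : lmodType k) (h : seq A -> V) s : mlin h -> 0 \in s -> h s = 0.
Proof.
by move=> hl s0; case/path.splitPr: s0 => s1 s2; apply: lin0 (mlin_at s1 s2 hl).
Qed.

Lemma prods_cat s t : s != [::] -> t != [::] ->
  prods (s ++ t) = prods s ** prods t.
Proof.
case: s => // y s _ t0; elim: s y => [|z s IHs] y; first by case: t t0.
by rewrite !cat_cons prods_cons -cat_cons IHs prods_cons fmulA.
Qed.

Lemma prods_swap s x y t :
  prods (s ++ x :: y :: t) = prods (s ++ y :: x :: t).
Proof.
elim: s => [|z s IHs].
  case: t => [|w t]; first exact: fmulC.
  by rewrite !cat0s !prods_cons -!fmulA (fmulC x).
case: s IHs => [|z' s] IHs; rewrite !cat_cons [LHS]prods_cons [RHS]prods_cons;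
  by congr (_ ** _); apply: IHs.
Qed.

Lemma psi_swap s x y t : psi (s ++ x :: y :: t) = psi (s ++ y :: x :: t).
Proof.
have st z w : size (s ++ z :: w :: t) != 1%N.
  by rewrite size_cat /= !addnS.
by rewrite !psiE // prods_swap.
Qed.
End FAlgTheory.

(** Adjacent transpositions generate the permutations. Only rearrangements of [s] have to be
    controlled, so that sizes and membership can be used for each swap. *)
Lemma perm_swap_cong (k : nzRingType) (V : lmodType k) (T : eqType)
    (W : V -> Prop) (h : seq T -> V) s :
  subspace W ->
  (forall s1 x y s2, perm_eq (s1 ++ x :: y :: s2) s ->
     W (h (s1 ++ x :: y :: s2) - h (s1 ++ y :: x :: s2))) ->
  forall t, perm_eq s t -> W (h s - h t).
Proof.
move=> subW; elim: s h => [|x s IHs] h hW t.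
  by move/perm_size/esym/size0nil->; rewrite subrr; apply: sub0.
move=> st; have xt : x \in t by rewrite -(perm_mem st) mem_head.
case/path.splitPr: xt st => t1 t2 st.
have st12 : perm_eq s (t1 ++ t2).
  by rewrite -(perm_cons x) (perm_trans st) // perm_catC /= perm_cons perm_catC.
have step1 : W (h (x :: s) - h (x :: t1 ++ t2)).
  apply: (IHs (fun u => h (x :: u))) => // s1 y z s2 sE.
  by apply: (hW (x :: s1)); rewrite perm_cons.
apply: (sub_congT subW step1).
have: perm_eq (rev t1 ++ x :: t2) (x :: s).
  rewrite perm_catC /= perm_cons perm_sym (perm_trans st12) // perm_catC.
  by rewrite perm_cat2l perm_sym perm_rev.
rewrite -{2 3}[t1]revK; elim: (rev t1) t2 {st st12 step1} => [|y r IHr] t2 rE.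
  by rewrite subrr; apply: sub0.
rewrite rev_cons !cat_rcons.
apply: (sub_congT subW (v := h (rev r ++ x :: y :: t2))).
  apply: IHr; rewrite (perm_trans _ rE) //.
  by apply/permP=> f; rewrite !(count_cat, count_rev) /=; lia.
apply: hW; rewrite (perm_trans _ rE) //.
by apply/permP=> f; rewrite !(count_cat, count_rev) /=; lia.
Qed.

Lemma perm_swap_eq (k : nzRingType) (V : lmodType k) (T : eqType)
    (h : seq T -> V) s t :
  (forall s1 x y s2, h (s1 ++ x :: y :: s2) = h (s1 ++ y :: x :: s2)) ->
  perm_eq s t -> h s = h t.
Proof.
move=> hh st; apply/eqP; rewrite -subr_eq0; apply/eqP.
apply: (perm_swap_cong (W := fun v => v = 0)) st => [|s1 x y s2 _].
  exact: zero_subspace.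
by rewrite hh subrr.
Qed.

Section NodeTheory.
Variables (k : fieldType) (A : falg k).
Implicit Types (a b c x y z p q l : A) (s t u xs ps ys zs : seq A).

Lemma der_ext (V : lmodType k) l (h h' : seq A -> V) s :
  h =1 h' -> der l h s = der l h' s.
Proof.
by elim: s h h' => [//|y s IHs] h h' hh' /=; rewrite hh' (IHs _ (fun t => h' (y :: t))).
Qed.

Lemma derZD (V : lmodType k) l (c : k) (h h' : seq A -> V) s :
  der l (fun t => c *: h t + h' t) s = c *: der l h s + der l h' s.
Proof.
elim: s h h' => [|y s IHs] h h' /=; first by rewrite scaler0 addr0.
by rewrite IHs scalerDr addrACA.
Qed.

Lemma derD (V : lmodType k) l (h h' : seq A -> V) s :
  der l (fun t => h t + h' t) s = der l h s + der l h' s.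
Proof.
rewrite -[der l h s]scale1r -derZD.
by apply: der_ext => t; rewrite scale1r.
Qed.

Lemma der_linl (V : lmodType k) (h : seq A -> V) s :
  mlin h -> linear (fun l => der l h s).
Proof.
elim: s h => [|y s IHs] h hl c l l' /=; first by rewrite scaler0 addr0.
rewrite fbr_linl (hl [::]) /= IHs ?scalerDr 1?addrACA // => u1 c1 u v t.
exact: (hl (y :: u1)).
Qed.

Lemma der_swap (V : lmodType k) l (h : seq A -> V) s x y t :
  (forall s x y t, h (s ++ x :: y :: t) = h (s ++ y :: x :: t)) ->
  der l h (s ++ x :: y :: t) = der l h (s ++ y :: x :: t).
Proof.
move=> hC; elim: s h hC => [|z s IHs] h hC /=.
  have hC0 a b r : h (a :: b :: r) = h (b :: a :: r) by apply: (hC [::]).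
  rewrite addrCA hC0 (hC0 y); congr (_ + (_ + _)).
  by apply: der_ext => u; apply: hC0.
rewrite (hC (_ :: s)) /= (IHs (fun u => h (z :: u))) // => u *.
exact: (hC (z :: u)).
Qed.

Lemma der_sub (V : lmodType k) (W : V -> Prop) l (h : seq A -> V) ys :
  subspace W -> (forall s y t, ys = s ++ y :: t -> W (h (s ++ {[l, y]} :: t))) ->
  W (der l h ys).
Proof.
move=> subW; elim: ys h => [|y ys IHys] h Wh /=; first exact: sub0.
apply: (subD subW); first exact: (Wh [::] y ys).
by apply: IHys => s z t ysE; apply: (Wh (y :: s)); rewrite ysE.
Qed.

(** The Jacobi identity in each slot; the terms that touch two different slots cancel. *)
Lemma derC (V : lmodType k) l l' (h : seq A -> V) s : mlin h ->
  der l' (der l h) s - der l (der l' h) s = der {[l, l']} h s.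
Proof.
elim: s h => [|y s IHs] h hl /=; first by rewrite subrr.
have hl' : mlin (fun t => h (y :: t)) by move=> u; apply: (hl (y :: u)).
rewrite -IHs // !derD.
have -> : h ({[{[l, l']}, y]} :: s) =
    h ({[l, {[l', y]}]} :: s) - h ({[l', {[l, y]}]} :: s).
  rewrite -(linB (mlin_at [::] s hl)) /=; congr (h (_ :: s)).
  by rewrite fJacobi addrK.
lmod k.
Qed.
End NodeTheory.

Arguments ad {k A}.
Arguments kap {k A}.
Arguments prods {k A}.
Arguments psi {k A}.
Arguments node1 {k A}.
Arguments node {k A}.

Section NodeValues.
Variables (k : fieldType) (A : falg k).
Implicit Types (a b c x y z p q l : A) (xs ps ys zs : seq A).

Definition ksym xs ps : A :=
  order_sum xs (fun xs' => order_sum ps (kap xs')).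

Lemma Dd_linear ys : linear (fun l => Dd l ys).
Proof.
move=> c l l'; rewrite /Dd (psi_mlin [::]) der_linl; last exact: psi_mlin.
by rewrite scalerDr addrACA.
Qed.

Lemma Dd_perm l ys zs : perm_eq ys zs -> Dd l ys = Dd l zs.
Proof.
apply: perm_swap_eq => s x y t; rewrite /Dd; congr (_ + _).
  exact: (psi_swap (l :: s)).
by apply: der_swap; apply: psi_swap.
Qed.

Lemma psi_perm ys zs : perm_eq ys zs -> psi ys = psi zs.
Proof. by apply: perm_swap_eq; apply: psi_swap. Qed.

Lemma Dd0 ys : Dd 0 ys = 0.
Proof. exact: lin0 (Dd_linear ys). Qed.

Lemma Dd_0 l ys : 0 \in ys -> Dd l ys = 0.
Proof.
move=> ys0; rewrite /Dd (mlin0 (@psi_mlin _ _)) ?inE ?ys0 ?orbT // add0r.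
case/path.splitPr: ys0 => s t; apply: (der_sub (zero_subspace _)) => u y v E.
apply: (mlin0 (@psi_mlin _ _)).
have [y0|y0] := eqVneq y 0; first by rewrite y0 fbr0 mem_cat inE eqxx orbT.
have: 0 \in u ++ y :: v by rewrite -E mem_cat mem_head orbT.
by rewrite !mem_cat !inE eq_sym (negPf y0) /= => /orP[->|->]; rewrite ?orbT.
Qed.

(** The tag records which component of a child is meant, even where its value is 0, so that the
    children can be sorted by kind. *)
Let untag (v : A + A) : A * A :=
  match v with inl p => (0, p) | inr y => (y, 0) end.
Let isl (v : A + A) := if v is inl _ then true else false.

Let pl (v : A + A) : A := if v is inl p then p else 0.
Let yr (v : A + A) : A := if v is inr y then y else 0.

Let kap_mixed xs (t : seq (A + A)) : ~~ all isl t -> kap xs (map pl t) = 0.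
Proof.
move=> tl; apply: mlin0; first exact: kap_mlinr.
apply: contraR tl => t0; apply/allP=> -[p //|y] yt.
by case/mapP: t0; exists (inr y).
Qed.

Let Dd_mixed l (t : seq (A + A)) :
  ~~ all (predC isl) t -> Dd l (map yr t) = 0.
Proof.
move=> tr; apply: Dd_0; apply: contraR tr => t0; apply/allP=> -[p|y //] pt.
by case/mapP: t0; exists (inl p).
Qed.

Let term xs (t : seq (A + A)) (i : nat) :=
  Dd (kap xs (map pl (take i.+1 t))) (map yr (drop i.+1 t)).

Let r := [rel x y | isl y ==> isl x].

Let pairwise_isl (t : seq (A + A)) : all isl t -> pairwise r t.
Proof.
elim: t => [//|x t IHt] /= /andP[xl tl]; rewrite IHt // andbT.
by apply/allP=> y _; rewrite /= xl implybT.
Qed.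

Let pairwise_isr (t : seq (A + A)) : all (predC isl) t -> pairwise r t.
Proof.
elim: t => [//|x t IHt] /= /andP[xr tr]; rewrite IHt // andbT.
by apply/allP=> y /(allP tr) /= /negPf ->.
Qed.

(** A 0 among the arguments of [kap] or [Dd] kills the term, so the cut has to fall exactly between
    a block of product parts and a block of indecomposable parts. *)
Let term0 xs (t : seq (A + A)) i : (i < size t)%N ->
  (i.+1 != count isl t) || ~~ pairwise r t -> term xs t i = 0.
Proof.
move=> it bad; rewrite /term.
have [tl|tl] := boolP (all isl (take i.+1 t)); last by rewrite kap_mixed // Dd0.
have [tr|tr] := boolP (all (predC isl) (drop i.+1 t)); last exact: Dd_mixed.
move: bad; rewrite -negb_and => /negP[]; apply/andP; split.
  rewrite -{1}[t](cat_take_drop i.+1) count_cat.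
  move: (tl) (tr); rewrite !all_count => /eqP -> /eqP trE.
  have := count_predC isl (drop i.+1 t); rewrite trE size_takel // => cE.
  by apply/eqP; lia.
rewrite -[t](cat_take_drop i.+1) pairwise_cat pairwise_isl // pairwise_isr //.
rewrite !andbT; apply/allrelP=> x y /(allP tl) /= -> _; exact: implybT.
Qed.

Let node1E xs (t : seq (A + A)) : has isl t ->
  node1 xs (map untag t) = \sum_(i < size t) term xs t i.
Proof.
move=> tl; have fstE u : map fst (map untag u) = map yr u.
  by rewrite -map_comp; apply: eq_map => -[].
have sndE u : map snd (map untag u) = map pl u.
  by rewrite -map_comp; apply: eq_map => -[].
have -> : node1 xs (map untag t) = (ad xs (prods (map yr t)), 0) +
  \sum_(i < size (map untag t)) term xs t i.
  have node1_cons cs : cs != [::] -> node1 xs cs =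
      (ad xs (prods (map fst cs)), 0) + \sum_(i < size cs)
        Dd (kap xs (map snd (take i.+1 cs))) (map fst (drop i.+1 cs)).
    by case: cs.
  rewrite node1_cons ?fstE; last by case: (t) tl.
  congr (_ + _); apply: eq_bigr => i _; rewrite /term.
  by rewrite -fstE -sndE map_take map_drop.
rewrite size_map (mlin0 (@prods_mlin _ _)) ?(lin0 (ad_lin xs)) ?add0r //.
by case/hasP: tl => -[p pt _|//]; apply/mapP; exists (inl p).
Qed.

(** In each ordering of the children at most one cut survives, and only if all product parts come
    first. The orderings of [ys] then contribute equally, [Dd] being symmetric in them. *)
Lemma node_mixed xs ps ys : ps != [::] ->
  node xs (map (pair 0) ps ++ map (fun y => (y, 0)) ys) =
  (size ys)`!%:R *: Dd (ksym xs ps) ys.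
Proof.
move=> ps0; have -> : map (pair (0 : A)) ps ++ map (fun y => (y, 0 : A)) ys =
    map untag (map inl ps ++ map inr ys) by rewrite map_cat -!map_comp.
have psl : all isl (map inl ps) by rewrite all_map; apply/allP.
have ysr : all (predC isl) (map inr ys) by rewrite all_map; apply/allP.
rewrite /node (@order_sum_ext _ _ _ xs _ (fun xs' =>
  (size ys)`!%:R *: Dd (order_sum ps (kap xs')) ys)).
  rewrite -(order_sum_morph (g := fun v => (size ys)`!%:R *: Dd v ys)) //.
  by move=> u v /=; rewrite (linD (Dd_linear ys)) scalerDr.
move=> xs'; rewrite order_sum_map.
have has_isl t : perm_eq t (map inl ps ++ map inr ys) -> has isl t.
  by move=> /perm_has ->; rewrite has_cat has_map; case: (ps) ps0.
rewrite (order_sum_ext_perm (h' := fun t => \sum_(i < size t) term xs' t i));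
  last by move=> t /has_isl /node1E ->.
rewrite (order_sum_cat psl ysr) => [|t bad]; last first.
  by apply: big1 => i _; apply: term0; rewrite ?bad ?orbT.
rewrite order_sum_map (@order_sum_ext_perm _ _ _ ps _ (fun ps' =>
  (size ys)`!%:R *: Dd (kap xs' ps') ys)).
  rewrite -(order_sum_morph (g := fun v => (size ys)`!%:R *: Dd v ys)) //.
  by move=> u v /=; rewrite (linD (Dd_linear ys)) scalerDr.
move=> ps' ps'E; rewrite order_sum_map; apply: order_sum_const => ys' ys'E.
rewrite size_cat !size_map.
(* The surviving index is one less than the number of product parts, as the cut lies after position
   [i.+1]. *)
have sps : ((size ps').-1 < size ps' + size ys')%N.
  by rewrite (perm_size ps'E) ltn_addr // ltn_predL lt0n size_eq0.
have spsE : (size ps').-1.+1 = size ps'.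
  by rewrite prednK // (perm_size ps'E) lt0n size_eq0.
rewrite (bigD1 (Ordinal sps)) //= big1 ?addr0 => [|i ips].
  rewrite /term spsE -[X in take X](size_map (@inl A A)).
  rewrite -[X in drop X](size_map (@inl A A)) take_size_cat // drop_size_cat //.
  by rewrite -!map_comp !map_id_in // (Dd_perm _ ys'E).
apply: term0; first by rewrite size_cat !size_map.
apply/orP; left; rewrite count_cat !count_map.
rewrite (eq_count (a2 := predT)) // count_predT.
rewrite (@eq_count _ _ pred0) // count_pred0 addn0.
apply: contra ips => /eqP iE; apply/eqP/val_inj.
exact: (congr1 predn iE).
Qed.

(** Without product parts every [kap] has a zero argument, and only the first summand of [node1] is
    left. *)
Lemma node_pure xs ys : (1 < size ys)%N ->
  node xs (map (fun y => (y, 0)) ys) =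
  (size ys)`!%:R *: (order_sum xs (fun xs' => ad xs' (prods ys)), 0).
Proof.
move=> ys1; rewrite /node (@order_sum_ext _ _ _ xs _ (fun xs' =>
  (size ys)`!%:R *: (ad xs' (prods ys), 0))).
  rewrite -(order_sum_morph (g := fun v : A => (size ys)`!%:R *: (v, 0 : A))) //.
  by move=> u v; rewrite -scalerDr; congr (_ *: (_, _)); rewrite addr0.
move=> xs'; rewrite order_sum_map; apply: order_sum_const => t tE.
have -> : ad xs' (prods ys) = ad xs' (prods t).
  congr (ad _ _); apply: perm_swap_eq; first exact: prods_swap.
  by rewrite perm_sym.
have: t != [::] by rewrite -size_eq0 (perm_size tE) -lt0n ltnW.
rewrite /node1; case: t tE => [//|y t] tE _.
rewrite [X in prods X](_ : _ = y :: t); last by rewrite -map_comp map_id_in.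
rewrite big1 ?addr0 // => i _; rewrite (mlin0 (@kap_mlinr _ _ xs')) ?Dd0 //.
by rewrite /= mem_head.
Qed.

Lemma node_leaf xs : node xs [::] = (size xs)`!%:R *: psi xs.
Proof.
rewrite /node /=; apply: order_sum_const => t; exact: psi_perm.
Qed.
End NodeValues.

(** * The node values span *)

Section Sized.
Variables (A : eqType).
Implicit Types (Q : nat -> A -> Prop) (s t : seq A).

Inductive sized Q : nat -> seq A -> Prop :=
| sized_nil : sized Q 0 [::]
| sized_cons i j a s : Q i a -> sized Q j s -> sized Q (i + j) (a :: s).

Lemma sized_consE Q n a s : sized Q n (a :: s) ->
  exists i j, [/\ Q i a, sized Q j s & n = (i + j)%N].
Proof.
move E: (a :: s) => t Qt; case: Qt E => // i j b t' Qb Qt' [-> ->].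
by exists i, j.
Qed.

Lemma sized_cat Q i j s t :
  sized Q i s -> sized Q j t -> sized Q (i + j) (s ++ t).
Proof.
by elim=> [//|i1 j1 a s' Qa _ IHs /IHs Qt]; rewrite -addnA; apply: sized_cons.
Qed.

Lemma sized_catE Q n s t : sized Q n (s ++ t) ->
  exists i j, [/\ sized Q i s, sized Q j t & n = (i + j)%N].
Proof.
elim: s n => [|a s IHs] n; first by exists 0%N, n; split=> //; apply: sized_nil.
case/sized_consE=> i [j [Qa /IHs[i1 [j1 [Qs Qt ->]]] ->]].
by exists (i + i1)%N, j1; split; [exact: sized_cons| |rewrite addnA].
Qed.

Lemma sized1 Q n a : Q n a -> sized Q n [:: a].
Proof. by move=> Qa; rewrite -[n]addn0; apply: sized_cons => //; apply: sized_nil. Qed.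

Lemma sized_nilE Q n : sized Q n [::] -> n = 0%N.
Proof. by move E: [::] => s Qs; case: Qs E. Qed.

Lemma sized1E Q n a : sized Q n [:: a] -> Q n a.
Proof. by case/sized_consE=> i [j [Qa /sized_nilE -> ->]]; rewrite addn0. Qed.

Lemma sized_perm Q n s t : perm_eq s t -> sized Q n s -> sized Q n t.
Proof.
elim: s t n => [|a s IHs] t n.
  by move/perm_size/esym/size0nil->.
move=> st; have at_ : a \in t by rewrite -(perm_mem st) mem_head.
case/path.splitPr: at_ st => t1 t2 st.
have {}st : perm_eq s (t1 ++ t2).
  by rewrite -(perm_cons a) (perm_trans st) // perm_catC /= perm_cons perm_catC.
case/sized_consE=> i [j [Qa /(IHs _ _ st)/sized_catE[i1 [j1 [Q1 Q2 ->]]] ->]].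
by rewrite addnCA; apply: sized_cat => //; apply: sized_cons.
Qed.

Lemma sized_mono Q Q' n s :
  (forall i a, Q i a -> Q' i a) -> sized Q n s -> sized Q' n s.
Proof. by move=> QQ'; elim=> [|*]; [apply: sized_nil|apply: sized_cons; auto]. Qed.

Lemma sized_mem Q n s a : sized Q n s -> a \in s -> exists i, Q i a.
Proof.
elim=> [//|i j b s' Qb _ IH]; rewrite inE => /orP[/eqP ->|/IH //].
by exists i.
Qed.
End Sized.

Section Generation.
Variables (k : fieldType) (char0 : [pchar k] =i pred0) (A : falg k).
Implicit Types (a b c x y z p q l : A) (xs ps ys zs : seq A).
Implicit Types (K : nat -> A -> Prop).

Lemma char0_natr_neq0 n : (0 < n)%N -> n%:R != 0 :> k.
Proof. by move=> n0; rewrite (pcharf0P _).1 // -lt0n. Qed.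

Lemma fact_neq0 n : (n`!)%:R != 0 :> k.
Proof. exact: char0_natr_neq0 (fact_gt0 n). Qed.

(** The second index counts the letters of the word: it is the coefficient that has to be inverted
    in [node_closed_psi]. *)
Inductive lie_word K : nat -> nat -> A -> Prop :=
| lw_letter n a : K n a -> lie_word K n 1 a
| lw_br i j m n a b : lie_word K i m a -> lie_word K j n b ->
    lie_word K (i + j) (m + n) {[a, b]}.

Definition lie K n := lspan (fun a => exists m, lie_word K n m a).

Lemma lie_subspace K n : subspace (lie K n).
Proof. exact: lspan_subspace. Qed.

Lemma lie_letter K n a : K n a -> lie K n a.
Proof. by move=> Ka; apply: lspan_gen; exists 1%N; apply: lw_letter. Qed.

Lemma lie_br K i j a b : lie K i a -> lie K j b -> lie K (i + j) {[a, b]}.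
Proof.
move=> Ka Kb; move: a Ka; apply: lspan_min.
  exact: subspace_preim (fbr_linl b) (lie_subspace K _).
move=> a [m Ka]; move: b Kb; apply: lspan_min.
  exact: subspace_preim (fbr_lin a) (lie_subspace K _).
by move=> b [n Kb]; apply: lspan_gen; exists (m + n)%N; apply: lw_br.
Qed.

Lemma lie_word_pos K n m a : lie_word K n m a -> (0 < m)%N.
Proof. by elim=> [//|*]; rewrite ltn_addr. Qed.

Lemma lie_ind K (W : nat -> A -> Prop) :
  (forall n, subspace (W n)) -> (forall n a, K n a -> W n a) ->
  (forall i j a b, lie K i a -> lie K j b -> W i a -> W j b ->
     W (i + j)%N {[a, b]}) ->
  forall n a, lie K n a -> W n a.
Proof.
move=> subW WK Wbr n; apply: lspan_min => // a [m]; elim=> {n m a} // *.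
by apply: Wbr => //; apply: lspan_gen; eexists; eassumption.
Qed.

Lemma lie_mono K K' : (forall n a, K n a -> lie K' n a) ->
  forall n a, lie K n a -> lie K' n a.
Proof.
move=> KK'; apply: lie_ind => // [n|i j a b _ _]; first exact: lie_subspace.
exact: lie_br.
Qed.

Lemma lie_derivation K i x : (forall n a, K n a -> lie K (i + n) {[x, a]}) ->
  forall n a, lie K n a -> lie K (i + n) {[x, a]}.
Proof.
move=> xK; apply: (@lie_ind K (fun n a => lie K (i + n) {[x, a]})) => //.
  by move=> n; apply: subspace_preim (fbr_lin x) (lie_subspace K _).
move=> j1 j2 a b Ka Kb xa xb; rewrite fJacobi.
apply: (subD (lie_subspace _ _)); first by rewrite addnA; apply: lie_br.
by rewrite addnCA; apply: lie_br.
Qed.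

Variable letter : nat -> A -> Prop.
Hypothesis letter_pos : forall n x, letter n x -> (0 < n)%N.
Hypothesis letter_br : forall i j x y,
  letter i x -> letter j y -> letter (i + j) {[x, y]}.

Inductive gen : nat -> A -> Prop :=
| gen_letter n x : letter n x -> gen n x
| gen_mul i j a b : gen i a -> gen j b -> gen (i + j) (a ** b)
| gen_br i j a b : gen i a -> gen j b -> gen (i + j) {[a, b]}
| gen0 n : gen n 0
| genD n a b : gen n a -> gen n b -> gen n (a + b)
| genZ n (c : k) a : gen n a -> gen n (c *: a).

Lemma gen_subspace n : subspace (gen n).
Proof. by split; [exact: gen0|exact: genD|exact: genZ]. Qed.

(** Both factors have positive degree, hence smaller degree than the product: this carries the
    induction of [gen_prods]. *)
Definition prod_space n := lspan (fun p => exists i j a b,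
  [/\ (0 < i)%N, (0 < j)%N, gen i a, gen j b & n = (i + j)%N /\ p = a ** b]).

Lemma prod_subspace n : subspace (prod_space n).
Proof. exact: lspan_subspace. Qed.

Definition kap_gen n l := exists i j xs ps,
  [/\ sized letter i xs, sized prod_space j ps, xs != [::], ps != [::] &
      n = (i + j)%N /\ l = kap xs ps].

Definition ksym_gen n l := exists i j xs ps,
  [/\ sized letter i xs, sized prod_space j ps, xs != [::], ps != [::] &
      n = (i + j)%N /\ l = ksym xs ps].

Lemma gen_size0 n a : gen n a -> n = 0%N -> a = 0.
Proof.
elim=> {n a} //.
- by move=> n x /letter_pos lt0n n0; rewrite n0 in lt0n.
- by move=> i j a b _ IHa _ _ /eqP; rewrite addn_eq0 => /andP[/eqP/IHa -> _];
    rewrite f0mul.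
- by move=> i j a b _ IHa _ _ /eqP; rewrite addn_eq0 => /andP[/eqP/IHa -> _];
    rewrite f0br.
- by move=> n a b _ IHa _ IHb n0; rewrite IHa ?IHb ?addr0.
- by move=> n c a _ IHa n0; rewrite IHa ?scaler0.
Qed.

Lemma prod_space_mul i j n a b :
  gen i a -> gen j b -> n = (i + j)%N -> prod_space n (a ** b).
Proof.
move=> ga gb nE; case: (posnP i) => [i0|i0].
  by rewrite (gen_size0 ga i0) f0mul; apply: lspan0.
case: (posnP j) => [j0|j0].
  by rewrite (gen_size0 gb j0) fmul0; apply: lspan0.
by apply: lspan_gen; exists i, j, a, b.
Qed.

(* The Hertling-Manin relation: products form a Lie subalgebra. *)
Lemma prod_space_br i j p q :
  prod_space i p -> prod_space j q -> prod_space (i + j) {[p, q]}.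
Proof.
move=> Pp Pq; move: p Pp; apply: lspan_min.
  exact: subspace_preim (fbr_linl q) (prod_subspace _).
move=> p [i1 [i2 [a [b [_ _ ga gb [-> ->]]]]]]; move: q Pq; apply: lspan_min.
  exact: subspace_preim (fbr_lin _) (prod_subspace _).
move=> q [j1 [j2 [c [d [_ _ gc gd [-> ->]]]]]].
have gm := gen_mul; have gB := gen_br.
rewrite fHM.
by do ![apply: (subB (prod_subspace _))|apply: (subD (prod_subspace _))];
  [apply: (prod_space_mul (gB _ _ _ _ (gm _ _ _ _ ga gb) gc) gd)
  |apply: (prod_space_mul (gB _ _ _ _ (gm _ _ _ _ ga gb) gd) gc)
  |apply: (prod_space_mul ga (gB _ _ _ _ gb (gm _ _ _ _ gc gd)))
  |apply: (prod_space_mul gb (gB _ _ _ _ ga (gm _ _ _ _ gc gd)))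
  |apply: (prod_space_mul (gm _ _ _ _ ga gc) (gB _ _ _ _ gb gd))
  |apply: (prod_space_mul (gm _ _ _ _ gb gc) (gB _ _ _ _ ga gd))
  |apply: (prod_space_mul (gm _ _ _ _ gb gd) (gB _ _ _ _ ga gc))
  |apply: (prod_space_mul (gm _ _ _ _ ga gd) (gB _ _ _ _ gb gc))]; lia.
Qed.

Lemma kap_cons xs p ps : ps != [::] -> kap xs (p :: ps) = {[p, kap xs ps]}.
Proof. by case: ps. Qed.

Lemma kap_gen_prod i j p l :
  prod_space i p -> kap_gen j l -> kap_gen (i + j) {[p, l]}.
Proof.
move=> Pp [i1 [j1 [xs [ps [Qx Qp xs0 ps0 [-> ->]]]]]].
exists i1, (i + j1)%N, xs, (p :: ps); split=> //; first exact: sized_cons.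
by rewrite kap_cons // addnCA.
Qed.

Lemma kap_gen_letter i j x p :
  letter i x -> prod_space j p -> kap_gen (i + j) {[x, p]}.
Proof.
by move=> Lx Pp; exists i, j, [:: x], [:: p]; split=> //; apply: sized1.
Qed.

Lemma lie_kap_prod i j p l :
  prod_space i p -> lie kap_gen j l -> lie kap_gen (i + j) {[p, l]}.
Proof.
move=> Pp; move: j l; apply: lie_derivation => n a Ka.
exact/lie_letter/kap_gen_prod.
Qed.

(** Jacobi moves [x] inwards past each product [p]; the extra term contains [{[x, p]}], which is
    itself a generator. When [x] reaches the last product it joins [xs]. *)
Lemma lie_kap_letter i j x l :
  letter i x -> lie kap_gen j l -> lie kap_gen (i + j) {[x, l]}.
Proof.
move=> Lx; move: j l; apply: lie_derivation => n l.
case=> [i1 [j1 [xs [ps [Qx Qp xs0 ps0 [-> ->]]]]]].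
elim: ps j1 Qp ps0 => // p ps IHps j1 /sized_consE[j2 [j3 [Pp Pps ->]]] _.
have [psE|ps0] := eqVneq ps [::].
  rewrite psE in Pps *; rewrite (sized_nilE Pps) addn0.
  apply: lie_letter; exists (i + i1)%N, j2, (x :: xs), [:: p].
  by split=> //; [exact: sized_cons|exact: sized1|rewrite addnA].
rewrite kap_cons // fJacobi; apply: (subD (lie_subspace _ _)).
  rewrite (addnCA i1) (addnA i); apply: lie_br; apply: lie_letter.
    exact: kap_gen_letter.
  by exists i1, j3, xs, ps.
rewrite (addnCA i1) addnCA; apply: lie_kap_prod => //.
exact: IHps.
Qed.

Definition reduced n := lspan (fun a =>
  [\/ letter n a, lie kap_gen n a | prod_space n a]).

Lemma reduced_subspace n : subspace (reduced n).
Proof. exact: lspan_subspace. Qed.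

(** Brackets of two summands stay inside: letters by [letter_br], products by the Hertling-Manin
    relation, a letter with a product by definition of [kap_gen], and the Lie algebra of the
    [kap_gen] is stable under all of them. *)
Lemma gen_reduced n a : gen n a -> reduced n a.
Proof.
elim=> {n a} [n x Lx|i j a b ga _ gb _|i j a b _ Ra _ Rb|n|n a b _ Ra _ Rb|n c a _ Ra].
- by apply: lspan_gen; constructor 1.
- by apply: lspan_gen; constructor 3; apply: prod_space_mul ga gb _.
- have brN u v m : reduced m {[u, v]} -> reduced m {[v, u]}.
    by rewrite (fbrC v); apply: (subN (reduced_subspace m)).
  move: a Ra; apply: lspan_min.
    exact: subspace_preim (fbr_linl b) (lspan_subspace _).
  move=> a Ra; move: b Rb; apply: lspan_min.
    exact: subspace_preim (fbr_lin a) (lspan_subspace _).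
  move=> b; case: Ra => [La|Ka|Pa] [Lb|Kb|Pb].
  + by apply: lspan_gen; constructor 1; apply: letter_br.
  + by apply: lspan_gen; constructor 2; apply: lie_kap_letter.
  + apply: lspan_gen; constructor 2; exact/lie_letter/kap_gen_letter.
  + apply: brN; rewrite addnC; apply: lspan_gen; constructor 2.
    exact: lie_kap_letter.
  + by apply: lspan_gen; constructor 2; apply: lie_br.
  + apply: brN; rewrite addnC; apply: lspan_gen; constructor 2.
    exact: lie_kap_prod.
  + apply: brN; rewrite addnC; apply: lspan_gen; constructor 2.
    exact/lie_letter/kap_gen_letter.
  + by apply: lspan_gen; constructor 2; apply: lie_kap_prod.
  + by apply: lspan_gen; constructor 3; apply: prod_space_br.
- exact: lspan0.
- exact: lspanD.
- exact: lspanZ.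
Qed.

Lemma ad_swap s x y t p :
  ad (s ++ x :: y :: t) p - ad (s ++ y :: x :: t) p = ad (s ++ {[x, y]} :: t) p.
Proof. by rewrite !ad_cat -(linB (ad_lin s)) /= fJacobi addrK. Qed.

(** The strict bounds on [i] and [j] are what the induction hypothesis of [kap_gen_ksym] asks
    for. *)
Definition kap_pair n := lspan (fun a => exists i j u v,
  [/\ (i < n)%N, (j < n)%N, kap_gen i u, kap_gen j v &
      n = (i + j)%N /\ a = {[u, v]}]).

Lemma kap_gen_pos n l : kap_gen n l -> (0 < n)%N.
Proof.
case=> i [j [[|x xs] [ps [Qx _ // _ _ [-> _]]]]].
by have [i1 [i2 [/letter_pos i1_gt0 _ ->]]] := sized_consE Qx; lia.
Qed.

Lemma kap_pair_br i j u v :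
  kap_gen i u -> kap_gen j v -> kap_pair (i + j) {[u, v]}.
Proof.
move=> Ku Kv; apply: lspan_gen; exists i, j, u, v.
by have := kap_gen_pos Ku; have := kap_gen_pos Kv; split=> //; lia.
Qed.

Lemma kap_pair_prod i j p l :
  prod_space i p -> kap_pair j l -> kap_pair (i + j) {[p, l]}.
Proof.
move=> Pp; move: l; apply: lspan_min.
  exact: subspace_preim (fbr_lin p) (lspan_subspace _).
move=> _ [j1 [j2 [u [v [_ _ Ku Kv [-> ->]]]]]]; rewrite fJacobi.
apply: (subD (lspan_subspace _)).
  by rewrite addnA; apply: kap_pair_br => //; apply: kap_gen_prod.
by rewrite addnCA; apply: kap_pair_br => //; apply: kap_gen_prod.
Qed.

(** By Jacobi the letters of [xs] are distributed over [q] and [p]. The two subtracted terms are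
    those where one of them receives everything; in all others, collected in [r], both receive a
    letter, so that the term is a bracket of two generators. *)
Lemma ad_br_prod i j1 j2 xs q p :
  sized letter i xs -> xs != [::] -> prod_space j1 q -> prod_space j2 p ->
  kap_pair (i + (j1 + j2))
    (ad xs {[q, p]} - {[ad xs q, p]} - {[q, ad xs p]}).
Proof.
move=> Lxs xs0 Pq Pp.
suff: exists2 r, lspan (fun a => exists i1 i2 s t, [/\ sized letter i1 s,
      sized letter i2 t, s != [::], t != [::] & i = (i1 + i2)%N /\
      a = {[ad s q, ad t p]}]) r &
    ad xs {[q, p]} = {[ad xs q, p]} + {[q, ad xs p]} + r.
  case=> r Rr ->; rewrite [_ + r - _]addrAC [_ - {[ad xs q, p]}]addrAC subrr add0r.
  rewrite addrAC subrr add0r; apply: lspan_min Rr; first exact: lspan_subspace.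
  move=> _ [i1 [i2 [s [t [Ls Lt s0 t0 [-> ->]]]]]].
  rewrite addnACA; apply: kap_pair_br.
    by exists i1, j1, s, [:: q]; split=> //; apply: sized1.
  by exists i2, j2, t, [:: p]; split=> //; apply: sized1.
elim: xs i Lxs xs0 => // x xs IHxs i /sized_consE[i1 [i2 [Lx Lxs ->]]] _.
have [xsE|xs0] := eqVneq xs [::].
  by exists 0; [apply: lspan0|rewrite xsE /= addr0 fJacobi].
have [r Rr /= ->] := IHxs _ Lxs xs0.
exists ({[ad xs q, {[x, p]}]} + {[{[x, q]}, ad xs p]} + {[x, r]}); last first.
  rewrite !(linD (fbr_lin x)) (fJacobi x (ad xs q)) (fJacobi x q).
  lmod k.
apply: lspanD; first apply: lspanD.
- apply: lspan_gen; exists i2, i1, xs, [:: x]; split=> //; first exact: sized1.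
  by rewrite addnC.
- by apply: lspan_gen; exists i1, i2, [:: x], xs; split=> //; apply: sized1.
move: r Rr; apply: lspan_min.
  exact: subspace_preim (fbr_lin x) (lspan_subspace _).
move=> _ [j3 [j4 [s [t [Ls Lt s0 t0 [-> ->]]]]]]; rewrite fJacobi.
apply: lspanD; apply: lspan_gen.
  exists (i1 + j3)%N, j4, (x :: s), t; split=> //; first exact: sized_cons.
  by rewrite addnA.
exists j3, (i1 + j4)%N, s, (x :: t); split=> //; first exact: sized_cons.
by rewrite addnCA.
Qed.

Lemma ad_kap_pair i j ps l :
  sized prod_space i ps -> kap_pair j l -> kap_pair (i + j) (ad ps l).
Proof.
move=> Pps Kl; elim: Pps => [//|i1 i2 p s Pp _ IHs] /=.
by rewrite -addnA; apply: kap_pair_prod.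
Qed.

(** A Poincare-Birkhoff-Witt argument: exchanging neighbours in [kap xs ps] costs generators with
    fewer entries and brackets of generators of smaller degree, so that [kap xs ps] agrees with the
    mean of its rearrangements up to elements already treated. *)
Lemma kap_gen_ksym n l : kap_gen n l -> lie ksym_gen n l.
Proof.
elim/ltn_ind: n l => n IHn l [i [j [xs [ps [Lxs Pps xs0 ps0 [nE ->]]]]]].
have pairW a : kap_pair n a -> lie ksym_gen n a.
  move: a; apply: lspan_min; first exact: lie_subspace.
  move=> _ [j1 [j2 [u [v [j1n j2n Ku Kv [-> ->]]]]]].
  by apply: lie_br; apply: IHn.
(* The second induction is on the number of entries: an exchange merges two entries into their
   bracket, which keeps the degree [n]. *)
have [N sN] := ubnP (size ps + size xs).
elim: N => // N IHN in i j xs ps Lxs Pps xs0 ps0 nE sN *.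
have subW := lie_subspace ksym_gen n.
have swap_xs xs' : perm_eq xs xs' ->
    lie ksym_gen n (kap xs ps - kap xs' ps).
  move=> xs'E; apply: (perm_swap_cong (h := fun s => kap s ps) subW _ xs'E) => s x y t xsE.
  have [qs [q psE]] : exists qs q, ps = rcons qs q.
    by case/lastP: (ps) ps0 => // qs q _; exists qs, q.
  rewrite psE !kap_rcons !(catA qs) ad_swap -catA -kap_rcons -psE.
  have xsE' := xsE; rewrite perm_sym in xsE'; have := sized_perm xsE' Lxs.
  case/sized_catE=> i1 [_ [Ls /sized_consE[i2 [_ [Lx /sized_consE[i3 [i4 [Ly Lt ->]]] ->]]] iE]].
  apply: (IHN i j) => //.
  - by rewrite iE (addnA i2); apply: sized_cat => //; apply: sized_cons => //; apply: letter_br.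
  - by case: (s).
  - by move: sN; rewrite -(perm_size xsE) !size_cat /=; lia.
have swap_ps xs' ps' : perm_eq xs' xs -> perm_eq ps ps' ->
    lie ksym_gen n (kap xs' ps - kap xs' ps').
  move=> xs'E; have Lxs' : sized letter i xs'.
    by apply: sized_perm Lxs; rewrite perm_sym.
  have sxs' := perm_size xs'E.
  have xs'0 : xs' != [::] by rewrite -size_eq0 sxs' size_eq0.
  move=> ps'E; apply: (perm_swap_cong (h := fun s => kap xs' s) subW _ ps'E) => s p q t psE.
  have psE' := psE; rewrite perm_sym in psE'; have := sized_perm psE' Pps.
  case/sized_catE=> j1 [_ [Ps /sized_consE[j2 [_ [Pp /sized_consE[j3 [j4 [Pq Pt ->]]] ->]]] jE]].
  have sps : size ps = (size s + (size t).+2)%N.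
    by rewrite -(perm_size psE) size_cat.
  (* If [q] is the last product it is the argument of [ad xs'], and the exchange also leaves the
     mixed terms of [ad_br_prod]. *)
  case/lastP: t Pt sps psE psE' => [|t r] Pt sps psE psE'.
    rewrite (sized_nilE Pt) addn0 in jE.
    rewrite -(cat_rcons p s [:: q]) -(cat_rcons q s [:: p]) !cats1 !kap_rcons.
    rewrite !cat_rcons !ad_cat -(linB (ad_lin s)) /=.
    have -> : {[p, ad xs' q]} - {[q, ad xs' p]} = ad xs' {[p, q]} -
       (ad xs' {[p, q]} - {[ad xs' p, q]} - {[p, ad xs' q]}).
      by rewrite (fbrC q); lmod k.
    rewrite (linB (ad_lin s)); apply: (subB subW).
      rewrite -ad_cat -kap_rcons; apply: (IHN i j) => //.
      + rewrite jE -cats1; apply: sized_cat => //; apply: sized1.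
        exact: prod_space_br.
      + by case: (s).
      + by move: sN; rewrite sps size_rcons /= sxs' addn2 addSn ltnS.
    apply: pairW; rewrite nE jE addnCA; apply: ad_kap_pair => //.
    exact: ad_br_prod.
  rewrite -!rcons_cons -!rcons_cat !kap_rcons -!catA /= ad_swap.
  rewrite -cat_cons catA -kap_rcons rcons_cat rcons_cons; apply: (IHN i j) => //.
  - rewrite jE (addnA j2); apply: sized_cat => //; apply: sized_cons => //.
    exact: prod_space_br.
  - by case: (s).
  - by move: sN; rewrite sps size_cat /= !size_rcons sxs' !addnS !addSn ltnS.
have symW : lie ksym_gen n (ksym xs ps).
  by apply: lie_letter; exists i, j, xs, ps.
(* All orderings being congruent, the symmetrized element is this multiple of [kap xs ps]. *)
have facts0 : (size xs)`!%:R * (size ps)`!%:R != 0 :> k.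
  by rewrite mulf_neq0 ?fact_neq0.
apply: (scale_sub subW facts0).
apply: (subBr subW symW); apply: (subBC subW).
rewrite -scalerA; apply: (order_sum_cong subW) => xs' xs'E.
apply: (sub_congT subW (v := (size ps)`!%:R *: kap xs' ps)).
  apply: (order_sum_cong subW) => ps' ps'E; apply: (subBC subW).
  by apply: swap_ps; rewrite // perm_sym.
rewrite -scalerBr; apply: (subZ subW); apply: (subBC subW).
by apply: swap_xs; rewrite perm_sym.
Qed.

Lemma ksym_gen_kap n l : ksym_gen n l -> lie kap_gen n l.
Proof.
case=> [i [j [xs [ps [Lxs Pps xs0 ps0 [-> ->]]]]]].
apply: (order_sum_sub (lie_subspace _ _)) => xs' xs'E.
apply: (order_sum_sub (lie_subspace _ _)) => ps' ps'E.
apply: lie_letter; exists i, j, xs', ps'; split=> //.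
- by apply: sized_perm Lxs; rewrite perm_sym.
- by apply: sized_perm Pps; rewrite perm_sym.
- by rewrite -size_eq0 (perm_size xs'E) size_eq0.
- by rewrite -size_eq0 (perm_size ps'E) size_eq0.
Qed.

Lemma ksym_gen_pos n l : ksym_gen n l -> (0 < n)%N.
Proof.
case=> i [j [[|x xs] [ps [Qx _ // _ _ [-> _]]]]].
by have [i1 [i2 [/letter_pos i1_gt0 _ ->]]] := sized_consE Qx; lia.
Qed.

Definition indec n := lspan (fun a => letter n a \/ lie ksym_gen n a).

Lemma indec_letter n a : letter n a -> indec n a.
Proof. by move=> La; apply: lspan_gen; left. Qed.

Lemma indec_lie n a : lie ksym_gen n a -> indec n a.
Proof. by move=> Ka; apply: lspan_gen; right. Qed.

(** Stability under letters is known for the generators [kap]; it passes to [ksym], which generates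
    the same Lie algebra. *)
Lemma indec_br i j a l :
  lie ksym_gen i l -> indec j a -> lie ksym_gen (i + j) {[l, a]}.
Proof.
move=> Kl; move: a; apply: lspan_min.
  exact: subspace_preim (fbr_lin l) (lie_subspace _ _).
move=> a [La|Ka]; last exact: lie_br.
rewrite fbrC; apply: (subN (lie_subspace _ _)).
apply: (lie_mono kap_gen_ksym); rewrite addnC; apply: lie_kap_letter => //.
exact: lie_mono ksym_gen_kap _ _ Kl.
Qed.

(** The bound is strict: [prods_space 0] asks for one factor and covers all of [gen],
    [prods_space 1] asks for two and covers [prod_space]. *)
Definition prods_space m n := lspan (fun v => exists ys,
  [/\ sized indec n ys, (m < size ys)%N & v = prods ys]).

Lemma prods_space_mul m1 m2 i j a b :
  prods_space m1 i a -> prods_space m2 j b ->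
  prods_space (m1 + m2).+1 (i + j) (a ** b).
Proof.
move=> Sa Sb; move: a Sa; apply: lspan_min.
  exact: subspace_preim (fmul_linl b) (lspan_subspace _).
move=> _ [ys [Iys mys ->]]; move: b Sb; apply: lspan_min.
  exact: subspace_preim (fmul_lin _) (lspan_subspace _).
move=> _ [zs [Izs mzs ->]]; apply: lspan_gen; exists (ys ++ zs); split.
- exact: sized_cat.
- by rewrite size_cat -addnS -addSn leq_add.
- by rewrite prods_cat //; [case: (ys) mys|case: (zs) mzs].
Qed.

Lemma gen_prods n a : gen n a -> prods_space 0 n a.
Proof.
elim/ltn_ind: n a => n IHn a /gen_reduced; move: a.
apply: lspan_min; first exact: lspan_subspace.
have indecP a : indec n a -> prods_space 0 n a.
  by move=> Ia; apply: lspan_gen; exists [:: a]; split=> //; apply: sized1.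
move=> a [La|Ka|]; first exact/indecP/indec_letter.
  exact/indecP/indec_lie/(lie_mono kap_gen_ksym).
move: a; apply: lspan_min; first exact: lspan_subspace.
move=> _ [i [j [a [b [i0 j0 ga gb [nE ->]]]]]].
have Sa : prods_space 0 i a by apply: IHn => //; lia.
have Sb : prods_space 0 j b by apply: IHn => //; lia.
rewrite nE; apply: lspan_mono (prods_space_mul Sa Sb) => v [ys [Iys mys ->]].
by exists ys; split=> //; lia.
Qed.

Lemma prod_space_prods n p : prod_space n p -> prods_space 1 n p.
Proof.
move: p; apply: lspan_min; first exact: lspan_subspace.
move=> _ [i [j [a [b [i0 j0 ga gb [-> ->]]]]]].
by apply: (@prods_space_mul 0 0); apply: gen_prods.
Qed.

Section NodeClosed.
Variables (T : A * A -> Prop) (subT : subspace T).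
Hypothesis T_node : forall n xs (cs : seq (A * A)), sized letter n xs ->
  xs != [::] -> (forall c : A * A, c \in cs -> T c) -> size cs != 1%N -> T (node xs cs).

(** By [node_mixed] this is, up to a factorial, a vertex with letters [xs] and children [ps] and
    [ys], all of which lie in [T] because their degrees are smaller. *)
Let T_lie_letter n ys l i j :
  (forall m zs, (m < n)%N -> sized indec m zs -> zs != [::] -> T (psi zs)) ->
  n = (i + j)%N -> ksym_gen i l -> sized indec j ys -> T (Dd l ys).
Proof.
move=> IHn nE Kl Iys; have i_gt0 := ksym_gen_pos Kl.
have Ty y : y \in ys -> T (y, 0).
  move=> yys; case/path.splitPr: yys Iys => s t Iys; have [i1 [_ [_ /sized_consE[i2 [i3 [Iy _ ->]]] jE]]] := sized_catE Iys.
  by apply: (IHn i2 [:: y]); [lia|exact: sized1|].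
have Tp m p : (m < n)%N -> prod_space m p -> T (0, p).
  move=> mn /prod_space_prods; move: p; apply: lspan_min.
    by apply: (subspace_preim _ subT) => a u v; rewrite pairZD scaler0 addr0.
  move=> _ [zs [Izs zs1 ->]]; rewrite -psiE; last by case: (zs) zs1 => [|z [|]].
  by apply: IHn mn Izs _; case: (zs) zs1.
case: Kl => [i1 [j1 [xs [ps [Lxs Pps xs0 ps0 [iE ->]]]]]].
have i1_gt0 : (0 < i1)%N.
  by case: xs xs0 Lxs => // x xs _ /sized_consE[i2 [i3 [/letter_pos ? _ ->]]]; lia.
(* The vertex would have the single child [p]. Writing [p] as a combination of products of at least
   two factors, [node_pure] gives a vertex with these factors as children. *)
have [one|one] := eqVneq (size ps + size ys)%N 1%N.
  have [p psE] : exists p, ps = [:: p].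
    by case: (ps) ps0 one => [|p [|q qs]] //; exists p.
  have -> : ys = [::] by case: (ys) one => //; rewrite psE.
  rewrite psE in Pps *; move/sized1E: Pps => Pp.
  rewrite /Dd /= addr0 /ksym /=.
  have lin_ad : linear (fun q => (order_sum xs (fun xs' => ad xs' q), 0 : A)).
    move=> a u v; rewrite pairZD scaler0 addr0 -order_sum_lin; congr (_, _).
    by apply: order_sum_ext => s; rewrite ad_lin.
  move/prod_space_prods: Pp; move: (p); apply: lspan_min.
    exact: subspace_preim lin_ad subT.
  move=> _ [zs [Izs zs1 ->]].
  apply: (scale_sub subT (fact_neq0 (size zs))).
  rewrite -node_pure //; apply: (T_node Lxs) => //; last by rewrite size_map; case: (zs) zs1 => [|z [|]].
  move=> c /mapP[z zz ->]; case/path.splitPr: zz Izs => s t Izs.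
  have [i2 [_ [_ /sized_consE[i3 [i4 [Iz _ ->]]] jE]]] := sized_catE Izs.
  by apply: (IHn i3 [:: z]); [lia|exact: sized1|].
apply: (scale_sub subT (fact_neq0 (size ys))).
rewrite -node_mixed //; apply: (T_node Lxs) => //; last by rewrite size_cat !size_map.
move=> c; rewrite mem_cat => /orP[] /mapP[z zz ->]; last exact: Ty.
case/path.splitPr: zz Pps => s t Pps.
have [i2 [_ [_ /sized_consE[i3 [i4 [Pz _ ->]]] jE]]] := sized_catE Pps.
by apply: (Tp i3); [lia|].
Qed.

(** Induction on the degree. Within a degree, Lie words are built from the generators, and products
    are then freed from their derivation terms, which have fewer factors. *)
Lemma node_closed_psi n ys : sized indec n ys -> ys != [::] -> T (psi ys).
Proof.
elim/ltn_ind: n ys => n IHn.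
have base l zs i j : n = (i + j)%N -> ksym_gen i l -> sized indec j zs -> T (Dd l zs).
  by move=> nE Kl Izs; apply: T_lie_letter nE Kl Izs => m ys mn Iys ys0; apply: (IHn m).
(* The combination is the operator m mu_l + ad_l applied to [zs]. For a bracket of words it is the
   commutator of the operators of the two words, assembled from [E1] to [E4]; the coefficients m and
   m' add up. *)
have word i m l : lie_word ksym_gen i m l -> forall j zs, n = (i + j)%N ->
    sized indec j zs -> T (m%:R *: psi (l :: zs) + der l psi zs).
  elim=> {i m l} [i l Kl j zs nE Izs|].
    by rewrite scale1r; apply: base nE Kl Izs.
  move=> i i' m m' l l' Kl IHl Kl' IHl' j zs nE Izs.
  have Il : indec i l by apply/indec_lie/lspan_gen; exists m.
  have Il' : indec i' l' by apply/indec_lie/lspan_gen; exists m'.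
  have indec_der c ic s y t : lie ksym_gen ic c -> zs = s ++ y :: t ->
      sized indec (ic + j) (s ++ {[c, y]} :: t).
    move=> Kc zsE; rewrite zsE in Izs.
    have [j1 [_ [Is /sized_consE[j2 [j3 [Iy It ->]]] ->]]] := sized_catE Izs.
    rewrite addnCA; apply: sized_cat => //; rewrite addnA; apply: sized_cons => //.
    exact/indec_lie/indec_br.
  have E1 := IHl (i' + j)%N (l' :: zs) _ (sized_cons Il' Izs).
  have E2 := IHl' (i + j)%N (l :: zs) _ (sized_cons Il Izs).
  have E3 : T (der l (fun t => m'%:R *: psi (l' :: t) + der l' psi t) zs).
    apply: (der_sub subT) => s y t zsE; apply: (IHl' (i + j)%N); first by lia.
    by apply: indec_der zsE; apply: lspan_gen; exists m.
  have E4 : T (der l' (fun t => m%:R *: psi (l :: t) + der l psi t) zs).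
    apply: (der_sub subT) => s y t zsE; apply: (IHl (i' + j)%N); first by lia.
    by apply: indec_der zsE; apply: lspan_gen; exists m'.
  have nE1 : n = (i + (i' + j))%N by lia.
  have nE2 : n = (i' + (i + j))%N by lia.
  have := subD subT (subB subT (subB subT (subZ subT m'%:R (E1 nE1))
    (subZ subT m%:R (E2 nE2))) E3) E4.
  have -> : der {[l, l']} psi zs = der l' (der l psi) zs -
      der l (der l' psi) zs.
    by rewrite -(derC _ _ zs (@psi_mlin _ _)).
  rewrite natrD.
  have derE c d : der c psi (d :: zs) =
      psi ({[c, d]} :: zs) + der c (fun t => psi (d :: t)) zs by [].
  have psiC : psi [:: l', l & zs] = psi [:: l, l' & zs] by apply: (psi_swap [::]).
  have psiN : psi ({[l', l]} :: zs) = - psi ({[l, l']} :: zs).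
    by rewrite fbrC (linN (mlin_at [::] zs (@psi_mlin _ _))).
  rewrite !derE !derZD psiC psiN.
  have eqT u v : u = v -> T u -> T v by move->.
  by apply: eqT; lmod k.
(* In the derivation term [l] and some [y] merge into the Lie element [{[l, y]}], so it has one
   factor less: induction on [q]. Then [m] is divided out. *)
have lieT (q : nat) i j l zs : size zs = q -> lie ksym_gen i l -> sized indec j zs ->
    n = (i + j)%N -> T (psi (l :: zs)).
  elim: q i j l zs => [|q IHq] i j l zs szs Kl Izs nE; move: l Kl; apply: lspan_min;
    try exact: subspace_preim (mlin_at [::] zs (@psi_mlin _ _)) subT.
    move=> l [m Kl]; have m0 := char0_natr_neq0 (lie_word_pos Kl).
    apply: (scale_sub subT m0); have := word _ _ _ Kl _ _ nE Izs.
    by rewrite (size0nil szs) /= addr0.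
  move=> l [m Kl]; have m0 := char0_natr_neq0 (lie_word_pos Kl).
  apply: (scale_sub subT m0); have := word _ _ _ Kl _ _ nE Izs.
  rewrite -[der l psi zs]opprK; apply: (subBr subT); apply: (subN subT).
  apply: (der_sub subT) => s y t zsE; rewrite zsE in Izs szs.
  have [j1 [_ [Is /sized_consE[j2 [j3 [Iy It ->]]] jE]]] := sized_catE Izs.
  rewrite (psi_perm (zs := {[l, y]} :: s ++ t)); last first.
    by rewrite perm_catC /= perm_cons perm_catC.
  apply: (IHq (i + j2)%N (j1 + j3)%N).
  - by move: szs; rewrite !size_cat /=; lia.
  - by apply: indec_br => //; apply: lspan_gen; exists m.
  - exact: sized_cat.
  - by lia.
(* [xs] accumulates the letters. A product of letters only is a leaf; a Lie factor is brought to the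
   front and handled by [lieT]. *)
have main ys : forall xs i j, sized letter i xs -> sized indec j ys ->
    n = (i + j)%N -> xs ++ ys != [::] -> T (psi (xs ++ ys)).
  elim: ys => [|y ys IHys] xs i j Lxs Iys nE xys0.
    rewrite cats0 in xys0 *.
    apply: (scale_sub subT (fact_neq0 (size xs))); rewrite -node_leaf.
    exact: (T_node Lxs).
  have [j1 [j2 [Iy {}Iys jE]]] := sized_consE Iys.
  move: y Iy {xys0}; apply: lspan_min.
    exact: subspace_preim (mlin_at xs ys (@psi_mlin _ _)) subT.
  move=> y [Ly|Ky].
    rewrite -cat_rcons -cats1; apply: (IHys _ (i + j1)%N j2) => //; last by case: (xs).
      by apply: sized_cat => //; apply: sized1.
    by lia.
  rewrite (psi_perm (zs := y :: xs ++ ys)); last first.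
    by rewrite perm_catC /= perm_cons perm_catC.
  apply: (lieT _ j1 (i + j2)%N) (erefl _) _ _ _ => //; last by lia.
  apply: sized_cat => //; apply: sized_mono Lxs => i1 a; exact: indec_letter.
move=> ys Iys ys0; exact: (main ys [::] 0%N n (sized_nil _) Iys).
Qed.

Lemma node_closed_gen n a : gen n a -> exists2 c, T c & a = c.1 + c.2.
Proof.
move=> /gen_prods; elim=> {a} [_ [ys [Iys ys0 ->]]||u v _ [c Tc ->] _ [d Td ->]|b u _ [c Tc ->]].
- exists (psi ys); first by apply: node_closed_psi Iys _; rewrite -size_eq0 -lt0n.
  by case: (ys) => [|y [|z s]] /=; rewrite ?addr0 ?add0r.
- by exists 0; [apply: sub0|rewrite addr0].
- by exists (c + d); [apply: subD|rewrite addrACA].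
- by exists (b *: c); [apply: subZ|rewrite scalerDr].
Qed.
End NodeClosed.
End Generation.

(** * Presented algebras graded by subsets *)

Definition upd (I : eqType) (T : Type) (x : I -> T) (i : I) (u : T) : I -> T :=
  fun j => if j == i then u else x j.

Section Interp.
Variables (k : fieldType) (O : Type) (V : lmodType k) (op : O -> V -> V -> V).

Fixpoint interp (I : Type) (x : I -> V) (t : expr k O I) : V :=
  match t with
  | EVar i => x i
  | EOp o t u => op o (interp x t) (interp x u)
  | EZero => 0
  | EAdd t u => interp x t + interp x u
  | EScale a t => a *: interp x t
  end.

Lemma interp_ext (I : Type) (x y : I -> V) t :
  x =1 y -> interp x t = interp y t.
Proof. by move=> xy; elim: t => //= [o t -> u ->|t -> u ->|a t ->]. Qed.

Lemma interp_bind (I J : Type) (x : J -> V) (s : I -> expr k O J) t :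
  interp x (ebind t s) = interp (fun i => interp x (s i)) t.
Proof. by elim: t => //= [o t -> u ->|t -> u ->|a t ->]. Qed.

Hypothesis op_linl : forall o b, linear (fun a => op o a b).
Hypothesis op_linr : forall o a, linear (op o a).

Lemma interp_upd_out (I : finType) (x : I -> V) (E : {set I}) t i u :
  multilinear E t -> i \notin E -> interp (upd x i u) t = interp x t.
Proof.
elim=> {E t} [j|o A B t1 t2 _ _ IH1 _ IH2|//|A t1 t2 _ IH1 _ IH2|A a t _ IHt] /=.
- by rewrite inE /upd eq_sym => /negPf ->.
- by rewrite inE negb_or => /andP[/IH1 -> /IH2 ->].
- by move=> iA; rewrite IH1 ?IH2.
- by move=> iA; rewrite IHt.
Qed.

Lemma interp_upd_lin (I : finType) (x : I -> V) (E : {set I}) t i :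
  multilinear E t -> i \in E -> linear (fun u => interp (upd x i u) t).
Proof.
move=> Et iE c u v; elim: Et iE => {E t}
  [j|o A B t1 t2 AB At1 IH1 Bt2 IH2|A _|A t1 t2 _ IH1 _ IH2 iA|A a t _ IHt iA] /=.
- by rewrite inE /upd eq_sym => ->.
- rewrite inE; have [iA|iA] := boolP (i \in A).
    have iB : i \notin B by rewrite (disjointFr AB iA).
    by rewrite !(interp_upd_out _ _ Bt2 iB) IH1 // op_linl.
  by move=> /IH2 ->; rewrite !(interp_upd_out _ _ At1 iA) op_linr.
- by rewrite scaler0 addr0.
- by rewrite IH1 // IH2 // scalerDr addrACA.
- by rewrite IHt // scalerDr !scalerA mulrC.
Qed.
End Interp.

Record ralg (k : fieldType) (R : presentation k) := RAlg {
  ra :> lmodType k;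
  rop : pr_ops R -> ra -> ra -> ra;
  rop_linl : forall o b, linear (fun a => rop o a b);
  rop_linr : forall o a, linear (rop o a);
  rop_rel : forall r (x : 'I_(id_arity (pr_id r)) -> ra),
    interp rop x (id_lhs (pr_id r)) = interp rop x (id_rhs (pr_id r)) }.

Section Eval.
Variables (k : fieldType) (R : presentation k) (V : ralg R).

Lemma interp_econg (I : finType) (x : I -> V) (A : {set I}) t u :
  @econg k R I A t u -> interp (@rop k R V) x t = interp (@rop k R V) x u.
Proof.
elim=> {A t u} /=.
- by move=> r D s _ _; rewrite !interp_bind; apply: rop_rel.
- by move=> o A B t t' u u' _ _ -> _ ->.
- by move=> o A B t t' u _ _ _ _; rewrite (linD (rop_linl o _)).
- by move=> o A B t u u' _ _ _ _; rewrite (linD (rop_linr o _)).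
- by move=> o A B a t u _ _ _; rewrite (linZ (rop_linl o _)).
- by move=> o A B a t u _ _ _; rewrite (linZ (rop_linr o _)).
- by [].
- by move=> A t u _ ->.
- by move=> A t u v _ -> _ ->.
- by move=> A t t' u u' _ -> _ ->.
- by move=> A a t t' _ ->.
- by move=> A t u v _ _ _; rewrite addrA.
- by move=> A t u _ _; rewrite addrC.
- by move=> A t _; rewrite add0r.
- by move=> A t _; rewrite scaleN1r addNr.
- by move=> A a b t _; rewrite scalerA.
- by move=> A t _; rewrite scale1r.
- by move=> A a t u _ _; rewrite scalerDr.
- by move=> A a b t _; rewrite scalerDl.
Qed.

Definition eval (I : finType) (x : I -> V) (A : {set I}) (c : @mspace k R I A) : V :=
  interp (@rop k R V) x (mrepr c).

Lemma eval_class (I : finType) (x : I -> V) (A : {set I}) t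
    (At : multilinear A t) :
  eval x (@mclass k R I A t At) = interp (@rop k R V) x t.
Proof. exact: interp_econg (mrepr_class At). Qed.

Lemma eval_linear (I : finType) (x : I -> V) (A : {set I}) :
  linear (@eval I x A).
Proof.
move=> a; elim/mclass_ind=> t At; elim/mclass_ind=> u Au.
by rewrite mclassZ mclassD !eval_class.
Qed.
End Eval.

Section Class.
Variables (k : fieldType) (R : presentation k) (J : finType).
Local Notation expr := (expr k (pr_ops R) J).
Local Notation mspace := (@mspace k R J).
Implicit Types (A B C : {set J}) (t u : expr).

(* The class of t in mspace A, or 0 if t does not have support A. *)
Definition cls A t : mspace A :=
  if pselect (multilinear A t) is left At then mclass At else 0.

Lemma clsE A t (At : multilinear A t) : cls A t = mclass At.
Proof.
rewrite /cls; case: pselect => [At'|//]; apply/mclassP; exact: ec_refl.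
Qed.

Lemma cls_econg A t u : @econg k R J A t u -> cls A t = cls A u.
Proof.
by move=> tu; have [At Au] := econg_ml tu; rewrite (clsE At) (clsE Au); apply/mclassP.
Qed.

Lemma clsD A t u : multilinear A t -> multilinear A u ->
  cls A (EAdd t u) = cls A t + cls A u.
Proof.
by move=> At Au; rewrite (clsE At) (clsE Au) (clsE (ml_add At Au)) mclassD.
Qed.

Lemma clsZ A a t : multilinear A t -> cls A (EScale a t) = a *: cls A t.
Proof. by move=> At; rewrite (clsE At) (clsE (ml_scale a At)) mclassZ. Qed.

Lemma cls0 A : cls A EZero = 0.
Proof. by rewrite (clsE (ml_zero _ _ A)) mclass0. Qed.

Lemma clsK A (c : mspace A) : cls A (mrepr c) = c.
Proof. by rewrite (clsE (mrepr_ml c)) mreprK. Qed.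

Lemma cls_repr A t : multilinear A t -> @econg k R J A (mrepr (cls A t)) t.
Proof. by move=> At; rewrite (clsE At); apply: mrepr_class. Qed.

Lemma mrepr_lin A a (c d : mspace A) :
  @econg k R J A (mrepr (a *: c + d)) (EAdd (EScale a (mrepr c)) (mrepr d)).
Proof.
apply/(mclassP (mrepr_ml _) (ml_add (ml_scale a (mrepr_ml c)) (mrepr_ml d))).
by rewrite mreprK -mclassD -mclassZ !mreprK.
Qed.

(* The direct sum of the multilinear parts over all subsets of J. *)
Definition gspace : Type := forall A : {set J}, mspace A.
HB.instance Definition _ := gen_eqMixin gspace.
HB.instance Definition _ := gen_choiceMixin gspace.

Implicit Types (a b : gspace).
Definition gadd a b : gspace := fun A => a A + b A.
Definition gopp a : gspace := fun A => - a A.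
Definition gzero : gspace := fun A => 0.
Definition gscale (c : k) a : gspace := fun A => c *: a A.

Lemma gspaceP a b : (forall A, a A = b A) -> a = b.
Proof. exact: functional_extensionality_dep. Qed.

Lemma gaddA : associative gadd.
Proof. by move=> a b c; apply: gspaceP => A; apply: addrA. Qed.
Lemma gaddC : commutative gadd.
Proof. by move=> a b; apply: gspaceP => A; apply: addrC. Qed.
Lemma gadd0 : left_id gzero gadd.
Proof. by move=> a; apply: gspaceP => A; apply: add0r. Qed.
Lemma gaddN : left_inverse gzero gopp gadd.
Proof. by move=> a; apply: gspaceP => A; apply: addNr. Qed.
HB.instance Definition _ := GRing.isZmodule.Build gspace gaddA gaddC gadd0 gaddN.

Lemma gscaleA c d a : gscale c (gscale d a) = gscale (c * d) a.
Proof. by apply: gspaceP => A; apply: scalerA. Qed.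
Lemma gscale1 : left_id 1 gscale.
Proof. by move=> a; apply: gspaceP => A; apply: scale1r. Qed.
Lemma gscaleDr : right_distributive gscale +%R.
Proof. by move=> c a b; apply: gspaceP => A; apply: scalerDr. Qed.
Lemma gscaleDl a : {morph gscale^~ a : c d / c + d}.
Proof. by move=> c d; apply: gspaceP => A; apply: scalerDl. Qed.
HB.instance Definition _ := GRing.Zmodule_isLmodule.Build k gspace
  gscaleA gscale1 gscaleDr gscaleDl.

Lemma gcompD a b A : (a + b) A = a A + b A. Proof. by []. Qed.
Lemma gcompZ c a A : (c *: a) A = c *: a A. Proof. by []. Qed.
Lemma gcomp_sum I (r : seq I) (P : pred I) (F : I -> gspace) A :
  (\sum_(i <- r | P i) F i) A = \sum_(i <- r | P i) F i A.
Proof. by elim/big_rec2: _ => // i x y _ <-. Qed.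

Definition gop o a b : gspace := fun C =>
  \sum_(A : {set J} | A \subset C)
    cls C (EOp o (mrepr (a A)) (mrepr (b (C :\: A)))).

Lemma setUD_sub A C : A \subset C -> A :|: (C :\: A) = C.
Proof. by move=> sAC; rewrite setDE setUIr setUCr setIT; apply/setUidPr. Qed.

Lemma disjointD A C : [disjoint A & C :\: A].
Proof. by rewrite -setI_eq0 setIDA setIC -setIDA setDv setI0. Qed.

Lemma ml_opD o A C t u : A \subset C -> multilinear A t ->
  multilinear (C :\: A) u -> multilinear C (EOp o t u).
Proof.
by move=> sAC At Bu; rewrite -(setUD_sub sAC); apply: ml_op => //; apply: disjointD.
Qed.

Lemma gop_linl o b : linear (fun a => gop o a b).
Proof.
move=> c a a'; apply: gspaceP => C; rewrite gcompD gcompZ /gop scaler_sumr.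
rewrite -big_split /=; apply: eq_bigr => A sAC.
have [[ma ma'] mb] := (mrepr_ml (a A), mrepr_ml (a' A), mrepr_ml (b (C :\: A))).
have dAC := disjointD A C.
rewrite -clsZ; last exact: ml_opD sAC ma mb.
rewrite -clsD; [|exact/ml_scale/(ml_opD o sAC ma mb)|exact: ml_opD sAC ma' mb].
apply: cls_econg; rewrite -{1}(setUD_sub sAC).
apply: ec_trans (ec_op o dAC (mrepr_lin c _ _) (ec_refl mb)) _.
apply: ec_trans (ec_opDl _ _ (ml_scale c ma) ma' mb) _ => //.
apply: ec_add; first exact: ec_opZl.
exact/ec_refl/ml_op.
Qed.

Lemma gop_linr o a : linear (gop o a).
Proof.
move=> c b b'; apply: gspaceP => C; rewrite gcompD gcompZ /gop scaler_sumr.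
rewrite -big_split /=; apply: eq_bigr => A sAC.
have [[ma mb] mb'] := (mrepr_ml (a A), mrepr_ml (b (C :\: A)), mrepr_ml (b' (C :\: A))).
have dAC := disjointD A C.
rewrite -clsZ; last exact: ml_opD sAC ma mb.
rewrite -clsD; [|exact/ml_scale/(ml_opD o sAC ma mb)|exact: ml_opD sAC ma mb'].
apply: cls_econg; rewrite -{1}(setUD_sub sAC).
apply: ec_trans (ec_op o dAC (ec_refl ma) (mrepr_lin c _ _)) _.
apply: ec_trans (ec_opDr _ _ ma (ml_scale c mb) mb') _ => //.
apply: ec_add; first exact: ec_opZr.
exact/ec_refl/ml_op.
Qed.

Definition hcls A t : gspace := fun C => if C == A then cls C t else 0.

Definition homog A a := forall C, C != A -> a C = 0.

Lemma hcls_homog A t : homog A (hcls A t).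
Proof. by move=> C CA; rewrite /hcls (negPf CA). Qed.

Lemma homogE A a : homog A a -> a = hcls A (mrepr (a A)).
Proof.
move=> ha; apply: gspaceP => C; rewrite /hcls.
by case: eqVneq => [->|/ha]; rewrite ?clsK.
Qed.

Lemma homog_subspace A : subspace (homog A).
Proof.
split=> [//|a b ha hb|c a ha] C CA; rewrite ?gcompD ?gcompZ ?ha ?hb ?addr0 //.
exact: scaler0.
Qed.

Lemma hcls_sum a : a = \sum_A hcls A (mrepr (a A)).
Proof.
apply: gspaceP => C; rewrite gcomp_sum (bigD1 C) //= big1 => [|A sAC].
  by rewrite /hcls eqxx clsK addr0.
by rewrite /hcls eq_sym (negPf sAC).
Qed.

Lemma hcls_econg A t u : @econg k R J A t u -> hcls A t = hcls A u.
Proof.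
move=> tu; apply: gspaceP => C; rewrite /hcls.
by case: eqVneq => [->|//]; apply: cls_econg.
Qed.

Lemma hclsD A t u : multilinear A t -> multilinear A u ->
  hcls A (EAdd t u) = hcls A t + hcls A u.
Proof.
move=> At Au; apply: gspaceP => C; rewrite gcompD /hcls.
by case: eqVneq => [->|_]; rewrite ?addr0 ?clsD.
Qed.

Lemma hclsZ A c t : multilinear A t -> hcls A (EScale c t) = c *: hcls A t.
Proof.
move=> At; apply: gspaceP => C; rewrite gcompZ /hcls.
by case: eqVneq => [->|_]; rewrite ?scaler0 ?clsZ.
Qed.

Lemma hcls0 A : hcls A EZero = 0.
Proof. by apply: gspaceP => C; rewrite /hcls; case: eqP => // ->; apply: cls0. Qed.

Lemma cls_op0 o A C t u : A \subset C -> multilinear A t ->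
  multilinear (C :\: A) u -> cls A t = 0 \/ cls (C :\: A) u = 0 ->
  cls C (EOp o t u) = 0.
Proof.
move=> sAC At Bu tu0; have dAC := disjointD A C.
have zero B v : multilinear B v -> cls B v = 0 -> @econg k R J B v (EScale 0 v).
  move=> Bv v0; apply/(mclassP Bv (ml_scale 0 Bv)).
  by rewrite -mclassZ scale0r -clsE.
rewrite -[RHS](scale0r (cls C (EOp o t u))) -clsZ; last exact: ml_opD sAC At Bu.
apply: cls_econg; rewrite -(setUD_sub sAC).
case: tu0 => [/(zero _ _ At) tz|/(zero _ _ Bu) uz].
  exact: ec_trans (ec_op o dAC tz (ec_refl Bu)) (ec_opZl o 0 dAC At Bu).
exact: ec_trans (ec_op o dAC (ec_refl At) uz) (ec_opZr o 0 dAC At Bu).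
Qed.

Lemma gop_term0 o A B C A' a b : homog A a -> homog B b -> A' \subset C ->
  (A' != A) || (C :\: A' != B) ->
  cls C (EOp o (mrepr (a A')) (mrepr (b (C :\: A')))) = 0.
Proof.
move=> ha hb sAC bad; apply: (cls_op0 o sAC (mrepr_ml _) (mrepr_ml _)).
by case: (orP bad) => bad'; [left|right]; rewrite clsK; [apply: ha|apply: hb].
Qed.

Lemma gop_homog o A B a b :
  homog A a -> homog B b -> homog (A :|: B) (gop o a b).
Proof.
move=> ha hb C CAB; apply: big1 => A' sAC; apply: (gop_term0 _ ha hb sAC).
rewrite -negb_and; apply: contra CAB => /andP[/eqP <- /eqP <-].
by rewrite (setUD_sub sAC).
Qed.

Lemma gop_overlap o A B a b :
  homog A a -> homog B b -> ~~ [disjoint A & B] -> gop o a b = 0.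
Proof.
move=> ha hb AB; apply: gspaceP => C; apply: big1 => A' sAC.
apply: gop_term0 ha hb sAC _; rewrite -negb_and.
by apply: contra AB => /andP[/eqP <- /eqP <-]; apply: disjointD.
Qed.

Lemma gop_hcls o A B t u : [disjoint A & B] -> multilinear A t ->
  multilinear B u -> gop o (hcls A t) (hcls B u) = hcls (A :|: B) (EOp o t u).
Proof.
move=> AB At Bu; have [hA hB] := (@hcls_homog A t, @hcls_homog B u).
apply: gspaceP => C; have [->|CAB] := eqVneq C (A :|: B); last first.
  by rewrite (gop_homog o hA hB) // hcls_homog.
have ABA : (A :|: B) :\: A = B.
  by rewrite setDUl setDv set0U; apply/setDidPl; rewrite disjoint_sym.
rewrite /gop (bigD1 A) ?subsetUl //= big1 => [|A' /andP[sAC AA]].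
  rewrite addr0 ABA /hcls !eqxx; apply: cls_econg.
  by apply: ec_op => //; apply: cls_repr.
by apply: (gop_term0 _ hA hB sAC); rewrite AA.
Qed.

Section InterpHomog.
Variables (I : finType) (D : I -> {set J}) (x : I -> gspace).
Hypothesis xD : forall i, homog (D i) (x i).

Lemma interp_homog (E : {set I}) (l : Defs.expr k (pr_ops R) I) :
  multilinear E l -> homog (\bigcup_(i in E) D i) (interp gop x l).
Proof.
elim=> {E l} [i|o A B t u _ _ IHt _ IHu|A|A t u _ IHt _ IHu|A a t _ IHt] /=.
- by rewrite big_set1.
- by rewrite bigcup_setU; apply: gop_homog.
- exact: sub0 (homog_subspace _).
- exact: subD (homog_subspace _) _ _ IHt IHu.
- exact: subZ (homog_subspace _) _ _ IHt.
Qed.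

(** At some operation the two variables lie in different arguments, whose degrees then overlap, so
    that [gop_overlap] applies. *)
Lemma interp_overlap (E : {set I}) l i j : multilinear E l ->
  i \in E -> j \in E -> i != j -> ~~ [disjoint D i & D j] ->
  interp gop x l = 0.
Proof.
move=> El; elim: El i j => {E l}
  [i'|o A B t u AB At IHt Bu IHu|A|A t u _ IHt _ IHu|A a t _ IHt] i j /=.
- by rewrite !inE => /eqP -> /eqP ->; rewrite eqxx.
- rewrite !inE => iAB jAB ij Dij.
  wlog: i j iAB jAB ij Dij / (i \in A) && (j \in B) => [wl|/andP[iA jB]].
    have [iA|iA] := boolP (i \in A); have [jA|jA] := boolP (j \in A).
    + by rewrite (IHt i j) // (lin0 (gop_linl o _)).
    + by apply: (wl i j) => //; rewrite iA; rewrite (negPf jA) in jAB.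
    + apply: (wl j i); rewrite // 1?eq_sym 1?disjoint_sym // jA.
      by rewrite (negPf iA) in iAB.
    + rewrite (negPf iA) /= in iAB; rewrite (negPf jA) /= in jAB.
      by rewrite (IHu i j) // (lin0 (gop_linr o _)).
  apply: gop_overlap (interp_homog At) (interp_homog Bu) _.
  apply: contra Dij => dAB; apply/pred0P=> s /=; apply/negP=> /andP[si sj].
  have sA : s \in \bigcup_(i in A) D i by apply/bigcupP; exists i.
  have sB : s \in \bigcup_(i in B) D i by apply/bigcupP; exists j.
  by rewrite (disjointFr dAB sA) in sB.
- by [].
- by move=> iA jA ij Dij; rewrite (IHt i j) // (IHu i j) // addr0.
- by move=> iA jA ij Dij; rewrite (IHt i j) // scaler0.
Qed.
End InterpHomog.

Lemma interp_hcls (I : finType) (D : I -> {set J}) (s : I -> expr)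
    (E : {set I}) (l : Defs.expr k (pr_ops R) I) :
  (forall i j, i != j -> [disjoint D i & D j]) ->
  (forall i, multilinear (D i) (s i)) -> multilinear E l ->
  interp gop (fun i => hcls (D i) (s i)) l =
  hcls (\bigcup_(i in E) D i) (ebind l s).
Proof.
move=> dD Ds; elim=> {E l}
  [i|o A B t u AB At IHt Bu IHu|A|A t u At IHt Au IHu|A a t At IHt] /=.
- by rewrite big_set1.
- rewrite IHt IHu bigcup_setU gop_hcls //; first exact: disjoint_bigcup.
    exact: ml_bind.
  exact: ml_bind.
- by rewrite hcls0.
- by rewrite IHt IHu hclsD //; apply: ml_bind.
- by rewrite IHt hclsZ //; apply: ml_bind.
Qed.

(** For disjoint degrees this is an instance of [ec_rel]; if two degrees overlap, both sides
    vanish. *)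
Let rel_homog r (D : 'I_(id_arity (pr_id r)) -> {set J}) x :
  (forall i, homog (D i) (x i)) ->
  interp gop x (id_lhs (pr_id r)) = interp gop x (id_rhs (pr_id r)).
Proof.
move=> xD; have [lml rml] := (pr_lhs_ml r, pr_rhs_ml r).
have [dD|] := boolP [forall i, forall j, (i != j) ==> [disjoint D i & D j]].
  have {}dD i j : i != j -> [disjoint D i & D j].
    by move/implyP: (forallP (forallP dD i) j).
  pose s i := mrepr (x i (D i)).
  have Ds i : multilinear (D i) (s i) by apply: mrepr_ml.
  have xE : x = fun i => hcls (D i) (s i).
    by apply/funext => i; apply: homogE.
  rewrite xE !(interp_hcls (E := setT)) //; apply: hcls_econg.
  have -> : \bigcup_(i in [set: 'I_(id_arity (pr_id r))]) D i = \bigcup_i D i.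
    by apply: eq_bigl => i; rewrite inE.
  exact: ec_rel.
rewrite negb_forall => /existsP[i]; rewrite negb_forall => /existsP[j].
rewrite negb_imply => /andP[ij Dij].
by rewrite !(interp_overlap xD (E := setT) (i := i) (j := j)).
Qed.

(** Both sides are linear in each variable, so the variables may be replaced, one after the other,
    by their homogeneous components. The list [s] holds those not yet replaced. *)
Lemma grel r (x : 'I_(id_arity (pr_id r)) -> gspace) :
  interp gop x (id_lhs (pr_id r)) = interp gop x (id_rhs (pr_id r)).
Proof.
have [lml rml] := (pr_lhs_ml r, pr_rhs_ml r).
suff rel (s : seq 'I_(id_arity (pr_id r))) (y : 'I_(id_arity (pr_id r)) -> gspace) :
    (forall i, i \notin s -> exists D, homog D (y i)) ->
    interp gop y (id_lhs (pr_id r)) = interp gop y (id_rhs (pr_id r)).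
  by apply: (rel (enum 'I_(id_arity (pr_id r)))) => i; rewrite mem_enum.
elim: s y => [|i s IHs] y yh.
  have /fin_all_exists[D yD] : forall i, exists D, homog D (y i).
    by move=> i; apply: yh.
  exact: rel_homog yD.
have yE : y = upd y i (y i) by apply/funext=> j; rewrite /upd; case: eqP => [->|].
have iT : i \in setT by [].
have [linl linr] := (gop_linl, gop_linr).
have Ll := interp_upd_lin linl linr y lml iT.
have Lr := interp_upd_lin linl linr y rml iT.
rewrite yE (hcls_sum (y i)).
elim: (index_enum _) => [|A r' IHr]; first by rewrite big_nil (lin0 Ll) (lin0 Lr).
rewrite big_cons (linD Ll) (linD Lr) IHr; congr (_ + _); apply: IHs => j js.
have [->|ji] := eqVneq j i.
  by exists A; rewrite /upd eqxx; apply: hcls_homog.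
by rewrite /upd (negPf ji); apply: yh; rewrite inE negb_or ji.
Qed.

Definition galg : ralg R := RAlg gop_linl gop_linr grel.

Definition gvar (j : J) : gspace := hcls [set j] (EVar j).

Lemma gvar_homog j : homog [set j] (gvar j).
Proof. exact: hcls_homog. Qed.

Lemma interp_gvar A t : multilinear A t -> interp gop gvar t = hcls A t.
Proof.
move=> At; rewrite (interp_hcls (D := fun j => [set j]) _ _ At).
- rewrite (@bigcup_singletons J J id) imset_id; congr hcls.
  exact: (@erelabel_id k R J id t).
- by move=> i j ij; rewrite disjoints1 inE.
- by move=> i; apply: ml_var.
Qed.

End Class.
Arguments gvar {k} R {J}.

(** * Trees evaluated in an F-manifold algebra *)

Section FalgOf.
Variables (k : fieldType) (X : ralg (FMan_presentation k)).
Local Notation mul := (@rop k (FMan_presentation k) X FMan_product).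
Local Notation br := (@rop k (FMan_presentation k) X FMan_bracket).
Implicit Types (a b c d : X).

Let mulC a b : mul a b = mul b a.
Proof. by have := @rop_rel _ _ X (FMan_comm : pr_index (FMan_presentation k)) (fun i => [:: a; b]`_i). Qed.

Let mulA a b c : mul (mul a b) c = mul a (mul b c).
Proof. by have := @rop_rel _ _ X (FMan_assoc : pr_index (FMan_presentation k)) (fun i => [:: a; b; c]`_i). Qed.

Let brC a b : br a b = - br b a.
Proof.
rewrite -scaleN1r.
by have := @rop_rel _ _ X (FMan_skew : pr_index (FMan_presentation k)) (fun i => [:: a; b]`_i).
Qed.

Let jacobi a b c : br a (br b c) = br (br a b) c + br b (br a c).
Proof.
have := (@rop_rel _ _ X (FMan_Jacobi : pr_index (FMan_presentation k)) (fun i => [:: a; b; c]`_i)).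
rewrite /= => /eqP; rewrite addrAC addr_eq0 => /eqP J.
rewrite [LHS]brC -J; congr (_ + _).
by rewrite brC (brC c) (linN (rop_linr _ _)) opprK.
Qed.

Let HM a b c d : br (mul a b) (mul c d) =
    mul (br (mul a b) c) d + mul (br (mul a b) d) c
    + mul a (br b (mul c d)) + mul b (br a (mul c d))
    - mul (mul a c) (br b d) - mul (mul b c) (br a d)
    - mul (mul b d) (br a c) - mul (mul a d) (br b c).
Proof.
rewrite -4!scaleN1r.
by have := @rop_rel _ _ X (FMan_HM : pr_index (FMan_presentation k)) (fun i => [:: a; b; c; d]`_i).
Qed.

Definition falg_of : falg k :=
  FAlg (@rop_linr _ _ X (FMan_product : pr_ops (FMan_presentation k)))
    (@rop_linr _ _ X (FMan_bracket : pr_ops (FMan_presentation k))) mulC mulA brC jacobi HM.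
End FalgOf.

(** * Homomorphisms of F-manifold algebras *)

Section Hom.
Variables (k : fieldType) (A B : falg k) (h : A -> B).

Record fhom : Prop := FHom {
  fh_lin : linear h;
  fh_mul : forall a b, h (a ** b) = h a ** h b;
  fh_br : forall a b, h {[a, b]} = {[h a, h b]} }.

Hypothesis hh : fhom.
Let h0 := lin0 (fh_lin hh).
Let hD := linD (fh_lin hh).

Definition hpair (c : A * A) : B * B := (h c.1, h c.2).

Lemma hpairD c d : hpair (c + d) = hpair c + hpair d.
Proof. by rewrite /hpair !hD. Qed.

Lemma hpair0 : hpair 0 = 0.
Proof. by rewrite /hpair !h0. Qed.

Lemma h_ad xs p : h (ad xs p) = ad (map h xs) (h p).
Proof. by elim: xs => [//|x xs IHxs] /=; rewrite (fh_br hh) IHxs. Qed.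

Lemma h_kap xs ps : h (kap xs ps) = kap (map h xs) (map h ps).
Proof.
case/lastP: ps => [|ps p]; first by rewrite /= h0.
by rewrite map_rcons !kap_rcons h_ad map_cat.
Qed.

Lemma h_prods ys : h (prods ys) = prods (map h ys).
Proof.
elim: ys => [|y ys IHys]; first exact: h0.
case: ys IHys => [//|z ys] IHys.
by rewrite !map_cons !prods_cons -map_cons -IHys (fh_mul hh).
Qed.

Lemma h_psi ys : hpair (psi ys) = psi (map h ys).
Proof.
have [|ys1] := eqVneq (size ys) 1%N.
  by case: ys => [|y [|z ys]] //= _; rewrite /hpair h0.
by rewrite !psiE ?size_map // /hpair h0 h_prods.
Qed.

Lemma h_der l (g : seq A -> A * A) (g' : seq B -> B * B) ys :
  (forall s, hpair (g s) = g' (map h s)) ->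
  hpair (der l g ys) = der (h l) g' (map h ys).
Proof.
elim: ys g g' => [|y ys IHys] g g' gg' /=; first exact: hpair0.
rewrite hpairD gg' /= (fh_br hh); congr (_ + _).
by apply: IHys => s; rewrite gg'.
Qed.

Lemma h_Dd l ys : hpair (Dd l ys) = Dd (h l) (map h ys).
Proof. by rewrite /Dd hpairD h_psi; congr (_ + _); apply: h_der => s; apply: h_psi. Qed.

Lemma h_node1 xs cs : hpair (node1 xs cs) = node1 (map h xs) (map hpair cs).
Proof.
case: cs => [|c cs]; first exact: h_psi.
have fstE s : map fst (map hpair s) = map h (map fst s) by rewrite -!map_comp.
have sndE s : map snd (map hpair s) = map h (map snd s) by rewrite -!map_comp.
rewrite /node1 [map hpair (c :: cs)]/= -[hpair c :: _]/(map hpair (c :: cs)).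
rewrite hpairD (big_morph _ hpairD hpair0) size_map; congr (_ + _).
  by rewrite /hpair h0 h_ad h_prods fstE.
by apply: eq_bigr => i _; rewrite h_Dd h_kap -map_take -map_drop fstE sndE.
Qed.

Lemma h_node xs cs : hpair (node xs cs) = node (map h xs) (map hpair cs).
Proof.
rewrite /node order_sum_map (order_sum_morph (g := hpair)); last exact: hpairD.
apply: order_sum_ext => xs'; rewrite order_sum_map (order_sum_morph (g := hpair)).
  by apply: order_sum_ext => cs'; apply: h_node1.
exact: hpairD.
Qed.
End Hom.

Lemma node_perm (k : fieldType) (A : falg k) (xs xs' : seq A) cs cs' :
  perm_eq xs xs' -> perm_eq cs cs' -> node xs cs = node xs' cs'.
Proof.
move=> xs_ cs_; rewrite /node (order_sum_perm _ xs_).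
by apply: order_sum_ext => s; apply: order_sum_perm.
Qed.

Section TreeValue.
Variables (k : fieldType) (A : falg k).

Section Fix.
Variables (V : finType) (p : V -> option V) (l : V -> seq A).

(** [d] bounds the depth of the recursion. In a rooted tree the value #|V| is enough, since no path
    repeats a vertex. *)
Fixpoint subtree_value (d : nat) (v : V) : A * A :=
  if d is d'.+1 then
    node (l v) [seq subtree_value d' c | c <- enum V & p c == Some v]
  else 0.

Definition tree_value : A := \sum_(r | p r == None)
  ((subtree_value #|V| r).1 + (subtree_value #|V| r).2).
End Fix.

Lemma subtree_value_equiv (V V' : finType) (e : equiv V V') p p' l l' d v :
  (forall v, p' (e v) = omap e (p v)) ->
  (forall v, perm_eq (l' (e v)) (l v)) ->
  subtree_value p' l' d (e v) = subtree_value p l d v.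
Proof.
move=> pe le; elim: d v => [//|d IHd] v /=; apply: node_perm => //.
rewrite -(eq_map (f := fun c => subtree_value p' l' d (e c))) //.
rewrite (map_comp (subtree_value p' l' d) e); apply: perm_map.
apply: uniq_perm.
- exact/filter_uniq/enum_uniq.
- rewrite map_inj_uniq; last exact: efun_inj.
  exact/filter_uniq/enum_uniq.
move=> w; rewrite mem_filter mem_enum andbT -[w](einvK e).
rewrite mem_map; last exact: efun_inj.
rewrite mem_filter mem_enum andbT pe; case: (p _) => //= u.
by rewrite !(inj_eq Some_inj) (inj_eq (@efun_inj _ _ e)).
Qed.

Lemma tree_value_equiv (V V' : finType) (e : equiv V V') p p' l l' :
  (forall v, p' (e v) = omap e (p v)) ->
  (forall v, perm_eq (l' (e v)) (l v)) ->
  tree_value p' l' = tree_value p l.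
Proof.
move=> pe le; rewrite /tree_value -(equiv_card e).
rewrite (reindex e) /=; last first.
  by apply: onW_bij; exists (einv e); [apply: efunK|apply: einvK].
apply: eq_big => [v|v _]; first by rewrite pe; case: (p v).
by rewrite (subtree_value_equiv _ _ pe le).
Qed.
End TreeValue.

Lemma h_subtree_value (k : fieldType) (A B : falg k) (h : A -> B) (V : finType) p
    (l : V -> seq A) d v : fhom h ->
  hpair h (subtree_value p l d v) = subtree_value p (fun w => map h (l w)) d v.
Proof.
move=> hh; elim: d v => [|d IHd] v /=; first exact: hpair0.
by rewrite h_node // -map_comp; congr (node _ _); apply: eq_map => c /=.
Qed.

Lemma h_tree_value (k : fieldType) (A B : falg k) (h : A -> B) (V : finType) p
    (l : V -> seq A) : fhom h ->
  h (tree_value p l) = tree_value p (fun w => map h (l w)).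
Proof.
move=> hh; rewrite /tree_value (big_morph h (linD (fh_lin hh)) (lin0 (fh_lin hh))).
by apply: eq_bigr => r _; rewrite (linD (fh_lin hh)) -h_subtree_value.
Qed.

(* The free algebra galg I maps to galg J by sending the variable i to any
   homogeneous x i; letters with overlapping degrees multiply to zero. *)
Section Substitution.
Variables (k : fieldType) (R : presentation k) (I J : finType).
Variables (D : I -> {set J}) (x : I -> galg R J).
Hypotheses (xD : forall i, homog (D i) (x i)) (D0 : forall i, D i != set0).

Definition gsub (a : galg R I) : galg R J := \sum_A eval x (a A).

Lemma gsub_linear : linear gsub.
Proof.
move=> c a b; rewrite /gsub scaler_sumr -big_split /=; apply: eq_bigr => A _.
exact: (eval_linear x c (a A) (b A)).
Qed.

Lemma gsub_hcls A t : multilinear A t ->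
  gsub (hcls A t : galg R I) = interp (@rop _ _ (galg R J)) x t.
Proof.
move=> At; rewrite /gsub (bigD1 A) //= big1 => [|B BA].
  by rewrite /hcls eqxx (clsE At) eval_class addr0.
by rewrite hcls_homog //; apply: (lin0 (eval_linear x (A := B))).
Qed.

(** The case to check is that of overlapping degrees, where the product is 0: the images overlap as
    well, because every [D i] is nonempty. *)
Lemma gsub_op o (a b : galg R I) :
  gsub (rop o a b) = rop o (gsub a) (gsub b).
Proof.
have [ll lr] := (@rop_linl _ _ (galg R J), @rop_linr _ _ (galg R J)).
have [ll' lr'] := (@rop_linl _ _ (galg R I), @rop_linr _ _ (galg R I)).
have ls := gsub_linear.
rewrite [a]hcls_sum; elim: (index_enum _) => [|A r IHr].
  by rewrite big_nil (lin0 (ll' o b)) (lin0 ls) (lin0 (ll o _)).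
rewrite big_cons (linD (ll' o b)) !(linD ls) (linD (ll o _)) IHr; congr (_ + _).
rewrite [b]hcls_sum; elim: (index_enum _) => [|B r' IHr'].
  by rewrite big_nil (lin0 (lr' o _)) (lin0 ls) (lin0 (lr o _)).
rewrite big_cons (linD (lr' o _)) !(linD ls) (linD (lr o _)) IHr'; congr (_ + _).
have [mA mB] := (mrepr_ml (a A), mrepr_ml (b B)).
rewrite !gsub_hcls //; have [AB|AB] := boolP [disjoint A & B].
  by rewrite [rop o _ _]gop_hcls // gsub_hcls //; apply: ml_op.
have -> : rop o (hcls A (mrepr (a A)) : galg R I) (hcls B (mrepr (b B)) : galg R I) = 0.
  by apply: (@gop_overlap _ _ _ o A B) => //; apply: hcls_homog.
rewrite (lin0 ls) [RHS](gop_overlap o (interp_homog xD mA) (interp_homog xD mB)) //.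
rewrite -setI_eq0 in AB; have [i] := set0Pn _ AB; rewrite inE => /andP[iA iB].
have [j ij] := set0Pn _ (D0 i).
rewrite -setI_eq0; apply/set0Pn; exists j; rewrite inE.
by apply/andP; split; apply/bigcupP; exists i.
Qed.
End Substitution.

Lemma gsub_hom (k : fieldType) (I J : finType) (D : I -> {set J})
    (x : I -> galg (FMan_presentation k) J) :
  (forall i, homog (D i) (x i)) -> (forall i, D i != set0) ->
  @fhom k (falg_of (galg _ I)) (falg_of (galg _ J)) (gsub x).
Proof.
move=> xD D0; split; first exact: gsub_linear.
  exact: (gsub_op xD D0 (FMan_product : pr_ops (FMan_presentation k))).
exact: (gsub_op xD D0 (FMan_bracket : pr_ops (FMan_presentation k))).
Qed.

Section FiberSum.
Variables (I J : finType) (f : J -> I).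
Let fw (s : fin_sum (fiber f)) : J := sval (tagged s).
Let bw (j : J) : fin_sum (fiber f) :=
  existT (fun i => fiber f i : Type) (f j) (exist _ j (eqxx _)).
Let fwK : cancel fw bw.
Proof.
case=> i [j ji]; have fji := eqP ji; rewrite /fw /bw /=.
by case: i / fji ji => ji; congr (existT _ _ _); apply: val_inj.
Qed.
Let bwK : cancel bw fw. Proof. by []. Qed.
Definition fiber_sum_equiv : equiv (fin_sum (fiber f)) J := Equiv fwK bwK.
End FiberSum.

(** * Extension of a map of species to the free right module *)

Section Extension.
Variables (k : fieldType) (X : species k) (P : operad k) (M : right_module P).
Variable phi : forall I : finType, X I -> M I.
Arguments phi {I}.
Hypothesis phi_linear : forall I, linear (@phi I).
Hypothesis phi_natural : forall (I J : finType) (e : equiv I J) x,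
  phi (sp_map e x) = sp_map e (phi x).

Let Mlaws := rm_axioms M.

Definition ext_gen (J : finType) (g : cgen X P J) : M J :=
  sp_map (fiber_sum_equiv (cg_f g)) (rm_act (phi (cg_x g)) (@cg_y _ _ _ _ g)).

Lemma ext_gen_rel J u v : @crel k X P J u v ->
  leval (@ext_gen J) u = leval (@ext_gen J) v.
Proof.
apply: comp_lift_rel => [n f y a x x'|n f x y i a u1 u2|n f s x y y' yy'];
  rewrite /ext_gen /=.
- by rewrite phi_linear (act_linear_l Mlaws) sp_linear.
- by rewrite (act_linear_r Mlaws) sp_linear.
pose F i : equiv (fiber f i) (fiber (s \o f) (s i)) :=
  sub_equiv (@perm_fiber J n f s i).
pose E : equiv (fin_sum (fiber f)) (fin_sum (fiber (s \o f))) :=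
  equiv_comp (equiv_inv (fiber_sum_equiv (s \o f))) (fiber_sum_equiv f).
have E1 t : fiber_sum_equiv (s \o f) (E t) = fiber_sum_equiv f t.
  exact: (einvK (fiber_sum_equiv (s \o f))).
rewrite phi_natural -(act_natural Mlaws (e := s) (f := F) (E := E) _ _ yy').
  by rewrite -sp_map_comp; apply: sp_map_eq => t; apply/esym/E1.
move=> i j; apply: (@efun_inj _ _ (fiber_sum_equiv (s \o f))).
exact: E1.
Qed.

Definition extension (J : finType) : free_module X P J -> M J :=
  plift (@ext_gen J).

Lemma extension_linear J : linear (@extension J).
Proof. exact: plift_linear (@ext_gen_rel J). Qed.

Lemma extension_cpgen (J : finType) n (f : J -> 'I_n) x y :
  extension (@cpgen k X P J n f x y) =
  sp_map (fiber_sum_equiv f) (rm_act (phi x) y).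
Proof. exact: (plift_gen (@ext_gen_rel J)). Qed.

Lemma extension_natural (I J : finType) (e : equiv I J) x :
  extension (sp_map e x) = sp_map e (extension x).
Proof.
move: x; apply: pext.
- by move=> a u v; rewrite (sp_linear (s := free_module X P)) extension_linear.
- by move=> a u v; rewrite extension_linear sp_linear.
case=> n f x y; rewrite -/(cpgen _ _) /= comp_map_cpgen !extension_cpgen.
pose F i : equiv (fiber f i) (fiber (f \o einv e) i) :=
  sub_equiv (map_fiber e f i).
pose E : equiv (fin_sum (fiber f)) (fin_sum (fiber (f \o einv e))) :=
  equiv_comp (equiv_inv (fiber_sum_equiv (f \o einv e)))
    (equiv_comp e (fiber_sum_equiv f)).
have E1 (t : fin_sum (fiber f)) :
    fiber_sum_equiv (f \o einv e) (E t) = e (fiber_sum_equiv f t).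
  exact: (einvK (fiber_sum_equiv (f \o einv e))).
rewrite -[X in rm_act X _](@sp_id k M _ (equiv_id 'I_n)) //.
have yy i : sp_map (F i) (y i) = sp_map (F i) (y i) by [].
rewrite -(act_natural Mlaws (e := equiv_id 'I_n) (f := F) (E := E) _ _ yy).
  by rewrite -!sp_map_comp; apply: sp_map_eq => t; apply: E1.
move=> i j; apply: (@efun_inj _ _ (fiber_sum_equiv (f \o einv e))).
exact: E1.
Qed.

(** Both sides are the same composition up to bijections: [E3] reassociates the disjoint unions, and
    [E2] replaces the index set [fin_sum (fiber f)] by [J]. *)
Lemma extension_act (J : finType) (L : J -> finType) (x : free_module X P J)
    (p : forall j, P (L j)) :
  extension (rm_act x p) = rm_act (extension x) p.
Proof.
move: x; apply: pext.
- by move=> a u v; rewrite [rm_act _ _](free_act_linear_l p) extension_linear.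
- by move=> a u v; rewrite extension_linear (act_linear_l Mlaws p).
case=> n f x y; rewrite -/(cpgen _ _) /= free_act_cpgen !extension_cpgen.
set fL := fun t : fin_sum L => f (tag t).
pose Lf (i : 'I_n) (j : fiber f i) := L (sval j).
pose q i := op_gamma (y i) (fun j => p (sval j)).
pose E := fiber_sum_equiv f; pose EL := fiber_sum_equiv fL.
pose E2fw (s : fin_sum (fun s => L (E s))) : fin_sum L :=
  existT (fun j => L j : Type) (E (tag s)) (tagged s).
pose E2bw (t : fin_sum L) : fin_sum (fun s => L (E s)) :=
  existT (fun s => L (E s) : Type) (einv E (tag t)) (tagged t).
have E2K : cancel E2fw E2bw.
  case=> -[i [j ji]] l; have fji := eqP ji; rewrite /E2fw /E2bw /=.
  case: i / fji ji l => ji l; rewrite /E /=.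
  by rewrite (eq_irrelevance (eqxx (f j)) ji).
have E2bK : cancel E2bw E2fw by case.
pose E2 := Equiv E2K E2bK.
pose E3 := sum_assoc_equiv Lf.
have -> : rm_act (sp_map E (rm_act (phi x) y)) p =
    sp_map E2 (sp_map E3 (rm_act (phi x) q)).
  rewrite -(act_assoc Mlaws (E := E3) _ (phi x) y (fun i j => p (sval j))) //.
  have pp s : p (E s) = sp_map (equiv_id (L (E s))) (p (E s)) by rewrite sp_id.
  by rewrite -(act_natural Mlaws (E := E2) _ _ pp).
pose E4 := equiv_comp (equiv_inv EL) (equiv_comp E2 E3).
have E4K t : EL (E4 t) = E2 (E3 t) by exact: (einvK EL).
rewrite -[X in rm_act X _](@sp_id k M _ (equiv_id 'I_n)) //.
have qq i : act_y y p i = sp_map (tag_fiber L f i) (q i) by [].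
rewrite -(act_natural Mlaws (e := equiv_id 'I_n) (E := E4) _ _ qq).
  rewrite -!sp_map_comp; apply: sp_map_eq => t; exact: E4K.
by move=> i [j l]; apply: (@efun_inj _ _ EL); rewrite E4K.
Qed.
End Extension.

(** * The map from the free module *)

Section TreeMap.
Variable k : fieldType.
Local Notation FP := (FMan_presentation k).
Local Notation gal I := (falg_of (galg FP I)).

(** For [Com] this is the only coordinate, and 0 on the empty set: a vertex without letters makes
    the whole tree vanish. *)
Definition weight (S : set_species) (I : finType) (y : linearize k S I) : k :=
  \sum_(u : S I) (y : {ffun S I -> k^o}) u.

Lemma weight_map (S : set_species) (I J : finType) (e : equiv I J)
    (y : linearize k S I) :
  weight (sp_map e y) = weight y.
Proof.
rewrite /weight [RHS](partition_big (ss_map e) xpredT) //=.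
by apply: eq_bigr => t _; rewrite ffunE.
Qed.

Lemma weight_linear (S : set_species) (I : finType) :
  linear (@weight S I : linearize k S I -> k^o).
Proof.
move=> a x y; rewrite /weight scaler_sumr -big_split; apply: eq_bigr => u _.
by rewrite !ffunE.
Qed.

Definition block_letters (I V : finType) (f : I -> V) (v : V) : seq (gal I) :=
  [seq (gvar FP i : gal I) | i <- enum I & f i == v].

Definition tree_elt (I V : finType) (f : I -> V) (p : V -> option V) : FMan k I :=
  (tree_value (A := gal I) p (block_letters f) : gspace FP I) setT.

Lemma tree_elt_equiv (I V V' : finType) (e : equiv V V') (f : I -> V) p p' :
  (forall v, p' (e v) = omap e (p v)) ->
  tree_elt (e \o f) p' = tree_elt f p.
Proof.
move=> pe; rewrite /tree_elt.
rewrite (tree_value_equiv (l := block_letters f) pe) // => v; rewrite /block_letters.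
have -> // : [seq i <- enum I | (e \o f) i == e v] = [seq i <- enum I | f i == v].
by apply: eq_filter => i /=; rewrite (inj_eq (@efun_inj _ _ e)).
Qed.

Section GSub.
Variables (I J : finType) (D : I -> {set J}) (x : I -> galg FP J).
Hypotheses (xD : forall i, homog (D i) (x i)) (D0 : forall i, D i != set0).
Hypothesis disjD : forall i j, i != j -> [disjoint D i & D j].

(** A component of degree [A] goes to the union of the [D i] for [i] in [A]; as the [D i] are
    disjoint and nonempty, only the full set can reach [setT]. *)
Lemma gsub_setT (a : galg FP I) :
  (gsub x a : gspace FP J) setT = (eval x (a setT) : gspace FP J) setT.
Proof.
rewrite /gsub gcomp_sum (bigD1 setT) //= big1 ?addr0 // => A AT.
apply: (interp_homog xD (mrepr_ml (a A))); apply: contra AT => /eqP AE.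
rewrite eqEsubset subsetT /=; apply/subsetP=> i _.
have [j ij] := set0Pn _ (D0 i).
have: j \in \bigcup_(i in A) D i by rewrite -AE.
case/bigcupP=> i' i'A ji'; have [->//|ii'] := eqVneq i i'.
by move: (disjointFr (disjD ii') ij); rewrite ji'.
Qed.

Lemma gsub_gvar i : gsub x (gvar FP i) = x i.
Proof. by rewrite gsub_hcls //; apply: ml_var. Qed.
End GSub.

Lemma interp_gvar_setT (J : finType) t (Jt : multilinear [set: J] t) :
  (interp (@gop k FP J) (gvar FP) t) setT = @mclass k FP J setT t Jt.
Proof. by rewrite (interp_gvar Jt) /hcls eqxx (clsE Jt). Qed.

Lemma FMan_map_eval (I J : finType) (e : equiv I J) (c : FMan k I) :
  sp_map e c = (@eval k FP (galg FP J) I (fun i => gvar FP (e i)) setT c : gspace FP J) setT.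
Proof.
elim/mclass_ind: c => t It; rewrite /= pr_mapE eval_class.
by rewrite -interp_gvar_setT /erelabel interp_bind.
Qed.

Lemma tree_elt_natural (I J V : finType) (e : equiv I J) (f : I -> V) p :
  sp_map e (tree_elt f p) = tree_elt (f \o einv e) p.
Proof.
rewrite FMan_map_eval /tree_elt.
have xD i : homog [set e i] (gvar FP (e i)) by apply: gvar_homog.
have D0 i : [set e i] != set0 by apply/set0Pn; exists (e i); rewrite inE.
have disjD i j : i != j -> [disjoint [set e i] & [set e j]].
  by move=> ij; rewrite disjoints1 inE (inj_eq (@efun_inj _ _ e)).
pose h : gal I -> gal J := gsub (fun i => gvar FP (e i)).
rewrite -(gsub_setT xD D0 disjD) (h_tree_value _ _ (gsub_hom xD D0)).
rewrite -(tree_value_equiv (e := equiv_id V) (p := p) (p' := p)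
  (l := fun v => map h (block_letters f v))
  (l' := block_letters (f \o einv e))) // => [v|v].
  by case: (p v).
rewrite perm_sym /block_letters -map_comp.
rewrite (eq_map (g := (gvar FP : J -> gal J) \o e)); last first.
  by move=> i /=; rewrite /h gsub_gvar.
rewrite map_comp; apply: perm_map; apply: uniq_perm.
- rewrite map_inj_uniq; last exact: efun_inj.
  exact/filter_uniq/enum_uniq.
- exact/filter_uniq/enum_uniq.
move=> j; rewrite -[j](einvK e) mem_map; last exact: efun_inj.
by rewrite !mem_filter /= efunK -!enumT !mem_enum.
Qed.

Definition tree_gen (I : finType) (g : cgen (RTn1 k) (Com k) I) : FMan k I :=
  (\prod_v weight (@cg_y _ _ _ _ g v)) *:
  \sum_(t : RTn1_ob 'I_(cg_n g))
    (cg_x g : {ffun RTn1_ob 'I_(cg_n g) -> k^o}) t *: tree_elt (cg_f g) (sval t).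

Lemma tree_gen_rel (I : finType) u v : @crel k (RTn1 k) (Com k) I u v ->
  leval (@tree_gen I) u = leval (@tree_gen I) v.
Proof.
apply: comp_lift_rel => [n f y a x x'|n f x y i a u1 u2|n f s x y y' yy'];
  rewrite /tree_gen /=.
- rewrite scalerA mulrC -scalerA -scalerDr; congr (_ *: _).
  rewrite scaler_sumr -big_split; apply: eq_bigr => t _.
  by rewrite !ffunE scalerDl -scalerA.
- rewrite scalerA -scalerDl; congr (_ *: _).
  have dfE (w : Com k (fiber f i)) : \prod_j weight (dfwith y w j) =
      weight w * \prod_(j | j != i) weight (y j).
    rewrite (bigD1 i) //= dfwith_in; congr (_ * _).
    by apply: eq_bigr => j ji; rewrite dfwith_out // eq_sym.
  by rewrite !dfE (weight_linear a u1 u2) mulrDl mulrA.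
congr (_ *: _).
  rewrite [RHS](reindex s) /=; last first.
    by apply: onW_bij; exists (einv s); [apply: efunK|apply: einvK].
  by apply: eq_bigr => i _; rewrite yy' weight_map.
rewrite (partition_big (ss_map (s := RTn1_species) s) xpredT) //=.
apply: eq_bigr => t' _; rewrite ffunE scaler_suml; apply: eq_bigr => t /eqP <-.
congr (_ *: _); apply/esym/tree_elt_equiv => w.
by rewrite /= ffunE efunK.
Qed.

Definition tree_map (I : finType) : comp_species (RTn1 k) (Com k) I -> FMan k I :=
  plift (@tree_gen I).

Lemma tree_map_linear I : linear (@tree_map I).
Proof. exact: plift_linear (@tree_gen_rel I). Qed.

Lemma tree_map_cpgen (I : finType) n (f : I -> 'I_n) x y :
  tree_map (@cpgen k (RTn1 k) (Com k) I n f x y) = tree_gen (CGen x y).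
Proof. exact: (plift_gen (@tree_gen_rel I)). Qed.

Lemma tree_map_natural (I J : finType) (e : equiv I J) x :
  tree_map (sp_map e x) = sp_map e (tree_map x).
Proof.
move: x; apply: pext.
- by move=> a u v; rewrite (sp_linear (s := comp_species _ _)) tree_map_linear.
- by move=> a u v; rewrite tree_map_linear sp_linear.
case=> n f x y; rewrite -/(cpgen _ _) [sp_map e _]comp_map_cpgen !tree_map_cpgen.
have eL := sp_linear (s := FMan k) e.
rewrite /tree_gen [RHS](linZ eL); congr (_ *: _).
  by apply: eq_bigr => v _; apply: weight_map.
rewrite (big_morph (sp_map e) (linD eL) (lin0 eL)).
by apply: eq_bigr => t _; rewrite (linZ eL) tree_elt_natural.
Qed.

Definition Phi := @extension k (comp_species (RTn1 k) (Com k)) (Lie k)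
  (FMan_Lie_module k) tree_map.

Lemma Phi_linear J : linear (@Phi J).
Proof.
by apply: extension_linear; [exact: tree_map_linear|exact: tree_map_natural].
Qed.

Lemma Phi_natural (I J : finType) (e : equiv I J) x :
  Phi (sp_map e x) = sp_map e (Phi x).
Proof.
by apply: extension_natural; [exact: tree_map_linear|exact: tree_map_natural].
Qed.

Lemma Phi_act (J : finType) (L : J -> finType)
    (x : free_module (comp_species (RTn1 k) (Com k)) (Lie k) J)
    (p : forall j, Lie k (L j)) :
  Phi (rm_act x p) = rm_act (Phi x) p.
Proof.
by apply: extension_act; [exact: tree_map_linear|exact: tree_map_natural].
Qed.

Definition lie_value (J K : finType) (h : K -> J) (y : Lie k K) : galg FP J :=
  @eval k FP (galg FP J) K (fun j => gvar FP (h j)) setT (Lie_to_FMan k K y).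

Lemma lie_value_homog (J K : finType) (h : K -> J) (y : Lie k K) :
  homog (h @: setT) (lie_value h y).
Proof.
rewrite -(@bigcup_singletons K J h) /lie_value /eval.
by apply: interp_homog (mrepr_ml _) => j; apply: gvar_homog.
Qed.

Definition tree_delta (n : nat) (t : RTn1_ob 'I_n) : RTn1 k 'I_n :=
  [ffun t' => (t' == t)%:R].

(** The action of [Lie] substitutes Lie elements for the variables of the tree; since [gsub] is a
    homomorphism, the substitution may be done in the letters before the tree is evaluated.
    Surjectivity of [f] makes the degrees nonempty. *)
Lemma Phi_tree (J : finType) n (f : J -> 'I_n) m (f' : 'I_n -> 'I_m) t
    (z : forall i, Com k (fiber f' i)) (y : forall i, Lie k (fiber f i)) :
  (forall i, exists j, f j = i) ->
  Phi (cpgen (X := comp_species (RTn1 k) (Com k)) (cpgen (tree_delta t) z) y) =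
  (\prod_v weight (z v)) *:
    (tree_value (A := gal J) (sval t) (fun v => [seq lie_value (fun j => sval j) (y i)
      | i <- enum 'I_n & f' i == v]) : gspace FP J) setT.
Proof.
move=> fsurj; have [tL tN] := (tree_map_linear, tree_map_natural).
rewrite /Phi (@extension_cpgen _ _ _ (FMan_Lie_module k) _ tL tN).
pose a := \prod_v weight (z v); pose c := tree_elt f' (sval t).
have -> : tree_map (cpgen (tree_delta t) z) = a *: c.
  rewrite tree_map_cpgen /tree_gen /=; congr (_ *: _).
  rewrite (bigD1 t) //= big1 ?addr0 => [|t' tt'].
    by rewrite ffunE eqxx scale1r.
  by rewrite ffunE (negPf tt') scale0r.
rewrite (linZ (act_linear_l (rm_axioms (FMan_Lie_module k)) y)).
rewrite (linZ (sp_linear (s := FMan k) (fiber_sum_equiv f))).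
congr (_ *: _).
pose x (i : 'I_n) : galg FP J := lie_value (fun j : fiber f i => sval j) (y i).
have -> : sp_map (s := FMan k) (fiber_sum_equiv f) (rm_act (r := FMan_Lie_module k) c y) =
    (eval x c : gspace FP J) setT.
  elim/mclass_ind: (c) => u Iu.
  rewrite /= /pullback_act /= pr_gammaE' pr_mapE eval_class -interp_gvar_setT.
  rewrite /erelabel /esubst !interp_bind; congr ((_ : gspace FP J) setT).
  by apply: interp_ext => i; rewrite /= /erelabel !interp_bind.
have xD i : homog [set j | f j == i] (x i).
  have -> : [set j | f j == i] = [set sval j | j in [set: fiber f i]].
    apply/setP=> j; rewrite inE; apply/idP/imsetP => [ji|[j' _ ->]].
      by exists (exist _ j ji).
    exact: (svalP j').
  exact: lie_value_homog.
have D0 i : [set j | f j == i] != set0.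
  by have [j fj] := fsurj i; apply/set0Pn; exists j; rewrite inE fj.
have disjD i j : i != j -> [disjoint [set j' | f j' == i] & [set j' | f j' == j]].
  move=> ij; apply/pred0P=> j' /=; rewrite !inE; apply: contra_neqF ij.
  by move=> /andP[/eqP <- /eqP <-].
rewrite -(gsub_setT xD D0 disjD) /c /tree_elt (h_tree_value _ _ (gsub_hom xD D0)).
suff -> : (fun v => map (gsub x : gal 'I_n -> gal J) (block_letters f' v)) =
  (fun v => [seq lie_value (fun j : fiber f i => sval j) (y i) : gal J
    | i <- enum 'I_n & f' i == v]) by [].
apply/funext=> v; rewrite /block_letters -map_comp; apply: eq_map => i /=.
by rewrite gsub_gvar.
Qed.
End TreeMap.

(** * Multilinearity of the vertex operations *)

Section NodeMultilinear.
Variables (k : fieldType) (A : falg k).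

Lemma der_mlin (V : lmodType k) (l : A) (h : seq A -> V) :
  mlin h -> mlin (der l h).
Proof.
move=> hl s; elim: s h hl => [|y s IHs] h hl a u v t /=.
  rewrite fbr_lin (hl [::]) /=.
  rewrite (@der_ext _ _ _ _ _ (fun r => a *: h (u :: r) + h (v :: r))).
    by rewrite derZD scalerDr addrACA.
  by move=> r; apply: (hl [::]).
rewrite (hl (_ :: s)) /= IHs ?scalerDr 1?addrACA // => s' *.
exact: (hl (y :: s')).
Qed.

Lemma Dd_mlin (l : A) : mlin (Dd l).
Proof.
move=> s a u v t; rewrite /Dd (psi_mlin (l :: s)) (der_mlin l (@psi_mlin _ A)).
by rewrite scalerDr addrACA.
Qed.

Lemma insert_sum_mlin (V W : lmodType k) (h : seq W -> V) t :
  mlin h -> linear (fun x => insert_sum x h t).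
Proof.
elim: t h => [|z t IHt] h hl a u v /=; first exact: (hl [::] a u v [::]).
rewrite (hl [::]) IHt ?scalerDr 1?addrACA // => s' *.
exact: (hl (z :: s')).
Qed.

Lemma order_sum_mlin (V W : lmodType k) (h : seq W -> V) :
  mlin h -> mlin (fun s => order_sum s h).
Proof.
move=> hl s a u v t; rewrite !order_sum_move /= -order_sum_lin.
by apply: order_sum_ext => r; apply: insert_sum_mlin.
Qed.

Lemma map_mlin (V W U : lmodType k) (g : U -> W) (h : seq W -> V) :
  linear g -> mlin h -> mlin (fun s => h (map g s)).
Proof. by move=> gl hl s a u v t; rewrite !map_cat /= gl hl. Qed.

Lemma fst_linear : linear (fst : A * A -> A). Proof. by []. Qed.
Lemma snd_linear : linear (snd : A * A -> A). Proof. by []. Qed.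

(** Each child enters each summand exactly once, by its second component before the cut and by its
    first one after it. *)
Lemma node1_mlin (xs : seq A) : mlin (node1 xs).
Proof.
have nodeE cs : cs != [::] -> node1 xs cs =
    (ad xs (prods (map fst cs)), 0) + \sum_(i < size cs)
      Dd (kap xs (map snd (take i.+1 cs))) (map fst (drop i.+1 cs)).
  by case: cs.
move=> s a u v t; rewrite !nodeE; try by case: (s).
rewrite !size_cat /= scalerDr addrACA; congr (_ + _).
  rewrite pairZD scaler0 addr0; congr (_, _).
  by rewrite (map_mlin fst_linear (@prods_mlin _ A)) ad_lin.
rewrite scaler_sumr -big_split /=; apply: eq_bigr => i _.
rewrite !take_cat !drop_cat; have [lt_is|le_si] := ltnP i.+1 (size s).
  exact: map_mlin fst_linear (Dd_mlin _) (drop i.+1 s) a u v t.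
case: (i.+1 - size s)%N => [|d].
  rewrite !take0 !drop0 !cats0.
  exact: map_mlin fst_linear (Dd_mlin _) [::] a u v t.
rewrite /= (map_mlin snd_linear (@kap_mlinr _ A xs)).
exact: (@Dd_linear _ A (map fst (drop d t))).
Qed.

Lemma node_mlin (xs : seq A) : mlin (node xs).
Proof.
move=> s a u v t; rewrite /node -order_sum_lin; apply: order_sum_ext => xs'.
exact: (order_sum_mlin (@node1_mlin xs')).
Qed.

Lemma node_0r (xs : seq A) cs : 0 \in cs -> node xs cs = 0.
Proof. by case/path.splitPr=> s t; apply: lin0 (mlin_at s t (@node_mlin xs)). Qed.

Lemma node_0l (xs : seq A) cs : 0 \in xs -> node xs cs = 0.
Proof.
move=> xs0; apply: (order_sum_sub (zero_subspace _)) => xs' /perm_mem xs'E.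
have {xs0 xs'E} xs0 : 0 \in xs' by rewrite xs'E.
have ad0 ps p : ad (ps ++ xs') p = 0.
  have : 0 \in ps ++ xs' by rewrite mem_cat xs0 orbT.
  by case/path.splitPr=> s t; apply: lin0 (mlin_at s t (@ad_mlin _ _ p)).
apply: (order_sum_sub (zero_subspace _)) => -[|c cs'] _.
  exact: mlin0 (@psi_mlin _ _) xs0.
rewrite /node1 (ad0 [::]) add0r big1 // => i _.
by rewrite [map snd _]/= lastI kap_rcons ad0 Dd0.
Qed.
End NodeMultilinear.

Lemma mlin_lspan (k : nzRingType) (U V : lmodType k) (h : seq U -> V)
    (S : U -> Prop) (W : V -> Prop) cs :
  mlin h -> subspace W ->
  (forall cs', size cs' = size cs -> (forall c, c \in cs' -> S c) -> W (h cs')) ->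
  (forall c, c \in cs -> lspan S c) -> W (h cs).
Proof.
move=> hl subW WS St.
suff cat_mem t : forall s, size (s ++ t) = size cs -> (forall c, c \in s -> S c) ->
    (forall c, c \in t -> lspan S c) -> W (h (s ++ t)).
  by apply: (cat_mem cs [::]).
elim: t {St} => [|u t IHt] s sE Ss St; first by rewrite cats0 in sE *; apply: WS.
have {}IHt v : S v -> W (h (s ++ v :: t)).
  move=> Sv; rewrite -cat_rcons; apply: IHt.
  - by rewrite cat_rcons size_cat /= -sE size_cat.
  - by move=> c; rewrite mem_rcons inE => /orP[/eqP ->|/Ss].
  - by move=> c ct; apply: St; rewrite inE ct orbT.
elim: (St u (mem_head _ _)) => {St sE u} [u /IHt //||u v _ Wu _ Wv|a u _ Wu].
- by rewrite (lin0 (mlin_at s t hl)); apply: sub0.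
- by rewrite (linD (mlin_at s t hl)); apply: subD.
- by rewrite (linZ (mlin_at s t hl)); apply: subZ.
Qed.

Lemma rooted_tree_unique (V : finType) (p : {ffun V -> option V}) r v :
  is_rooted_tree p -> p r = None -> connect (fun u w => p u == Some w) v r.
Proof.
case/existsP=> r' /andP[_ /forallP conn] pr.
suff -> : r = r' by apply: conn.
have /connectP[[|w s] /=] := conn r; first by [].
by rewrite pr.
Qed.

(** * Surjectivity *)

Section TreeData.
Variables (k : fieldType) (A : falg k) (letter : A -> Prop).

Record tree_data := TreeData {
  td_V : finType;
  td_p : {ffun td_V -> option td_V};
  td_r : td_V;
  td_l : td_V -> seq A;
  td_RTn1 : is_RTn1 td_p;
  td_root : td_p td_r = None;
  td_ne : forall v, td_l v != [::];
  td_letter : forall v x, x \in td_l v -> letter x }.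

Definition td_value (t : tree_data) (d : nat) : A * A :=
  subtree_value (td_p t) (td_l (t := t)) d (td_r t).

(** A subtree of a grafted tree is evaluated with the depth bound of the larger tree, so its value
    has to be the same for all large bounds. *)
Definition td_stable (t : tree_data) (c : A * A) :=
  forall d, (#|td_V t| <= d)%N -> td_value t d = c.

Section Graft.
Variables (xs : seq A) (n : nat) (sub : 'I_n -> tree_data).
Hypotheses (xs0 : xs != [::]) (n1 : n != 1%N).
Hypothesis xs_letter : forall x, x \in xs -> letter x.

Let V : finType := option (fin_sum (fun i => td_V (sub i))).
Let inV i (v : td_V (sub i)) : V :=
  Some (existT (fun i => td_V (sub i) : Type) i v).

Let p : {ffun V -> option V} := [ffun u : V =>
  if u is Some s then
    Some (if td_p (sub (tag s)) (tagged s) is Some w then inV w else None)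
  else None].

Let l (u : V) : seq A := if u is Some s then td_l (tagged s) else xs.

Let inV_inj i : injective (@inV i).
Proof. by move=> v w [] /eqP; rewrite eq_Tagged => /eqP. Qed.

Let p_inV i (v : td_V (sub i)) : p (inV v) =
  Some (if td_p (sub i) v is Some w then inV w else None).
Proof. by rewrite ffunE. Qed.

Let p_None : p None = None.
Proof. by rewrite ffunE. Qed.

Let p_inV_eq i (u : V) (w : td_V (sub i)) :
  (p u == Some (inV w)) =
  (if u is Some s then if tag s == i then
     (p u == Some (inV w)) else false else false).
Proof.
case: u => [[j v]|]; last by rewrite p_None.
rewrite -/(inV v) p_inV [tag _]/=; case: (eqVneq j i) => // ji.
case: (td_p (sub j) v) => // w'; apply/eqP => -[] ji'.
by rewrite ji' eqxx in ji.
Qed.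

Let children_inV i (w : td_V (sub i)) :
  perm_eq [seq c <- enum V | p c == Some (inV w)]
    (map (@inV i) [seq c <- enum (td_V (sub i)) | td_p (sub i) c == Some w]).
Proof.
apply: uniq_perm; first exact/filter_uniq/enum_uniq.
  by rewrite (map_inj_uniq (@inV_inj i)); apply/filter_uniq/enum_uniq.
move=> u; rewrite mem_filter mem_enum andbT.
apply/idP/mapP => [|[v]]; last first.
  rewrite mem_filter => /andP[/eqP pv _ ->].
  by rewrite p_inV pv eqxx.
rewrite p_inV_eq; case: u => [[j v]|//] /=; case: eqP => // ji.
case: i / ji w => w pv; exists v => //; rewrite mem_filter mem_enum andbT.
move: pv; rewrite -/(inV v) p_inV; case: (td_p (sub j) v) => // w' /eqP[] /eqP.
by rewrite eq_Tagged => /= /eqP ->.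
Qed.

Let children_None :
  perm_eq [seq c <- enum V | p c == Some None]
    [seq inV (td_r (sub i)) | i <- enum 'I_n].
Proof.
apply: uniq_perm; first exact/filter_uniq/enum_uniq.
  rewrite map_inj_uniq ?enum_uniq // => i j.
  by move/(congr1 (omap (@tag _ _))) => [].
move=> u; rewrite mem_filter mem_enum andbT.
apply/idP/mapP => [|[i _ ->]]; last by rewrite p_inV td_root eqxx.
case: u => [[i v]|]; last by rewrite p_None.
rewrite -/(inV v) p_inV; case pv: (td_p (sub i) v) => // _; exists i; first by rewrite mem_enum.
have [tree _] := andP (td_RTn1 (sub i)).
have := rooted_tree_unique v tree (td_root (sub i)).
case/connectP=> -[|w s] /=; first by move=> _ ->.
by rewrite pv.
Qed.

Let value_inV d i (v : td_V (sub i)) :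
  subtree_value p l d (inV v) = subtree_value (td_p (sub i)) (td_l (t := sub i)) d v.
Proof.
elim: d v => [//|d IHd] v /=; apply: node_perm => //.
apply: perm_trans (perm_map _ (children_inV v)) _.
suff -> s : map (subtree_value p l d) (map (@inV i) s) =
    map (subtree_value (td_p (sub i)) (td_l (t := sub i)) d) s.
  exact: perm_refl.
by elim: s => //= w s ->; rewrite IHd.
Qed.

Let graft_RTn1 : is_RTn1 p.
Proof.
apply/andP; split.
  apply/existsP; exists None; rewrite p_None eqxx /=; apply/forallP=> u.
  case: u => [[i v]|]; last exact: connect0.
  have [tree _] := andP (td_RTn1 (sub i)).
  have /connectP[s] := rooted_tree_unique v tree (td_root (sub i)).
  rewrite -/(inV v); elim: s v => [|w s IHs] v /=.
    by move=> _ <-; apply: connect1; rewrite p_inV td_root eqxx.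
  case/andP=> /eqP pv ps ls; apply: connect_trans (IHs w ps ls).
  by apply: connect1; rewrite p_inV pv eqxx.
apply/forallP=> u.
have cardE : #|children p u| = size [seq c <- enum V | p c == Some u].
  rewrite cardE; apply: perm_size; apply: uniq_perm.
  - exact: enum_uniq.
  - exact/filter_uniq/enum_uniq.
  - by move=> c; rewrite mem_filter !mem_enum andbT inE.
rewrite cardE; case: u {cardE} => [[i v]|]; last first.
  by rewrite (perm_size children_None) size_map size_enum_ord.
rewrite -/(inV v) (perm_size (children_inV v)) size_map.
have [_ /forallP/(_ v)] := andP (td_RTn1 (sub i)); apply: contra => /eqP <-.
rewrite cardE; apply/eqP; apply: perm_size; apply: uniq_perm.
- exact: enum_uniq.
- exact/filter_uniq/enum_uniq.
- by move=> c; rewrite mem_filter !mem_enum andbT inE.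
Qed.

Definition graft_data : tree_data.
Proof.
refine (@TreeData V p None l graft_RTn1 p_None _ _).
- by case=> [s|]; [apply: td_ne|apply: xs0].
- by case=> [s|] x; [apply: td_letter|apply: xs_letter].
Defined.

Lemma graft_data_value (cs : seq (A * A)) : size cs = n ->
  (forall i : 'I_n, td_stable (sub i) (cs`_i)) ->
  td_stable graft_data (node xs cs).
Proof.
move=> scs sub_cs d; rewrite card_option card_tagged sumnE big_map big_enum /= => Vd.
case: d Vd => [//|d] Vd; rewrite /td_value /=; apply: node_perm => //.
apply: perm_trans (perm_map _ children_None) _; rewrite -map_comp.
suff -> : [seq (subtree_value p l d \o (fun i => inV (td_r (sub i)))) i | i <- enum 'I_n] = cs by [].
apply: (@eq_from_nth _ 0); first by rewrite size_map size_enum_ord scs.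
move=> i; rewrite size_map size_enum_ord => ltin.
rewrite (nth_map (Ordinal ltin)) ?size_enum_ord //= value_inV.
rewrite -[X in nth _ _ X]/(nat_of_ord (Ordinal ltin)) nth_ord_enum.
apply: (sub_cs (Ordinal ltin)); move: Vd; rewrite ltnS; apply: leq_trans.
by rewrite (bigD1 (Ordinal ltin)) //= leq_addr.
Qed.
End Graft.

Definition tree_span : A * A -> Prop :=
  lspan (fun c => exists t, td_stable t c).

Lemma tree_span_node (xs : seq A) (cs : seq (A * A)) :
  (forall x, x \in xs -> letter x) -> xs != [::] ->
  (forall c, c \in cs -> tree_span c) -> size cs != 1%N ->
  tree_span (node xs cs).
Proof.
move=> Lxs xs0 Tcs scs.
apply: (mlin_lspan (@node_mlin _ _ xs) (lspan_subspace _) _ Tcs) => cs' scs' Scs'.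
have /fin_all_exists[sub subE] : forall i : 'I_(size cs'),
    exists t, td_stable t (cs'`_i).
  by move=> i; apply: Scs'; apply: mem_nth.
rewrite -scs' in scs; apply: lspan_gen.
by exists (graft_data sub xs0 scs Lxs); apply: graft_data_value.
Qed.
End TreeData.

Section ZeroLetter.
Variables (k : fieldType) (A : falg k) (V : finType) (p : {ffun V -> option V}).
Hypothesis tree : is_rooted_tree p.

Lemma tree_value_0 (l : V -> seq A) v : 0 \in l v -> tree_value p l = 0.
Proof.
move=> lv0; apply: big1 => r /eqP pr.
suff -> : subtree_value p l #|V| r = 0 by rewrite addr0.
have /connectP[s ps ->] := rooted_tree_unique v tree pr.
have : forall d, subtree_value p l d v = 0.
  by case=> [//|d]; apply: node_0l.
elim: s v ps {lv0} => [|w s IHs] v /=; first by move=> _; apply.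
case/andP=> /eqP vw ps val0; apply: IHs => // -[//|d] /=; apply: node_0r.
by apply/mapP; exists v => //; rewrite mem_filter vw eqxx mem_enum.
Qed.
End ZeroLetter.

Section Restrict.
Variables (k O : Type) (K J : finType) (h : K -> J).
Hypothesis h_inj : injective h.

Lemma ml_restrict (D : {set J}) (t : expr k O J) :
  D \subset h @: setT -> multilinear D t ->
  exists2 t', multilinear (h @^-1: D) t' & t = erelabel h t'.
Proof.
move=> hD Dt; elim: Dt hD => {D t} [j|o D1 D2 t u D12 _ IHt _ IHu|D|D t u _ IHt _ IHu|D a t _ IHt] hD.
- have /imsetP[i _ ji] := subsetP hD j (set11 j); exists (EVar i); last by rewrite ji.
  suff -> : h @^-1: [set j] = [set i] by apply: ml_var.
  by apply/setP=> i'; rewrite !inE ji (inj_eq h_inj).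
- have [|t' Dt' ->] := IHt; first exact: subset_trans (subsetUl _ _) hD.
  have [|u' Du' ->] := IHu; first exact: subset_trans (subsetUr _ _) hD.
  exists (EOp o t' u') => //; rewrite preimsetU; apply: ml_op => //.
  apply/pred0P=> i /=; rewrite !inE; apply/negP=> /andP[h1 h2].
  by move: (disjointFr D12 h1); rewrite h2.
- by exists EZero => //; apply: ml_zero.
- have [t' Dt' ->] := IHt hD; have [u' Du' ->] := IHu hD.
  by exists (EAdd t' u') => //; apply: ml_add.
- have [t' Dt' ->] := IHt hD.
  by exists (EScale a t') => //; apply: ml_scale.
Qed.
End Restrict.

Section Surjective.
Variable k : fieldType.
Hypothesis char0 : [pchar k] =i pred0.
Local Notation FP := (FMan_presentation k).
Local Notation LP := (Lie_presentation k).
Local Notation gal I := (falg_of (galg FP I)).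
Local Notation to_FMan := (eopmap (@Lie_to_FMan_op k)).

(** If [i] is not in [A], substituting 0 for the variable [i] leaves the component of degree [A]
    unchanged, while a tree with a zero letter has value 0. *)
Lemma tree_value_homog (I V : finType) (f : I -> V) (p : {ffun V -> option V}) :
  is_rooted_tree p ->
  homog setT (tree_value (A := gal I) p (@block_letters k I V f) : gspace FP I).
Proof.
move=> tree A AT; have [i iA] : exists i, i \notin A.
  apply/existsP; apply: contraNT AT; rewrite negb_exists => /forallP all_in.
  by apply/eqP/setP=> i; move: (all_in i); rewrite negbK inE.
pose x := upd (gvar FP : I -> galg FP I) i 0.
have xD j : homog [set j] (x j).
  by rewrite /x /upd; case: eqP => _; [|apply: gvar_homog].
have D0 (j : I) : [set j] != set0 by apply/set0Pn; exists j; rewrite inE.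
set a := tree_value _ _.
have xa : (gsub x a : gspace FP I) A = (a : gspace FP I) A.
  rewrite /gsub gcomp_sum (bigD1 A) //= big1 ?addr0 => [|B BA].
    rewrite /eval (interp_upd_out (@gop k FP I) _ _ (mrepr_ml _)) //.
    by rewrite (interp_gvar (mrepr_ml _)) /hcls eqxx clsK.
  apply: (interp_homog xD (mrepr_ml _)).
  suff -> : \bigcup_(j in B) [set j] = B by rewrite eq_sym.
  by apply/setP=> j; apply/bigcupP/idP => [[j' j'B]|jB]; [rewrite inE => /eqP->|exists j; rewrite ?inE].
rewrite -xa /a (h_tree_value _ _ (gsub_hom xD D0)).
rewrite (@tree_value_0 _ _ _ _ tree _ (f i)) //; apply/mapP.
exists (gvar FP i); last by rewrite gsub_gvar // /x /upd eqxx.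
by apply/mapP; exists i => //; rewrite mem_filter eqxx mem_enum.
Qed.

(** The degree is nonempty so that the substitution of such elements for variables is a homomorphism
    ([gsub_hom]). *)
Definition lie_element (J : finType) (x : gal J) : Prop := exists D t,
  [/\ D != set0, multilinear D t & x = hcls (R := FP) D (to_FMan t)].

Lemma lie_element_value (J K : finType) (h : K -> J) D (t : expr k _ J) :
  injective h -> h @: setT = D -> multilinear D t ->
  exists y : Lie k K, lie_value h y = hcls (R := FP) D (to_FMan t).
Proof.
move=> h_inj hD Dt; have [|t' Dt' tE] := ml_restrict h_inj _ Dt; first by rewrite hD.
have Kt' : multilinear [set: K] t'.
  suff <- : h @^-1: D = setT by [].
  by apply/setP=> i; rewrite !inE -hD imset_f.
exists (mclass (R := LP) Kt'); rewrite /lie_value [Lie_to_FMan k K _](pmorE (@Lie_to_FMan_relationE k)) eval_class.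
rewrite -(interp_gvar (ml_opmap (@Lie_to_FMan_op k) Dt)) tE /erelabel eopmap_bind.
by rewrite interp_bind.
Qed.

Definition Phi_image (J : finType) (c : FMan k J) : Prop :=
  exists x, @Phi k J x = c.

Lemma Phi_image_subspace J : subspace (@Phi_image J).
Proof.
have L := @Phi_linear k J; split=> [|_ _ [x <-] [y <-]|a _ [x <-]].
- by exists 0; rewrite (lin0 L).
- by exists (x + y); rewrite (linD L).
- by exists (a *: x); rewrite (linZ L).
Qed.

(** Overlapping degrees give value 0, and degrees that do not cover [J] give nothing in degree
    [setT]. Otherwise the degrees partition [J], and the value is the image of a decomposable tensor
    whose labels in [Com] all have weight 1. *)
Lemma tree_letters_image (J I V : finType) (f : I -> V) (p : RTn1_ob V)
    (x : I -> gal J) : (forall v, exists i, f i = v) ->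
  (forall i, lie_element (x i)) ->
  Phi_image ((tree_value (A := gal J) (sval p)
    (fun v => [seq x i | i <- enum I & f i == v]) : gspace FP J) setT).
Proof.
move=> fsurj /fin_all_exists[D] /fin_all_exists[t xt].
have D0 i : D i != set0 by case: (xt i).
have xE i : x i = hcls (R := FP) (D i) (to_FMan (t i)) by case: (xt i).
have mlt i : multilinear (D i) (t i) by case: (xt i).
have xD i : homog (D i) (x i) by rewrite xE; apply: hcls_homog.
have sub0 := sub0 (Phi_image_subspace J).
have [tree _] := andP (svalP p).
pose a := tree_value (A := gal I) (sval p) (@block_letters k I V f).
have ax : gsub x a = tree_value (A := gal J) (sval p)
    (fun v => [seq x i | i <- enum I & f i == v]).
  rewrite (h_tree_value _ _ (gsub_hom xD D0)).
  suff -> : (fun v => map (gsub x : gal I -> gal J) (@block_letters k I V f v)) =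
      (fun v => [seq x i | i <- enum I & f i == v]) by [].
  apply/funext=> v; rewrite -map_comp; apply: eq_map => i /=.
  by rewrite gsub_gvar.
have [disjD|overlap] := pselect (forall i j, i != j -> [disjoint D i & D j]); last first.
  rewrite -ax; suff -> : gsub x a = 0 by [].
  rewrite /a (homogE (tree_value_homog f tree)) gsub_hcls; last exact: mrepr_ml.
  have [i [j [ij Dij]]] : exists i j, i != j /\ ~~ [disjoint D i & D j].
    apply: contrapT => no; apply: overlap => i j ij; apply: contrapT => /negP Dij.
    by apply: no; exists i, j.
  by apply: (interp_overlap xD (mrepr_ml _) _ _ ij Dij); rewrite inE.
have [cover|ncover] := boolP (\bigcup_i D i == setT); last first.
  rewrite -ax; suff -> : (gsub x a : gspace FP J) setT = 0 by [].
  rewrite /a (homogE (tree_value_homog f tree)) gsub_hcls; last exact: mrepr_ml.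
  apply: (interp_homog xD (mrepr_ml _)); rewrite eq_sym.
  by under eq_bigl do rewrite inE.
have /fin_all_exists[g gD] : forall j, exists i, j \in D i.
  move=> j; have : j \in \bigcup_i D i by rewrite (eqP cover).
  by case/bigcupP=> i _; exists i.
have gE j i : (j \in D i) = (g j == i).
  apply/idP/eqP => [jD|<-//]; apply/eqP; apply: contraT => gi.
  by move: (disjointFr (disjD _ _ gi) (gD j)); rewrite jD.
pose e : equiv I 'I_#|I| := Equiv (@enum_rankK I) (@enum_valK I).
pose e' : equiv V 'I_#|V| := Equiv (@enum_rankK V) (@enum_valK V).
pose h : J -> 'I_#|I| := fun j => e (g j).
have hy i : exists y : Lie k (fiber h i),
    lie_value (fun j : fiber h i => sval j) y = x (einv e i).
  rewrite xE; apply: lie_element_value => //; first exact: val_inj.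
  apply/setP=> j; rewrite gE; apply/imsetP/eqP => [[j' _ ->]|ji].
    by case: j' => j' /= /eqP <-; rewrite enum_rankK.
  have hj : h j == i by rewrite /h ji einvK.
  by exists (exist _ j hj).
have [y yE] := fin_all_exists hy.
pose f' (i : 'I_#|I|) : 'I_#|V| := e' (f (einv e i)).
have f'surj v : exists i, f' i = v.
  by have [i fi] := fsurj (einv e' v); exists (e i); rewrite /f' efunK fi einvK.
have fib v : (0 < #|fiber f' v|)%N.
  have [i fi] := f'surj v; have fi' : f' i == v by rewrite fi.
  by apply/card_gt0P; exists (exist _ i fi').
pose z v : Com k (fiber f' v) := [ffun=> 1].
have z1 v : weight (z v) = 1.
  pose u : nonempty_ob (fiber f' v) := exist _ tt (fib v).
  have uE (w : nonempty_ob (fiber f' v)) : w = u by apply: val_inj; case: w => -[].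
  by rewrite /weight (bigD1 u) //= big1 ?addr0 ?ffunE // => w; rewrite uE eqxx.
exists (cpgen (X := comp_species (RTn1 k) (Com k))
  (cpgen (tree_delta k (RTn1_map e' p)) z) y).
rewrite Phi_tree; last first.
  move=> i; have [j ji] := set0Pn _ (D0 (einv e i)).
  by exists j; move: ji; rewrite gE /h => /eqP ->; rewrite einvK.
rewrite big1 ?scale1r; last by move=> v _; exact: z1.
rewrite (tree_value_equiv (e := e') (p := sval p)
  (l := fun v => [seq x i | i <- enum I & f i == v])) // => v.
  by rewrite /= ffunE efunK.
under eq_map do rewrite yE.
rewrite (map_comp x (einv e)); apply: perm_map; apply: uniq_perm.
- rewrite map_inj_uniq; first exact/filter_uniq/enum_uniq.
  exact: (can_inj (einvK e)).
- exact/filter_uniq/enum_uniq.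
move=> i; rewrite -[i](efunK e) mem_map; last exact: (can_inj (einvK e)).
by rewrite !mem_filter /f' efunK (inj_eq (@efun_inj _ _ e')) -?enumT ?mem_enum.
Qed.

Lemma tree_span_image (J : finType) c :
  tree_span (@lie_element J) c -> Phi_image ((c.1 + c.2 : gspace FP J) setT).
Proof.
have subI := Phi_image_subspace J.
elim=> {c} [c [t tc]||u v _ Iu _ Iv|a u _ Iu].
- rewrite -(tc _ (leqnn _)) /td_value.
  have [tree _] := andP (td_RTn1 t).
  have rE (r : td_V t) : (td_p t r == None) = (r == td_r t).
    apply/eqP/eqP => [pr|->]; last exact: td_root.
    have /connectP[[|w s] //= ] := rooted_tree_unique r tree (td_root t).
    by rewrite pr.
  have -> : let c := subtree_value (td_p t) (td_l (t := t)) #|td_V t| (td_r t) in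
      c.1 + c.2 = tree_value (td_p t) (td_l (t := t)).
    by rewrite /tree_value (big_pred1 (td_r t)).
  pose I : finType := fin_sum (fun v => 'I_(size (td_l (t := t) v))).
  pose x (i : I) : gal J := (td_l (tag i))`_(tagged i).
  have x_ltr i : lie_element (x i) by apply: (td_letter (v := tag i)); apply: mem_nth.
  have tagsurj (v : td_V t) : exists i : I, tag i = v.
    have lt0 : (0 < size (td_l v))%N by rewrite lt0n size_eq0 td_ne.
    by exists (existT (fun v => 'I_(size (td_l (t := t) v)) : Type) v (Ordinal lt0)).
  have := tree_letters_image (exist (@is_RTn1 (td_V t)) _ (td_RTn1 t)) tagsurj x_ltr.
  rewrite /= (tree_value_equiv (e := equiv_id _) (p := td_p t) (l := td_l (t := t))) //.
    by move=> v; case: (td_p t v).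
  move=> v; pose iv (i : 'I_(size (td_l v))) : I :=
    existT (fun v => 'I_(size (td_l (t := t) v)) : Type) v i.
  have -> : td_l v = map x (map iv (enum 'I_(size (td_l v)))).
    apply: (@eq_from_nth _ 0) => [|i iv_]; first (rewrite 2!size_map; by rewrite -cardE card_ord).
    rewrite -map_comp (nth_map (Ordinal iv_)) -?cardE ?card_ord //.
    by rewrite (nth_ord_enum (Ordinal iv_) (Ordinal iv_)).
  apply: perm_map; apply: uniq_perm.
  + exact/filter_uniq/enum_uniq.
  + rewrite map_inj_uniq ?enum_uniq // => i j /eqP.
    by rewrite eq_Tagged => /eqP.
  case=> w i; rewrite mem_filter mem_enum andbT /=; apply/eqP/mapP.
    by move=> wv; case: v / wv @iv => iv; exists i; rewrite ?mem_enum.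
  by case=> j _ [].
- by rewrite addr0; apply: sub0.
- by rewrite /= addrACA; apply: subD.
- by rewrite /= -scalerDr; apply: subZ.
Qed.

(** The size is any positive number, not tied to the degree of [x]: it serves the inductions of the
    spanning argument. *)
Let sized_letter (J : finType) n (x : gal J) : Prop := (0 < n)%N /\ lie_element x.

Lemma interp_gen (J : finType) B (t : expr k _ J) : multilinear B t ->
  gen (@sized_letter J) #|B| (interp (@gop k FP J) (gvar FP) t : gal J).
Proof.
elim=> {B t} [j|o D1 D2 t u D12 _ IHt _ IHu|D|D t u _ IHt _ IHu|D a t _ IHt] /=.
- rewrite cards1; apply: gen_letter; split=> //.
  exists [set j], (EVar j); split; last by [].
    by apply/set0Pn; exists j; rewrite inE.
  exact: ml_var.
- rewrite cardsU; move: D12; rewrite -setI_eq0 => /eqP ->; rewrite cards0 subn0.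
  by case: o; [apply: (gen_mul IHt IHu)|apply: (gen_br IHt IHu)].
- exact: gen0.
- exact: genD.
- exact: genZ.
Qed.

Theorem Phi_surjective (J : finType) (c : FMan k J) : Phi_image c.
Proof.
elim/mclass_ind: c => t Jt; rewrite -interp_gvar_setT.
have [|||n xs cs sxs xs0 Tcs scs|c Tc ->] := @node_closed_gen k char0 (gal J)
  (@sized_letter J) _ _ (tree_span (@lie_element J)) _ _ _ _ (interp_gen Jt).
- by move=> n x [].
- move=> i j x y [i0 [D1 [t1 [D10 Dt1 ->]]]] [j0 [D2 [t2 [D20 Dt2 ->]]]].
  split; first by rewrite addn_gt0 i0.
  have [D12|D12] := boolP [disjoint D1 & D2].
    exists (D1 :|: D2), (EOp Lie_bracket t1 t2); split; last 1 first.
    + by rewrite [LHS](gop_hcls _ D12) //; apply: ml_opmap.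
    + by apply: contra D10; rewrite -!subset0 subUset => /andP[].
    + exact: ml_op.
  (* The bracket is 0, and [EZero] has every support, in particular the nonempty [D1]. *)
  exists D1, EZero; split; [by []|exact: ml_zero|].
  rewrite hcls0.
  exact: (gop_overlap (FMan_bracket : pr_ops FP) (hcls_homog _) (hcls_homog _) D12).
- exact: lspan_subspace.
- apply: tree_span_node => // x /(sized_mem sxs)[i []] //.
- exact: tree_span_image.
Qed.
End Surjective.

From mathcomp Require Import mpoly.

(** * Pre-Lie algebras and vector fields *)

Section PreLie.
Variables (R : comNzRingType) (L : lmodType R) (pre : L -> L -> L).
Local Notation "x <~ y" := (pre x y) (at level 40, left associativity).
Hypothesis pre_linl : forall y, linear (fun x => x <~ y).
Hypothesis pre_linr : forall x, linear (fun y => x <~ y).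
Hypothesis pre_lie : forall x y z,
  x <~ z <~ y = x <~ y <~ z - x <~ (y <~ z) + x <~ (z <~ y).
Implicit Types (w x y z : L).

Definition pcirc x y := x <~ y + y <~ x.
Definition pbr x y := x <~ y - y <~ x.
Local Notation "x ** y" := (pcirc x y) (at level 40, left associativity).
Local Notation "{[ x , y ]}" := (pbr x y).

Let plD x y z : (x + y) <~ z = x <~ z + y <~ z. Proof. exact: (linD (pre_linl z)). Qed.
Let plN x z : (- x) <~ z = - (x <~ z). Proof. exact: (linN (pre_linl z)). Qed.
Let prD x y z : x <~ (y + z) = x <~ y + x <~ z. Proof. exact: (linD (pre_linr x)). Qed.
Let prN x z : x <~ (- z) = - (x <~ z). Proof. exact: (linN (pre_linr x)). Qed.
Let plin := (plD, plN, prD, prN).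

Lemma pcirc_linl y : linear (fun x => x ** y).
Proof. by move=> a u v; rewrite /pcirc pre_linl pre_linr; lmod R. Qed.
Lemma pcirc_linr x : linear (fun y => x ** y).
Proof. by move=> a u v; rewrite /pcirc pre_linl pre_linr; lmod R. Qed.
Lemma pbr_linl y : linear (fun x => {[x, y]}).
Proof. by move=> a u v; rewrite /pbr pre_linl pre_linr; lmod R. Qed.
Lemma pbr_linr x : linear (fun y => {[x, y]}).
Proof. by move=> a u v; rewrite /pbr pre_linl pre_linr; lmod R. Qed.

(** The symmetric brace x{y, z}: [y] and [z] are grafted on [x] independently. *)
Definition brace x y z := x <~ y <~ z - x <~ (y <~ z).

(** Each term contains a commutator: a brace lies one step deeper in the filtration than its form
    suggests. *)
Lemma braceE x y z :
  brace x y z = {[x, y]} <~ z + y <~ {[x, z]} - {[x, y <~ z]}.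
Proof. rewrite /brace /pbr !plin (pre_lie y x z); lmod R. Qed.

Lemma pbrC x y : {[x, y]} = - {[y, x]}.
Proof. by rewrite /pbr opprB. Qed.

Lemma pbr_jacobi x y z :
  {[{[x, y]}, z]} + {[{[y, z]}, x]} + {[{[z, x]}, y]} = 0.
Proof.
rewrite /pbr !plin (pre_lie x y z) (pre_lie y x z) (pre_lie z x y); lmod R.
Qed.

Lemma pbr_scaled_jacobi h x y z :
  h *: {[h *: {[x, y]}, z]} + h *: {[h *: {[y, z]}, x]} + h *: {[h *: {[z, x]}, y]} = 0.
Proof.
by rewrite !(linZ (pbr_linl _)) !scalerA -!scalerDr pbr_jacobi scaler0.
Qed.

(** With [braceE] every term on the right contains a commutator, so that the product is associative
    to leading order. *)
Lemma pcirc_assoc x y z : x ** y ** z - x ** (y ** z) =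
  2%:R *: brace x y z - 2%:R *: brace z x y + y <~ {[x, z]} - {[x, z]} <~ y.
Proof.
rewrite /brace /pcirc /pbr !plin (pre_lie x y z) (pre_lie y x z) (pre_lie z x y).
lmod R.
Qed.

(** The failure of [{[x, -]}] to be a derivation of the product. Given associativity and
    commutativity, the Hertling-Manin relation says that [leib] is itself a derivation in its first
    argument. *)
Definition leib x y z := {[x, y ** z]} - {[x, y]} ** z - y ** {[x, z]}.

Lemma leibE x y z : leib x y z = - 2%:R *: brace x y z.
Proof.
rewrite /leib /brace /pcirc /pbr !plin.
rewrite (pre_lie x y z) (pre_lie y x z) (pre_lie z x y); lmod R.
Qed.

(** On the left remain the graftings in which [y] or [z] lands on [w], minus those in which [w]
    lands on [y] or [z]; paired, the latter give the commutators. *)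
Let brace_pre x w y z : brace (x <~ w) y z - brace x y z <~ w =
  x <~ brace w y z + brace x {[w, y]} z + brace x {[w, z]} y.
Proof.
have E1 : x <~ w <~ y <~ z = x <~ y <~ w <~ z + (x <~ {[w, y]}) <~ z.
  by rewrite (pre_lie x y w) /pbr !plin; lmod R.
have E2 := pre_lie (x <~ y) z w.
have E3 : x <~ w <~ (y <~ z) = x <~ (y <~ z) <~ w + x <~ {[w, y <~ z]}.
  by rewrite (pre_lie x (y <~ z) w) /pbr !plin; lmod R.
have E4 : (x <~ y) <~ {[w, z]} =
    x <~ {[w, z]} <~ y + x <~ {[y, {[w, z]}]}.
  by rewrite (pre_lie x {[w, z]} y) /pbr !plin; lmod R.
have E5 : brace w y z = {[w, y]} <~ z + {[w, z]} <~ y + {[y, {[w, z]}]} - {[w, y <~ z]}.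
  by rewrite braceE [{[y, {[w, z]}]}]/pbr; lmod R.
rewrite E5 {1 2}/brace E1 E2 E3.
have -> : x <~ y <~ (w <~ z) = (x <~ y) <~ {[w, z]} + x <~ y <~ (z <~ w).
  by rewrite /pbr !plin; lmod R.
rewrite E4 /brace !plin; lmod R.
Qed.

(** The terms on the right have one commutator as an argument and, by [leibE] and [braceE], a second
    one in [leib]: one more than the left side. *)
Lemma leib_circ x w y z :
  leib (x ** w) y z - x ** leib w y z - w ** leib x y z =
  leib x {[w, y]} z + leib x {[w, z]} y + leib w {[x, y]} z + leib w {[x, z]} y.
Proof.
rewrite !leibE.
have oZ a u v : u ** (a *: v) = a *: (u ** v).
  by rewrite /pcirc (linZ (pre_linr u)) (linZ (pre_linl u)) scalerDr.
have braceD u v : brace (u + v) y z = brace u y z + brace v y z.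
  by rewrite /brace !plin; lmod R.
rewrite !oZ {1}/pcirc braceD.
have E1 := brace_pre x w y z; have E2 := brace_pre w x y z.
have {}E1 : brace (x <~ w) y z = brace x y z <~ w + (x <~ brace w y z +
    brace x {[w, y]} z + brace x {[w, z]} y) by rewrite -E1; lmod R.
have {}E2 : brace (w <~ x) y z = brace w y z <~ x + (w <~ brace x y z +
    brace w {[x, y]} z + brace w {[x, z]} y) by rewrite -E2; lmod R.
by rewrite E1 E2 /pcirc; lmod R.
Qed.

(** [h] becomes the Rees parameter, which marks each bracket. Apart from the defect computed in
    [leib_circ], only associators remain, from the regrouping of products. *)
Lemma HM_defect h x w y z :
  let br a b := h *: {[a, b]} in
  let assoc a b c := a ** b ** c - a ** (b ** c) in
  br (x ** w) (y ** z) -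
    (br (x ** w) y ** z + br (x ** w) z ** y + x ** br w (y ** z) + w ** br x (y ** z)
     - (x ** y) ** br w z - (w ** y) ** br x z - (w ** z) ** br x y - (x ** z) ** br w y) =
  h *: (leib x {[w, y]} z + leib x {[w, z]} y + leib w {[x, y]} z + leib w {[x, z]} y)
  + assoc x z (br w y) + assoc x y (br w z) + assoc w z (br x y) + assoc w y (br x z).
Proof.
rewrite /= -leib_circ.
have oC a b : a ** b = b ** a by rewrite /pcirc addrC.
have oZ c a b : a ** (c *: b) = c *: (a ** b) := linZ (pcirc_linr a) c b.
have Zo c a b : (c *: a) ** b = c *: (a ** b) := linZ (pcirc_linl b) c a.
have oB a b c d : a ** (b - c - d) = a ** b - a ** c - a ** d.
  by rewrite !(linB (pcirc_linr a)).
have oleib a b c d : a ** leib b c d =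
    a ** {[b, c ** d]} - a ** ({[b, c]} ** d) - a ** (c ** {[b, d]}) := oB a _ _ _.
rewrite !oleib /leib !oZ !Zo.
rewrite (oC y {[x ** w, z]}) (oC {[w, y]} z) (oC {[x, y]} z); lmod R.
Qed.

Lemma leibZr x y z c : leib x (c *: y) z = c *: leib x y z.
Proof.
rewrite /leib (linZ (pcirc_linl z)) !(linZ (pbr_linr x)) !(linZ (pcirc_linl _)).
by rewrite -!scalerBr.
Qed.
End PreLie.

(* Vector fields sum_i x_i d_i on the variables u_i, where d_l acts on the u_j
   as if u_j were exp(sum_l a_jl x_l): thus x <~ y grafts the root l of y below
   each vertex j of x and records the new edge as a_jl. *)
Section VectorFields.
Variables (R : comNzRingType) (J : finType).
Local Notation n := #|{: J + J * J}|.
Local Notation M := (mpoly n R).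

Definition vidx (j : J) : 'I_n := enum_rank (inl j).
Definition eidx (j l : J) : 'I_n := enum_rank (inr (j, l)).

Definition euler (j : J) (f : M) : M := 'X_(vidx j) * mderiv (vidx j) f.

(** [P] restricts the grafting to the vertices in [P]. With a single vertex it builds individual
    trees, where the pre-Lie product yields sums of trees. *)
Definition gder (P : pred J) (l : J) (f : M) : M :=
  \sum_(j | P j) 'X_(eidx j l) * euler j f.

Lemma euler_linear j : linear (euler j).
Proof. by move=> c f g; rewrite /euler mderivD mderivZ mulrDr scalerAr. Qed.

Lemma eulerM j f g : euler j (f * g) = euler j f * g + f * euler j g.
Proof. by rewrite /euler mderivM; ring. Qed.

Lemma eulerX j m : euler j 'X_[m] = (m (vidx j))%:R *: 'X_[m].
Proof.
rewrite /euler mderivX -scalerAr -mpolyXD; case: (posnP (m (vidx j))) => [->|mj].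
  by rewrite !scale0r.
congr (_ *: 'X_[_]); apply/mnmP=> i; rewrite mnmDE mnmBE mnm1E.
by case: eqP => [<-|_]; rewrite ?subnKC ?subn0.
Qed.

Lemma euler_edge i j l f : euler i ('X_(eidx j l) * f) = 'X_(eidx j l) * euler i f.
Proof.
rewrite eulerM eulerX mnm1E (inj_eq enum_rank_inj) /= scale0r mul0r add0r //.
Qed.

Lemma euler_comm i j f : euler i (euler j f) = euler j (euler i f).
Proof.
have eE i' j' : euler i' (euler j' f) =
    (vidx j' == vidx i')%:R *: 'X_(vidx j') * mderiv (vidx j') f +
    'X_(vidx i') * 'X_(vidx j') * mderiv (vidx i') (mderiv (vidx j') f).
  by rewrite {2}/euler eulerM eulerX mnm1E /euler; ring.
rewrite !eE (mulrC 'X_(vidx i)) (mderiv_comm (vidx i)); congr (_ + _).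
by rewrite eq_sym; case: eqP => [->//|_]; rewrite !scale0r !mul0r.
Qed.

Lemma gder_linear P l : linear (gder P l).
Proof.
move=> c f g; rewrite /gder scaler_sumr -big_split; apply: eq_bigr => j _ /=.
by rewrite euler_linear mulrDr -scalerAr.
Qed.

Lemma gderM P l f g : gder P l (f * g) = gder P l f * g + f * gder P l g.
Proof.
rewrite /gder mulr_suml mulr_sumr -big_split; apply: eq_bigr => j _ /=.
by rewrite eulerM; ring.
Qed.

Lemma gder_comm P Q l m f : gder P l (gder Q m f) = gder Q m (gder P l f).
Proof.
have gE P' Q' l' m' : gder P' l' (gder Q' m' f) = \sum_(j | P' j) \sum_(i | Q' i)
    'X_(eidx j l') * 'X_(eidx i m') * euler j (euler i f).
  apply: eq_bigr => j _; rewrite /gder.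
  rewrite (big_morph (euler j) (linD (euler_linear j)) (lin0 (euler_linear j))).
  by rewrite mulr_sumr; apply: eq_bigr => i _; rewrite euler_edge mulrA.
rewrite !gE exchange_big; apply: eq_bigr => i _; apply: eq_bigr => j _ /=.
by rewrite euler_comm (mulrC 'X_(eidx j l)).
Qed.

Definition field : lmodType R := {ffun J -> M}.

Definition graft (P : pred J) (x y : field) : field :=
  [ffun i => \sum_l (y : {ffun J -> M}) l * gder P l ((x : {ffun J -> M}) i)].

Lemma field_linE c (u v : field) i :
  (c *: u + v : {ffun J -> M}) i = c *: (u : {ffun J -> M}) i + (v : {ffun J -> M}) i.
Proof. by rewrite !ffunE. Qed.

Lemma graft_linl P y : linear (fun x => graft P x y).
Proof.
move=> c u v; apply/ffunP=> i; rewrite !ffunE scaler_sumr -big_split /=.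
by apply: eq_bigr => l _; rewrite gder_linear mulrDr -scalerAr.
Qed.

Lemma graft_linr P x : linear (graft P x).
Proof.
move=> c u v; apply/ffunP=> i; rewrite !ffunE scaler_sumr -big_split /=.
by apply: eq_bigr => l _; rewrite field_linE mulrDl -scalerAl.
Qed.

Lemma graftE P x y i : (graft P x y : {ffun J -> M}) i =
  \sum_l (y : {ffun J -> M}) l * gder P l ((x : {ffun J -> M}) i).
Proof. exact: ffunE. Qed.

(** Grafting [y] on [x] and grafting [z] on [x] commute; the correction terms are those in which one
    of them lands on the other. For P = Q this is the pre-Lie identity; distinct P and Q are used in
    [filt_graft]. *)
Lemma graft_graft P Q x y z : graft P (graft Q x z) y =
  graft Q (graft P x y) z - graft P x (graft Q y z) + graft Q x (graft P z y).
Proof.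
apply/ffunP=> i.
have gder_sum P' l (F : J -> M) : gder P' l (\sum_m F m) = \sum_m gder P' l (F m).
  exact: (big_morph _ (linD (gder_linear P' l)) (lin0 (gder_linear P' l))).
have gE P' Q' (x' y' z' : field) : graft P' (graft Q' x' z') y' i =
    graft Q' x' (graft P' z' y') i +
    \sum_l \sum_m y' l * z' m * gder P' l (gder Q' m (x' i)).
  rewrite !graftE.
  have inner l : y' l * gder P' l (\sum_m z' m * gder Q' m (x' i)) =
      \sum_m y' l * gder P' l (z' m) * gder Q' m (x' i) +
      \sum_m y' l * z' m * gder P' l (gder Q' m (x' i)).
    rewrite gder_sum mulr_sumr -big_split; apply: eq_bigr => m _.
    by rewrite gderM mulrDr !mulrA.
  rewrite (eq_bigr _ (fun l _ => inner l)) big_split; congr (_ + _).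
  rewrite exchange_big; apply: eq_bigr => m _.
  by rewrite graftE mulr_suml.
have gC : \sum_l \sum_m y l * z m * gder P l (gder Q m (x i)) =
    \sum_l \sum_m z l * y m * gder Q l (gder P m (x i)).
  rewrite exchange_big; apply: eq_bigr => l _; apply: eq_bigr => m _.
  by rewrite gder_comm (mulrC (y m)).
have coordE (a b c : field) : (a - b + c : {ffun J -> M}) i =
    (a : {ffun J -> M}) i - (b : {ffun J -> M}) i + (c : {ffun J -> M}) i.
  by rewrite !ffunE.
rewrite coordE (gE P Q x y z) (gE Q P x z y) gC.
have swapE (u v w : M) : u + v = w + v - w + u by rewrite (addrC w) addrK addrC.
exact: swapE.
Qed.
End VectorFields.

(** * The bracket filtration *)

Section Filtration.
Variables (k : fieldType) (J : finType).
Hypothesis char0 : [pchar k] =i pred0.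
Local Notation R := {poly k}.
Local Notation L := (field R J).
Local Notation FP := (FMan_presentation k).
Local Notation pre := (@graft R J xpredT).
Local Notation "x <~ y" := (pre x y) (at level 40, left associativity).
Local Notation "x ** y" := (pcirc pre x y) (at level 40, left associativity).
Local Notation "{[ x , y ]}" := (pbr pre x y).
Local Notation pl := (@graft_linl R J xpredT).
Local Notation pr := (@graft_linr R J xpredT).
Implicit Types (x y z : L) (e f g : J -> nat).

Definition vertex (j : J) : L :=
  [ffun i => if i == j then 'X_(vidx j) else 0].

(* filt e d x: x is a combination of values of monomials with at least d
   brackets in which the vertex j occurs e j times. *)
Inductive filt : (J -> nat) -> nat -> L -> Prop :=
| filt_vertex e j : (forall i, e i = (i == j)) -> filt e 0 (vertex j)
| filt_circ e f g a b c x y : (forall i, g i = e i + f i)%N -> c = (a + b)%N ->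
    filt e a x -> filt f b y -> filt g c (x ** y)
| filt_br e f g a b c x y : (forall i, g i = e i + f i)%N -> c = (a + b).+1 ->
    filt e a x -> filt f b y -> filt g c {[x, y]}
| filt0 e d : filt e d 0
| filtD e d x y : filt e d x -> filt e d y -> filt e d (x + y)
| filtZ e d c x : filt e d x -> filt e d (c%:P *: x)
| filt_weak e d x : filt e d.+1 x -> filt e d x.

Lemma filtN e d x : filt e d x -> filt e d (- x).
Proof. by move=> Fx; rewrite -scaleN1r -[-1]polyCN; apply: filtZ. Qed.

Lemma filt_ext e f d x : (forall i, e i = f i) -> filt e d x -> filt f d x.
Proof.
move=> ef Fx; elim: Fx f ef => {e d x}.
- by move=> e j ej f ef; apply: filt_vertex => i; rewrite -ef ej.
- move=> e1 e2 e a b c x y ee cc Fx _ Fy _ f ef.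
  by apply: filt_circ Fx Fy => // i; rewrite -ef.
- move=> e1 e2 e a b c x y ee cc Fx _ Fy _ f ef.
  by apply: filt_br Fx Fy => // i; rewrite -ef.
- by move=> *; apply: filt0.
- by move=> e d x y _ IHx _ IHy f ef; apply: filtD; [apply: IHx|apply: IHy].
- by move=> e d c x _ IHx f ef; apply: filtZ; apply: IHx.
- by move=> e d x _ IHx f ef; apply: filt_weak; apply: IHx.
Qed.

Lemma filt_le e c d x : (c <= d)%N -> filt e d x -> filt e c x.
Proof.
move=> cd; rewrite -(subnK cd); elim: (d - c)%N => [//|n IHn] Fx.
by apply: IHn; apply: filt_weak.
Qed.

Lemma filt_pre e f g a b x y : (forall i, g i = e i + f i)%N ->
  filt e a x -> filt f b y -> filt g (a + b) (x <~ y).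
Proof.
move=> gE Fx Fy; have two0 : 2%:R != 0 :> k by apply: (char0_natr_neq0 char0 (n := 2)).
have -> : x <~ y = (2%:R^-1)%:P *: (x ** y + {[x, y]}).
  have E : x ** y + {[x, y]} = (2%:R)%:P *: (x <~ y).
    by rewrite /pcirc /pbr polyC_natr scaler_nat mulr2n addrACA subrr addr0.
  by rewrite E scalerA -polyCM mulVf // polyC1 scale1r.
apply: filtZ; apply: filtD; first exact: filt_circ Fx Fy.
by apply: filt_weak; apply: filt_br Fx Fy.
Qed.

(** A monomial with n letters has n - 1 operations, hence fewer than n brackets. *)
Lemma filt_big e d x : (\sum_j e j <= d)%N -> filt e d x -> x = 0.
Proof.
move=> + Fx; elim: Fx => {e d x}.
- by move=> e j ej; rewrite (bigD1 j) //= ej eqxx.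
- move=> e f g a b c x y gE -> _ IHx _ IHy.
  rewrite (eq_bigr (fun i => e i + f i)%N) // big_split /= => le.
  have [|] := leqP (\sum_i e i) a; first by move/IHx->; rewrite (lin0 (pcirc_linl pl pr y)).
  move=> lt; have /IHy -> : (\sum_i f i <= b)%N by lia.
  exact: (lin0 (pcirc_linr pl pr x)).
- move=> e f g a b c x y gE -> _ IHx _ IHy.
  rewrite (eq_bigr (fun i => e i + f i)%N) // big_split /= => le.
  have [|] := leqP (\sum_i e i) a; first by move/IHx->; rewrite (lin0 (pbr_linl pl pr y)).
  move=> lt; have /IHy -> : (\sum_i f i <= b)%N by lia.
  exact: (lin0 (pbr_linr pl pr x)).
- by [].
- by move=> e d x y _ IHx _ IHy le; rewrite IHx // IHy // addr0.
- by move=> e d c x _ IHx le; rewrite IHx // scaler0.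
- by move=> e d x _ IHx le; apply: IHx; apply: leqW.
Qed.

Let graftable P e x := forall f g y, (forall i, g i = e i + f i)%N ->
  filt f 0 y -> filt g 0 (graft P x y).

Let filt_graft_pre P e f g a b x z f' g' y : filt e a x -> filt f b z ->
  graftable P e x -> graftable P f z -> (forall i, g i = e i + f i)%N ->
  (forall i, g' i = g i + f' i)%N -> filt f' 0 y -> filt g' 0 (graft P (x <~ z) y).
Proof.
move=> /(filt_le (leq0n _)) Fx /(filt_le (leq0n _)) Fz IHx IHz gE g'E Fy.
rewrite graft_graft; apply: filtD; [apply: filtD; [|apply: filtN]|].
- apply: (@filt_pre (fun i => e i + f' i)%N f g' 0 0) => //.
    by move=> i; rewrite g'E gE addnAC.
  exact: (IHx f').
- apply: (IHx (fun i => f' i + f i)%N) => [i|].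
    by rewrite g'E gE addnAC addnA.
  exact: (@filt_pre f' f _ 0 0).
- apply: (@filt_pre e (fun i => f i + f' i)%N g' 0 0) => //.
    by move=> i; rewrite g'E gE addnA.
  exact: (IHz f').
Qed.

(** [graft P] is not an operation of the pre-Lie algebra, but by [graft_graft] it can be pushed
    inside pre-Lie products until its first argument is a vertex, where it equals the pre-Lie
    product or 0. *)
Lemma filt_graft P e f g a b x y : (forall i, g i = e i + f i)%N ->
  filt e a x -> filt f b y -> filt g 0 (graft P x y).
Proof.
move=> gE Fx /(filt_le (leq0n _)); elim: Fx f g y gE {b} => {e a x}.
- move=> e j ej f g y gE Fy.
  have edge0 i l : i != j ->
      'X_(eidx i l) * euler i 'X_(vidx j) = 0 :> mpoly #|{: J + J * J}| {poly k}.
    move=> ij; rewrite eulerX mnm1E (inj_eq enum_rank_inj) /=.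
    by rewrite (inj_eq (@inl_inj _ _)) eq_sym (negPf ij) scale0r mulr0.
  case Pj: (P j).
    suff -> : graft P (vertex j) y = vertex j <~ y.
      by apply: (@filt_pre e f g 0 0) => //; apply: filt_vertex.
    apply/ffunP=> i; rewrite !graftE; apply: eq_bigr => l _; rewrite ffunE.
    case: eqP => _; last by rewrite !(lin0 (gder_linear _ _)).
    rewrite /gder (bigD1 j) //= [in RHS](bigD1 j) //=; congr (_ * (_ + _)).
    by rewrite !big1 // => i' i'j; rewrite edge0 //; case/andP: i'j.
  suff -> : graft P (vertex j) y = 0 by apply: filt0.
  apply/ffunP=> i; rewrite graftE big1 ?ffunE // => l _.
  case: eqP => _; last by rewrite (lin0 (gder_linear _ _)) mulr0.
  rewrite /gder big1 ?mulr0 // => i' Pi'; rewrite edge0 //.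
  by apply: contraTneq Pi' => ->; rewrite Pj.
- move=> e f g a b c x z gE cE Fx IHx Fz IHz f' g' y g'E Fy.
  rewrite (linD (graft_linl P y)).
  apply: filtD; first exact: (filt_graft_pre Fx Fz IHx IHz gE g'E Fy).
  by apply: (filt_graft_pre Fz Fx IHz IHx _ g'E Fy) => i; rewrite gE addnC.
- move=> e f g a b c x z gE cE Fx IHx Fz IHz f' g' y g'E Fy.
  rewrite (linB (graft_linl P y)).
  apply: filtD; first exact: (filt_graft_pre Fx Fz IHx IHz gE g'E Fy).
  apply: filtN.
  by apply: (filt_graft_pre Fz Fx IHz IHx _ g'E Fy) => i; rewrite gE addnC.
- by move=> e d f g y _ _; rewrite (lin0 (graft_linl P y)); apply: filt0.
- move=> e d x z _ IHx _ IHz f g y gE Fy; rewrite (linD (graft_linl P y)).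
  by apply: filtD; [apply: IHx Fy|apply: IHz Fy].
- move=> e d c x _ IHx f g y gE Fy; rewrite (linZ (graft_linl P y)).
  by apply: filtZ; apply: IHx Fy.
- by move=> e d x _ IHx.
Qed.

(** The indeterminate of [R] is reserved for the Rees grading: coefficients being constant, the
    exponent in ['X^d *: x] shows the filtration degree. *)
Definition constant_coefs (f : mpoly #|{: J + J * J}| R) :=
  forall m, exists a : k, f@_m = a%:P.

Let cst_sum I (r : seq I) (F : I -> R) : (forall i, exists a : k, F i = a%:P) ->
  exists a : k, \sum_(i <- r) F i = a%:P.
Proof.
move=> Fc; elim: r => [|i r [a IHr]]; first by exists 0; rewrite big_nil.
by have [b Fi] := Fc i; exists (b + a); rewrite big_cons IHr Fi polyCD.
Qed.

Lemma constant_coefs_sum I (r : seq I) (F : I -> mpoly #|{: J + J * J}| R) :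
  (forall i, constant_coefs (F i)) -> constant_coefs (\sum_(i <- r) F i).
Proof. by move=> Fc m; rewrite raddf_sum; apply: cst_sum => i; apply: Fc. Qed.

Lemma constant_coefsM (f g : mpoly #|{: J + J * J}| R) : constant_coefs f -> constant_coefs g ->
  constant_coefs (f * g).
Proof.
move=> fc gc m; rewrite mcoeffM big_mkcond /=; apply: cst_sum => i.
case: ifP => _; last by exists 0.
by have [[a ->] [b ->]] := (fc i.1, gc i.2); exists (a * b); rewrite polyCM.
Qed.

Lemma constant_coefsX m : constant_coefs 'X_[m].
Proof. by move=> m'; exists ((m == m')%:R); rewrite mcoeffX polyC_natr. Qed.

Lemma constant_coefs_gder P l (f : mpoly #|{: J + J * J}| R) : constant_coefs f -> constant_coefs (gder P l f).
Proof.
move=> fc; rewrite /gder big_mkcond; apply: constant_coefs_sum => j.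
case: ifP => _; last by move=> m; exists 0; rewrite mcoeff0.
apply: constant_coefsM; first exact: constant_coefsX.
have eL := @euler_linear R J j; rewrite [f]mpolyE (big_morph _ (linD eL) (lin0 eL)).
apply: constant_coefs_sum => m m'; rewrite (linZ eL) eulerX !mcoeffZ mcoeffX.
have [a ->] := fc m; exists (a * ((m (vidx j))%:R * (m == m')%:R)).
by rewrite !polyCM !polyC_natr.
Qed.

Let pre_constant x y i : (forall i, constant_coefs (x i)) ->
  (forall i, constant_coefs (y i)) -> constant_coefs ((x <~ y) i).
Proof.
move=> xc yc; rewrite graftE; apply: constant_coefs_sum => l.
by apply: constant_coefsM => //; apply: constant_coefs_gder.
Qed.

Lemma filt_constant e d x i : filt e d x -> constant_coefs (x i).
Proof.
move=> Fx; elim: Fx i => {e d x}.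
- move=> e j _ i; rewrite ffunE; case: eqP => _; first exact: constant_coefsX.
  by move=> m; exists 0; rewrite mcoeff0.
- move=> e f g a b c x y _ _ _ IHx _ IHy i m.
  rewrite ffunE mcoeffD; have [a' E1] := pre_constant i IHx IHy m.
  by have [b' E2] := pre_constant i IHy IHx m; exists (a' + b'); rewrite polyCD -E1 -E2.
- move=> e f g a b c x y _ _ _ IHx _ IHy i m.
  rewrite !ffunE mcoeffB; have [a' E1] := pre_constant i IHx IHy m.
  by have [b' E2] := pre_constant i IHy IHx m; exists (a' - b'); rewrite polyCB -E1 -E2 !graftE.
- by move=> e d i m; exists 0; rewrite ffunE mcoeff0.
- move=> e d x y _ IHx _ IHy i m; rewrite ffunE mcoeffD.
  by have [[a ->] [b ->]] := (IHx i m, IHy i m); exists (a + b); rewrite polyCD.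
- move=> e d c x _ IHx i m; rewrite ffunE mcoeffZ.
  by have [a ->] := IHx i m; exists (c * a); rewrite polyCM.
- by [].
Qed.

Section TreeField.
Variable p : J -> option J.

Definition edge_mnm (v : J) : 'X_{1..#|{: J + J * J}|} :=
  if p v is Some w then U_(eidx w v)%MM else 0%MM.

Definition tree_mnm (S : {set J}) : 'X_{1..#|{: J + J * J}|} :=
  (\sum_(v in S) (U_(vidx v) + edge_mnm v))%MM.

Definition tree_field (r : J) (S : {set J}) : L :=
  [ffun i => if i == r then 'X_[tree_mnm S] else 0].

Lemma tree_mnm_vertex S w : tree_mnm S (vidx w) = (w \in S).
Proof.
have vE v : ((U_(vidx v) + edge_mnm v)%MM (vidx w) = (v == w))%N.
  rewrite mnmDE mnm1E (inj_eq enum_rank_inj) (inj_eq (@inl_inj _ _)) /edge_mnm.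
  case: (p v) => [u|]; last by rewrite mnm0E addn0.
  by rewrite mnm1E (inj_eq enum_rank_inj) addn0.
rewrite /tree_mnm mnm_sumE; under eq_bigr do rewrite vE.
have [wS|wS] := boolP (w \in S).
  by rewrite (bigD1 w) //= eqxx big1 // => v /andP[_ /negPf->].
by rewrite big1 // => v vS; case: eqP => // vw; rewrite -vw vS in wS.
Qed.

Lemma tree_mnm_edge v w : tree_mnm setT (eidx w v) = (p v == Some w).
Proof.
have uE u : ((U_(vidx u) + edge_mnm u)%MM (eidx w v) =
    (p u == Some w) && (u == v))%N.
  rewrite mnmDE mnm1E (inj_eq enum_rank_inj) add0n /edge_mnm.
  case: (p u) => [u'|]; last by rewrite mnm0E.
  rewrite mnm1E (inj_eq enum_rank_inj) (inj_eq (@inr_inj _ _)) xpair_eqE.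
  by rewrite (inj_eq Some_inj).
rewrite /tree_mnm mnm_sumE; under eq_bigr do rewrite uE.
rewrite (bigD1 v) ?inE //= eqxx andbT big1 ?addn0 // => u /andP[_ /negPf ->].
by rewrite andbF.
Qed.

Lemma tree_field_graft r (S : {set J}) l w : l \notin S -> w \in S -> p l = Some w ->
  graft (pred1 w) (tree_field r S) (vertex l) = tree_field r (l |: S).
Proof.
move=> lS wS pl; apply/ffunP=> i; rewrite graftE (bigD1 l) //= big1 => [|l' l'l].
  rewrite !ffunE eqxx addr0; case: eqP => _; last by rewrite (lin0 (gder_linear _ _)) mulr0.
  rewrite /gder big_pred1_eq eulerX tree_mnm_vertex wS scale1r -!mpolyXD.
  rewrite /tree_mnm big_setU1 //= /edge_mnm pl.
  by congr ('X_[_]); rewrite addmA.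
by rewrite !ffunE (negPf l'l) mul0r.
Qed.

(** The tree grows from its root by grafting one vertex at a time below its parent. *)
Lemma filt_tree_step r n (S : {set J}) : (#|~: S| <= n)%N ->
  p r = None -> (forall v, connect (fun u w => p u == Some w) v r) -> r \in S ->
  filt (fun i => i \in S) 0 (tree_field r S) -> filt (fun=> 1%N) 0 (tree_field r setT).
Proof.
move=> + pr conn; elim: n S => [|n IHn] S leS rS FS.
  have ST : S = setT by apply/setP=> i; move: leS; rewrite leqn0 cards_eq0 => /eqP/setP/(_ i); rewrite !inE; case: (i \in S).
  by apply: filt_ext (_ : forall i, (i \in S : nat) = 1%N) _; rewrite -?ST // => i; rewrite ST inE.
have [/setP ST|] := eqVneq S setT.
  by apply: (IHn S) => //; rewrite (_ : ~: S = set0) ?cards0 //; apply/setP=> i; rewrite inE ST !inE.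
move=> ST; have [v vS] : exists v, v \notin S.
  apply/existsP; apply: contraNT ST; rewrite negb_exists => /forallP all_in.
  by apply/eqP/setP=> i; move: (all_in i); rewrite negbK inE.
(* The edge by which the path from [v] to the root first enters [S]. *)
have [u [w [uS wS pu]]] : exists u w, [/\ u \notin S, w \in S & p u = Some w].
  have /connectP[s ps rE] := conn v; rewrite rE in rS.
  elim: s v vS ps rS {rE} => [|w s IHs] v vS /=; first by move=> _; rewrite (negPf vS).
  case/andP=> /eqP vw ps ls; have [wS|wS] := boolP (w \in S); first by exists v, w.
  exact: IHs ps ls.
apply: (IHn (u |: S)).
- have := cardsC S; have := cardsC (u |: S); rewrite cardsU1 uS; lia.
- by rewrite inE rS orbT.
rewrite -(tree_field_graft r uS wS pu).
apply: (filt_graft (pred1 w) _ FS (filt_vertex (e := fun i => (i == u)) _)) => // i.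
by rewrite !inE; case: eqP => [->|_]; rewrite ?(negPf uS) ?addn0.
Qed.

Lemma filt_tree r : p r = None ->
  (forall v, connect (fun u w => p u == Some w) v r) ->
  filt (fun=> 1%N) 0 (tree_field r setT).
Proof.
move=> pr conn; apply: (filt_tree_step (leqnn _) pr conn (set11 r)).
have -> : tree_field r [set r] = vertex r.
  apply/ffunP=> i; rewrite !ffunE; case: eqP => // _.
  by rewrite /tree_mnm big_set1 /edge_mnm pr addm0.
by apply: filt_vertex => i; rewrite inE.
Qed.
End TreeField.
End Filtration.

(* Unification would otherwise unfold these and diverge. *)
#[local] Opaque graft pcirc pbr brace leib.

(** * The Rees module of the bracket filtration *)

Section Rees.
Variables (k : fieldType) (J : finType).
Hypothesis char0 : [pchar k] =i pred0.
Local Notation R := {poly k}.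
Local Notation L := (field R J).
Local Notation FP := (FMan_presentation k).
Local Notation pre := (@graft R J xpredT).
Local Notation "x <~ y" := (pre x y) (at level 40, left associativity).
Local Notation "x ** y" := (pcirc pre x y) (at level 40, left associativity).
Local Notation "{[ x , y ]}" := (pbr pre x y).
Local Notation pl := (@graft_linl R J xpredT).
Local Notation pr := (@graft_linr R J xpredT).
Implicit Types (x y z : L) (e f g : J -> nat).

Local Notation vert := (@vertex k J).

Let pG x y z : x <~ z <~ y = x <~ y <~ z - x <~ (y <~ z) + x <~ (z <~ y).
Proof. exact: graft_graft. Qed.

(** The sum of the 'X^d F_d for the decreasing filtration F. Its quotient by the elements [z] with
    ['X *: z] in it is the sum of the F_d / F_(d+1), so membership of ['X *: (x - y)] is equality in
    the associated graded space. *)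
Inductive rees e : L -> Prop :=
| rees_gen d x : filt e d x -> rees e ('X^d *: x)
| rees0 : rees e 0
| reesD x y : rees e x -> rees e y -> rees e (x + y).

Lemma reesZ e c x : rees e x -> rees e (c%:P *: x).
Proof.
elim=> {x} [d x Fx||x y _ IHx _ IHy].
- by rewrite scalerA mulrC -scalerA; apply/rees_gen/filtZ.
- by rewrite scaler0; apply: rees0.
- by rewrite scalerDr; apply: reesD.
Qed.

Lemma reesN e x : rees e x -> rees e (- x).
Proof. by move=> Gx; rewrite -scaleN1r -[-1]polyCN; apply: reesZ. Qed.

Lemma reesB e x y : rees e x -> rees e y -> rees e (x - y).
Proof. by move=> Gx Gy; apply: reesD => //; apply: reesN. Qed.

Lemma rees_ext e f x : (forall i, e i = f i) -> rees e x -> rees f x.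
Proof.
move=> ef; elim=> {x} [d x Fx||x y _ IHx _ IHy].
- by apply: rees_gen; apply: filt_ext Fx.
- exact: rees0.
- exact: reesD.
Qed.

Let rees_bilin (op : L -> L -> L) n e f g x y :
  (forall z, linear (fun x => op x z)) -> (forall z, linear (op z)) ->
  (forall a b x y, filt e a x -> filt f b y -> filt g (n + (a + b)) (op x y)) ->
  rees e x -> rees f y -> rees g ('X^n *: op x y).
Proof.
move=> ll lr Fop Gx Gy; elim: Gx => {x} [a x Fx||x x' _ IHx _ IHx'].
- elim: Gy => {y} [b y Fy||y y' _ IHy _ IHy'].
  + rewrite (linZ (ll _)) (linZ (lr _)) !scalerA -!exprD -?addnA.
    exact/rees_gen/Fop.
  + by rewrite (lin0 (lr _)) scaler0; apply: rees0.
  + by rewrite (linD (lr _)) scalerDr; apply: reesD.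
- by rewrite (lin0 (ll _)) scaler0; apply: rees0.
- by rewrite (linD (ll _)) scalerDr; apply: reesD.
Qed.

Lemma rees_circ e f g x y : (forall i, g i = e i + f i)%N ->
  rees e x -> rees f y -> rees g (x ** y).
Proof.
move=> gE Gx Gy; rewrite -[_ ** _]scale1r -[1](expr0 'X).
apply: rees_bilin Gx Gy; [exact: (pcirc_linl pl pr)|exact: (pcirc_linr pl pr)|].
by move=> a b x' y' Fx Fy; apply: filt_circ Fx Fy.
Qed.

Lemma rees_pre e f g x y : (forall i, g i = e i + f i)%N ->
  rees e x -> rees f y -> rees g (x <~ y).
Proof.
move=> gE Gx Gy; rewrite -[_ <~ _]scale1r -[1](expr0 'X).
apply: rees_bilin Gx Gy; [exact: pl|exact: pr|].
by move=> a b x' y' Fx Fy; apply: (filt_pre char0) Fx Fy.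
Qed.

Lemma rees_br e f g x y : (forall i, g i = e i + f i)%N ->
  rees e x -> rees f y -> rees g ('X *: {[x, y]}).
Proof.
move=> gE Gx Gy; rewrite -['X]expr1.
apply: rees_bilin Gx Gy; [exact: (pbr_linl pl pr)|exact: (pbr_linr pl pr)|].
by move=> a b x' y' Fx Fy; apply: filt_br Fx Fy.
Qed.

Local Notation br x y := ('X *: {[x, y]}).

(** The commutators provided by [pcirc_assoc] and [braceE] absorb the factor 'X. *)
Lemma rees_assoc e f g h x y z : (forall i, h i = e i + f i + g i)%N ->
  rees e x -> rees f y -> rees g z -> rees h ('X *: (x ** y ** z - x ** (y ** z))).
Proof.
have Gbrace e' f' g' x' y' z' : (forall i, h i = e' i + f' i + g' i)%N ->
    rees e' x' -> rees f' y' -> rees g' z' -> rees h ('X *: brace pre x' y' z').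
  move=> hE Gx Gy Gz; rewrite (braceE pl pr pG).
  have E (c : R) (u v s : L) : c *: (u + v - s) = c *: u + c *: v - c *: s.
    by rewrite scalerBr scalerDr.
  rewrite E -(linZ (pl _)) -(linZ (pr _)); apply: reesB; first apply: reesD.
  - by apply: (rees_pre (e := fun i => (e' i + f' i)%N) _ _ Gz); [|exact: rees_br Gx Gy].
  - apply: (rees_pre (f := fun i => (e' i + g' i)%N) _ Gy); last exact: rees_br Gx Gz.
    by move=> i; rewrite hE; lia.
  - apply: (rees_br (f := fun i => (f' i + g' i)%N) _ Gx); last exact: rees_pre Gy Gz.
    by move=> i; rewrite hE; lia.
move=> hE Gx Gy Gz; rewrite (pcirc_assoc pl pr pG).
have E (c : R) (u v s t : L) : c *: (2%:R *: u - 2%:R *: v + s - t) =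
    (c *: u + c *: u) - (c *: v + c *: v) + c *: s - c *: t.
  by rewrite !scaler_nat !mulr2n !(scalerBr, scalerDr).
rewrite E -(linZ (pr y) 'X {[x, z]}) -(linZ (pl y) 'X {[x, z]}).
have G1 := Gbrace _ _ _ _ _ _ hE Gx Gy Gz.
have hE2 i : (h i = g i + e i + f i)%N by rewrite hE; lia.
have G2 := Gbrace _ _ _ _ _ _ hE2 Gz Gx Gy.
have Gxz : rees (fun i => (e i + g i)%N) (br x z) by exact: rees_br Gx Gz.
apply: (reesB (reesD (reesB (reesD G1 G1) (reesD G2 G2)) _) _).
- by apply: (rees_pre _ Gy Gxz) => i; rewrite hE; lia.
- by apply: (rees_pre _ Gxz Gy) => i; rewrite hE; lia.
Qed.

Lemma rees_leib e f g h x y z : (forall i, h i = e i + f i + g i)%N ->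
  rees e x -> rees f y -> rees g z -> rees h ('X *: leib pre x y z).
Proof.
move=> hE Gx Gy Gz; rewrite [leib _ _ _ _]/(_ - _ - _).
have E (c : R) (u v s : L) : c *: (u - v - s) = c *: u - c *: v - c *: s.
  by rewrite !scalerBr.
rewrite E -(linZ (pcirc_linl pl pr z) 'X {[x, y]}) -(linZ (pcirc_linr pl pr y) 'X {[x, z]}).
apply: reesB; first apply: reesB.
- apply: (rees_br (f := fun i => (f i + g i)%N) _ Gx); last exact: rees_circ Gy Gz.
  by move=> i; rewrite hE; lia.
- by apply: (rees_circ (e := fun i => (e i + f i)%N) _ _ Gz); [|exact: rees_br Gx Gy].
- apply: (rees_circ (f := fun i => (e i + g i)%N) _ Gy); last exact: rees_br Gx Gz.
  by move=> i; rewrite hE; lia.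
Qed.

(** Of the two factors 'X in front of a [leib] term, one goes to the commutator inside it and the
    other to [leib] itself, by [rees_leib]. *)
Lemma rees_HM e1 e2 e3 e4 h x w y z : (forall i, h i = e1 i + e2 i + e3 i + e4 i)%N ->
  rees e1 x -> rees e2 w -> rees e3 y -> rees e4 z ->
  rees h ('X *: (br (x ** w) (y ** z) -
    (br (x ** w) y ** z + br (x ** w) z ** y + x ** br w (y ** z) + w ** br x (y ** z)
     - (x ** y) ** br w z - (w ** y) ** br x z - (w ** z) ** br x y - (x ** z) ** br w y))).
Proof.
move=> hE Gx Gw Gy Gz; set D := _ - _.
have DE := HM_defect pl pr pG 'X x w y z; rewrite /= in DE; rewrite /D {D}DE.
have Gsum (u a b s t : L) : rees h ('X *: u) -> rees h ('X *: a) -> rees h ('X *: b) ->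
    rees h ('X *: s) -> rees h ('X *: t) -> rees h ('X *: (u + a + b + s + t)).
  by move=> *; rewrite !scalerDr; do 4![apply: reesD => //].
have Gsum4 (c : R) (a b s t : L) : rees h ('X *: (c *: a)) -> rees h ('X *: (c *: b)) ->
    rees h ('X *: (c *: s)) -> rees h ('X *: (c *: t)) ->
    rees h ('X *: (c *: (a + b + s + t))).
  by move=> *; rewrite !scalerDr; do 3![apply: reesD => //].
have Gbr e e' g a b : (forall i, g i = e i + e' i)%N -> rees e a -> rees e' b ->
  rees g (br a b) by exact: rees_br.
have lZ a b c d : 'X *: leib pre a {[b, c]} d = leib pre a (br b c) d.
  by rewrite (leibZr pl pr).
have Gwy : rees (fun i => e2 i + e3 i)%N (br w y) by exact: Gbr Gw Gy.
have Gwz : rees (fun i => e2 i + e4 i)%N (br w z) by exact: Gbr Gw Gz.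
have Gxy : rees (fun i => e1 i + e3 i)%N (br x y) by exact: Gbr Gx Gy.
have Gxz : rees (fun i => e1 i + e4 i)%N (br x z) by exact: Gbr Gx Gz.
have Gleib e e' e'' a b c d : (forall i, h i = e i + e' i + e'' i)%N -> rees e a ->
    rees e' (br b c) -> rees e'' d -> rees h ('X *: ('X *: leib pre a {[b, c]} d)).
  by move=> hE' Ga Gbc Gd; rewrite lZ; apply: rees_leib hE' Ga Gbc Gd.
apply: Gsum.
- apply: Gsum4.
  + by apply: (Gleib _ _ _ _ _ _ _ _ Gx Gwy Gz) => i; rewrite hE; lia.
  + by apply: (Gleib _ _ _ _ _ _ _ _ Gx Gwz Gy) => i; rewrite hE; lia.
  + by apply: (Gleib _ _ _ _ _ _ _ _ Gw Gxy Gz) => i; rewrite hE; lia.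
  + by apply: (Gleib _ _ _ _ _ _ _ _ Gw Gxz Gy) => i; rewrite hE; lia.
- by apply: (rees_assoc _ Gx Gz Gwy) => i; rewrite hE; lia.
- by apply: (rees_assoc _ Gx Gy Gwz) => i; rewrite hE; lia.
- by apply: (rees_assoc _ Gw Gz Gxy) => i; rewrite hE; lia.
- by apply: (rees_assoc _ Gw Gy Gxz) => i; rewrite hE; lia.
Qed.

(** The factor 'X makes a monomial with d brackets land in 'X^d F_d. *)
Definition ev_op (o : FMan_op) : L -> L -> L :=
  match o with
  | FMan_product => pcirc pre
  | FMan_bracket => fun x y => 'X *: {[x, y]}
  end.

Fixpoint ev (I : Type) (x : I -> L) (t : expr k (pr_ops FP) I) : L :=
  match t with
  | EVar i => x i
  | EOp o t u => ev_op o (ev x t) (ev x u)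
  | EZero => 0
  | EAdd t u => ev x t + ev x u
  | EScale a t => a%:P *: ev x t
  end.

Lemma ev_bind (I I' : Type) (x : I' -> L) (s : I -> expr k _ I') t :
  ev x (ebind t s) = ev (fun i => ev x (s i)) t.
Proof. by elim: t => //= [o t -> u ->|t -> u ->|a t ->]. Qed.

Lemma ev_op_linl o y : linear (fun x => ev_op o x y).
Proof.
case: o => a u v /=; first exact: (pcirc_linl pl pr).
by rewrite (pbr_linl pl pr) scalerDr !scalerA mulrC.
Qed.

Lemma ev_op_linr o x : linear (ev_op o x).
Proof.
case: o => a u v /=; first exact: (pcirc_linr pl pr).
by rewrite (pbr_linr pl pr) scalerDr !scalerA mulrC.
Qed.

Lemma rees_op o e f g x y : (forall i, g i = e i + f i)%N ->
  rees e x -> rees f y -> rees g (ev_op o x y).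
Proof. by case: o; [apply: rees_circ|apply: rees_br]. Qed.

Let ind (A : {set J}) (j : J) : nat := j \in A.

Let indU (A B : {set J}) j : [disjoint A & B] -> (ind (A :|: B) j = ind A j + ind B j)%N.
Proof.
move=> AB; rewrite /ind inE; have [jA|//] := boolP (j \in A).
by rewrite (disjointFr AB jA).
Qed.

Lemma ind_bigcup n (D : 'I_n -> {set J}) j :
  (forall i i', i != i' -> [disjoint D i & D i']) ->
  ind (\bigcup_i D i) j = (\sum_i ind (D i) j)%N.
Proof.
move=> disjD; rewrite /ind; have [/bigcupP[i _ ji]|jD] := boolP (_ \in _).
  rewrite (bigD1 i) //= ji big1 // => i' i'i.
  by rewrite (disjointFl (disjD i' i i'i) ji).
rewrite big1 // => i _; apply/eqP; rewrite eqb0.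
by apply: contra jD => ji; apply/bigcupP; exists i.
Qed.

Lemma ev_rees A t : multilinear A t -> rees (ind A) (ev vert t).
Proof.
elim=> {A t} /= [j|o A B t u AB _ IHt _ IHu|A|A t u _ IHt _ IHu|A a t _ IHt].
- rewrite -[vertex _ j]scale1r -[1](expr0 'X); apply: rees_gen.
  by apply: filt_vertex => i; rewrite /ind inE.
- by apply: rees_op IHt IHu => j; apply: indU.
- exact: rees0.
- exact: reesD.
- exact: reesZ.
Qed.

Let sumI3 (F : 'I_3 -> nat) : (\sum_i F i = F (@Ordinal 3 0 isT) +
  F (@Ordinal 3 1 isT) + F (@Ordinal 3 2 isT))%N.
Proof.
rewrite !big_ord_recl big_ord0 addn0 addnA.
by congr (F _ + F _ + F _)%N; apply: val_inj.
Qed.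

Let sumI4 (F : 'I_4 -> nat) : (\sum_i F i = F (@Ordinal 4 0 isT) +
  F (@Ordinal 4 1 isT) + F (@Ordinal 4 2 isT) + F (@Ordinal 4 3 isT))%N.
Proof.
rewrite !big_ord_recl big_ord0 addn0 !addnA.
by congr (F _ + F _ + F _ + F _)%N; apply: val_inj.
Qed.

Let scaleN1P x : (-1)%:P *: x = - x.
Proof. by rewrite polyCN scaleN1r. Qed.

Lemma ev_rel (r : FMan_relation) (D : 'I_(id_arity (FMan_identity k r)) -> {set J})
    (x : 'I_(id_arity (FMan_identity k r)) -> L) :
  (forall i j, i != j -> [disjoint D i & D j]) ->
  (forall i, rees (ind (D i)) (x i)) ->
  rees (ind (\bigcup_i D i))
    ('X *: (ev x (id_lhs (FMan_identity k r)) - ev x (id_rhs (FMan_identity k r)))).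
Proof.
move=> disjD Gx; have DE j := ind_bigcup j disjD.
case: r D x disjD Gx DE => /= D x disjD Gx DE.
- rewrite (_ : _ - _ = 0) ?scaler0; first exact: rees0.
  by rewrite [X in _ - X]addrC subrr.
- by apply: (rees_assoc _ (Gx _) (Gx _) (Gx _)) => i; rewrite DE sumI3.
- rewrite (_ : _ - _ = 0) ?scaler0; first exact: rees0.
  by rewrite scaleN1P opprK -scalerDr pbrC addNr scaler0.
- rewrite (_ : _ - _ = 0) ?scaler0; first exact: rees0.
  by rewrite subr0 (pbr_scaled_jacobi pl pr pG).
- have E (c : R) (u a1 a2 a3 a4 b1 b2 b3 b4 : L) :
      rees (ind (\bigcup_i D i)) (c *: (u - (a1 + a2 + a3 + a4 - b1 - b2 - b3 - b4))) ->
      rees (ind (\bigcup_i D i)) (c *: (u - (a1 + a2 + a3 + a4 + (-1)%:P *: b1 +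
        (-1)%:P *: b2 + (-1)%:P *: b3 + (-1)%:P *: b4))) by rewrite !scaleN1P.
  apply: E.
  by apply: (rees_HM _ (Gx _) (Gx _) (Gx _) (Gx _)) => i; rewrite DE sumI4.
Qed.

(** Evaluation is well defined only in the associated graded space: the relations hold up to deeper
    terms, and the operations preserve such differences. *)
Lemma ev_econg A t u : @econg k FP J A t u ->
  rees (ind A) ('X *: (ev vert t - ev vert u)).
Proof.
have zero (B : {set J}) x y : x = y -> rees (ind B) ('X *: (x - y)).
  by move=> ->; rewrite subrr scaler0; apply: rees0.
elim=> {A t u} /=.
- move=> r D s disjD Ds; rewrite !ev_bind; apply: (ev_rel disjD) => i.
  exact: ev_rees.
- move=> o A B t t' u u' AB tt' Gt uu' Gu.
  have [[_ At'] [Bu _]] := (econg_ml tt', econg_ml uu').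
  rewrite (_ : _ - _ = ev_op o (ev vert t - ev vert t') (ev vert u) +
    ev_op o (ev vert t') (ev vert u - ev vert u')); last first.
    by rewrite (linB (ev_op_linl o _)) (linB (ev_op_linr o _)) addrA subrK.
  rewrite scalerDr -(linZ (ev_op_linl o _)) -(linZ (ev_op_linr o _)).
  apply: reesD; first exact: (rees_op o (fun j => indU j AB) Gt (ev_rees Bu)).
  exact: (rees_op o (fun j => indU j AB) (ev_rees At') Gu).
- by move=> o A B t t' u *; apply: zero; rewrite (linD (ev_op_linl o _)).
- by move=> o A B t u u' *; apply: zero; rewrite (linD (ev_op_linr o _)).
- by move=> o A B a t u *; apply: zero; rewrite (linZ (ev_op_linl o _)).
- by move=> o A B a t u *; apply: zero; rewrite (linZ (ev_op_linr o _)).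
- by move=> A t _; apply: zero.
- by move=> A t u _ Gtu; have := reesN Gtu; rewrite -scalerN opprB.
- move=> A t u v _ Gtu _ Guv; rewrite -(subrK (ev vert u) (ev vert t)) -addrA scalerDr.
  exact: reesD.
- move=> A t t' u u' _ Gt _ Gu; rewrite opprD addrACA scalerDr; exact: reesD.
- move=> A a t t' _ Gt; rewrite -scalerBr scalerA mulrC -scalerA; exact: reesZ.
- by move=> A t u v *; apply: zero; rewrite addrA.
- by move=> A t u *; apply: zero; rewrite addrC.
- by move=> A t *; apply: zero; rewrite add0r.
- by move=> A t *; apply: zero; rewrite scaleN1P addNr.
- by move=> A a b t *; apply: zero; rewrite scalerA -polyCM.
- by move=> A t *; apply: zero; rewrite polyC1 scale1r.
- by move=> A a t u *; apply: zero; rewrite scalerDr.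
- by move=> A a b t *; apply: zero; rewrite polyCD scalerDl.
Qed.

Let split_ind e f g A : (forall j, g j = e j + f j)%N -> (forall j, g j = ind A j) ->
  exists B C, [/\ A = B :|: C, [disjoint B & C], forall j, e j = ind B j &
    forall j, f j = ind C j].
Proof.
move=> gE gA; exists [set j | e j == 1%N], [set j | f j == 1%N].
have le1 j : (e j + f j <= 1)%N by rewrite -gE gA leq_b1.
split.
- apply/setP=> j; rewrite !inE; have := gA j; have := le1 j; rewrite gE /ind.
  by case: (j \in A); case: (e j) (f j) => [|[|?]] [|[|?]].
- apply/pred0P=> j /=; rewrite !inE; apply/negP=> /andP[/eqP ej /eqP fj].
  by have := le1 j; rewrite ej fj.
- by move=> j; rewrite /ind inE; have := le1 j; case: (e j) => [|[|?]].
- by move=> j; rewrite /ind inE; have := le1 j; case: (e j) (f j) => [|[|?]] [|[|?]].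
Qed.

Let subDr (a b c : L) : a - b - c = a - (c + b).
Proof. by rewrite opprD addrA addrAC. Qed.

(** The monomials of [t] have exactly d brackets; [y] collects what lies deeper in the
    filtration. *)
Lemma filt_expr e d x (A : {set J}) : filt e d x -> (forall j, e j = ind A j) ->
  exists t y, [/\ multilinear A t, filt e d.+1 y & ev vert t = 'X^d *: (x - y)].
Proof.
move=> Fx; elim: Fx A => {e d x}.
- move=> e j ej A eA; exists (EVar j), 0; split; last by rewrite subr0 scale1r.
    suff -> : A = [set j] by apply: ml_var.
    apply/setP=> i; rewrite inE; have := eA i; rewrite ej /ind.
    by case: (i == j); case: (i \in A).
  exact: filt0.
- move=> e f g a b c x y gE -> Fx IHx Fy IHy A gA.
  have [B [C [AE BC eB fC]]] := split_ind gE gA.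
  have [t [x' [Bt Fx' tE]]] := IHx B eB; have [u [y' [Cu Fy' uE]]] := IHy C fC.
  exists (EOp FMan_product t u), (x' ** (y - y') + x ** y'); split.
  + by rewrite AE; apply: ml_op.
  + apply: filtD; last by apply: filt_circ Fx Fy' => //; rewrite addnS.
    by apply: filt_circ Fx' (filtD Fy (filtN (filt_weak Fy'))) => //; rewrite addSn.
  rewrite /= tE uE (linZ (pcirc_linl pl pr _)) (linZ (pcirc_linr pl pr _)) scalerA -exprD.
  congr (_ *: _); rewrite (linB (pcirc_linl pl pr _)) (linB (pcirc_linr pl pr x)).
  exact: subDr.
- move=> e f g a b c x y gE -> Fx IHx Fy IHy A gA.
  have [B [C [AE BC eB fC]]] := split_ind gE gA.
  have [t [x' [Bt Fx' tE]]] := IHx B eB; have [u [y' [Cu Fy' uE]]] := IHy C fC.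
  exists (EOp FMan_bracket t u), ({[x', y - y']} + {[x, y']}); split.
  + by rewrite AE; apply: ml_op.
  + apply: filtD; last by apply: filt_br Fx Fy' => //; rewrite addnS.
    by apply: filt_br Fx' (filtD Fy (filtN (filt_weak Fy'))) => //; rewrite addSn.
  rewrite /= tE uE (linZ (pbr_linl pl pr _)) (linZ (pbr_linr pl pr _)) !scalerA.
  rewrite -?mulrA -exprD -exprS.
  congr (_ *: _); rewrite (linB (pbr_linl pl pr _)) (linB (pbr_linr pl pr x)).
  exact: subDr.
- by move=> e d A _; exists EZero, 0; split; [exact: ml_zero|exact: filt0|rewrite subr0 scaler0].
- move=> e d x y _ IHx _ IHy A eA.
  have [t [x' [At Fx' tE]]] := IHx A eA; have [u [y' [Au Fy' uE]]] := IHy A eA.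
  exists (EAdd t u), (x' + y'); split; [exact: ml_add|exact: filtD|].
  by rewrite /= tE uE -scalerDr opprD addrACA.
- move=> e d c x _ IHx A eA; have [t [x' [At Fx' tE]]] := IHx A eA.
  exists (EScale c t), (c%:P *: x'); split; [exact: ml_scale|exact: filtZ|].
  by rewrite /= tE scalerA mulrC -scalerA scalerBr.
- move=> e d x Fx _ A _; exists EZero, x; split; [exact: ml_zero|exact: Fx|].
  by rewrite subrr scaler0.
Qed.
End Rees.

(** A subspace inside [S] is enlarged by vectors of [S] as long as there are any outside it; its
    codimension bounds the number of steps. *)
Lemma subspace_vspace (k : fieldType) (V : vectType k) (S : V -> Prop) :
  subspace S -> exists U : {vspace V}, forall v, S v <-> v \in U.
Proof.
move=> subS.
suff max n (U : {vspace V}) : (\dim {:V} - \dim U <= n)%N ->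
    (forall v, v \in U -> S v) -> exists U : {vspace V}, forall v, S v <-> v \in U.
  apply: (max _ 0%VS (leqnn _)) => v; rewrite memv0 => /eqP ->; exact: sub0.
elim: n U => [|n IHn] U dU US.
  have UT : U = fullv.
    by apply/eqP; rewrite eqEdim subvf /= -subn_eq0 -leqn0.
  by exists U => v; split=> [_|/US//]; rewrite UT memvf.
have [SU|/existsNP[v /not_implyP[Sv /negP vU]]] := pselect (forall v, S v -> v \in U).
  by exists U => v; split; [apply: SU|apply: US].
apply: (IHn (U + <[v]>)%VS) => [|w /memv_addP[u uU [w' /vlineP[a ->] ->]]].
  have lt : (\dim U < \dim (U + <[v]>))%N.
    rewrite ltn_neqAle dimvS ?addvSl // andbT; apply: contra vU => dE.
    have /eqP UE : (U == U + <[v]>)%VS by rewrite eqEdim addvSl /= (eqP dE).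
    by rewrite UE; apply: (subvP (addvSr U <[v]>)); apply: memv_line.
  have := dimvS (subvf (U + <[v]>)%VS); lia.
by apply: subD (US _ uU) _ => //; apply: subZ.
Qed.

(** * The lower bound by rooted trees: symbols in the associated graded space *)

Section LowerBound.
Variables (k : fieldType) (J : finType).
Hypothesis char0 : [pchar k] =i pred0.
Local Notation L := (field {poly k} J).
Local Notation FP := (FMan_presentation k).
Local Notation vert := (@vertex k J).
Local Notation one := ((fun=> 1%N) : J -> nat).

Definition rooted_trees : finType := {p : {ffun J -> option J} | is_rooted_tree p}.

Definition tree_root (p : rooted_trees) : J := xchoose (existsP (svalP p)).

Definition parent (p : rooted_trees) : J -> option J := sval p.

Lemma parent_inj (p q : rooted_trees) : parent p =1 parent q -> p = q.
Proof. by move=> pq; apply: val_inj; apply/ffunP. Qed.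

Lemma tree_rootE (p : rooted_trees) : parent p (tree_root p) = None.
Proof. by have /andP[/eqP] := xchooseP (existsP (svalP p)). Qed.

Lemma tree_root_connect (p : rooted_trees) v :
  connect (fun u w => parent p u == Some w) v (tree_root p).
Proof. by have /andP[_ /forallP] := xchooseP (existsP (svalP p)). Qed.

(** Only the coordinates at tree monomials are kept: there the tree fields become a basis
    ([tree_coefs_field]). *)
Definition tree_coefs (d : nat) (x : L) : {ffun rooted_trees -> k^o} :=
  [ffun p => ((x (tree_root p))@_(tree_mnm (parent p) setT))`_d].

Lemma tree_coefs_lin d c (x y : L) :
  tree_coefs d (c%:P *: x + y) = c *: tree_coefs d x + tree_coefs d y.
Proof. by apply/ffunP=> p; rewrite !ffunE mcoeffD mcoeffZ coefD coefCM. Qed.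

Lemma tree_coefs0 d : tree_coefs d 0 = 0.
Proof. by apply/ffunP=> p; rewrite !ffunE mcoeff0 coef0. Qed.

Lemma tree_coefsD d (x y : L) : tree_coefs d (x + y) = tree_coefs d x + tree_coefs d y.
Proof. by have := tree_coefs_lin d 1 x y; rewrite polyC1 !scale1r. Qed.

Lemma tree_coefsZ d c (x : L) : tree_coefs d (c%:P *: x) = c *: tree_coefs d x.
Proof. by have := tree_coefs_lin d c x 0; rewrite tree_coefs0 !addr0. Qed.

Lemma tree_coefsB d (x y : L) : tree_coefs d (x - y) = tree_coefs d x - tree_coefs d y.
Proof. by rewrite tree_coefsD -[in LHS]scaleN1r -polyCN tree_coefsZ scaleN1r. Qed.

Lemma tree_coefsX d (x : L) : tree_coefs d.+1 ('X *: x) = tree_coefs d x.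
Proof. by apply/ffunP=> p; rewrite !ffunE mcoeffZ coefXM. Qed.

Lemma tree_coefs_filt e d n x : filt e d x ->
  tree_coefs n ('X^d *: x) = if n == d then tree_coefs 0 x else 0.
Proof.
move=> Fx; apply/ffunP=> p; rewrite !ffunE mcoeffZ coefXnM.
have [a aE] := filt_constant (tree_root p) Fx (tree_mnm (parent p) setT).
have xE m : (x (tree_root p))@_(tree_mnm (parent p) setT)`_m = if m == 0%N then a else 0.
  by rewrite aE coefC.
rewrite xE; case: ltngtP => [nd|dn|->].
- by rewrite ffunE.
- by rewrite ffunE subn_eq0 leqNgt dn.
- by rewrite subnn !ffunE xE.
Qed.

Lemma tree_coefs_field (p : rooted_trees) : tree_coefs 0 (tree_field k (parent p) (tree_root p) setT) =
  [ffun q => (q == p)%:R].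
Proof.
apply/ffunP=> q; rewrite !ffunE; have [->|qp] := eqVneq q p.
  by rewrite eqxx mcoeffX eqxx coef1.
case: eqP => [_|]; last by rewrite mcoeff0 coef0.
rewrite mcoeffX; case: eqP => [mE|]; last by rewrite coef0.
case/eqP: qp; apply: parent_inj => v.
have E w : (parent q v == Some w) = (parent p v == Some w).
  have : (parent q v == Some w) = (parent p v == Some w) :> nat.
    by rewrite -!tree_mnm_edge mE.
  by case: (parent q v == _); case: (parent p v == _).
case Eq: (parent q v) => [w|].
  by have := E w; rewrite Eq eqxx => /esym/eqP ->.
by case Ep: (parent p v) => [w|//]; have := E w; rewrite Eq Ep eqxx.
Qed.

Local Notation W := {ffun rooted_trees -> k^o}.

Lemma tree_coefs_filt_subspace d :
  subspace (fun w : W => exists2 x, filt one d x & w = tree_coefs 0 x).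
Proof.
split=> [|_ _ [x Fx ->] [y Fy ->]|a _ [x Fx ->]].
- by exists 0; [apply: filt0|rewrite tree_coefs0].
- by exists (x + y); [apply: filtD|rewrite tree_coefsD].
- by exists (a%:P *: x); [apply: filtZ|rewrite tree_coefsZ].
Qed.

Section Flag.
Variable U : nat -> {vspace W}.
Hypothesis UE : forall d w, (exists2 x, filt one d x & w = tree_coefs 0 x) <-> w \in U d.

Lemma flag_rees d x : rees one x -> tree_coefs d x \in U d.
Proof.
elim=> {x} [n x Fx||x y _ IHx _ IHy].
- rewrite (tree_coefs_filt _ Fx); case: eqP Fx => [<- Fx|_ _]; last exact: mem0v.
  by apply/UE; exists x.
- by rewrite tree_coefs0 mem0v.
- by rewrite tree_coefsD memvD.
Qed.

Lemma flag_top w : w \in U 0.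
Proof.
have delta p : [ffun q => (q == p)%:R] \in U 0.
  apply/UE; exists (tree_field k (parent p) (tree_root p) setT).
    exact: (filt_tree char0 (tree_rootE p) (tree_root_connect p)).
  by rewrite tree_coefs_field.
have -> : w = \sum_p w p *: ([ffun q => (q == p)%:R] : W).
  apply/ffunP=> q; rewrite sum_ffunE (bigD1 q) //= big1 => [|p pq]; rewrite !ffunE.
    by rewrite eqxx addr0 [_ *: _]mulr1.
  by rewrite eq_sym (negPf pq) [_ *: _]mulr0.
by apply: rpred_sum => p _; apply: memvZ.
Qed.

Lemma flag_bottom w : w \in U #|J| -> w = 0.
Proof.
move/UE=> [x Fx ->]; rewrite (filt_big _ Fx) ?tree_coefs0 //.
by rewrite sum_nat_const muln1.
Qed.

(** The class modulo [U d.+1], represented in the complement on which [projv (U d.+1)] vanishes, so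
    that no quotient space is formed. *)
Definition symbol d (c : FMan k J) : W :=
  let w := tree_coefs d (ev vert (mrepr c)) in w - projv (U d.+1) w.

(** Congruent expressions differ by an element that ['X] carries into [rees], so their coefficients
    in degree d differ by an element of [U d.+1]. *)
Lemma symbol_class d t (Jt : multilinear [set: J] t) :
  symbol d (mclass (R := FP) Jt) =
  tree_coefs d (ev vert t) - projv (U d.+1) (tree_coefs d (ev vert t)).
Proof.
rewrite /symbol; set u := tree_coefs d _; set w := tree_coefs d _.
have uw : u - w \in U d.+1.
  rewrite -tree_coefsB -tree_coefsX; apply: flag_rees.
  by apply: rees_ext (ev_econg char0 (mrepr_class Jt)) => j; rewrite inE.
by rewrite -[u](subrK w) linearD /= (projv_id uw) opprD addrACA subrr add0r.
Qed.

Lemma symbol_linear d : linear (symbol d).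
Proof.
move=> a; elim/mclass_ind=> t Jt; elim/mclass_ind=> u Ju.
rewrite mclassZ mclassD !symbol_class /= tree_coefs_lin.
by rewrite linearP /= scalerBr opprD addrACA.
Qed.

(** The expression given by [filt_expr] has its value in a single power of 'X, hence no symbol
    outside degree [d]. *)
Lemma symbol_onto d w : w \in U d -> exists c, forall e,
  symbol e c = if e == d then w - projv (U d.+1) w else 0.
Proof.
move/UE=> [x Fx wE].
have [|t [y [Jt Fy tE]]] := @filt_expr k J _ _ _ [set: J] Fx.
  by move=> j; rewrite inE.
exists (mclass (R := FP) Jt) => e; rewrite symbol_class tE.
have Fxy : filt one d (x - y) by apply: filtD Fx (filtN (filt_weak Fy)).
rewrite (tree_coefs_filt _ Fxy); case: eqP => [->|_]; last by rewrite linear0 subrr.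
have yU : tree_coefs 0 y \in U d.+1 by apply/UE; exists y.
rewrite tree_coefsB -wE linearB /= (projv_id yU) opprB addrA.
by rewrite subrK.
Qed.

Variables (I : finType) (g : I -> FMan k J).
Hypothesis gspan : forall c, exists a : I -> k, c = \sum_i a i *: g i.
Hypothesis cardI : (#|I| <= #|rooted_trees|)%N.

(** The symbols in all degrees form a linear map [X] on [FMan k J]. The image of [X], spanned by the
    images of the [g i], is sent onto [W] by summation over the degrees, so its dimension is at
    least the number of rooted trees. *)
Lemma flag_independent (a : I -> k) : \sum_i a i *: g i = 0 -> forall i, a i = 0.
Proof.
pose Z := {ffun 'I_#|J| -> W}.
pose X (c : FMan k J) : Z := [ffun d : 'I_#|J| => symbol d c].
have Xlin : linear X.
  by move=> b u v; apply/ffunP=> d; rewrite !ffunE symbol_linear.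
pose s := [tuple X (g (enum_val i)) | i < #|I|].
have Xsum (b : I -> k) : X (\sum_i b i *: g i) = \sum_(i < #|I|) b (enum_val i) *: s`_i.
  rewrite (big_morph X (linD Xlin) (lin0 Xlin)) (reindex (@enum_val I predT)) /=; last first.
    by apply: onW_bij; apply: enum_val_bij.
  by apply: eq_bigr => i _; rewrite (linZ Xlin) nth_mktuple.
have Xspan c : X c \in <<s>>%VS.
  have [b ->] := gspan c; rewrite Xsum; apply: rpred_sum => i _.
  by apply/memvZ/memv_span/mem_nth; rewrite size_tuple.
pose S (z : Z) : W := \sum_d z d.
have Slin : linear S.
  move=> b u v; rewrite /S scaler_sumr -big_split; apply: eq_bigr => d _.
  by rewrite !ffunE.
pose SL : {linear Z -> W} := HB.pack S (GRing.isLinear.Build _ _ _ _ S Slin).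
(* Descending induction on [d], from [U #|J|], which is zero: [w] is a symbol of degree [d] plus its
   projection to [U d.+1]. *)
have onto n d w : (n + d = #|J|)%N -> w \in U d -> exists2 z, z \in <<s>>%VS & S z = w.
  elim: n d w => [|n IHn] d w.
    rewrite add0n => -> /flag_bottom ->; exists 0; first exact: mem0v.
    exact: lin0 Slin.
  move=> nd Uw; have ltd : (d < #|J|)%N by lia.
  have [z zs Sz] := IHn d.+1 _ (etrans (addnS _ _) nd) (memv_proj (U d.+1) w).
  have [c cE] := symbol_onto Uw; exists (X c + z); first exact: memvD (Xspan c) zs.
  rewrite (linD Slin) Sz /S (bigD1 (Ordinal ltd)) //= big1 => [|e ed].
    by rewrite ffunE cE eqxx addr0 subrK.
  by rewrite ffunE cE (negPf (ed : (e : nat) != d)).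
have dimW : (#|rooted_trees| <= \dim <<s>>)%N.
  have -> : #|rooted_trees| = \dim {:W} by rewrite dimvf /dim /= muln1.
  apply: leq_trans (_ : (\dim (linfun SL @: <<s>>) <= _)%N); last first.
    by rewrite -(limg_ker_dim (linfun SL) <<s>>) leq_addl.
  apply/dimvS/subvP=> w _; have [z zs <-] := onto _ 0%N w (addn0 _) (flag_top w).
  by have -> : S z = linfun SL z; [rewrite lfunE|apply: memv_img].
have free_s : free s.
  by rewrite /free eqn_leq dim_span size_tuple (leq_trans cardI).
move=> a0 i; move/freeP: free_s => /(_ (fun i => a (enum_val i))).
rewrite -Xsum a0 (lin0 Xlin) => /(_ erefl (enum_rank i)).
by rewrite enum_rankK.
Qed.
End Flag.

Lemma spanning_independent (I : finType) (g : I -> FMan k J) :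
  (forall c, exists a : I -> k, c = \sum_i a i *: g i) ->
  (#|I| <= #|rooted_trees|)%N ->
  forall a : I -> k, \sum_i a i *: g i = 0 -> forall i, a i = 0.
Proof.
have [U UE] := choice (fun d => subspace_vspace (tree_coefs_filt_subspace d)).
exact: flag_independent UE I g.
Qed.
End LowerBound.

(** * Expanding vertices into chains *)

Section ChainTree.
Variables (J : finType) (j0 : J).

Section Tree.
Variables (V : finType) (t : {ffun V -> option V}) (c : V -> seq J).

Definition bottom v := last j0 (c v).

(** Chains run downwards: the first letter of [c v] is attached to the last letter of the parent
    chain, so that the branching of [v] happens at [bottom v]. *)
Definition chain_parent : {ffun J -> option J} :=
  [ffun j => if [pick v | j \in c v] is Some v then
     if index j (c v) is i.+1 then Some (nth j0 (c v) i) else omap bottom (t v)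
   else None].

Record chain_data : Prop := ChainData {
  cd_RTn1 : is_RTn1 t;
  cd_ne : forall v, c v != [::];
  cd_uniq : forall v, uniq (c v);
  cd_cover : forall j, exists v, j \in c v;
  cd_disj : forall v w j, j \in c v -> j \in c w -> v = w }.

Hypothesis cd : chain_data.
Let p := chain_parent.

Let pick_owner v j : j \in c v -> [pick v | j \in c v] = Some v.
Proof.
move=> jv; case: pickP => [w jw|/(_ v)]; last by rewrite jv.
by rewrite (cd_disj cd jv jw).
Qed.

Lemma parent_next v s1 a b s2 : c v = s1 ++ a :: b :: s2 -> p b = Some a.
Proof.
move=> cv; have bv : b \in c v by rewrite cv mem_cat !inE eqxx !orbT.
rewrite ffunE (pick_owner bv); have := cd_uniq cd v.
rewrite cv cat_uniq => /and3P[_ /hasPn nin /andP[]].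
rewrite inE negb_or => /andP[ab _] _.
have bs1 : b \notin s1 by apply: nin; rewrite !inE eqxx orbT.
rewrite index_cat (negPf bs1) /= (negPf ab) eqxx addn1.
by rewrite nth_cat ltnn subnn.
Qed.

Lemma parent_head v b s : c v = b :: s -> p b = omap bottom (t v).
Proof.
move=> cv; have bv : b \in c v by rewrite cv mem_head.
by rewrite ffunE (pick_owner bv) cv /= eqxx.
Qed.

Lemma bottom_mem v : bottom v \in c v.
Proof. by rewrite /bottom; have := cd_ne cd v; case: (c v) => //= a s _; apply: mem_last. Qed.

Lemma bottom_inj : injective bottom.
Proof.
by move=> v w vw; apply: (cd_disj cd (bottom_mem v)); rewrite vw bottom_mem.
Qed.

Lemma chain_parentP u j : p u = Some j ->
  (exists v s1 s2, c v = s1 ++ j :: u :: s2) \/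
  (exists v w s, [/\ c w = u :: s, t w = Some v & j = bottom v]).
Proof.
have [v uv] := cd_cover cd u; case/splitPr def_c: _ / uv => [s1 s2].
case/lastP: s1 def_c => [|s1 a] cv.
  rewrite (parent_head cv); case tv: (t v) => [w|//] [<-].
  by right; exists w, v, s2.
rewrite cat_rcons in cv; rewrite (parent_next cv) => -[<-].
by left; exists v, s1, s2.
Qed.

Lemma children_inner v s1 a b s2 : c v = s1 ++ a :: b :: s2 ->
  children p a = [set b].
Proof.
move=> cv; have av : a \in c v by rewrite cv mem_cat mem_head orbT.
apply/setP=> u; rewrite !inE; apply/eqP/eqP => [pu|->]; last exact: parent_next cv.
case: (chain_parentP pu) => [[w [s3 [s4 cw]]]|[w [w' [s [cw' tw' aE]]]]].
  have aw : a \in c w by rewrite cw mem_cat mem_head orbT.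
  have wv := cd_disj cd aw av; rewrite wv cv in cw.
  have /eqP : s1 ++ a :: b :: s2 = s3 ++ a :: u :: s4 by [].
  have uc := cd_uniq cd v; rewrite cv in uc.
  have ia : index a (s1 ++ a :: b :: s2) = size s1.
    move: uc; rewrite cat_uniq => /and3P[_ /hasPn/(_ a (mem_head _ _)) /= as1 _].
    by rewrite index_cat (negPf as1) /= eqxx addn0.
  have ia' : index a (s3 ++ a :: u :: s4) = size s3.
    move: uc; rewrite cw cat_uniq => /and3P[_ /hasPn/(_ a (mem_head _ _)) /= as1 _].
    by rewrite index_cat (negPf as1) /= eqxx addn0.
  have szs : size s1 = size s3 by rewrite -ia cw ia'.
  by rewrite eqseq_cat // => /andP[_] /eqP[].
have aw : a \in c w by rewrite aE bottom_mem.
have wv := cd_disj cd aw av; move: aE; rewrite wv /bottom cv last_cat /= => aE.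
have := cd_uniq cd v; rewrite cv cat_uniq => /and3P[_ _ /= /andP[]].
by rewrite {1}aE mem_last.
Qed.

(** The children of [bottom v] are the first letters of the chains of the children of [v]. *)
Lemma card_children_bottom v : #|children p (bottom v)| = #|children t v|.
Proof.
pose h w := head j0 (c w).
have hc w : exists s, c w = h w :: s.
  by rewrite /h; have := cd_ne cd w; case: (c w) => // a s _; exists s.
have h_inj : injective h.
  move=> w w' ww'; have [[s cw] [s' cw']] := (hc w, hc w').
  by apply: (@cd_disj cd w w' (h w)); rewrite ?cw ?cw' ?ww' mem_head.
rewrite -(card_imset _ h_inj); apply: eq_card => u; rewrite !inE.
apply/eqP/imsetP => [pu|[w]].
  case: (chain_parentP pu) => [[w [s1 [s2 cw]]]|[v' [w [s [cw tw vv']]]]].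
    have bw : bottom v \in c w by rewrite cw mem_cat mem_head orbT.
    have vw := cd_disj cd bw (bottom_mem v); have := children_inner cw.
    have := cd_uniq cd v; rewrite -vw {1}cw cat_uniq => /and3P[_ _ /= /andP[]].
    by rewrite vw /bottom -vw cw last_cat /= mem_last.
  exists w; last by rewrite /h cw.
  by rewrite inE tw (bottom_inj vv').
rewrite inE => /eqP tw ->; have [s cw] := hc w.
by rewrite (parent_head cw) tw.
Qed.

Definition unary (q : {ffun J -> option J}) j := #|children q j| == 1.

(** With [nonunary_bottom]: since [t] has no unary vertex, the last letters of the chains are
    exactly the vertices that are not unary, and can be read off from the tree. *)
Lemma unary_bottom v : ~~ unary p (bottom v).
Proof.
have /andP[_ /forallP/(_ v)] := cd_RTn1 cd.
by rewrite /unary card_children_bottom.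
Qed.

Lemma unary_inner v s1 a b s2 : c v = s1 ++ a :: b :: s2 -> unary p a.
Proof. by move=> cv; rewrite /unary (children_inner cv) cards1. Qed.

Lemma nonunary_bottom j : ~~ unary p j -> exists v, j = bottom v.
Proof.
have [v jv] := cd_cover cd j; case/splitPr def_c: _ / jv => [s1 s2].
case: s2 def_c => [|b s2] cv; last by rewrite (unary_inner cv).
by move=> _; exists v; rewrite /bottom cv last_cat.
Qed.

(* A reversed initial segment of a maximal chain of unary vertices. *)
Fixpoint rchain (q : {ffun J -> option J}) (b : J) (s : seq J) : bool :=
  if s is a :: s' then [&& q b == Some a, unary q a & rchain q a s']
  else if q b is Some a then ~~ unary q a else true.

Lemma rchain_chain v s : c v = rcons (rev s) (bottom v) -> rchain p (bottom v) s.
Proof.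
rewrite -cats1; elim: s (bottom v) [::] => [|a s IHs] b s2 /= cv.
  rewrite (parent_head cv); case: (t v) => //= w; exact: unary_bottom.
rewrite rev_cons cat_rcons in cv.
by rewrite (parent_next cv) eqxx (unary_inner cv) (IHs a (b :: s2)).
Qed.

Lemma chain_rooted : is_rooted_tree p.
Proof.
have /andP[/existsP[r /andP[/eqP tr /forallP conn]] _] := cd_RTn1 cd.
pose h w := head j0 (c w).
have hc w : exists s, c w = h w :: s.
  by rewrite /h; have := cd_ne cd w; case: (c w) => // a s _; exists s.
have up v j : j \in c v -> connect (fun u w => p u == Some w) j (h v).
  case/splitPr def_c: _ / => [s1 s2].
  elim/last_ind: s1 j s2 def_c => [|s1 a IHs] j s2 cv.
    by rewrite /h cv connect0.
  rewrite cat_rcons in cv; apply: connect_trans (IHs _ _ cv).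
  by apply: connect1; rewrite (parent_next cv).
apply/existsP; exists (h r); have [s cr] := hc r.
rewrite (parent_head cr) tr /=; apply/forallP=> j.
have [v /up jv] := cd_cover cd j; apply: connect_trans jv _.
have /connectP[s' ps ls] := conn v; elim: s' v ps ls => [|w s' IHs] v /=.
  by move=> _ <-; apply: connect0.
case/andP=> /eqP tv ps ls; have [s1 cv] := hc v.
apply: (@connect_trans _ _ (bottom w)).
  by apply: connect1; rewrite (parent_head cv) tv.
exact: connect_trans (up _ _ (bottom_mem w)) (IHs _ ps ls).
Qed.
End Tree.

Lemma rchain_unique q b s s' : rchain q b s -> rchain q b s' -> s = s'.
Proof.
elim: s s' b => [|a s IHs] [|a' s'] b //=.
- by move=> qb /and3P[/eqP qa' ua' _]; rewrite qa' ua' in qb.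
- by move=> /and3P[/eqP qa ua _]; rewrite qa ua.
case/and3P=> /eqP -> _ cs /and3P[/eqP[aa'] _ cs']; congr (_ :: _) => //.
by apply: IHs cs _; rewrite aa'.
Qed.

Lemma chain_parent_inj (V V' : finType) (t : {ffun V -> option V})
    (t' : {ffun V' -> option V'}) (c : V -> seq J) (c' : V' -> seq J) :
  chain_data t c -> chain_data t' c' -> chain_parent t c = chain_parent t' c' ->
  exists r : equiv V V', (forall v, c' (r v) = c v) /\
    (forall v, t' (r v) = omap r (t v)).
Proof.
move=> cd cd' pp'.
(* Equal trees have the same non-unary vertices, so the last letters of the chains match in both
   directions. *)
have half (U U' : finType) (s : {ffun U -> option U}) (s' : {ffun U' -> option U'})
      (d : U -> seq J) (d' : U' -> seq J) :
    chain_data s d -> chain_data s' d' -> chain_parent s d = chain_parent s' d' ->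
    exists r : U -> U', forall v, bottom d' (r v) = bottom d v.
  move=> dd dd' ss'.
  have /fin_all_exists[r rE] : forall v, exists w, bottom d' w = bottom d v.
    move=> v; have := unary_bottom dd v; rewrite ss'.
    by case/(nonunary_bottom dd')=> w ->; exists w.
  by exists r.
have [r rE] := half _ _ _ _ _ _ cd cd' pp'.
have [r' r'E] := half _ _ _ _ _ _ cd' cd (esym pp').
have rK : cancel r r' by move=> v; apply: (bottom_inj cd); rewrite r'E rE.
have r'K : cancel r' r by move=> v; apply: (bottom_inj cd'); rewrite rE r'E.
exists (Equiv rK r'K) => /=.
have cE v : c' (r v) = c v.
  have split (U : finType) (s : {ffun U -> option U}) (d : U -> seq J) (dd : chain_data s d) w :
      exists s1, d w = rcons (rev s1) (bottom d w).
    rewrite /bottom; have := cd_ne dd w; case/lastP: (d w) => // s1 a _.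
    by exists (rev s1); rewrite revK last_rcons.
  have [[s1 E1] [s2 E2]] := (split _ _ _ cd v, split _ _ _ cd' (r v)).
  have R1 := rchain_chain cd E1; have R2 := rchain_chain cd' E2.
  rewrite -pp' rE in R2; rewrite E1 E2 rE; congr (rcons (rev _) _).
  exact: rchain_unique R2 R1.
split=> // v; have [a [s cv]] : exists a s, c v = a :: s.
  by have := cd_ne cd v; case: (c v) => // a s _; exists a, s.
have cv' : c' (r v) = a :: s by rewrite cE.
have := parent_head cd cv; rewrite pp' (parent_head cd' cv').
case: (t v) (t' (r v)) => [w|] [w'|] //= [E]; congr Some.
by apply: (bottom_inj cd'); rewrite rE.
Qed.
End ChainTree.

(** * Spanning the free module *)

Lemma set_rcons (I : finType) (s : seq I) j :
  [set i in rcons s j] = [set i in s] :|: [set j].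
Proof. by apply/setP=> i; rewrite !inE mem_rcons inE orbC. Qed.

Section LieWords.
Variables (k : fieldType) (K : finType).
Local Notation LP := (Lie_presentation k).
Local Notation br := (@gop k LP K Lie_bracket).
Local Notation expr := (expr k (pr_ops LP)).

Definition lie_norm (I : Type) (i : I) (s : seq I) : expr I :=
  foldl (fun t j => EOp (Lie_bracket : pr_ops LP) t (EVar j)) (EVar i) s.

Lemma lie_norm_rcons (I : Type) (i : I) s j :
  lie_norm i (rcons s j) = EOp (Lie_bracket : pr_ops LP) (lie_norm i s) (EVar j).
Proof. by rewrite /lie_norm -cats1 foldl_cat. Qed.

Lemma lie_norm_relabel (I I' : Type) (h : I -> I') i s :
  erelabel h (lie_norm i s) = lie_norm (h i) (map h s).
Proof.
elim/last_ind: s => [//|s j IHs].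
by rewrite map_rcons !lie_norm_rcons -IHs.
Qed.

Lemma lie_norm_ml (I : finType) (i : I) s : uniq (i :: s) ->
  multilinear [set j in i :: s] (lie_norm i s).
Proof.
elim/last_ind: s => [_|s j IHs].
  suff -> : [set j in [:: i]] = [set i] by apply: ml_var.
  by apply/setP=> j; rewrite !inE.
rewrite lie_norm_rcons -rcons_cons rcons_uniq => /andP[js /IHs Is].
rewrite set_rcons; apply: ml_op => //; last exact: ml_var.
by rewrite disjoint_sym disjoints1 inE.
Qed.

Let brC a b : br a b = - br b a.
Proof.
rewrite -scaleN1r.
by have := @rop_rel _ _ (galg LP K) (Lie_skew : pr_index LP) (fun i => [:: a; b]`_i).
Qed.

Let brr a b c : br a (br b c) = br (br a b) c - br (br a c) b.
Proof.
have := (@rop_rel _ _ (galg LP K) (Lie_Jacobi : pr_index LP) (fun i => [:: a; b; c]`_i)).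
rewrite /= => E.
have {}E : br (br a b) c + br (br b c) a + br (br c a) b = 0 := E.
have lN x y : br (- x) y = - br x y := linN (gop_linl _ _) x.
rewrite (brC (br b c)) (brC c a) lN in E; move/eqP: E.
by rewrite -addrA -opprD subr_eq0 => /eqP ->; rewrite addrK.
Qed.

Section Span.
Variable k0 : K.

Definition word_span (A : {set K}) : gspace LP K -> Prop :=
  lspan (fun x => exists s, [/\ uniq (k0 :: s), [set j in k0 :: s] = A &
    x = hcls A (lie_norm k0 s)]).

(** By [brr] a bracket with a Lie monomial on the right reduces to brackets with single letters on
    the right, which prolong left-normed words. *)
Lemma word_span_br (B : {set K}) u : multilinear B u -> forall (A : {set K}) a, [disjoint A & B] ->
  word_span A a -> word_span (A :|: B) (br a (interp (@gop k LP K) (gvar LP) u)).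
Proof.
elim=> {B u} [j|[] B1 B2 u1 u2 B12 _ IH1 _ IH2|B|B u v _ IHu _ IHv|B c u _ IHu] A a AB /= Ta.
- elim: Ta => {a} [_ [s [us sA ->]]||a b _ Ia _ Ib|c a _ Ia].
  + apply: lspan_gen; exists (rcons s j).
    have js : j \notin k0 :: s.
      by have := disjointFl AB (set11 j); rewrite -sA inE => ->.
    rewrite -rcons_cons rcons_uniq js; split=> //.
      by rewrite -sA set_rcons.
    have As := lie_norm_ml us; rewrite sA in As.
    rewrite lie_norm_rcons -(gop_hcls (Lie_bracket : pr_ops LP) AB As (ml_var _ _ j)).
    by rewrite -(interp_gvar (ml_var _ _ j)).
  + by rewrite (lin0 (gop_linl _ _)); apply: lspan0.
  + by rewrite (linD (gop_linl _ _)); apply: lspanD.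
  + by rewrite (linZ (gop_linl _ _)); apply: lspanZ.
- have AB1 : [disjoint A & B1] by apply: disjointWr AB; apply: subsetUl.
  have AB2 : [disjoint A & B2] by apply: disjointWr AB; apply: subsetUr.
  rewrite brr; apply: (subB (lspan_subspace _)).
    rewrite setUA; apply: IH2; last exact: IH1.
    by rewrite -setI_eq0 setIUl setU_eq0 !setI_eq0 AB2 B12.
  rewrite (setUC B1) setUA; apply: IH1; last exact: IH2.
  by rewrite -setI_eq0 setIUl setU_eq0 !setI_eq0 AB1 disjoint_sym B12.
- by rewrite (lin0 (gop_linr _ _)); apply: lspan0.
- by rewrite (linD (gop_linr _ _)); apply: lspanD; [apply: IHu|apply: IHv].
- by rewrite (linZ (gop_linr _ _)); apply: lspanZ; apply: IHu.
Qed.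

(** Skew-symmetry moves the factor that contains [k0] to the left. *)
Lemma word_spanP A t : multilinear A t -> k0 \in A ->
  word_span A (interp (@gop k LP K) (gvar LP) t).
Proof.
elim=> {A t} [j|[] A B t u AB At IHt Bu IHu|A|A t u _ IHt _ IHu|A c t _ IHt] kA /=.
- move: kA; rewrite inE => /eqP <-; apply: lspan_gen; exists [::]; split=> //.
  by apply/setP=> i; rewrite !inE.
- move: kA; rewrite inE => /orP[kA|kB].
    by apply: word_span_br => //; apply: IHt.
  rewrite brC setUC; apply: (subN (lspan_subspace _)); apply: word_span_br => //.
    by rewrite disjoint_sym.
  exact: IHu.
- exact: lspan0.
- by apply: lspanD; [apply: IHt|apply: IHu].
- by apply: lspanZ; apply: IHt.
Qed.

Lemma lie_word_span (y : Lie k K) : lspan (fun y' : Lie k K => exists s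
  (Kt : multilinear [set: K] (lie_norm k0 s)),
  [/\ uniq (k0 :: s), forall i, i \in k0 :: s & y' = mclass (R := LP) Kt]) y.
Proof.
elim/mclass_ind: y => t Kt; have := word_spanP Kt (in_setT k0).
have -> : mclass (R := LP) Kt =
    (interp (@gop k LP K) (gvar LP) t : gspace LP K) setT.
  by rewrite (interp_gvar Kt) /hcls eqxx (clsE Kt).
elim=> [_ [s [us sT ->]]||a b _ Ia _ Ib|c a _ Ia].
- have Ks := lie_norm_ml us; rewrite sT in Ks.
  apply: lspan_gen; exists s, Ks; split=> //.
    by move=> i; move/setP/(_ i): sT; rewrite !inE.
  by rewrite /hcls eqxx (clsE Ks).
- exact: lspan0.
- by rewrite gcompD; apply: lspanD.
- by rewrite gcompZ; apply: lspanZ.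
Qed.
End Span.
End LieWords.

Section WordLists.
Variables (J : eqType) (j0 : J) (rank : J -> nat).

(* The first letter of a Lie word is its least one; words at a vertex are listed
   by decreasing first letter, so they can be read off from their concatenation
   as the blocks between its left-to-right minima. *)
Definition min_headed (w : seq J) :=
  if w is i :: s then all (fun j => rank i < rank j)%N s else false.

Definition head_gt (w w' : seq J) := (rank (head j0 w') < rank (head j0 w))%N.

Let cat_stop (P : pred J) s s' u u' : all P s -> all P s' ->
  (if u is a :: _ then ~~ P a else true) -> (if u' is a :: _ then ~~ P a else true) ->
  s ++ u = s' ++ u' -> s = s' /\ u = u'.
Proof.
elim: s s' => [|a s IHs] [|a' s'] //=.
- by move=> _ /andP[Pa' _] + _ uE; rewrite uE /= Pa'.
- by move=> /andP[Pa _] _ _ + uE; rewrite -uE /= Pa.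
move=> /andP[_ Ps] /andP[_ Ps'] Pu Pu' [-> /(IHs _ Ps Ps' Pu Pu')[-> ->]] //.
Qed.

(** The first word is its head followed by the letters of larger rank; the head of the next word has
    smaller rank and stops it. *)
Lemma flatten_words_inj (ws ws' : seq (seq J)) :
  all min_headed ws -> all min_headed ws' -> sorted head_gt ws -> sorted head_gt ws' ->
  flatten ws = flatten ws' -> ws = ws'.
Proof.
have stop i s vs : path head_gt (i :: s) vs -> all min_headed vs ->
    if flatten vs is a :: _ then ~~ (rank i < rank a)%N else true.
  case: vs => [//|[|a v] vs] //= /andP[]; rewrite /head_gt /= => ia _ _.
  by rewrite -leqNgt ltnW.
elim: ws ws' => [|[|i s] ws IHws] [|[|i' s'] ws'] //=.
case/andP=> ms mws /andP[ms' mws'] pw pw' [ii']; rewrite -{i'}ii' in ms' pw' *.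
case/(cat_stop ms ms' (stop _ _ _ pw mws) (stop _ _ _ pw' mws'))=> ss' ff.
rewrite ss'; congr (_ :: _); apply: IHws ff => //.
  exact: path_sorted pw.
exact: path_sorted pw'.
Qed.
End WordLists.

Section Code.
Variables (k : fieldType) (J : finType).
Local Notation LP := (Lie_presentation k).
Local Notation X := (free_module (comp_species (RTn1 k) (Com k)) (Lie k)).

Definition is_word (K : finType) (h : K -> J) (y : Lie k K) (w : seq J) : Prop :=
  exists i s (Kt : multilinear [set: K] (lie_norm k i s)),
    [/\ uniq (i :: s), forall i', i' \in i :: s, w = map h (i :: s) &
      y = mclass (R := LP) Kt].

Lemma is_word_unique (K : finType) (h : K -> J) y y' w :
  injective h -> is_word h y w -> is_word h y' w -> y = y'.
Proof.
move=> h_inj [i [s [Kt [_ _ -> ->]]]] [i' [s' [Kt' [_ _ /(inj_map h_inj)[ii ss] ->]]]].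
case: i' / ii Kt'; case: s' / ss => Kt'; exact/mclassP/ec_refl.
Qed.

Lemma is_word_map (K K' : finType) (e : equiv K K') (h : K -> J) (h' : K' -> J) y w :
  (forall i, h' (e i) = h i) -> is_word h y w -> is_word h' (sp_map e y) w.
Proof.
move=> hE [i [s [Kt [us sT -> ->]]]]; have K't := ml_equiv e Kt.
rewrite lie_norm_relabel in K't; exists (e i), (map e s), K't; split.
- by rewrite -map_cons map_inj_uniq //; apply: efun_inj.
- by move=> i'; rewrite -map_cons -[i'](einvK e) map_f.
- by rewrite -map_cons -map_comp; apply: eq_map => i'; rewrite /= hE.
rewrite /= pr_mapE; apply/mclassP; rewrite lie_norm_relabel; exact: ec_refl.
Qed.

Definition com_one (I : finType) : Com k I := [ffun=> 1].

Lemma com_one_map (I I' : finType) (e : equiv I I') : sp_map e (com_one I) = com_one I'.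
Proof.
apply/ffunP=> u; rewrite !ffunE; have uniq_u (v : nonempty_ob I) : nonempty_map e v == u.
  by apply/eqP/val_inj; case: (val _) (val _) => -[].
have I0 : (0 < #|I|)%N by rewrite (equiv_card e); case: u uniq_u.
pose v : nonempty_ob I := exist _ tt I0.
by rewrite (bigD1 v) //= big1 ?ffunE ?addr0 // => w /andP[_] /eqP[].
Qed.

(** The words at a vertex are compared up to order: the numbering of the [n] words is no part of the
    code, that of the [m] vertices is. *)
Definition code_of (m : nat) (t : RTn1_ob 'I_m) (S : 'I_m -> seq (seq J)) (x : X J) : Prop :=
  exists n (f : J -> 'I_n) (f' : 'I_n -> 'I_m) (y : forall i, Lie k (fiber f i))
    (w : 'I_n -> seq J),
  [/\ x = cpgen (X := comp_species (RTn1 k) (Com k))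
            (cpgen (tree_delta k t) (fun v => com_one (fiber f' v))) y,
    forall i, is_word (fun j : fiber f i => sval j) (y i) (w i) &
    forall v, perm_eq (S v) [seq w i | i <- enum 'I_n & f' i == v]].

Lemma is_word_fiber n (f : J -> 'I_n) i (y : Lie k (fiber f i)) w j :
  is_word (fun j : fiber f i => sval j) y w -> (j \in w) = (f j == i).
Proof.
case=> i' [s [Kt [_ sT -> _]]]; apply/mapP/idP => [[j' _ ->]|ji].
  exact: (svalP j').
by exists (exist _ j ji) => //; apply: sT.
Qed.

Lemma is_word_ne (K : finType) (h : K -> J) y w : is_word h y w -> w != [::].
Proof. by case=> i [s [Kt [_ _ -> _]]]. Qed.

(** Words of one tensor are nonempty with disjoint supports, hence distinct. Two numberings of the
    same lists therefore differ by a bijection, and the tensors are identified as in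
    [cpgen_perm]. *)
Lemma code_of_unique m t S x x' : @code_of m t S x -> code_of t S x' -> x = x'.
Proof.
move=> [n [f [f' [y [w [-> yw Sw]]]]]] [n1 [f1 [f1' [y1 [w1 [-> yw1 Sw1]]]]]].
have wE i j : (j \in w i) = (f j == i) := is_word_fiber j (yw i).
have wE1 i j : (j \in w1 i) = (f1 j == i) := is_word_fiber j (yw1 i).
have inj l (g : J -> 'I_l) (u : 'I_l -> seq J) : (forall i, u i != [::]) ->
    (forall i j, (j \in u i) = (g j == i)) -> injective u.
  move=> u0 uE i i' ii'; have := u0 i; case ui: (u i) => [//|j s] _.
  have ji : j \in u i by rewrite ui mem_head.
  by have := ji; rewrite {2}ii' in ji *; move: ji; rewrite !uE => /eqP <- /eqP.
have w_inj := inj _ _ _ (fun i => is_word_ne (yw i)) wE.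
have w1_inj := inj _ _ _ (fun i => is_word_ne (yw1 i)) wE1.
have match_ l l' (g : 'I_l -> 'I_m) (g' : 'I_l' -> 'I_m) u u' :
    (forall v, perm_eq (S v) [seq u i | i <- enum 'I_l & g i == v]) ->
    (forall v, perm_eq (S v) [seq u' i | i <- enum 'I_l' & g' i == v]) ->
    exists s : 'I_l -> 'I_l', forall i, u' (s i) = u i /\ g' (s i) = g i.
  move=> Su Su'; apply: (fin_all_exists (P := fun i j => u' j = u i /\ g' j = g i)) => i.
  have : u i \in S (g i).
    by rewrite (perm_mem (Su _)); apply: map_f; rewrite mem_filter eqxx mem_enum.
  rewrite (perm_mem (Su' _)) => /mapP[j]; rewrite mem_filter => /andP[/eqP gj _] ->.
  by exists j.
have [s sE] := match_ _ _ _ _ _ _ Sw Sw1; have [s' s'E] := match_ _ _ _ _ _ _ Sw1 Sw.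
have sK : cancel s s' by move=> i; apply: w_inj; rewrite (s'E _).1 (sE _).1.
have s'K : cancel s' s by move=> i; apply: w1_inj; rewrite (sE _).1 (s'E _).1.
have nn1 : n = n1 by rewrite -(card_ord n) -(card_ord n1) (equiv_card (Equiv sK s'K)).
case: n1 / nn1 f1 f1' y1 w1 yw1 Sw1 wE1 w1_inj s s' sE s'E sK s'K => f1 f1' y1 w1 yw1 Sw1 wE1 w1_inj s s' sE s'E sK s'K.
pose e := Equiv sK s'K.
have f1E : f1 = e \o f.
  apply/funext=> j; have := wE1 (s (f j)) j.
  by rewrite (sE _).1 wE eqxx => /esym/eqP.
subst f1; rewrite (cpgen_perm (s := e) _ (y' := y1)) => [|i]; last first.
  apply: (is_word_unique (w := w1 (e i)) val_inj (yw1 _)).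
  rewrite (sE _).1; apply: is_word_map (yw i) => j; exact: erefl.
congr (cpgen _ y1); rewrite [LHS]comp_map_cpgen; apply: cpgen_ext.
  by move=> i /=; rewrite -(sE _).2 s'K.
by move=> v E _; rewrite !com_one_map.
Qed.

Lemma code_of_relabel m (t t' : RTn1_ob 'I_m) S S' x (r : equiv 'I_m 'I_m) :
  (forall v, sval t' (r v) = omap r (sval t v)) -> (forall v, S' (r v) = S v) ->
  @code_of m t S x -> code_of t' S' x.
Proof.
move=> tE SE [n [f [f' [y [w [-> yw Sw]]]]]].
exists n, f, (r \o f'), y, w; split=> // [|v].
  have tE' : RTn1_map r t = t'.
    by apply/val_inj/ffunP=> v; rewrite ffunE -[v in RHS](einvK r) tE.
  congr (cpgen _ y).
  rewrite (cpgen_perm (s := r) _ (y' := fun v => com_one (fiber (r \o f') v))) => [|v].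
    congr (cpgen _ _); apply/ffunP=> u; rewrite ffunE.
    rewrite -tE' ffunE; have [<-|ut] := eqVneq (RTn1_map r t) u.
      rewrite (bigD1 t) //= big1 => [|v /andP[_ vt]]; first by rewrite ffunE eqxx addr0.
      by rewrite ffunE (negPf vt).
    by rewrite big1 // => v /eqP vu; rewrite ffunE; case: eqP => // vt; rewrite -vu vt eqxx in ut.
  by rewrite com_one_map.
rewrite -[v](einvK r) SE (perm_trans (Sw _)) //.
by under [X in perm_eq _ (map _ X)]eq_filter do rewrite /= (inj_eq (@efun_inj _ _ r)).
Qed.

Lemma code_of_equiv m m' (t : RTn1_ob 'I_m) (t' : RTn1_ob 'I_m') S S' x x'
    (r : equiv 'I_m 'I_m') :
  (forall v, sval t' (r v) = omap r (sval t v)) -> (forall v, S' (r v) = S v) ->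
  code_of t S x -> code_of t' S' x' -> x = x'.
Proof.
have mm' : m = m' by rewrite -(card_ord m) -(card_ord m') (equiv_card r).
case: m' / mm' t' S' r => t' S' r tE SE Cx Cx'.
exact: code_of_unique (code_of_relabel tE SE Cx) Cx'.
Qed.
End Code.

Lemma presented_span (k : fieldType) (G : Type) (R : lterm k G -> lterm k G -> Prop)
    (W : presented R -> Prop) :
  subspace W -> (forall g, W (pgen R g)) -> forall x, W x.
Proof.
move=> subW Wg; apply: lq_ind => x; rewrite lq_class_leval.
elim: x => [g||x IHx y IHy|a x IHx] /=; first exact: Wg.
- exact: sub0.
- exact: subD.
- exact: subZ.
Qed.

Lemma dfwith_lspan (k : fieldType) (I : finType) (Y : I -> lmodType k) (V : lmodType k)
    (h : (forall i, Y i) -> V) (S : forall i, Y i -> Prop) (W : V -> Prop) :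
  (forall y i, linear (fun u : Y i => h (dfwith y u))) -> subspace W ->
  (forall y, (forall i, S i (y i)) -> W (h y)) ->
  forall y, (forall i, lspan (@S i) (y i)) -> W (h y).
Proof.
move=> hlin subW WS.
suff span_on (r : seq I) y : (forall i, i \notin r -> S i (y i)) ->
    (forall i, lspan (@S i) (y i)) -> W (h y).
  by move=> y; apply: (span_on (enum I)) => i; rewrite mem_enum.
elim: r y => [|i r IHr] y Sy Ly; first by apply: WS => i; apply: Sy.
have dfE : dfwith y (y i) = y.
  apply: functional_extensionality_dep => j.
  by case: (dfwithP y (y i) j).
rewrite -dfE; elim: (Ly i) => [u Su||u v _ Wu _ Wv|a u _ Wu].
- apply: IHr => j.
    case: (dfwithP y u j) => [//|j' ij jr]; apply: Sy.
    by rewrite inE negb_or eq_sym ij jr.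
  by case: (dfwithP y u j) => [|j' _]; [apply: lspan_gen|apply: Ly].
- by rewrite (lin0 (hlin y i)); apply: sub0.
- by rewrite (linD (hlin y i)); apply: subD.
- by rewrite (linZ (hlin y i)); apply: subZ.
Qed.

Section Spanning.
Variables (k : fieldType) (J : finType).
Local Notation LP := (Lie_presentation k).
Local Notation X := (free_module (comp_species (RTn1 k) (Com k)) (Lie k)).

Definition letter_rank (j : J) : nat := enum_rank j.

Lemma letter_rank_inj : injective letter_rank.
Proof. by move=> i j /val_inj /enum_rank_inj. Qed.

Definition good_word (K : finType) (h : K -> J) (y : Lie k K) :=
  exists w, is_word h y w /\ min_headed letter_rank w.

(** Without variables every expression is built from [EZero]. *)
Lemma lie_empty (K : finType) (y : Lie k K) : #|K| = 0%N -> y = 0.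
Proof.
move=> K0; elim/mclass_ind: y => t Kt.
have -> : mclass (R := LP) Kt = (interp (@gop k LP K) (gvar LP) t : gspace LP K) setT.
  by rewrite (interp_gvar Kt) /hcls eqxx (clsE Kt).
suff -> : interp (@gop k LP K) (gvar LP) t = 0 by [].
elim: Kt => {t} /= [j|o A B t u _ _ -> _ _|//|A t u _ -> _ ->|A a t _ ->].
- by have /card0_eq/(_ j) := K0.
- exact: lin0 (gop_linl _ _).
- exact: addr0.
- exact: scaler0.
Qed.

Lemma good_word_span (K : finType) (h : K -> J) (y : Lie k K) :
  injective h -> lspan (good_word h) y.
Proof.
move=> h_inj; have [K0|] := posnP #|K|.
  by rewrite (lie_empty y K0); apply: lspan0.
case/card_gt0P=> i1 _; pose i0 := [arg min_(i < i1) letter_rank (h i)].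
have i0_min i : (letter_rank (h i0) <= letter_rank (h i))%N.
  by rewrite /i0; case: arg_minnP => // i' _; apply.
apply: lspan_mono (lie_word_span i0 y) => _ [s [Kt [us sT ->]]].
exists (map h (i0 :: s)); split; first by exists i0, s, Kt.
apply/allP=> _ /mapP[i si ->]; rewrite ltn_neqAle i0_min andbT.
apply: contraTneq us => /letter_rank_inj/h_inj ->; by rewrite /= si.
Qed.

Lemma com_one_span (I : finType) (z : Com k I) :
  lspan (fun z' => z' = com_one k I /\ (0 < #|I|)%N) z.
Proof.
have zE (u v : nonempty_ob I) : u = v by apply: val_inj; case: (val u) (val v) => -[].
have [I0|I0] := posnP #|I|.
  suff -> : z = 0 by apply: lspan0.
  by apply/ffunP=> -[u uI]; exfalso; rewrite I0 in uI.
pose u : nonempty_ob I := exist _ tt I0.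
have -> : z = (z : {ffun nonempty_ob I -> k^o}) u *: com_one k I.
  by apply/ffunP=> v; rewrite !ffunE (zE v u) [_ *: _]mulr1.
by apply: lspanZ; apply: lspan_gen.
Qed.

Lemma generator_span (C : X J -> Prop) :
  (forall m (t : RTn1_ob 'I_m) n (f : J -> 'I_n) (f' : 'I_n -> 'I_m) y,
    (forall v, 0 < #|fiber f' v|)%N ->
    (forall i, good_word (fun j : fiber f i => sval j) (y i)) ->
    C (cpgen (X := comp_species (RTn1 k) (Com k))
      (cpgen (tree_delta k t) (fun v => com_one k (fiber f' v))) y)) ->
  forall x, lspan C x.
Proof.
move=> Cgen x; have subC := lspan_subspace C.
move: x; apply: (presented_span subC) => -[n f x y].
rewrite -/(cpgen x y).
have hlin := @cpgen_y k (comp_species (RTn1 k) (Com k)) (Lie k) J n f x.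
apply: (dfwith_lspan hlin subC _ (fun i => good_word_span (y i) val_inj)).
move=> {}y yw {hlin}; pose W (u : comp_species (RTn1 k) (Com k) 'I_n) :=
  lspan C (cpgen u y).
have subW : subspace W := subspace_preim (cpgen_x y) subC.
move: x; apply: (presented_span subW) => -[m f' x z]; rewrite -/(cpgen x z).
have hlin := @cpgen_y k (RTn1 k) (Com k) 'I_n m f' x.
apply: (dfwith_lspan hlin subW _ (fun v => com_one_span (z v))) => {}z zE.
have zE1 : z = fun v => com_one k (fiber f' v).
  by apply: functional_extensionality_dep => v; case: (zE v).
have -> : x = \sum_t (x : {ffun RTn1_ob 'I_m -> k^o}) t *: tree_delta k t.
  apply/ffunP=> u; rewrite sum_ffunE (bigD1 u) //= big1 => [|t tu]; rewrite !ffunE.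
    by rewrite eqxx addr0 [_ *: _]mulr1.
  by rewrite eq_sym (negPf tu) [_ *: _]mulr0.
have subW' := subspace_preim (cpgen_x z) subW.
apply: (sub_sum subW') => t _; apply: (subZ subW'); rewrite zE1.
apply: lspan_gen; apply: Cgen => // v; exact: (zE v).2.
Qed.

Section Codes.
Variable j0 : J.

Definition good_code m (t : RTn1_ob 'I_m) (S : 'I_m -> seq (seq J)) :=
  [/\ forall v, all (min_headed letter_rank) (S v),
    forall v, sorted (head_gt j0 letter_rank) (S v) &
    chain_data (sval t) (fun v => flatten (S v))].

Definition coded (x : X J) := exists m t S, @good_code m t S /\ code_of t S x.

Lemma coded_gen m (t : RTn1_ob 'I_m) n (f : J -> 'I_n) (f' : 'I_n -> 'I_m) y :
  (forall v, 0 < #|fiber f' v|)%N ->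
  (forall i, good_word (fun j : fiber f i => sval j) (y i)) ->
  coded (cpgen (X := comp_species (RTn1 k) (Com k))
    (cpgen (tree_delta k t) (fun v => com_one k (fiber f' v))) y).
Proof.
move=> f'0 /fin_all_exists[w wP].
have wE i j : (j \in w i) = (f j == i) := is_word_fiber j (wP i).1.
pose key u := letter_rank (head j0 u).
pose l v := [seq w i | i <- enum 'I_n & f' i == v].
pose S v := sort (relpre key geq) (l v).
have Sl v : perm_eq (S v) (l v) by rewrite perm_sort.
have head_w i : f (head j0 (w i)) = i.
  apply/eqP; rewrite -wE; have := is_word_ne (wP i).1.
  by case: (w i) => // a s _; apply: mem_head.
have fS v j : (j \in flatten (S v)) = (f' (f j) == v).
  rewrite (perm_mem (perm_flatten (Sl v))); apply/flattenP/idP => [[_ /mapP[i + ->]]|vj].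
    by rewrite mem_filter wE => /andP[fi _] /eqP ->.
  exists (w (f j)); last by rewrite wE.
  by apply: map_f; rewrite mem_filter vj mem_enum.
exists m, t, S; split; last first.
  by exists n, f, f', y, w; split=> // i; case: (wP i).
split=> [v|v|].
- apply/allP=> u; rewrite (perm_mem (Sl v)) => /mapP[i _ ->]; exact: (wP i).2.
(* The words have distinct heads, so sorting them by weakly decreasing rank gives a strictly
   decreasing list. *)
- have : sorted gtn (map key (S v)).
    rewrite gtn_sorted_uniq_geq; apply/andP; split; last first.
      by rewrite sorted_map; apply: sort_sorted => a b; apply: leq_total.
    rewrite (perm_uniq (perm_map key (Sl v))) -map_comp map_inj_uniq.
      exact/filter_uniq/enum_uniq.
    by move=> i i' /letter_rank_inj ii'; rewrite -[i]head_w ii' head_w.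
  by rewrite sorted_map.
split=> [|v|v|j|v u j].
- exact: svalP t.
- have /card_gt0P[[i fi] _] := f'0 v; apply/eqP => Sv0.
  have := fS v (head j0 (w i)); by rewrite Sv0 head_w fi.
- rewrite (perm_uniq (perm_flatten (Sl v))) /l.
  have : uniq [seq i <- enum 'I_n | f' i == v] by exact/filter_uniq/enum_uniq.
  elim: [seq i <- _ | _] => //= i s IHs /andP[is_ /IHs us].
  rewrite cat_uniq us andbT; apply/andP; split.
    have [i' [s' [Kt [us' _ -> _]]]] := (wP i).1.
    by rewrite map_inj_uniq //; apply: val_inj.
  apply/hasPn=> j /flattenP[_ /mapP[i' i's ->]]; rewrite /= !wE => /eqP ->.
  by apply: contra is_ => /eqP <-.
- by exists (f' (f j)); rewrite fS.
- by rewrite !fS => /eqP <- /eqP.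
Qed.

Lemma good_code_unique m m' (t : RTn1_ob 'I_m) (t' : RTn1_ob 'I_m') S S' x x' :
  good_code t S -> good_code t' S' ->
  chain_parent j0 (sval t) (fun v => flatten (S v)) =
    chain_parent j0 (sval t') (fun v => flatten (S' v)) ->
  @code_of k J m t S x -> code_of t' S' x' -> x = x'.
Proof.
move=> [mS sS cS] [mS' sS' cS'] /(chain_parent_inj cS cS')[r [SE tE]].
apply: (code_of_equiv tE) => v.
exact: (flatten_words_inj (mS' _) (mS v) (sS' _) (sS v)).
Qed.

Lemma tree_spanning_point : exists g : rooted_trees J -> X J,
  forall x, exists a : rooted_trees J -> k, x = \sum_p a p *: g p.
Proof.
pose has_tree (p : rooted_trees J) (x : X J) := exists m (t : RTn1_ob 'I_m) S,
  [/\ good_code t S, code_of t S x &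
    sval p = chain_parent j0 (sval t) (fun v => flatten (S v))].
(* A tree codes at most one element, by [good_code_unique]; [g p] is this element, or 0 if there is
   none. *)
have /fin_all_exists[g gP] : forall p, exists y, forall x, has_tree p x -> x = y.
  move=> p; have [[y py]|no] := pselect (exists y, has_tree p y); last first.
    by exists 0 => x px; case: no; exists x.
  exists y => x [m [t [S [gS Cx pE]]]]; case: py => m' [t' [S' [gS' Cy pE']]].
  by apply: (good_code_unique gS gS') Cx Cy; rewrite -pE.
exists g => x; elim: (generator_span coded_gen x) => {x} [x [m [t [S [gS Cx]]]]||x y _ [a ->] _ [b ->]|c x _ [a ->]].
- have [_ _ cd] := gS.
  pose p : rooted_trees J := exist (@is_rooted_tree J) _ (chain_rooted j0 cd).
  exists (fun q => (q == p)%:R); rewrite (bigD1 p) //= big1 => [|q /negPf ->].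
    by rewrite eqxx scale1r addr0; apply: gP; exists m, t, S.
  by rewrite scale0r.
- by exists (fun=> 0); rewrite big1 // => p _; rewrite scale0r.
- by exists (fun p => a p + b p); rewrite -big_split; apply: eq_bigr => p _; rewrite scalerDl.
- by exists (fun p => c * a p); rewrite scaler_sumr; apply: eq_bigr => p _; rewrite scalerA.
Qed.
End Codes.

Lemma tree_spanning : exists g : rooted_trees J -> X J,
  forall x, exists a : rooted_trees J -> k, x = \sum_p a p *: g p.
Proof.
have [j0 _|J0] := pickP J; first exact: (tree_spanning_point j0).
exists (fun=> 0) => x; exists (fun=> 0).
rewrite big1 => [|p _]; last by rewrite scaler0.
(* Without letters there are no words, while a tree has a vertex and a vertex must carry a word:
   there are no generators. *)
have noC : forall y : X J, lspan (fun=> False) y.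
  apply: generator_span => m t n f f' y f'0 yw.
  have /andP[/existsP[v _] _] := svalP t.
  have /card_gt0P[[i _] _] := f'0 v; have [w [/is_word_ne + _]] := yw i.
  by case: w => // j; have := J0 j.
by elim: (noC x) => // [u v _ -> _ ->|a u _ ->]; rewrite ?addr0 ?scaler0.
Qed.
End Spanning.

Lemma Phi_bijective (k : fieldType) (J : finType) : [pchar k] =i pred0 ->
  bijective (@Phi k J).
Proof.
move=> char0; have L := @Phi_linear k J.
have [g gspan] := tree_spanning k J.
have Phi_sum (a : rooted_trees J -> k) :
    Phi (\sum_p a p *: g p) = \sum_p a p *: Phi (g p).
  rewrite (big_morph _ (linD L) (lin0 L)); apply: eq_bigr => p _; exact: (linZ L).
have indep := spanning_independent char0 (I := rooted_trees J) (g := fun p => Phi (g p)) _ (leqnn _).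
have Phi_inj : injective (@Phi k J).
  move=> x y xy; apply/eqP; rewrite -subr_eq0; have [a aE] := gspan (x - y).
  have : Phi (x - y) = 0 by rewrite (linB L) xy subrr.
  rewrite aE Phi_sum => /indep a0; rewrite big1 // => p _.
  rewrite a0 ?scale0r // => c; have [z <-] := Phi_surjective char0 c.
  by have [b ->] := gspan z; exists b.
have [h hK] := choice (fun c => Phi_surjective char0 (J := J) c).
by exists h => x; [apply: Phi_inj|].
Qed.

Theorem corollary1 (k : fieldType) (hk : [pchar k] =i pred0) :
  isomorphic (FMan_Lie_module k)
    (free_module (comp_species (RTn1 k) (Com k)) (Lie k)).
Proof.
have bij J := Phi_bijective J hk.
(* The isomorphism goes from [FMan] to the free module, so it is the family of inverses of [Phi],
   chosen for all sets at once. *)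
have [h hK] : exists h : forall J, FMan k J -> free_module (comp_species (RTn1 k) (Com k)) (Lie k) J,
    forall J, cancel (@Phi k J) (h J) /\ cancel (h J) (@Phi k J).
  have ex J : exists hJ, cancel (@Phi k J) hJ /\ cancel hJ (@Phi k J).
    by have [hJ] := bij J; exists hJ.
  exists (fun J => sval (cid (ex J))) => J; exact: svalP (cid (ex J)).
constructor; apply: (@RightModuleIso k (Lie k) (FMan_Lie_module k)
  (free_module (comp_species (RTn1 k) (Com k)) (Lie k)) h).
- move=> J a x y; apply: (can_inj (hK J).1).
  by rewrite (@Phi_linear k J) !(hK J).2.
- by move=> J; exists (@Phi k J); [apply: (hK J).2|apply: (hK J).1].
- move=> I J e x; apply: (can_inj (hK J).1).
  by rewrite Phi_natural (hK I).2 (hK J).2.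
- move=> I J x p; apply: (can_inj (hK _).1).
  by rewrite Phi_act (hK I).2 (hK _).2.
Qed.
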